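(* Let $d\ge 3$ and let $(M^d,g)$ be a $d$-dimensional Riemannian manifold of constant curvature. Let $K$ be a compact subset of a coordinate patch of $M^d$, let $1\le p\le \frac{d+2}{2}$ and let $q=(d-1)p'$, where $\frac1p+\frac1{p'}=1$ (so $q=\infty$ if $p=1$). Then for every $\epsilon>0$ there is a constant $C_\epsilon$, independent of $\delta$ and $f$, such that for all $0<\delta<1$ and all $f\in L^p(M^d)$ supported in $K$, $$\|f_\delta^{**}\|_{L^q(M^d)}\le C_\epsilon\,\delta^{-\epsilon}\,\delta^{1-\frac dp}\,\|f\|_{L^p(M^d)}.$$
   Context: Fix a number $\alpha$ with $0<\alpha<\min\{1,\tfrac12\,\mathrm{inj}\,M^d\}$, where $\mathrm{inj}\,M^d$ is the injectivity radius of $M^d$ (assumed positive). For $x\in M^d$, $\gamma_x$ denotes any geodesic segment of length $\alpha$ passing through (containing) $x$, and $T_{\gamma_x}^\delta=\{y\in M^d:\mathrm{dist}(y,\gamma_x)\le\delta\}$ is the tubular $\delta$-neighborhood of it. The Nikodym maximal function of $f$ is $$f_\delta^{**}(x)=\sup_{\gamma_x}\frac1{|T_{\gamma_x}^\delta|}\int_{T_{\gamma_x}^\delta}|f(y)|\,dy,$$ the supremum being over all geodesic segments $\gamma_x$ of length $\alpha$ containing $x$; $|\cdot|$ and $dy$ refer to Riemannian volume. The constant $C_\epsilon$ may depend on $\epsilon,d,p,\alpha,(M^d,g),K$. *)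

(* Defs.v *)
(* Riemannian geometry in local coordinates.  Tangent vectors are row vectors of
   components, so the differential of a map acts by right multiplication by its
   Jacobian matrix. *)
From HB Require Import structures.
From mathcomp Require Import all_boot all_order all_algebra.
From mathcomp Require Import all_classical all_reals all_analysis.

Set Implicit Arguments.
Unset Strict Implicit.
Unset Printing Implicit Defensive.

Import Order.TTheory GRing.Theory Num.Theory.
Import numFieldNormedType.Exports.

Local Open Scope classical_set_scope.
Local Open Scope ring_scope.

(* Meant for open A in a finite-dimensional V, where continuity of all iterated
   directional derivatives up to order k is the usual C^k regularity. *)
Fixpoint Ck (R : realType) (V W : normedModType R) (k : nat)
    (A : set V) (f : V -> W) : Prop :=
  (forall x, A x -> {for x, continuous f}) /\
  if k is k'.+1 then
    forall v, (forall x, A x -> derivable f x v) /\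
              Ck k' A (fun x => derive f x v)
  else True.

Definition smooth (R : realType) (V W : normedModType R)
    (A : set V) (f : V -> W) : Prop := forall k, Ck k A f.

(* The values of cmap outside chart_dom, and of cinv outside
   cmap @` chart_dom, are irrelevant. *)
Record chart (R : realType) (d : nat) (M : ptopologicalType) := Chart {
  chart_dom : set M;
  cmap : M -> 'rV[R]_d;
  cinv : 'rV[R]_d -> M;
  open_chart_dom : open chart_dom;
  open_chart_img : open (cmap @` chart_dom);
  cmapK : forall x, chart_dom x -> cinv (cmap x) = x;
  cmap_continuous : forall x, chart_dom x -> {for x, continuous cmap};
  cinv_continuous : forall y, (cmap @` chart_dom) y -> {for y, continuous cinv} }.

Definition chart_img (R : realType) (d : nat) (M : ptopologicalType)
  (a : chart R d M) : set 'rV[R]_d := cmap a @` chart_dom a.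

Definition transition (R : realType) (d : nat) (M : ptopologicalType)
  (a b : chart R d M) : 'rV[R]_d -> 'rV[R]_d := cmap b \o cinv a.

Definition compatible (R : realType) (d : nat) (M : ptopologicalType)
    (a b : chart R d M) : Prop :=
  smooth (cmap a @` (chart_dom a `&` chart_dom b)) (transition a b) /\
  smooth (cmap b @` (chart_dom a `&` chart_dom b)) (transition b a).

Record smoothManifold (R : realType) (d : nat) (M : ptopologicalType) :=
  SmoothManifold {
  hausdorffM : hausdorff_space M;
  second_countableM : @second_countable M;
  atlas : set (chart R d M);
  atlas_cover : forall x, exists a, atlas a /\ chart_dom a x;
  atlas_compatible : forall a b, atlas a -> atlas b -> compatible a b;
  atlas_maximal :
    forall a, (forall b, atlas b -> compatible a b) -> atlas a }.

(* [metric a y] is the Gram matrix (g_ij) at the point of coordinates y in the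
   chart a. *)
Record riemannianManifold (R : realType) (d : nat) (M : ptopologicalType) :=
  RiemannianManifold {
  manifold_of :> smoothManifold R d M;
  metric : chart R d M -> 'rV[R]_d -> 'M[R]_d;
  metric_smooth : forall a, atlas manifold_of a ->
    smooth (chart_img a) (metric a);
  metric_sym : forall a y, atlas manifold_of a -> chart_img a y ->
    (metric a y)^T = metric a y;
  metric_posdef : forall a y, atlas manifold_of a -> chart_img a y ->
    forall u : 'rV[R]_d, u != 0 -> 0 < (u *m metric a y *m u^T) 0 0;
  metric_transition : forall a b x,
    atlas manifold_of a -> atlas manifold_of b -> chart_dom a x -> chart_dom b x ->
    let J := jacobian (transition a b) (cmap a x) in
    metric a (cmap a x) = J *m metric b (cmap b x) *m J^T }.

Section Coordinates.
Variables (R : realType) (d : nat) (M : ptopologicalType).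
Variables (g : riemannianManifold R d M) (a : chart R d M).
Implicit Types (y u v w : 'rV[R]_d) (i j k l m : 'I_d).

Definition pderiv i (F : 'rV[R]_d -> R) y : R := derive F y (delta_mx 0 i).

Definition gform y u v : R := (u *m metric g a y *m v^T) 0 0.

(* Gamma^k_ij *)
Definition christoffel k i j y : R :=
  2^-1 * \sum_l invmx (metric g a y) k l *
    (pderiv i (fun z => metric g a z j l) y
     + pderiv j (fun z => metric g a z i l) y
     - pderiv l (fun z => metric g a z i j) y).

(* R^l_kij, where R(d_i, d_j) d_k = \sum_l R^l_kij d_l and
   R(X, Y) = [nabla_X, nabla_Y] - nabla_[X, Y] *)
Definition curvature_coef l k i j y : R :=
  pderiv i (christoffel l j k) y - pderiv j (christoffel l i k) y
  + \sum_m (christoffel m j k y * christoffel l i m y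
            - christoffel m i k y * christoffel l j m y).

(* R(u, v) w *)
Definition curvature y u v w : 'rV[R]_d :=
  \row_l \sum_i \sum_j \sum_k
    u 0 i * v 0 j * w 0 k * curvature_coef l k i j y.

Definition sectional_curvature y u v : R :=
  gform y (curvature y u v v) u
  / (gform y u u * gform y v v - gform y u v ^+ 2).

End Coordinates.

Definition constant_curvature (R : realType) (d : nat) (M : ptopologicalType)
    (g : riemannianManifold R d M) : Prop :=
  exists kappa : R, forall a y (u v : 'rV[R]_d), atlas g a -> chart_img a y ->
    row_free (col_mx u v) -> sectional_curvature g a y u v = kappa.

Section Geometry.
Variables (R : realType) (d : nat) (M : ptopologicalType).
Variable g : riemannianManifold R d M.
Implicit Types (c : R -> M) (x y z p : M) (I : set R).

(* The tangent space at p is identified with 'rV_d through this chart. *)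
Definition chart_at p : chart R d M := projT1 (cid (atlas_cover g p)).

Definition inner p (u v : 'rV[R]_d) : R :=
  gform g (chart_at p) (cmap (chart_at p) p) u v.

Definition velocity c (t : R) : 'rV[R]_d :=
  derive (cmap (chart_at (c t)) \o c) t 1.

Definition Ck_curve (n : nat) I c : Prop :=
  (forall t, I t -> {for t, continuous c}) /\
  forall a, atlas g a -> Ck n (I `&` c @^-1` chart_dom a) (cmap a \o c).

Definition curve_length c (s t : R) : \bar R :=
  \int[lebesgue_measure]_(r in `[s, t])
    (Num.sqrt (inner (c r) (velocity c r) (velocity c r)))%:E.

(* There is a piecewise C^1 curve from x to y of length l; being C^1 on [s, t]
   means being the restriction of a C^1 curve on an open set. *)
Inductive joined : M -> M -> \bar R -> Prop :=
| joined_refl x : joined x x 0%E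
| joined_cons c s t I z l : s <= t -> open I -> `[s, t] `<=` I ->
    Ck_curve 1 I c -> joined (c t) z l ->
    joined (c s) z (curve_length c s t + l)%E.

(* +oo between distinct connected components *)
Definition gdist x y : \bar R := ereal_inf [set l | joined x y l].

Definition gdist_set x (A : set M) : \bar R := ereal_inf (gdist x @` A).

Definition geodesic I c : Prop :=
  [/\ open I, Ck_curve 2 I c &
      forall a t, atlas g a -> I t -> chart_dom a (c t) ->
        let X := cmap a \o c in
        let X' := fun s => derive X s 1 in
        forall k, derive X' t 1 0 k
          + \sum_i \sum_j christoffel g a k i j (X t) * X' t 0 i * X' t 0 j
          = 0].

Definition geodesic_segment (len : R) (gam : set M) : Prop :=
  exists c s t I, [/\ s <= t, `[s, t] `<=` I, geodesic I c,
    curve_length c s t = len%:E & gam = c @` `[s, t]].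

(* exp_p v is defined and equal to x *)
Definition is_exp p (v : 'rV[R]_d) x : Prop :=
  exists c I, [/\ `[0, 1] `<=` I, geodesic I c, c 0 = p,
    velocity c 0 = v & c 1 = x].

(* exp_p is defined on the open ball of radius r of the tangent space, and is a
   diffeomorphism from it onto an open subset of M; equivalently, by
   maximality of the atlas, exp_p on that ball is the inverse of a chart. *)
Definition normal_ball p (r : R) : Prop :=
  exists a, [/\ atlas g a, chart_img a = [set v | inner p v v < r ^+ 2] &
    forall v, inner p v v < r ^+ 2 -> is_exp p v (cinv a v)].

Definition inj_radius_at p : \bar R :=
  ereal_sup [set r%:E | r in [set r : R | 0 < r /\ normal_ball p r]].

Definition inj_radius : \bar R := ereal_inf (range inj_radius_at).

Definition tube (delta : R) (gam : set M) : set M :=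
  [set y | (gdist_set y gam <= delta%:E)%E].

End Geometry.

Notation borel M := (g_sigma_algebraType (@open M)).

(* Lebesgue integral over R^n of a nonnegative Borel function, as an iterated
   integral. *)
Fixpoint integral_rV (R : realType) (n : nat) : ('rV[R]_n -> \bar R) -> \bar R :=
  match n return ('rV[R]_n -> \bar R) -> \bar R with
  | 0 => fun F => F 0
  | n'.+1 => fun F => (\int[lebesgue_measure]_(t in [set: R])
      integral_rV (fun y : 'rV[R]_n' =>
        F (row_mx (const_mx t : 'rV[R]_1) y : 'rV[R]_(1 + n'))))%E
  end.

(* dV = sqrt(det g) dy in every chart.  As M is second countable, this
   determines the Borel measure mu. *)
Definition is_riemannian_volume (R : realType) (d : nat) (M : ptopologicalType)
    (g : riemannianManifold R d M)
    (mu : {measure set (borel M) -> \bar R}) : Prop :=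
  forall a (A : set (borel M)), atlas g a -> measurable A -> A `<=` chart_dom a ->
    mu A = integral_rV (fun y =>
      (\1_(cmap a @` A) y * Num.sqrt (\det (metric g a y)))%:E).

(* f_delta^** *)
Definition nikodym (R : realType) (d : nat) (M : ptopologicalType)
    (g : riemannianManifold R d M) (mu : {measure set (borel M) -> \bar R})
    (alpha delta : R) (f : borel M -> R) (x : borel M) : \bar R :=
  ereal_sup
    [set ((mu (tube g delta gam))^-1 *
          \int[mu]_(y in tube g delta gam) `|f y|%:E)%E
    | gam in [set gam | geodesic_segment g alpha gam /\ gam x]].

(* Main.v *)
(* Constant curvature makes the metric explicit in normal coordinates: along a
   ray of squared length rho it is S(rho)^2 <.,.> plus a radial term, where
   S(rho) = sin(sqrt(kappa rho))/sqrt(kappa rho) and C(rho) = cos(sqrt(kappa rho)).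
   Beltrami's map v |-> (S/C) v is bi-Lipschitz on small balls and sends geodesics to straight
   segments, so near each of finitely many points covering a neighbourhood of K
   the delta-tubes become straight tubes in R^d, made of about 1/delta cells of a
   delta-grid.  Fixing the coordinate axis along which a tube makes its steepest
   progress and slicing the base points by that coordinate leaves an incidence problem
   for N ~ 1/delta: a 1-separated family of lines through a hyperplane against a set of
   cells.  Wolff's hairbrush argument bounds it: after pruning, every line meets
   many others at one common angle scale K^-i (N = K^M), the lines of a hairbrush
   overlap little away from the stem, and Cauchy-Schwarz bounds the number of
   cells from below.  Splitting f into levels K^-i, with M large in terms of eps, turns this
   into the strong-type bound; Hoelder's inequality on the cells carries it over
   to the Nikodym maximal function.  For p = 1, or delta bounded below, the lower bound
   on the volume of a tube is enough. *)
Require Import Defs.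
From HB Require Import structures.
From mathcomp Require Import all_boot all_order all_algebra.
From mathcomp Require Import all_classical all_reals all_analysis.
From mathcomp Require Import measurable_realfun.
From mathcomp Require Import ring lra zify.
Set Implicit Arguments.
Unset Strict Implicit.
Unset Printing Implicit Defensive.
Import Order.TTheory GRing.Theory Num.Theory.
Import numFieldNormedType.Exports.
Local Open Scope classical_set_scope.
Local Open Scope ring_scope.

(** * Calculus *)

(** Write d = n + 1 and N ~ 1/delta. Lines are labelled by base points in a hyperplane, not by
    directions: two lines meeting at angle theta have base points within about theta N, and this
    replaces the separation of directions in the Kakeya problem. The count for |J| lines with at
    least h cells each in E is h^(n+3) |J|^(1+1/n) <= C K^2 N^(n+1) |E|^2. Its power n/(n+1)
    controls |J| h^q as soon as q >= n(n+3)/(n+1), which for q = (d-1)p' says exactly p <= (d+2)/2;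
    the levels of f then add up because p(q-n) = q. The supremum in [nikodym] runs over an
    uncountable family, so its measurability is avoided: it is dominated by a function constant on
    cells, and nonnegative integrals are monotone anyway. The factor 1/2 in the bound on alpha makes
    Beltrami's map finite: S(4 rho) = S(rho) C(rho), and S > 0 on the whole normal ball because the
    metric is nondegenerate there, so C > 0 on the ball of half the radius. That the radii of normal
    balls are bounded below gives compact neighbourhoods of K without completeness. *)

Definition lincomb (R : realType) (d : nat) (c : 'I_d -> R) (h : 'rV[R]_d) : R :=
  \sum_i h 0 i * c i.

Lemma lincomb_is_linear (R : realType) (d : nat) (c : 'I_d -> R) : linear (lincomb c).
Proof.
move=> a u v; rewrite /lincomb scaler_sumr -big_split /=.
by apply: eq_bigr => i _; rewrite !mxE mulrDl -mulrA.
Qed.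

HB.instance Definition _ (R : realType) (d : nat) (c : 'I_d -> R) :=
  GRing.isLinear.Build R 'rV[R]_d R _ (lincomb c) (lincomb_is_linear c).

Lemma lincomb_continuous (R : realType) (d : nat) (c : 'I_d -> R) :
  continuous (lincomb c).
Proof.
move=> x; apply: differentiable_continuous.
rewrite (_ : lincomb c = \sum_i (fun h : 'rV[R]_d => h 0 i * c i)); last first.
  by apply/funext => h; rewrite fct_sumE.
apply: differentiable_sum => i.
apply: (@differentiableM _ _ (fun h : 'rV[R]_d => h 0 i) (cst (c i))).
  exact: differentiable_coord.
exact: differentiable_cst.
Qed.

Lemma mvt_dist (R : realType) (f df : R -> R) (c e t : R) :
  (forall s : R, `|s| <= `|t| -> is_derive s 1 f (df s)) ->
  (forall s, `|s| <= `|t| -> `|df s - c| <= e) ->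
  `|f t - f 0 - t * c| <= e * `|t|.
Proof.
move=> fd dfc.
have cont s : `|s| <= `|t| -> {for s, continuous f}.
  by move=> st; apply: differentiable_continuous; apply/derivable1_diffP; have [] := fd s st.
have withinc a b : (forall s, s \in `[a, b] -> `|s| <= `|t|) -> {within `[a, b], continuous f}.
  move=> H; apply: continuous_in_subspaceT => s; rewrite inE => sab.
  by apply: cont; apply: H.
have [t0|t0] := leP 0 t.
  have ab s : s \in `[0, t] -> `|s| <= `|t|.
    by rewrite in_itv/= => /andP[s0 st]; rewrite !ger0_norm.
  have [|s|s sI E] := @MVT_segment R f df 0 t t0.
  - by move=> s sI; apply: fd; apply: ab; apply: subset_itv_oo_cc.
  - exact: withinc.
  rewrite E subr0 [t * c]mulrC -mulrBl normrM ler_wpM2r//.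
  exact/dfc/ab.
have ab s : s \in `[t, 0] -> `|s| <= `|t|.
  rewrite in_itv/= => /andP[s0 st]; rewrite !ler0_norm ?lerN2// ltW//.
have [|s|s sI E] := @MVT_segment R f df t 0 (ltW t0).
- by move=> s sI; apply: fd; apply: ab; apply: subset_itv_oo_cc.
- exact: withinc.
rewrite -(opprB (f 0)) E sub0r mulrN opprK [t * c]mulrC -mulrBl normrM ler_wpM2r//.
exact/dfc/ab.
Qed.

(** Corners of the path from 0 to [h] that changes one coordinate at a time. *)
Definition prefix_rV (R : realType) (d : nat) (h : 'rV[R]_d) (k : nat) : 'rV[R]_d :=
  \row_j (if (j < k)%N then h 0 j else 0).

Lemma prefix_rVS (R : realType) (d : nat) (h : 'rV[R]_d) (i : 'I_d) :
  prefix_rV h i.+1 = prefix_rV h i + h 0 i *: delta_mx 0 i.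
Proof.
apply/rowP => j; rewrite !mxE eqxx/= ltnS leq_eqVlt.
case: (eqVneq j i) => [->|ji] /=; first by rewrite eqxx ltnn mulr1 add0r.
have -> : (j == i :> nat) = false by apply/negbTE.
by rewrite mulr0 addr0.
Qed.

Lemma prefix_rV0 (R : realType) (d : nat) (h : 'rV[R]_d) : prefix_rV h 0 = 0.
Proof. by apply/rowP => j; rewrite !mxE. Qed.

Lemma prefix_rV_full (R : realType) (d : nat) (h : 'rV[R]_d) : prefix_rV h d = h.
Proof. by apply/rowP => j; rewrite !mxE ltn_ord. Qed.

Lemma rV_norm_le (R : realType) (d : nat) (h : 'rV[R]_d) (M : R) : 0 <= M ->
  (forall i, `|h 0 i| <= M) -> `|h| <= M.
Proof.
move=> M0 H; rewrite /Num.Def.normr/= mx_normrE.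
by apply/bigmax_leP; split => // -[a b] _ /=; rewrite (ord1 a).
Qed.

Lemma rV_coord_le (R : realType) (d : nat) (h : 'rV[R]_d) i : `|h 0 i| <= `|h|.
Proof.
rewrite [leRHS]/Num.Def.normr/= mx_normrE.
exact: (le_bigmax _ (fun ij : 'I_1 * 'I_d => `|h ij.1 ij.2|) (0, i)).
Qed.

Lemma prefix_rV_norm (R : realType) (d : nat) (h : 'rV[R]_d) k (i : 'I_d) (s : R) :
  (k <= i)%N -> `|s| <= `|h 0 i| -> `|prefix_rV h k + s *: delta_mx 0 i| <= `|h|.
Proof.
move=> ki si; apply: rV_norm_le => // j; rewrite !mxE eqxx/=.
case: (eqVneq j i) => [->|ji].
  by rewrite ltnNge ki add0r mulr1 (le_trans si)// rV_coord_le.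
rewrite mulr0 addr0; case: ifP => _; first exact: rV_coord_le.
by rewrite normr0.
Qed.

(** [Ck] provides directional derivatives only; differentiability is recovered here. The increment
    of [f] telescopes along the coordinate path [prefix_rV], and on each edge the mean value theorem
    compares it with the partial derivative at [x]. *)
Lemma partials_differentiable (R : realType) (d : nat) (f : 'rV[R]_d -> R) (x : 'rV[R]_d) :
  (forall i, \forall y \near x, derivable f y (delta_mx 0 i)) ->
  (forall i, {for x, continuous ('D_(delta_mx 0 i) f)}) ->
  differentiable f x.
Proof.
move=> fd fc; pose c i := 'D_(delta_mx 0 i) f x.
suff H : (f : 'rV[R]_d -> R^o) \o shift x = cst (f x) + (lincomb c) +o_ (0 : 'rV[R]_d) id.
  apply/diff_locallyP; rewrite (diff_unique (@lincomb_continuous _ _ c) H).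
  by split => //; exact: lincomb_continuous.
apply/eqaddoP => e e0.
(* Each of the [d] edges may cost [e / d.+1]; the successor keeps the denominator nonzero when
   [d = 0]. *)
have [r /= r0 Hr] : exists2 r : R, 0 < r & forall y, `|y - x| < r -> forall i,
    derivable f y (delta_mx 0 i) /\ `|'D_(delta_mx 0 i) f y - c i| <= e / d.+1%:R.
  pose P (i : 'I_d) y := derivable f y (delta_mx 0 i) /\
     `|'D_(delta_mx 0 i) f y - c i| <= e / d.+1%:R.
  have : \forall y \near x, forall i, P i y.
    apply: (@filter_forall _ _ P _ (nbhs_filter x)) => i; near=> y; split; first by near: y; exact: fd.
    rewrite distrC; near: y.
    by move/cvgrPdist_le: (fc i); apply; rewrite divr_gt0.
  move=> /nbhs_ballP[r /= r0 H]; exists r => // y yr.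
  by apply: H; rewrite -ball_normE /= distrC.
near=> h.
rewrite /= !fctE /=.
have hr : `|h| < r.
  near: h; apply/nbhs_ballP; exists r => //= y; rewrite -ball_normE /= sub0r normrN//.
have step (i : 'I_d) : `|f (prefix_rV h i.+1 + x) - f (prefix_rV h i + x) - h 0 i * c i|
    <= e / d.+1%:R * `|h|.
  pose g s := f (s *: delta_mx 0 i + (prefix_rV h i + x)).
  have gin s : `|s| <= `|h 0 i| -> `|s *: delta_mx 0 i + (prefix_rV h i + x) - x| < r.
    move=> si; rewrite addrA addrK addrC (le_lt_trans _ hr)//.
    exact: prefix_rV_norm.
  have := @mvt_dist R g (fun s => 'D_(delta_mx 0 i) f (s *: delta_mx 0 i + (prefix_rV h i + x)))
    (c i) (e / d.+1%:R) (h 0 i).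
  have -> : g (h 0 i) = f (prefix_rV h i.+1 + x).
    by rewrite prefix_rVS /g addrA [_ *: _ + _]addrC.
  have -> : g 0 = f (prefix_rV h i + x) by rewrite /g scale0r add0r.
  move=> mvt; apply: le_trans (mvt _ _) _.
  - move=> s si; have [df _] := Hr _ (gin s si) i.
    have E : (fun h : R => h^-1 *: ((g \o shift s) (h *: (1:R)) - g s)) =
      (fun h0 : R => h0^-1 *: ((f \o shift (s *: delta_mx 0 i + (prefix_rV h i + x)))
         (h0 *: delta_mx 0 i) - f (s *: delta_mx 0 i + (prefix_rV h i + x)))).
      apply/funext => u; rewrite /g /= scalerDl -!addrA; congr (_ *: (f (_ + _) - _)).
      by rewrite -[u *: 1]/(u * 1) mulr1.
    by split; rewrite /derivable /derive E.
  - by move=> s si; have [_] := Hr _ (gin s si) i.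
  - by apply: ler_wpM2l; [rewrite divr_ge0// ltW | exact: rV_coord_le].
have -> : f (h + x) - (f x + lincomb c h) =
    \sum_(i < d) (f (prefix_rV h i.+1 + x) - f (prefix_rV h i + x) - h 0 i * c i).
  rewrite sumrB opprD addrA; congr (_ - _).
  rewrite -(big_mkord xpredT (fun i => f (prefix_rV h i.+1 + x) - f (prefix_rV h i + x))).
  rewrite telescope_sumr// prefix_rV_full prefix_rV0 add0r//.
apply: (le_trans (ler_norm_sum _ _ _)).
apply: (le_trans (ler_sum _ (fun i _ => step i))).
rewrite sumr_const card_ord -mulrnAl ler_wpM2r// -mulr_natr -mulrA ler_piMr ?ltW//.
by rewrite mulrC ltr_pdivrMr// mul1r ltr_nat.
Unshelve. all: by end_near.
Qed.

Lemma mx_differentiable (R : realType) (V : normedModType R) m n (f : V -> 'M[R]_(m, n)) x :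
  (forall i j, differentiable (fun y => f y i j) x) -> differentiable f x.
Proof.
move=> H.
rewrite (_ : f = \sum_i \sum_j (fun y => f y i j *: delta_mx i j)).
  apply: differentiable_sum => i; apply: differentiable_sum => j.
  exact: differentiableZl.
apply/funext => y; rewrite fct_sumE {1}(matrix_sum_delta (f y)).
by apply: eq_bigr => i _; rewrite fct_sumE.
Qed.

Lemma open_near (T : topologicalType) (U : set T) x : open U -> U x -> \forall y \near x, U y.
Proof. by move=> oU Ux; apply: open_nbhs_nbhs. Qed.

Lemma C1_mx_differentiable (R : realType) (d m n : nat) (U : set 'rV[R]_d)
    (f : 'rV[R]_d -> 'M[R]_(m, n)) x : open U -> U x ->
  (forall v y, U y -> derivable f y v) ->
  (forall v y, U y -> {for y, continuous ('D_v f)}) ->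
  differentiable f x.
Proof.
move=> oU Ux fd fc; have nU := open_near oU Ux.
apply: mx_differentiable => i j.
apply: partials_differentiable => k.
  near=> y; have Uy : U y by near: y; exact: nU.
  by have /derivable_mxP := fd (delta_mx 0 k) y Uy; apply.
have E y : U y -> 'D_(delta_mx 0 k) (fun z => f z i j) y = 'D_(delta_mx 0 k) f y i j.
  by move=> Uy; rewrite derive_mx ?mxE//; exact: fd.
rewrite /prop_for /continuous_at E//.
have H : (fun y => 'D_(delta_mx 0 k) f y i j) @ x --> 'D_(delta_mx 0 k) f x i j.
  exact: (@continuous_comp _ _ _ ('D_(delta_mx 0 k) f)
    (fun M : 'M[R]_(m, n) => M i j) x (fc (delta_mx 0 k) x Ux)
    (differentiable_continuous (differentiable_coord _ i j))).
have EN : \forall y \near x, 'D_(delta_mx 0 k) f y i j = 'D_(delta_mx 0 k) (fun z => f z i j) y.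
  by apply: filterS nU => y Uy; rewrite E.
exact: cvg_trans (near_eq_cvg EN) H.
Unshelve. all: by end_near.
Qed.

Lemma smooth_derive (R : realType) (V W : normedModType R) (A : set V) (f : V -> W) v :
  smooth A f -> smooth A ('D_v f).
Proof. by move=> sf k; have [_ /(_ v)[]] := sf k.+1. Qed.

Lemma smooth_continuous (R : realType) (V W : normedModType R) (A : set V) (f : V -> W) x :
  smooth A f -> A x -> {for x, continuous f}.
Proof. by move=> /(_ 0%N)[H _]; exact: H. Qed.

Lemma smooth_derivable (R : realType) (V W : normedModType R) (A : set V) (f : V -> W) x v :
  smooth A f -> A x -> derivable f x v.
Proof. by move=> /(_ 1%N)[_ /(_ v)[H _]]; exact: H. Qed.

Lemma smooth_differentiable (R : realType) (d m n : nat) (U : set 'rV[R]_d)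
    (f : 'rV[R]_d -> 'M[R]_(m, n)) x : open U -> smooth U f -> U x -> differentiable f x.
Proof.
move=> oU sf Ux; apply: (C1_mx_differentiable oU Ux) => v y Uy.
  exact: smooth_derivable sf Uy.
exact: (smooth_continuous (smooth_derive v sf) Uy).
Qed.

Lemma is_derive_comp_curve (R : realType) (V W : normedModType R) (f : V -> W)
    (X : R -> V) (t : R) (v : V) :
  is_derive t 1 X v -> differentiable f (X t) -> is_derive t 1 (f \o X) ('D_v f (X t)).
Proof.
move=> [dX EX] df.
have dX' : differentiable X t by apply/derivable1_diffP.
apply: DeriveDef.
  by apply/derivable1_diffP; exact: differentiable_comp.
rewrite deriveE; last exact: differentiable_comp.
by rewrite diff_comp //= deriveE// -EX deriveE.
Qed.

Lemma is_derive_continuous (R : realType) (W : normedModType R) (f : R -> W) (t : R) v :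
  is_derive t 1 f v -> {for t, continuous f}.
Proof. by move=> [d _]; apply: differentiable_continuous; apply/derivable1_diffP. Qed.

(** With the integrating factor, [e t * expR (- L * t)] is nonincreasing. *)
Lemma gronwall_le0 (R : realType) (e de : R -> R) (L a b : R) :
  (forall t, t \in `]a, b[ -> is_derive t 1 e (de t)) ->
  (forall t, t \in `]a, b[ -> de t <= L * e t) ->
  {within `[a, b], continuous e} -> e a <= 0 ->
  forall t, t \in `[a, b] -> e t <= 0.
Proof.
move=> ed ede ec ea t tab; pose h s := e s * expR (- L * s).
have hd s : s \in `]a, b[ -> is_derive s 1 h ((de s - L * e s) * expR (- L * s)).
  move=> sab; have := ed s sab => eds.
  have : is_derive s 1 (e * (fun s => expR (- L * s)))
     (e s *: (- L * expR (- L * s)) + expR (- L * s) *: de s).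
    apply: is_deriveM; apply: is_derive_eq.
    by rewrite /GRing.scale/= mulr1 mulrC.
  move=> H; apply: (is_derive_eq H).
  by rewrite /GRing.scale/=; ring.
have hc : {within `[a, b], continuous h}.
  move=> s; apply: cvgM; first exact: ec.
  apply: continuous_subspaceT => {s}s.
  by apply: continuous_comp; [exact: mulrl_continuous|exact: continuous_expR].
have hab : h t <= h a.
  have [at_ tb] : a <= t /\ t <= b by move: tab; rewrite in_itv/= => /andP.
  apply: (@ler0_derive1_nincr _ h a b) => //.
  - by move=> s sab; have [] := hd s sab.
  - move=> s sab; rewrite derive1E; have [_ ->] := hd s sab.
    by rewrite mulr_le0_ge0 ?expR_ge0// subr_le0 ede.
have : h a <= 0 by rewrite /h pmulr_lle0 ?expR_gt0.
by move=> /(le_trans hab); rewrite /h pmulr_lle0 ?expR_gt0.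
Qed.

(** * Bilinear forms and curvature in coordinates *)

Fact lock_key : unit. Proof. exact: tt. Qed.

(* Locked, as are the other tensors below, to keep conversion checks on them cheap. *)
Definition bil (R : realType) (d : nat) : 'M[R]_d -> 'rV[R]_d -> 'rV[R]_d -> R :=
  locked_with lock_key (fun A u v => (u *m A *m v^T) 0 0).

Lemma bil_unlock (R : realType) (d : nat) (A : 'M[R]_d) (u v : 'rV[R]_d) :
  bil A u v = (u *m A *m v^T) 0 0.
Proof. by rewrite /bil unlock. Qed.

Section Bil.
Variables (R : realType) (d : nat).
Implicit Types (A B : 'M[R]_d) (u v w : 'rV[R]_d) (c : R).

Lemma bilDl A u v w : bil A (u + v) w = bil A u w + bil A v w.
Proof. by rewrite !bil_unlock !mulmxDl mxE. Qed.
Lemma bilDr A u v w : bil A u (v + w) = bil A u v + bil A u w.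
Proof. by rewrite !bil_unlock linearD mulmxDr mxE. Qed.
Lemma bilZl A c u v : bil A (c *: u) v = c * bil A u v.
Proof. by rewrite !bil_unlock -!scalemxAl mxE. Qed.
Lemma bilZr A c u v : bil A u (c *: v) = c * bil A u v.
Proof. by rewrite !bil_unlock linearZ/= -scalemxAr mxE. Qed.
Lemma bilNl A u v : bil A (- u) v = - bil A u v.
Proof. by rewrite -scaleN1r bilZl mulN1r. Qed.
Lemma bilNr A u v : bil A u (- v) = - bil A u v.
Proof. by rewrite -scaleN1r bilZr mulN1r. Qed.
Lemma bilBl A u v w : bil A (u - v) w = bil A u w - bil A v w.
Proof. by rewrite bilDl bilNl. Qed.
Lemma bilBr A u v w : bil A u (v - w) = bil A u v - bil A u w.
Proof. by rewrite bilDr bilNr. Qed.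
Lemma bil0l A v : bil A 0 v = 0.
Proof. by rewrite !bil_unlock !mul0mx mxE. Qed.
Lemma bil0r A v : bil A v 0 = 0.
Proof. by rewrite !bil_unlock linear0 mulmx0 mxE. Qed.
Lemma bilDm A B u v : bil (A + B) u v = bil A u v + bil B u v.
Proof. by rewrite !bil_unlock mulmxDr mulmxDl mxE. Qed.
Lemma bilZm A c u v : bil (c *: A) u v = c * bil A u v.
Proof. by rewrite !bil_unlock -scalemxAr -scalemxAl mxE. Qed.

Lemma bilE A u v : bil A u v = \sum_i \sum_j u 0 i * A i j * v 0 j.
Proof.
rewrite !bil_unlock !mxE exchange_big/=; apply: eq_bigr => j _.
by rewrite !mxE mulr_suml.
Qed.

Lemma bil_symm A u v : A^T = A -> bil A u v = bil A v u.
Proof.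
move=> sA; rewrite !bil_unlock.
have -> : v *m A *m u^T = (u *m A *m v^T)^T by rewrite !trmx_mul trmxK sA mulmxA.
by rewrite [RHS]mxE.
Qed.

Lemma posdef_unitmx A : (forall u, u != 0 -> 0 < bil A u u) -> A \in unitmx.
Proof.
move=> pA; rewrite -row_free_unit -kermx_eq0; apply/eqP/row_matrixP => i.
rewrite row0; apply/eqP; apply: contraT => nz.
have := pA _ nz; rewrite bil_unlock (_ : row i (kermx A) *m A = 0) ?mul0mx ?mxE ?ltxx//.
by apply/sub_kermxP; exact: row_sub.
Qed.

Lemma posdef_inj A u v : (forall u, u != 0 -> 0 < bil A u u) ->
  (forall w, bil A u w = bil A v w) -> u = v.
Proof.
move=> pA H; apply/eqP; rewrite -subr_eq0; apply: contraT => nz.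
by have := pA _ nz; rewrite bilBl H subrr ltxx.
Qed.

(** Positivity at the vector [bil A v v *: u - bil A u v *: v], which is orthogonal to [v]. *)
Lemma bil_CS A u v : A^T = A -> (forall u, u != 0 -> 0 < bil A u u) ->
  bil A u v ^+ 2 <= bil A u u * bil A v v.
Proof.
move=> sA pA; have [->|v0] := eqVneq v 0; first by rewrite !bil0r mulr0 expr0n.
have vv := pA v v0.
have : 0 <= bil A (bil A v v *: u - bil A u v *: v) (bil A v v *: u - bil A u v *: v).
  by have [->|/pA/ltW//] := eqVneq (bil A v v *: u - bil A u v *: v) 0; rewrite bil0l.
rewrite !(bilBl, bilBr, bilZl, bilZr) (bil_symm v u sA).
set x := bil A u u; set y := bil A u v; set z := bil A v v.
move=> H; have : 0 <= z * (x * z - y ^+ 2) by lra.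
by rewrite pmulr_rge0 // subr_ge0.
Qed.

End Bil.

Section DiffMx.
Variables (R : realType) (V : normedModType R).

Lemma differentiable_big_prod (I : Type) (r : seq I) (P : pred I) (f : I -> V -> R) x :
  (forall i, differentiable (f i) x) ->
  differentiable (fun y => \prod_(i <- r | P i) f i y) x.
Proof.
move=> df; elim: r => [|i r IH].
  rewrite (_ : (fun _ => _) = cst 1); first exact: differentiable_cst.
  by apply/funext => y; rewrite big_nil.
case: (boolP (P i)) => Pi.
  rewrite (_ : (fun _ => _) = (f i * (fun y => \prod_(j <- r | P j) f j y))).
    exact: differentiableM.
  by apply/funext => y; rewrite big_cons Pi.
rewrite (_ : (fun _ => _) = (fun y => \prod_(j <- r | P j) f j y))//.
by apply/funext => y; rewrite big_cons (negbTE Pi).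
Qed.

Lemma differentiable_big_sum (W : normedModType R) (I : Type) (r : seq I) (P : pred I)
  (f : I -> V -> W) x : (forall i, differentiable (f i) x) ->
  differentiable (fun y => \sum_(i <- r | P i) f i y) x.
Proof.
move=> df; elim: r => [|i r IH].
  rewrite (_ : (fun _ => _) = cst 0); first exact: differentiable_cst.
  by apply/funext => y; rewrite big_nil.
case: (boolP (P i)) => Pi.
  rewrite (_ : (fun _ => _) = (f i + (fun y => \sum_(j <- r | P j) f j y))).
    exact: differentiableD.
  by apply/funext => y; rewrite big_cons Pi.
rewrite (_ : (fun _ => _) = (fun y => \sum_(j <- r | P j) f j y))//.
by apply/funext => y; rewrite big_cons (negbTE Pi).
Qed.

Lemma differentiable_mul (f g : V -> R) x : differentiable f x -> differentiable g x ->
  differentiable (fun y => f y * g y) x.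
Proof. exact: differentiableM. Qed.

Lemma differentiable_det n (A : V -> 'M[R]_n) x :
  (forall i j, differentiable (fun y => A y i j) x) -> differentiable (fun y => \det (A y)) x.
Proof.
move=> dA; rewrite /determinant; apply: differentiable_big_sum => s.
apply: differentiable_mul; first exact: differentiable_cst.
exact: differentiable_big_prod.
Qed.

Lemma near_eq_differentiable (W : normedModType R) (f g : V -> W) x :
  (\forall y \near x, f y = g y) -> differentiable f x -> differentiable g x.
Proof.
move=> fg /diff_locallyP[cf H].
have H' : g \o shift x = cst (g x) + 'd f x +o_ (0 : V) id.
  apply/eqaddoP => e e0; move/eqaddoP: H => /(_ e e0) H.
  have fg0 : \forall h \near (0 : V), f (h + x) = g (h + x).
    move: fg; rewrite -{1}(add0r x) => fg.
    have c : {for (0 : V), continuous (fun h : V => h + x)}.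
      by apply: cvgD; [exact: cvg_id|exact: cvg_cst].
    exact: (c _ fg).
  near=> h; rewrite /= !fctE /=.
  rewrite -(nbhs_singleton fg) -(near fg0 h)//.
  by near: h.
apply/diff_locallyP; rewrite (diff_unique cf H'); split => //.
Unshelve. all: by end_near.
Qed.

Lemma differentiable_invmx n (A : V -> 'M[R]_n) x i j :
  (\forall y \near x, A y \in unitmx) ->
  (forall i j, differentiable (fun y => A y i j) x) ->
  differentiable (fun y => invmx (A y) i j) x.
Proof.
move=> uA dA.
have H : differentiable (fun y => (\det (A y))^-1 * cofactor (A y) j i) x.
  apply: differentiable_mul.
    apply: differentiableV; first exact: differentiable_det.
    by have := nbhs_singleton uA; rewrite unitmxE unitfE.
  rewrite /cofactor; apply: differentiable_mul; first exact: differentiable_cst.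
  apply: differentiable_det => k l.
  by under eq_fun do rewrite !mxE; exact: dA.
have E : \forall y \near x, (\det (A y))^-1 * cofactor (A y) j i = invmx (A y) i j.
  by apply: filterS uA => y uy; rewrite /invmx uy !mxE.
exact: near_eq_differentiable E H.
Qed.

End DiffMx.

Section Chart.
Variables (R : realType) (d : nat) (M : ptopologicalType).
Variables (g : riemannianManifold R d M) (a : chart R d M).
Hypothesis aA : atlas g a.
Implicit Types (y u v w : 'rV[R]_d).

Let U := chart_img a.
Let G := metric g a.

Lemma open_chart_imgE : open (chart_img a).
Proof. exact: open_chart_img. Qed.
Let oU := open_chart_imgE.

Lemma metric_smooth_at : smooth U G.
Proof. exact: metric_smooth. Qed.

Lemma metric_diff y : U y -> differentiable G y.
Proof. exact: smooth_differentiable oU metric_smooth_at. Qed.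

Lemma metric_diff_entry y i j : U y -> differentiable (fun z => G z i j) y.
Proof.
move=> Uy; apply: (@differentiable_comp _ _ _ _ G (fun M : 'M[R]_d => M i j)).
  exact: metric_diff.
exact: differentiable_coord.
Qed.

Definition dmetric : 'rV[R]_d -> 'rV[R]_d -> 'M[R]_d :=
  locked_with lock_key (fun y c => 'D_c G y).

Lemma dmetric_unlock y c : dmetric y c = 'D_c G y.
Proof. by rewrite /dmetric unlock. Qed.

Lemma dmetric_diff y c : U y -> differentiable (fun z => dmetric z c) y.
Proof.
rewrite (_ : dmetric^~ c = 'D_c G); last by apply/funext => z; rewrite dmetric_unlock.
exact: smooth_differentiable oU (smooth_derive c metric_smooth_at).
Qed.

Lemma dmetric_entry y c i j : U y -> 'D_c (fun z => G z i j) y = dmetric y c i j.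
Proof.
move=> Uy; rewrite !dmetric_unlock derive_mx ?mxE//.
exact: smooth_derivable metric_smooth_at Uy.
Qed.

Lemma pderiv_metric y i j k : U y ->
  pderiv k (fun z => G z i j) y = dmetric y (delta_mx 0 k) i j.
Proof. by move=> Uy; rewrite /pderiv dmetric_entry. Qed.

Lemma dmetric_linear y c : U y -> dmetric y c = \sum_k c 0 k *: dmetric y (delta_mx 0 k).
Proof.
move=> Uy; rewrite !dmetric_unlock deriveE; last exact: metric_diff.
rewrite {1}(row_sum_delta c) linear_sum; apply: eq_bigr => k _.
by rewrite linearZ dmetric_unlock deriveE//; exact: metric_diff.
Qed.

Lemma dmetricZ y k c : U y -> dmetric y (k *: c) = k *: dmetric y c.
Proof. by move=> Uy; rewrite !dmetric_unlock !deriveE ?linearZ//; exact: metric_diff. Qed.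

Lemma metricT y : U y -> (G y)^T = G y.
Proof. by move=> Uy; apply: Defs.metric_sym. Qed.

Lemma metric_pos y u : U y -> u != 0 -> 0 < bil (G y) u u.
Proof. by rewrite bil_unlock => Uy; exact: metric_posdef. Qed.

Lemma metric_unit y : U y -> G y \in unitmx.
Proof. by move=> Uy; apply: posdef_unitmx => u; exact: metric_pos. Qed.

Lemma dmetricT y c : U y -> (dmetric y c)^T = dmetric y c.
Proof.
move=> Uy; apply/matrixP => i j; rewrite mxE -!dmetric_entry//.
apply: near_eq_derive; apply: filterS (open_near oU Uy) => z Uz.
by rewrite -[in LHS](metricT Uz) mxE.
Qed.

(** The Christoffel symbols as a vector-valued bilinear form: the geodesic equation reads X'' = -
    chr X' X'. *)
Definition chr : 'rV[R]_d -> 'rV[R]_d -> 'rV[R]_d -> 'rV[R]_d :=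
  locked_with lock_key (fun y u v =>
    \row_k \sum_i \sum_j christoffel g a k i j y * u 0 i * v 0 j).

Lemma chrE y u v k :
  chr y u v 0 k = \sum_i \sum_j christoffel g a k i j y * u 0 i * v 0 j.
Proof. by rewrite /chr unlock mxE. Qed.

Lemma chrZl y k u v : chr y (k *: u) v = k *: chr y u v.
Proof.
apply/rowP => l; rewrite mxE !chrE mulr_sumr; apply: eq_bigr => i _.
by rewrite mulr_sumr; apply: eq_bigr => j _; rewrite !mxE; ring.
Qed.

Lemma chrZr y k u v : chr y u (k *: v) = k *: chr y u v.
Proof.
apply/rowP => l; rewrite mxE !chrE mulr_sumr; apply: eq_bigr => i _.
by rewrite mulr_sumr; apply: eq_bigr => j _; rewrite !mxE; ring.
Qed.

Lemma chrDl y u v w : chr y (u + v) w = chr y u w + chr y v w.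
Proof.
apply/rowP => l; rewrite mxE !chrE -big_split; apply: eq_bigr => i _.
by rewrite -big_split; apply: eq_bigr => j _; rewrite !mxE /=; ring.
Qed.

Lemma chrDr y u v w : chr y u (v + w) = chr y u v + chr y u w.
Proof.
apply/rowP => l; rewrite mxE !chrE -big_split; apply: eq_bigr => i _.
by rewrite -big_split; apply: eq_bigr => j _; rewrite !mxE /=; ring.
Qed.

Lemma bil_dmetric y b u v : U y ->
  bil (dmetric y b) u v =
    \sum_i \sum_j \sum_l u 0 i * v 0 j * b 0 l * dmetric y (delta_mx 0 l) i j.
Proof.
move=> Uy; rewrite bilE; apply: eq_bigr => i _; apply: eq_bigr => j _.
rewrite dmetric_linear// summxE mulr_sumr mulr_suml; apply: eq_bigr => l _.
by rewrite mxE; ring.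
Qed.

(** Koszul's formula for constant coordinate fields. Lowering the index with the metric removes the
    inverse matrix from the definition of the Christoffel symbols, and later arguments use only this
    form. *)
Lemma bil_chr y u v w : U y ->
  bil (G y) (chr y u v) w =
    2^-1 * (bil (dmetric y u) v w + bil (dmetric y v) u w - bil (dmetric y w) u v).
Proof.
move=> Uy.
pose t : 'rV[R]_d := \row_l (2^-1 * \sum_i \sum_j u 0 i * v 0 j *
   (dmetric y (delta_mx 0 i) j l + dmetric y (delta_mx 0 j) i l - dmetric y (delta_mx 0 l) i j)).
have E : chr y u v = t *m (invmx (G y))^T.
  apply/rowP => k; rewrite chrE mxE.
  transitivity (\sum_i \sum_j \sum_l 2^-1 * (invmx (G y) k l * (u 0 i * v 0 j *
   (dmetric y (delta_mx 0 i) j l + dmetric y (delta_mx 0 j) i l - dmetric y (delta_mx 0 l) i j)))).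
    apply: eq_bigr => i _; apply: eq_bigr => j _.
    rewrite /christoffel -/G mulr_sumr !mulr_suml; apply: eq_bigr => l _.
    by rewrite !pderiv_metric//; ring.
  under eq_bigr do rewrite exchange_big/=.
  rewrite exchange_big/=; apply: eq_bigr => l _; rewrite !mxE.
  rewrite mulr_sumr mulr_suml; apply: eq_bigr => i _.
  by rewrite mulr_sumr mulr_suml; apply: eq_bigr => j _; ring.
have -> : bil (G y) (chr y u v) w = (t *m w^T) 0 0.
  rewrite bil_unlock E -(metricT Uy) trmx_inv trmxK (metricT Uy).
  by rewrite -(mulmxA t) mulVmx ?mulmx1//; exact: metric_unit.
pose T i j l := dmetric y (delta_mx 0 l) i j.
have -> : (t *m w^T) 0 0 = 2^-1 * (\sum_i \sum_j \sum_l u 0 i * v 0 j * w 0 l * T j l i +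
   \sum_i \sum_j \sum_l u 0 i * v 0 j * w 0 l * T i l j
   - \sum_i \sum_j \sum_l u 0 i * v 0 j * w 0 l * T i j l).
  rewrite mxE -big_split -sumrB/= mulr_sumr.
  under [RHS]eq_bigr do rewrite -big_split -sumrB/= mulr_sumr.
  under [RHS]eq_bigr do under eq_bigr do rewrite -big_split -sumrB/= mulr_sumr.
  under [RHS]eq_bigr do rewrite exchange_big/=.
  rewrite [RHS]exchange_big/=; apply: eq_bigr => l _; rewrite !mxE.
  rewrite mulr_sumr mulr_suml; apply: eq_bigr => i _.
  by rewrite mulr_sumr mulr_suml; apply: eq_bigr => j _; rewrite /T; ring.
congr (_ * (_ + _ - _)); symmetry; [apply: etrans (bil_dmetric u v w Uy) _|
  apply: etrans (bil_dmetric v u w Uy) _|exact: etrans (bil_dmetric w u v Uy) _];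
  symmetry.
- rewrite exchange_big/=; apply: eq_bigr => j _.
  rewrite exchange_big/=; apply: eq_bigr => l _.
  by apply: eq_bigr => i _; rewrite /T; ring.
- apply: eq_bigr => i _; rewrite exchange_big/=; apply: eq_bigr => l _.
  by apply: eq_bigr => j _; rewrite /T; ring.
Qed.

Lemma chr_sym y u v : U y -> chr y u v = chr y v u.
Proof.
move=> Uy; apply: (@posdef_inj _ _ (G y)) => [w|w]; first exact: metric_pos.
 rewrite !bil_chr//.
congr (_ * (_ - _)); first exact: addrC.
exact: (bil_symm _ _ (dmetricT w Uy)).
Qed.

Lemma christoffel_diff y k i j : U y -> differentiable (christoffel g a k i j) y.
Proof.
move=> Uy.
have dE l m n : differentiable (fun z => pderiv l (fun z => G z m n) z) y.
  apply: (@near_eq_differentiable _ _ _ (fun z => dmetric z (delta_mx 0 l) m n)).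
    by apply: filterS (open_near oU Uy) => z Uz; rewrite pderiv_metric.
  apply: (@differentiable_comp _ _ _ _ (fun z => dmetric z (delta_mx 0 l)) (fun M : 'M[R]_d => M m n)).
    exact: dmetric_diff.
  exact: differentiable_coord.
rewrite /christoffel; apply: differentiable_mul; first exact: differentiable_cst.
apply: differentiable_big_sum => l; apply: differentiable_mul.
  apply: differentiable_invmx => [|m n]; last exact: metric_diff_entry.
  by apply: filterS (open_near oU Uy) => z Uz; exact: metric_unit.
by apply: differentiableB => //; apply: differentiableD.
Qed.

Lemma chr_diff y u v : U y -> differentiable (fun z => chr z u v) y.
Proof.
move=> Uy; apply: mx_differentiable => i j.
rewrite (_ : (fun _ => _) = (fun z => \sum_k \sum_l christoffel g a j k l z * u 0 k * v 0 l)); last first.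
  by apply/funext => z; rewrite ?(ord1 i) chrE.
apply: differentiable_big_sum => k; apply: differentiable_big_sum => l.
apply: differentiable_mul; last exact: differentiable_cst.
apply: differentiable_mul; last exact: differentiable_cst.
exact: christoffel_diff.
Qed.

Definition dchr : 'rV[R]_d -> 'rV[R]_d -> 'rV[R]_d -> 'rV[R]_d -> 'rV[R]_d :=
  locked_with lock_key (fun y c u v => 'D_c (fun z => chr z u v) y).

Lemma dchr_unlock y c u v : dchr y c u v = 'D_c (fun z => chr z u v) y.
Proof. by rewrite /dchr unlock. Qed.

Lemma dchrE y c u v l : U y ->
  dchr y c u v 0 l = \sum_i \sum_j \sum_k
     c 0 k * pderiv k (christoffel g a l i j) y * u 0 i * v 0 j.
Proof.
move=> Uy; rewrite dchr_unlock derive_mx ?mxE; last exact/diff_derivable/chr_diff.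
rewrite (_ : (fun _ => _) = (fun z => \sum_i \sum_j christoffel g a l i j z * u 0 i * v 0 j)); last first.
  by apply/funext => z; rewrite ?(ord1 i) chrE.
have E (f : 'I_d -> 'rV[R]_d -> R) : (forall i, differentiable (f i) y) ->
    'D_c (fun z => \sum_i f i z) y = \sum_i 'D_c (f i) y.
  move=> df; rewrite (_ : (fun _ => _) = \sum_i f i); last by apply/funext => z; rewrite fct_sumE.
  by rewrite derive_sum// => i; exact: diff_derivable.
have D i j : differentiable (fun z => christoffel g a l i j z * u 0 i * v 0 j) y.
  apply: differentiable_mul; last exact: differentiable_cst.
  apply: differentiable_mul; last exact: differentiable_cst.
  exact: christoffel_diff.
rewrite E => [|i]; last by apply: differentiable_big_sum.
apply: eq_bigr => i _; rewrite E//; apply: eq_bigr => j _.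
have -> : (fun z => christoffel g a l i j z * u 0 i * v 0 j) =
  ((u 0 i * v 0 j) *: christoffel g a l i j).
  by apply/funext => z; rewrite /GRing.scale/= /GRing.scale/=; ring.
rewrite deriveE; last by apply: differentiableZ; exact: christoffel_diff.
rewrite {1}(row_sum_delta c) linear_sum; apply: eq_bigr => k _.
rewrite linearZ -deriveE; last by apply: differentiableZ; exact: christoffel_diff.
rewrite deriveZ/=; last by apply: diff_derivable; exact: christoffel_diff.
by rewrite /GRing.scale/= /pderiv; ring.
Qed.

(** Index-free form of the curvature: the vectors are extended as constant fields, so the bracket
    term disappears. *)
Lemma curvatureE y u v w : U y ->
  curvature g a y u v w =
    dchr y u v w - dchr y v u w + chr y u (chr y v w) - chr y v (chr y u w).
Proof.
move=> Uy; apply/rowP => l; rewrite !mxE !dchrE// !chrE.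
transitivity (\sum_i \sum_j \sum_k (u 0 i * v 0 j * w 0 k *
   (pderiv i (christoffel g a l j k) y) - u 0 i * v 0 j * w 0 k * pderiv j (christoffel g a l i k) y
  + (\sum_m u 0 i * v 0 j * w 0 k * (christoffel g a m j k y * christoffel g a l i m y)
   - \sum_m u 0 i * v 0 j * w 0 k * (christoffel g a m i k y * christoffel g a l j m y)))).
  apply: eq_bigr => i _; apply: eq_bigr => j _; apply: eq_bigr => k _.
  rewrite /curvature_coef mulrDr mulrBr; congr (_ + _).
  by rewrite mulr_sumr -sumrB; apply: eq_bigr => m _; ring.
under eq_bigr do under eq_bigr do rewrite big_split sumrB sumrB /=.
under eq_bigr do rewrite big_split sumrB sumrB /=.
rewrite big_split sumrB sumrB /= addrA; congr (_ - _ + _ - _).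
- rewrite exchange_big/=; apply: eq_bigr => j _; rewrite exchange_big/=.
  by apply: eq_bigr => k _; apply: eq_bigr => i _; ring.
- apply: eq_bigr => i _; rewrite exchange_big/=.
  by apply: eq_bigr => k _; apply: eq_bigr => j _; ring.
- apply: eq_bigr => i _.
  under [RHS]eq_bigr do rewrite chrE mulr_sumr.
  rewrite [RHS]exchange_big/=; apply: eq_bigr => j _.
  under [RHS]eq_bigr do rewrite mulr_sumr.
  rewrite [RHS]exchange_big/=; apply: eq_bigr => k _.
  by apply: eq_bigr => m _; ring.
- rewrite exchange_big/=; apply: eq_bigr => j _.
  under [RHS]eq_bigr do rewrite chrE mulr_sumr.
  rewrite [RHS]exchange_big/=; apply: eq_bigr => i _.
  under [RHS]eq_bigr do rewrite mulr_sumr.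
  rewrite [RHS]exchange_big/=; apply: eq_bigr => k _.
  by apply: eq_bigr => m _; ring.
Qed.
End Chart.

(** Let S be the set of [t] such that [P] holds on [a, t]. The limit hypothesis gives [P] at sup S,
    and the extension hypothesis forbids sup S < b. This serves to follow curves from chart to
    chart. *)
Lemma real_induction (R : realType) (P : R -> Prop) (a b : R) : P a ->
  (forall t, a <= t -> t < b -> (forall s, a <= s <= t -> P s) ->
     exists2 e, 0 < e & forall s, t < s < t + e -> s <= b -> P s) ->
  (forall t, a < t -> t <= b -> (forall s, a <= s < t -> P s) -> P t) ->
  forall t, a <= t <= b -> P t.
Proof.
move=> Pa Hs Hl t0 /andP[at0 t0b].
pose S := [set t | a <= t <= b /\ forall s, a <= s <= t -> P s].
have Sa : S a.
  split; first by rewrite lexx (le_trans at0).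
  by move=> s; rewrite -eq_le => /eqP <-.
have hS : has_sup S by split; [exists a|exists b => t [/andP[]]].
have aS : a <= sup S by apply: ub_le_sup => //; case: hS.
have Sb : sup S <= b by apply: ge_sup; [exists a|move=> t [/andP[]]].
have below s : a <= s -> s < sup S -> P s.
  move=> as_ sS; have e0 : 0 < sup S - s by rewrite subr_gt0.
  have [t [_ tP] st] := sup_adherent e0 hS.
  by apply: tP; rewrite as_ ltW//; move: st; rewrite opprB addrC subrK.
have PS : P (sup S).
  move: aS; rewrite le_eqVlt => /predU1P[<-//|aS]; apply: Hl => // s /andP[].
  exact: below.
have upto s : a <= s <= sup S -> P s.
  by move=> /andP[as_]; rewrite le_eqVlt => /predU1P[->//|]; exact: below.
move: Sb; rewrite le_eqVlt => /predU1P[Sb|Sb].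
  by apply: upto; rewrite at0 Sb.
have [e e0 He] := Hs _ aS Sb upto.
pose t1 := Num.min b (sup S + e / 2).
suff : S t1.
  move=> St1; have : t1 <= sup S by apply: ub_le_sup => //; case: hS.
  by rewrite /t1 ge_min leNgt Sb/= gerDl leNgt divr_gt0.
have St1 : sup S <= t1 by rewrite /t1 le_min ltW//= lerDl ltW// divr_gt0.
split; first by rewrite (le_trans aS)//= /t1 ge_min lexx.
move=> s /andP[as_ st1]; have [sS|Ss] := leP s (sup S); first by apply: upto; rewrite as_.
apply: He.
  rewrite Ss (le_lt_trans st1)// /t1 gt_min; apply/orP; right.
  by rewrite ltrD2l ltr_pdivrMr// mulr_natr mulr2n ltrDl.
by rewrite (le_trans st1)// /t1 ge_min lexx.
Qed.

Lemma sqr_sum_le (R : realType) (I : finType) (x : I -> R) :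
  (\sum_i x i) ^+ 2 <= #|I|%:R * \sum_i x i ^+ 2.
Proof.
have : 0 <= \sum_i \sum_j (x i - x j) ^+ 2.
  by apply: sumr_ge0 => i _; apply: sumr_ge0 => j _; exact: sqr_ge0.
have -> : \sum_i \sum_j (x i - x j) ^+ 2 =
    \sum_i \sum_j (x i ^+ 2 + x j ^+ 2 - 2 * (x i * x j)).
  by apply: eq_bigr => i _; apply: eq_bigr => j _; ring.
under eq_bigr do rewrite sumrB big_split/=.
rewrite sumrB big_split/=.
have -> : \sum_i \sum_(j : I) x i ^+ 2 = #|I|%:R * \sum_i x i ^+ 2.
  by rewrite mulr_sumr; apply: eq_bigr => i _; rewrite sumr_const mulr_natl.
have -> : \sum_(i : I) \sum_j x j ^+ 2 = #|I|%:R * \sum_i x i ^+ 2.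
  by rewrite sumr_const mulr_natl.
have -> : \sum_i \sum_j 2 * (x i * x j) = 2 * (\sum_i x i) ^+ 2.
  rewrite expr2 mulr_suml mulr_sumr; apply: eq_bigr => i _.
  by rewrite mulr_sumr mulr_sumr.
by move=> H; lra.
Qed.

Lemma is_derive_bigsum (R : realType) (V W : normedModType R) (I : Type) (r : seq I)
    (P : pred I) (f : I -> V -> W) (df : I -> W) (x v : V) :
  (forall i, is_derive x v (f i) (df i)) ->
  is_derive x v (fun y => \sum_(i <- r | P i) f i y) (\sum_(i <- r | P i) df i).
Proof.
move=> fd; elim: r => [|i r IH].
  rewrite big_nil (_ : (fun _ => _) = cst 0); first exact: is_derive_cst.
  by apply/funext => y; rewrite big_nil.
rewrite big_cons; case: (boolP (P i)) => Pi.
  rewrite (_ : (fun _ => _) = (f i + (fun y => \sum_(j <- r | P j) f j y))).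
    exact: is_deriveD.
  by apply/funext => y; rewrite big_cons Pi.
rewrite (_ : (fun _ => _) = (fun y => \sum_(j <- r | P j) f j y))//.
by apply/funext => y; rewrite big_cons (negbTE Pi).
Qed.

Lemma cvg_bigsum (R : realType) (W : normedModType R) (T : Type) (F : set_system T)
    (I : Type) (r : seq I) (P : pred I) (f : I -> T -> W) (l : I -> W) : Filter F ->
  (forall i, f i @ F --> l i) ->
  (fun y => \sum_(i <- r | P i) f i y) @ F --> \sum_(i <- r | P i) l i.
Proof.
move=> FF fl; elim: r => [|i r IH].
  rewrite big_nil (_ : (fun _ => _) = cst 0); first exact: cvg_cst.
  by apply/funext => y; rewrite big_nil.
rewrite big_cons; case: (boolP (P i)) => Pi.
  rewrite (_ : (fun _ => _) = (f i \+ (fun y => \sum_(j <- r | P j) f j y))).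
    exact: cvgD.
  by apply/funext => y; rewrite big_cons Pi.
rewrite (_ : (fun _ => _) = (fun y => \sum_(j <- r | P j) f j y))//.
by apply/funext => y; rewrite big_cons (negbTE Pi).
Qed.

(** Uniqueness for a linear first-order system: the sum of the squares has derivative at most 2 L
    times the square of the sum of the |z j|, hence at most [2 * L * #|I|%:R] times itself. *)
Lemma gronwall_family (R : realType) (I : finType) (z dz : I -> R -> R) (L a b : R) :
  0 <= L ->
  (forall i t, t \in `]a, b[ -> is_derive t 1 (z i) (dz i t)) ->
  (forall i t, t \in `]a, b[ -> `|dz i t| <= L * \sum_j `|z j t|) ->
  (forall i, {within `[a, b], continuous (z i)}) -> (forall i, z i a = 0) ->
  forall t, t \in `[a, b] -> forall i, z i t = 0.
Proof.
move=> L0 zd zdz zc za t tab i.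
pose e s := \sum_i z i s ^+ 2.
suff : e t <= 0.
  rewrite le_eqVlt ltNge sumr_ge0 ?orbF; last by move=> j _; exact: sqr_ge0.
  rewrite psumr_eq0 => [/allP/(_ i)|j _]; last exact: sqr_ge0.
  by rewrite mem_index_enum sqrf_eq0 => /(_ isT)/eqP.
apply: (@gronwall_le0 _ e (fun s => \sum_i 2 * (z i s * dz i s)) (2 * L * #|I|%:R) a b) => //.
- move=> s sab.
  have H j : is_derive s 1 (fun s => z j s ^+ 2) (2 * (z j s * dz j s)).
    have := @is_deriveX _ _ (z j) 2 s 1 (dz j s) (zd j s sab).
    by move=> H; apply: (is_derive_eq H); rewrite /GRing.scale/= expr1; ring.
  exact: is_derive_bigsum.
- move=> s sab.
  apply: (@le_trans _ _ (\sum_j 2 * (`|z j s| * (L * \sum_k `|z k s|)))).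
    apply: ler_sum => j _; rewrite ler_pM2l//.
    by rewrite (le_trans (ler_norm _))// normrM ler_wpM2l// zdz.
  rewrite -mulr_sumr -mulr_suml.
  have := @sqr_sum_le R I (fun j => `|z j s|).
  under [X in _ <= _ * X]eq_bigr do rewrite real_normK ?num_real//.
  rewrite -/(e s); set T := \sum_k _ => H.
  have -> : 2 * (T * (L * T)) = 2 * L * T ^+ 2 by ring.
  by rewrite -(mulrA (2 * L)) ler_wpM2l// mulr_ge0.
- move=> s; apply: cvg_bigsum => j.
  exact: (cvgM (zc j s) (zc j s)).
- by rewrite /e big1// => j _; rewrite za expr0n.
Qed.

Section ForContinuous.
Variables (R : realType) (T : topologicalType) (k l : T -> R) (x : T).
Hypotheses (ck : {for x, continuous k}) (cl : {for x, continuous l}).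

Lemma for_continuousD : {for x, continuous (fun y => k y + l y)}.
Proof. exact: (cvgD ck cl). Qed.

Lemma for_continuousM : {for x, continuous (fun y => k y * l y)}.
Proof. exact: (cvgM ck cl). Qed.

Lemma for_continuousN : {for x, continuous (fun y => - k y)}.
Proof. exact: (cvgN ck). Qed.

Lemma for_continuousV : k x != 0 -> {for x, continuous (fun y => (k y)^-1)}.
Proof. by move=> k0; exact: (cvgV k0 ck). Qed.

End ForContinuous.

Lemma is_derive_scalel (R : realType) (V : normedModType R) (w : V) (s : R) :
  is_derive s 1 (fun t : R => t *: w) w.
Proof.
have ds : is_diff s (fun t : R => t *: w) (fun t : R => t *: w) by exact: is_diff_scalel.
have d : differentiable (fun t : R => t *: w) s by exact: ex_diff.
by split; [exact: diff_derivable|rewrite deriveE// diff_val scale1r].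
Qed.

Lemma is_derive_line (R : realType) (V : normedModType R) (y w : V) (s : R) :
  is_derive s 1 (fun t : R => y + t *: w) w.
Proof.
rewrite -[X in is_derive _ _ _ X]add0r.
by apply: is_deriveD; exact: is_derive_scalel.
Qed.

(** * Continuously differentiable scalar functions and their local Lipschitz bounds *)

Section C1.
Variables (R : realType) (d : nat).
Implicit Types (U : set 'rV[R]_d) (f h : 'rV[R]_d -> R).

Definition C1fun U f := (forall x, U x -> differentiable f x) /\
  (forall v x, U x -> {for x, continuous ('D_v f)}).

Lemma C1fun_continuous U f x : C1fun U f -> U x -> {for x, continuous f}.
Proof. by move=> [df _] Ux; exact/differentiable_continuous/df. Qed.

Lemma continuous_near_eq (T S : topologicalType) (k l : T -> S) x :
  (\forall y \near x, k y = l y) -> {for x, continuous k} -> {for x, continuous l}.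
Proof.
move=> kl; rewrite /prop_for /continuous_at -(nbhs_singleton kl) => H.
exact: cvg_trans (near_eq_cvg kl) H.
Qed.

Lemma C1fun_eq U f h : open U -> (forall x, U x -> f x = h x) -> C1fun U f -> C1fun U h.
Proof.
move=> oU fh [df cf]; have N x : U x -> \forall y \near x, f y = h y.
  by move=> Ux; apply: filterS (open_near oU Ux); exact: fh.
split=> [x Ux|v x Ux]; first exact: near_eq_differentiable (N x Ux) (df x Ux).
apply: continuous_near_eq (cf v x Ux).
by apply: filterS (open_near oU Ux) => y Uy; exact/near_eq_derive/N.
Qed.

Lemma C1fun_cst U c : C1fun U (cst c).
Proof.
split=> [x Ux|v x Ux]; first exact: differentiable_cst.
rewrite (_ : 'D_v _ = cst 0); first exact: cst_continuous.
by apply/funext => y; rewrite derive_cst.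
Qed.

Lemma C1funM U f h : open U -> C1fun U f -> C1fun U h -> C1fun U (fun x => f x * h x).
Proof.
move=> oU Cf Ch; have [df cf] := Cf; have [dh ch] := Ch.
split=> [x Ux|v x Ux]; first by apply: differentiable_mul; [exact: df|exact: dh].
apply: (@continuous_near_eq _ _ (fun y => f y * 'D_v h y + h y * 'D_v f y)).
  apply: filterS (open_near oU Ux) => y Uy.
  by rewrite (deriveM (diff_derivable (df y Uy)) (diff_derivable (dh y Uy))).
by apply: for_continuousD; apply: for_continuousM; [exact: C1fun_continuous Cf Ux|exact: ch
  |exact: C1fun_continuous Ch Ux|exact: cf].
Qed.

Lemma C1funD U f h : open U -> C1fun U f -> C1fun U h -> C1fun U (fun x => f x + h x).
Proof.
move=> oU [df cf] [dh ch].
split=> [x Ux|v x Ux]; first by apply: differentiableD; [exact: df|exact: dh].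
apply: (@continuous_near_eq _ _ (fun y => 'D_v f y + 'D_v h y)).
  apply: filterS (open_near oU Ux) => y Uy.
  by rewrite (deriveD (diff_derivable (df y Uy)) (diff_derivable (dh y Uy))).
by apply: for_continuousD; [exact: cf|exact: ch].
Qed.

Lemma C1funV U f : open U -> (forall x, U x -> f x != 0) -> C1fun U f ->
  C1fun U (fun x => (f x)^-1).
Proof.
move=> oU f0 Cf; have [df cf] := Cf.
split=> [x Ux|v x Ux]; first by apply: differentiableV; [exact: df|exact: f0].
apply: (@continuous_near_eq _ _ (fun y => - ((f y)^-1 * (f y)^-1 * 'D_v f y))).
  apply: filterS (open_near oU Ux) => y Uy.
  rewrite (deriveV (f0 y Uy) (diff_derivable (df y Uy))).
  by rewrite /GRing.scale/= -expr2 exprVn mulNr.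
have cV : {for x, continuous (fun x => (f x)^-1)}.
  by apply: for_continuousV; [exact: C1fun_continuous Cf Ux|exact: f0].
apply: for_continuousN; apply: for_continuousM; last exact: cf.
exact: for_continuousM.
Qed.

Lemma C1fun_sum U (I : Type) (r : seq I) (P : pred I) (f : I -> 'rV[R]_d -> R) :
  open U -> (forall i, C1fun U (f i)) -> C1fun U (fun x => \sum_(i <- r | P i) f i x).
Proof.
move=> oU Cf; elim: r => [|i r IH].
  by apply: (C1fun_eq oU) (C1fun_cst U 0) => x _; rewrite big_nil.
case: (boolP (P i)) => Pi.
  by apply: (C1fun_eq oU) (C1funD oU (Cf i) IH) => x _; rewrite big_cons Pi.
by apply: (C1fun_eq oU) IH => x _; rewrite big_cons (negbTE Pi).
Qed.

Lemma C1fun_prod U (I : Type) (r : seq I) (P : pred I) (f : I -> 'rV[R]_d -> R) :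
  open U -> (forall i, C1fun U (f i)) -> C1fun U (fun x => \prod_(i <- r | P i) f i x).
Proof.
move=> oU Cf; elim: r => [|i r IH].
  by apply: (C1fun_eq oU) (C1fun_cst U 1) => x _; rewrite big_nil.
case: (boolP (P i)) => Pi.
  by apply: (C1fun_eq oU) (C1funM oU (Cf i) IH) => x _; rewrite big_cons Pi.
by apply: (C1fun_eq oU) IH => x _; rewrite big_cons (negbTE Pi).
Qed.

Lemma C1fun_det U n (A : 'rV[R]_d -> 'M[R]_n) : open U ->
  (forall i j, C1fun U (fun y => A y i j)) -> C1fun U (fun y => \det (A y)).
Proof.
move=> oU CA; rewrite /determinant; apply: C1fun_sum => // s.
apply: C1funM => //; first exact: C1fun_cst.
exact: C1fun_prod.
Qed.

Lemma C1fun_invmx U n (A : 'rV[R]_d -> 'M[R]_n) i j : open U ->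
  (forall y, U y -> A y \in unitmx) ->
  (forall i j, C1fun U (fun y => A y i j)) -> C1fun U (fun y => invmx (A y) i j).
Proof.
move=> oU uA CA.
apply: (@C1fun_eq U (fun y => (\det (A y))^-1 * cofactor (A y) j i)) => //.
  by move=> x /uA ux; rewrite /invmx ux !mxE.
apply: C1funM => //.
  apply: C1funV => //; last exact: C1fun_det.
  by move=> x /uA; rewrite unitmxE unitfE.
rewrite /cofactor; apply: C1funM => //; first exact: C1fun_cst.
apply: C1fun_det => // k l.
by apply: C1fun_eq (CA (lift j k) (lift i l)) => // x _; rewrite !mxE.
Qed.

Lemma smooth_C1fun U m n (f : 'rV[R]_d -> 'M[R]_(m, n)) i j : open U -> smooth U f ->
  C1fun U (fun x => f x i j).
Proof.
move=> oU sf.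
have co : continuous (fun M : 'M[R]_(m, n) => M i j).
  by move=> M; exact: (differentiable_continuous (differentiable_coord _ i j)).
split=> [x Ux|v x Ux].
  apply: (@differentiable_comp _ _ _ _ f (fun M : 'M[R]_(m, n) => M i j)).
    exact: smooth_differentiable sf Ux.
  exact: differentiable_coord.
apply: (@continuous_near_eq _ _ ((fun M : 'M[R]_(m, n) => M i j) \o 'D_v f)).
  apply: filterS (open_near oU Ux) => y Uy.
  by rewrite /= derive_mx ?mxE//; exact: smooth_derivable sf Uy.
apply: continuous_comp; first exact: smooth_continuous (smooth_derive v sf) Ux.
exact: co.
Qed.

Lemma derive_rV_sum f x v : differentiable f x ->
  'D_v f x = \sum_i v 0 i * 'D_(delta_mx 0 i) f x.
Proof.
move=> df; rewrite deriveE// {1}(row_sum_delta v) linear_sum; apply: eq_bigr => k _.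
by rewrite linearZ deriveE.
Qed.

(** The partial derivatives are bounded on a small ball; balls are convex, so the mean value theorem
    applies on the segment between two points. *)
Lemma C1fun_lipschitz U f x0 : open U -> U x0 -> C1fun U f ->
  exists r L, [/\ 0 < r, 0 <= L, (forall x, `|x - x0| < r -> U x) &
    forall x y, `|x - x0| < r -> `|y - x0| < r -> `|f x - f y| <= L * `|x - y|].
Proof.
move=> oU Ux0 [df cf].
pose P (i : 'I_d) y := `|'D_(delta_mx 0 i) f y| <= `|'D_(delta_mx 0 i) f x0| + 1.
have : \forall y \near x0, U y /\ forall i, P i y.
  have nU := open_near oU Ux0; apply: filterI; first exact: nU.
  apply: (@filter_forall _ _ P _ (nbhs_filter x0)) => i.
  have /cvgrPdist_le/(_ 1 ltr01) := cf (delta_mx 0 i) x0 Ux0.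
  apply: filterS => y H; rewrite /P -lerBlDl; apply: le_trans H.
  by rewrite distrC; exact: lerB_dist.
move=> /nbhs_ballP[r /= r0 Hr].
exists r, (\sum_i (`|'D_(delta_mx 0 i) f x0| + 1)); split => //.
- by apply: sumr_ge0 => i _; rewrite addr_ge0.
- by move=> x xr; have [] := Hr x; rewrite -?ball_normE//= distrC.
move=> x y xr yr; pose z s := y + s *: (x - y).
have zr s : 0 <= s <= 1 -> U (z s) /\ forall i, P i (z s).
  move=> /andP[s0 s1]; apply: Hr; rewrite -ball_normE /= distrC.
  have -> : z s - x0 = s *: (x - x0) + (1 - s) *: (y - x0).
    by rewrite /z; apply/rowP => k; rewrite !mxE; ring.
  rewrite (le_lt_trans (ler_normD _ _))// !normrZ (ger0_norm s0) ger0_norm ?subr_ge0//.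
  have [->|sn0] := eqVneq s 0; first by rewrite mul0r add0r subr0 mul1r.
  have sp : 0 < s by rewrite lt_neqAle eq_sym sn0.
  have A : s * `|x - x0| < s * r by rewrite ltr_pM2l.
  have B : (1 - s) * `|y - x0| <= (1 - s) * r by rewrite ler_wpM2l ?subr_ge0// ltW.
  lra.
have zd (s : R) : 0 <= s <= 1 -> is_derive s 1 (f \o z) ('D_(x - y) f (z s)).
  move=> /zr[Us _]; apply: is_derive_comp_curve; last exact: df.
  exact: is_derive_line.
have [||s sI0] := @MVT_segment R (f \o z) (fun s => 'D_(x - y) f (z s)) 0 1 ler01.
- by move=> s sI; apply: zd; move: sI; rewrite in_itv/= => /andP[/ltW-> /ltW->].
- apply: continuous_in_subspaceT => s; rewrite inE/= in_itv/= => sI.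
  exact: is_derive_continuous (zd s sI).
rewrite /= /z scale1r scale0r addr0 [y + _]addrC subrK subr0 mulr1 => ->.
have sI : 0 <= s <= 1 by move: sI0; rewrite in_itv.
have [Us Ps] := zr s sI.
rewrite derive_rV_sum; last exact: df.
rewrite (le_trans (ler_norm_sum _ _ _))// mulr_suml; apply: ler_sum => i _.
by rewrite normrM mulrC ler_pM//; [exact: Ps|exact: rV_coord_le].
Qed.

Lemma C1fun_lipschitz_family (I : finType) U (f : I -> 'rV[R]_d -> R) x0 :
  open U -> U x0 -> (forall i, C1fun U (f i)) ->
  exists r L, [/\ 0 < r, 0 <= L, (forall x, `|x - x0| < r -> U x) &
    forall i x y, `|x - x0| < r -> `|y - x0| < r -> `|f i x - f i y| <= L * `|x - y|].
Proof.
move=> oU Ux0 Cf.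
have [r0 [L0 [r00 _ rU _]]] := C1fun_lipschitz oU Ux0 (C1fun_cst U 0).
have [rL H] := choice (fun i => C1fun_lipschitz oU Ux0 (Cf i)).
have {H}[L H] := choice H.
exists (\big[Num.min/r0]_i rL i), (\sum_i L i).
have minle i : \big[Num.min/r0]_j rL j <= rL i by exact: bigmin_le.
split.
- apply: lt_bigmin => // i _; by have [] := H i.
- by apply: sumr_ge0 => i _; have [] := H i.
- move=> x xr; apply: rU; apply: lt_le_trans xr _; exact: bigmin_le_id.
- move=> i x y xr yr; have [_ _ _ ] := H i => /(_ x y).
  move=> /(_ (lt_le_trans xr (minle i)) (lt_le_trans yr (minle i)))/le_trans; apply.
  rewrite ler_wpM2r// (bigD1 i)//= lerDl sumr_ge0// => j _.
  by have [] := H j.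
Qed.

End C1.

Lemma is_derive_coord (R : realType) (V : normedModType R) m n (X : V -> 'M[R]_(m, n)) x v dX i j :
  is_derive x v X dX -> is_derive x v (fun y => X y i j) (dX i j).
Proof.
move=> [dd <-]; split; first by move/derivable_mxP: dd; apply.
by rewrite derive_mx// mxE.
Qed.

(** * Geodesics *)

Lemma christoffel_C1 (R : realType) (d : nat) (M : ptopologicalType)
    (g : riemannianManifold R d M) (a : chart R d M) k i j : atlas g a ->
  C1fun (chart_img a) (christoffel g a k i j).
Proof.
move=> aA; have oU := @open_chart_imgE _ _ _ a.
have sG := metric_smooth_at aA.
have dE l m n : C1fun (chart_img a) (fun z => pderiv l (fun z => metric g a z m n) z).
  apply: (@C1fun_eq _ _ _ (fun z => ('D_(delta_mx 0 l) (metric g a) z) m n)) => //.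
    by move=> x Ux; rewrite pderiv_metric// dmetric_unlock.
  by apply: smooth_C1fun => //; exact: smooth_derive.
rewrite /christoffel; apply: C1funM => //; first exact: C1fun_cst.
apply: C1fun_sum => // l; apply: C1funM => //.
  apply: C1fun_invmx => // [y Uy|m n]; first exact: metric_unit.
  exact: smooth_C1fun.
apply: C1funD => //; first exact: C1funD.
by apply: (@C1fun_eq _ _ _ _ _ oU _ (C1funM oU (C1fun_cst _ (-1)) (dE l i j))) => x _; rewrite mulN1r.
Qed.

(** One factor is changed at a time. It is applied to a Christoffel symbol times two velocity
    components. *)
Lemma trilinear_diff_le (R : realType) (L B Q T p q a b c d : R) :
  0 <= B -> 0 <= Q -> 0 <= T -> `|p - q| <= L * T -> `|q| <= Q ->
  `|a| <= B -> `|b| <= B -> `|c| <= B -> `|d| <= B -> `|a - c| <= T -> `|b - d| <= T ->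
  `|p * a * b - q * c * d| <= (L * B ^+ 2 + 2 * (Q * B)) * T.
Proof.
move=> B0 Q0 T0 LX QX aB bB cB dB ac bd.
have -> : p * a * b - q * c * d = (p - q) * (a * b) + q * ((a - c) * b) + q * (c * (b - d)) by ring.
have -> : (L * B ^+ 2 + 2 * (Q * B)) * T = L * T * (B * B) + Q * (T * B) + Q * (B * T) by ring.
rewrite (le_trans (ler_normD _ _))// lerD//.
  by rewrite (le_trans (ler_normD _ _))// lerD// !normrM ler_pM ?mulr_ge0// ler_pM.
by rewrite !normrM ler_pM ?mulr_ge0// ler_pM.
Qed.

Section Geodesics.
Variables (R : realType) (d : nat) (M : ptopologicalType).
Variable g : riemannianManifold R d M.
Implicit Types (a : chart R d M) (c : R -> M) (I : set R).

Lemma curve_dom_open a c I : open I -> (forall t, I t -> {for t, continuous c}) ->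
  open (I `&` c @^-1` chart_dom a).
Proof.
move=> oI cI; rewrite openE => t [It ct].
apply: filterI; first exact: open_nbhs_nbhs.
by apply: (cI t It); exact: open_nbhs_nbhs (conj (open_chart_dom a) ct).
Qed.

Lemma Ck_curve_reg n a c I t : atlas g a -> open I -> Ck_curve g n.+1 I c ->
  I t -> chart_dom a (c t) ->
  derivable (cmap a \o c) t 1 /\ {for t, continuous ('D_1 (cmap a \o c))}.
Proof.
move=> aA oI [cc H] It dt; have [_ /(_ 1)[dd]] := H a aA.
by move=> Hn; split; [exact: dd|case: n H Hn => [|n] H [+ _]; apply].
Qed.

Lemma geodesic_C1 I c : geodesic g I c -> Ck_curve g 1 I c.
Proof.
move=> [oI [cc H] _]; split; first exact: cc.
move=> a aA; have [H0 H1] := H a aA.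
split=> [t tt|v]; first exact: H0.
have [H2 [H3 _]] := H1 v; split => //.
Qed.

Lemma geodesic_eq a c I t : atlas g a -> geodesic g I c -> I t -> chart_dom a (c t) ->
  is_derive t 1 ('D_1 (cmap a \o c))
    (- chr g a (cmap a (c t)) ('D_1 (cmap a \o c) t) ('D_1 (cmap a \o c) t)).
Proof.
move=> aA [oI CI Heq] It dt.
have [cc H] := CI; have [_ /(_ 1)[_ [_ /(_ 1)[dd _]]]] := H a aA.
split; first exact: dd.
apply/rowP => k; rewrite mxE chrE; apply/eqP; rewrite -subr_eq0 opprK; apply/eqP.
exact: (Heq a t aA It dt k).
Qed.

Lemma curve_img a c t : chart_dom a (c t) -> chart_img a (cmap a (c t)).
Proof. by exists (c t). Qed.

(** Christoffel symbols are locally Lipschitz, so the differences of positions and of velocities in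
    one chart satisfy a linear differential inequality with zero initial data. *)
Lemma geodesic_local_uniq a c1 c2 I1 I2 (t0 : R) : atlas g a ->
  geodesic g I1 c1 -> geodesic g I2 c2 -> I1 t0 -> I2 t0 ->
  chart_dom a (c1 t0) -> c1 t0 = c2 t0 ->
  'D_1 (cmap a \o c1) t0 = 'D_1 (cmap a \o c2) t0 ->
  exists2 e, 0 < e & forall t, t0 <= t < t0 + e -> c1 t = c2 t.
Proof.
move=> aA g1 g2 I1t I2t dt c12 D12.
pose X1 := cmap a \o c1; pose X2 := cmap a \o c2.
pose x0 := X1 t0; have Ux0 : chart_img a x0 by exact: curve_img.
have oU := @open_chart_imgE _ _ _ a.
have := @C1fun_lipschitz_family _ _ ('I_d * 'I_d * 'I_d)%type (chart_img a)
   (fun k => christoffel g a k.1.1 k.1.2 k.2) x0 oU Ux0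
   (fun k => christoffel_C1 _ _ _ aA).
move=> [r [L [r0 L0 rU HL]]].
have G1 := geodesic_eq aA g1; have G2 := geodesic_eq aA g2.
have [oI1 C1 _] := g1; have [oI2 C2 _] := g2; have [cc1 _] := C1; have [cc2 _] := C2.
have O1 := @curve_dom_open a c1 I1 oI1 cc1; have O2 := @curve_dom_open a c2 I2 oI2 cc2.
have reg c I t : geodesic g I c -> I t -> chart_dom a (c t) ->
    is_derive t 1 (cmap a \o c) ('D_1 (cmap a \o c) t) /\ {for t, continuous ('D_1 (cmap a \o c))}.
  move=> gc It ct; have [oI _ _] := gc.
  have [D1 D2] := Ck_curve_reg aA oI (geodesic_C1 gc) It ct.
  by split=> //; exact: derivableP.
have dt2 : chart_dom a (c2 t0) by rewrite -c12.
have [dX1 cV1] := reg _ _ _ g1 I1t dt; have [dX2 cV2] := reg _ _ _ g2 I2t dt2.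
pose V1 := 'D_1 X1; pose V2 := 'D_1 X2.
(* [B] bounds both velocities and [Q] the Christoffel symbols on the short interval where everything
   stays close to its value at [t0]. *)
pose B := `|V1 t0| + 1.
pose Q := L * r + \sum_(k : 'I_d * 'I_d * 'I_d) `|christoffel g a k.1.1 k.1.2 k.2 x0|.
have near0 : \forall t \near t0, [/\ (I1 `&` c1 @^-1` chart_dom a) t,
    (I2 `&` c2 @^-1` chart_dom a) t, `|X1 t - x0| < r /\ `|X2 t - x0| < r
    & `|V1 t| <= B /\ `|V2 t| <= B].
  have N1 := open_near O1 (conj I1t dt); have N2 := open_near O2 (conj I2t dt2).
  have N3 : \forall t \near t0, `|X1 t - x0| < r.
    have /cvgrPdist_lt/(_ r r0) := is_derive_continuous dX1.
    by apply: filterS => t; rewrite distrC.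
  have N4 : \forall t \near t0, `|X2 t - x0| < r.
    have /cvgrPdist_lt/(_ r r0) := is_derive_continuous dX2.
    by rewrite /= -c12; apply: filterS => t; rewrite distrC.
  have BN (V : R -> 'rV[R]_d) : {for t0, continuous V} -> V t0 = V1 t0 ->
      \forall t \near t0, `|V t| <= B.
    move=> /cvgrPdist_le/(_ 1 ltr01) H E; apply: filterS H => t H; rewrite /B -lerBlDl -E.
    by apply: le_trans H; rewrite distrC; exact: lerB_dist.
  have N5 := BN V1 cV1 erefl; have N6 := BN V2 cV2 (esym D12).
  apply: (filterS _ (filterI (filterI N1 N2) (filterI (filterI N3 N4) (filterI N5 N6)))).
  move=> t [[n1 n2] [[n3 n4] [n5 n6]]].
  exact: (And4 n1 n2 (conj n3 n4) (conj n5 n6)).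
move: near0 => /nbhs_ballP[e /= e0 He].
exists (e / 2); first by rewrite divr_gt0.
have {}He t : t0 <= t <= t0 + e / 2 -> [/\ (I1 `&` c1 @^-1` chart_dom a) t,
    (I2 `&` c2 @^-1` chart_dom a) t, `|X1 t - x0| < r /\ `|X2 t - x0| < r
    & `|V1 t| <= B /\ `|V2 t| <= B].
  move=> /andP[t0t tt]; apply: He; rewrite /ball/= distrC ger0_norm ?subr_ge0//.
  rewrite ltrBlDl (le_lt_trans tt)// ltrD2l ltr_pdivrMr// mulr_natr mulr2n ltrDl//.
(* The second-order equation as a first-order system: [inl] indexes the differences of positions,
   [inr] those of velocities. *)
pose z (i : 'I_d + 'I_d) t : R := match i with
  | inl i => X1 t 0 i - X2 t 0 i | inr i => V1 t 0 i - V2 t 0 i end.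
pose dz (i : 'I_d + 'I_d) t : R := match i with
  | inl i => V1 t 0 i - V2 t 0 i
  | inr i => (- chr g a (X1 t) (V1 t) (V1 t)) 0 i - (- chr g a (X2 t) (V2 t) (V2 t)) 0 i end.
have zd i t : t0 <= t <= t0 + e / 2 -> is_derive t 1 (z i) (dz i t).
  move=> /He[[I1s d1] [I2s d2] _ _]; case: i => i /=; apply: is_deriveB; apply: is_derive_coord.
  - by have [] := reg _ _ _ g1 I1s d1.
  - by have [] := reg _ _ _ g2 I2s d2.
  - exact: G1.
  - exact: G2.
have z0 t : t \in `[t0, t0 + e / 2] -> forall i, z i t = 0.
  have Q0 : 0 <= Q by rewrite addr_ge0// ?mulr_ge0 ?(ltW r0)// sumr_ge0.
  have B0 : 0 <= B by rewrite addr_ge0.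
  pose L' := 1 + \sum_(i < d) \sum_(j < d) (L * B ^+ 2 + 2 * (Q * B)).
  have SS : 0 <= \sum_(i < d) \sum_(j < d) (L * B ^+ 2 + 2 * (Q * B)).
    by apply: sumr_ge0 => i _; apply: sumr_ge0 => j _; rewrite addr_ge0 ?mulr_ge0// sqr_ge0.
  apply: (@gronwall_family _ _ z dz L').
  - by rewrite addr_ge0.
  - move=> i s; rewrite in_itv/= => /andP[/ltW s1 /ltW s2]; apply: zd.
    by rewrite s1.
  - move=> i s; rewrite in_itv/= => /andP[/ltW s1 /ltW s2].
    have [|_ _ [r1 r2] [b1 b2]] := He s; first by rewrite s1.
    set T := \sum_j `|z j s|.
    have zT j : `|z j s| <= T by rewrite /T (bigD1 j)//= lerDl sumr_ge0.
    have T0 : 0 <= T by rewrite sumr_ge0.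
    case: i => i; rewrite /dz.
      apply: le_trans (zT (inr i)) _; by rewrite ler_peMl// lerDl.
    have E (u v : 'rV[R]_d) : (- u) 0 i - (- v) 0 i = - (u 0 i - v 0 i).
      by rewrite !mxE opprB opprK addrC.
    rewrite E normrN !chrE -sumrB.
    under eq_bigr do rewrite -sumrB.
    rewrite mulrDl mul1r (le_trans (ler_norm_sum _ _ _))//.
    apply: (@le_trans _ _ (\sum_(i < d) \sum_(j < d) (L * B ^+ 2 + 2 * (Q * B)) * T)); last first.
      rewrite mulr_suml; under [X in _ <= _ + X]eq_bigr do rewrite mulr_suml.
      by rewrite lerDr.
    apply: ler_sum => j _; rewrite (le_trans (ler_norm_sum _ _ _))//.
    apply: ler_sum => k _.
    have XT : `|X1 s - X2 s| <= T.
      by apply: rV_norm_le => // l; rewrite !mxE; exact: (zT (inl l)).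
    have LX := HL (i, j, k) (X1 s) (X2 s) r1 r2; rewrite /= in LX.
    have QX : `|christoffel g a i j k (X2 s)| <= Q.
      have := HL (i, j, k) (X2 s) x0 r2; rewrite subrr normr0 => /(_ r0) /= H.
      have H1 : L * `|X2 s - x0| <= L * r by rewrite ler_wpM2l// ltW.
      have H2 : `|christoffel g a i j k x0| <=
          \sum_(k : 'I_d * 'I_d * 'I_d) `|christoffel g a k.1.1 k.1.2 k.2 x0|.
        by rewrite (bigD1 (i, j, k))//= lerDl sumr_ge0.
      rewrite -[christoffel g a i j k (X2 s)](subrK (christoffel g a i j k x0)).
      by rewrite (le_trans (ler_normD _ _))// lerD// (le_trans H).
    have V1B l : `|V1 s 0 l| <= B by exact: le_trans (rV_coord_le _ _) b1.
    have V2B l : `|V2 s 0 l| <= B by exact: le_trans (rV_coord_le _ _) b2.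
    have zTj := zT (inr j); have zTk := zT (inr k); rewrite /= in zTj zTk.
    exact: (trilinear_diff_le B0 Q0 T0 (le_trans LX (ler_wpM2l L0 XT)) QX).
  - move=> i; apply: continuous_in_subspaceT => s; rewrite inE/= in_itv/= => sI.
    exact: is_derive_continuous (zd i s sI).
  - by move=> [i|i] /=; [rewrite /X1 /X2 /= c12 subrr|rewrite /V1 /V2 D12 subrr].
move=> t /andP[t0t tt].
have tI : t0 <= t <= t0 + e / 2 by rewrite t0t ltW.
have [[_ d1] [_ d2] _ _] := He t tI.
rewrite -(cmapK d1) -(cmapK d2); congr (cinv a _).
by apply/rowP => i; apply/eqP; rewrite -subr_eq0; apply/eqP; apply: (z0 t _ (inl i)); rewrite in_itv.
Unshelve. all: by end_near.
Qed.
End Geodesics.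

Lemma Ck_eq (R : realType) (V W : normedModType R) k (A : set V) (f h : V -> W) : open A ->
  (forall x, A x -> f x = h x) -> Ck k A f -> Ck k A h.
Proof.
move=> oA; elim: k f h => [|k IH] f h fh [cf H].
  split=> // x Ax; apply: continuous_near_eq (cf x Ax).
  by apply: filterS (open_near oA Ax) => y; exact: fh.
have N x : A x -> \forall y \near x, f y = h y.
  by move=> Ax; apply: filterS (open_near oA Ax) => y; exact: fh.
split=> [x Ax|v]; first exact: continuous_near_eq (N x Ax) (cf x Ax).
have [df Cf] := H v; split=> [x Ax|]; first exact: near_eq_derivable (N x Ax) (df x Ax).
by apply: IH Cf => x Ax; exact: near_eq_derive (N x Ax).
Qed.

Lemma open_scale (R : realType) (A : set R) (t : R) : open A -> open [set s | A (t * s)].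
Proof.
by move=> oA; apply: (@open_comp _ _ ( *%R t)) => // x _; exact: mulrl_continuous.
Qed.

Lemma derivable_dir1 (R : realType) (W : normedModType R) (f : R -> W) (s v : R) :
  derivable f s 1 -> is_derive s v f (v *: 'D_1 f s).
Proof.
move=> /derivable1_diffP df; split; first exact: diff_derivable.
by rewrite !deriveE// -linearZ /= /GRing.scale/= mulr1.
Qed.

Lemma is_derive_scale (R : realType) (W : normedModType R) (f : R -> W) (c t s v : R) :
  derivable f (t * s) 1 -> is_derive s v (fun s => c *: f (t * s)) ((c * t) *: 'D_v f (t * s)).
Proof.
move=> df; have dfv := derivable_dir1 v df.
have H1 : is_derive s 1 (fun s => f (t * s)) (t *: 'D_1 f (t * s)).
  have dt : is_derive s 1 ( *%R t) t.
    have := @is_deriveZ _ _ _ id t s 1 1 (is_derive_id _ _).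
    by rewrite /GRing.scale/= mulr1.
  have /derivable1_diffP df' := df.
  have := is_derive_comp_curve dt df'.
  by have [_ ->] := derivable_dir1 t df.
have [_ ->] := dfv.
have [ex1 E1] := H1.
have := @derivable_dir1 _ _ (fun s => f (t * s)) s v ex1.
rewrite E1 => H2.
have := @is_deriveZ _ _ _ _ c _ _ _ H2; move=> H3; apply: (is_derive_eq H3).
by rewrite !scalerA; congr (_ *: _); ring.
Qed.

Lemma Ck_scale (R : realType) (W : normedModType R) k (A : set R) (f : R -> W) (c t : R) :
  open A -> Ck k A f -> Ck k [set s | A (t * s)] (fun s => c *: f (t * s)).
Proof.
move=> oA; elim: k f c => [|k IH] f c [cf H]; have oS := @open_scale R A t oA.
  split=> // s As; apply: continuousZr.
  by apply: continuous_comp; [exact: mulrl_continuous|exact: cf].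
have D v s : A (t * s) -> is_derive s v (fun s => c *: f (t * s)) ((c * t) *: 'D_v f (t * s)).
  by move=> As; apply: is_derive_scale; have [+ _] := H 1; apply.
split=> [s As|v].
  by apply: is_derive_continuous; exact: D.
split=> [s As|]; first by have [] := D v s As.
have [_ Cv] := H v; apply: Ck_eq (IH _ (c * t) Cv) => // s As.
by have [_ ->] := D v s As.
Qed.

(** In a Hausdorff space two functions continuous at [t] that agree just before [t] agree at [t]. It
    supplies the limit step of the inductions over an interval. *)
Lemma eq_left_limit (R : realType) (T : topologicalType) (f h : R -> T) (a t : R) :
  hausdorff_space T -> {for t, continuous f} -> {for t, continuous h} -> a < t ->
  (forall s, a <= s < t -> f s = h s) -> f t = h t.
Proof.
move=> hT cf ch at_ fh; apply: hT => A B fA hB.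
have Nf : nbhs t (f @^-1` A) by exact: cf.
have Nh : nbhs t (h @^-1` B) by exact: ch.
have : nbhs t (f @^-1` A `&` h @^-1` B) by exact: filterI.
move=> /nbhs_ballP[e /= e0 He].
pose s := Num.max a (t - e / 2).
have st : a <= s < t by rewrite /s le_max lexx gt_max at_/= gtrBl divr_gt0.
have : ball t e s.
  rewrite /ball/= ger0_norm ?subr_ge0 ?ltW//; last by case/andP: st.
  rewrite ltrBlDr -ltrBlDl /s lt_max; apply/orP; right.
  by rewrite ltrD2l ltrN2 ltr_pdivrMr// mulr_natr mulr2n ltrDl.
by move=> /He[/= As Bs]; exists (f s); split=> //; rewrite fh.
Qed.

Section Uniq.
Variables (R : realType) (d : nat) (M : ptopologicalType).
Variable g : riemannianManifold R d M.
Implicit Types (a b : chart R d M) (c : R -> M) (I : set R).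

Lemma cinvK a y : chart_img a y -> cmap a (cinv a y) = y /\ chart_dom a (cinv a y).
Proof. by case=> x dx <-; rewrite cmapK. Qed.

Lemma transition_open a b : open (cmap a @` (chart_dom a `&` chart_dom b)).
Proof.
have -> : cmap a @` (chart_dom a `&` chart_dom b) = chart_img a `&` cinv a @^-1` chart_dom b.
  apply/seteqP; split=> [_ [x [ax bx] <-]|y [ay by_]].
    by split; [exists x|rewrite /= cmapK].
  by exists (cinv a y); have [] := cinvK ay.
rewrite openE => y [ay by_]; apply: filterI.
  exact: open_near (@open_chart_imgE _ _ _ a) ay.
by apply: (cinv_continuous ay); exact: open_near (open_chart_dom b) by_.
Qed.

Lemma transition_diff a b x : atlas g a -> atlas g b -> chart_dom a x -> chart_dom b x ->
  differentiable (transition a b) (cmap a x).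
Proof.
move=> aA bA ax bx; have [S _] := atlas_compatible aA bA.
by apply: (smooth_differentiable (@transition_open a b) S); exists x.
Qed.

Lemma curve_chart_change a b c (t : R) v : atlas g a -> atlas g b ->
  {for t, continuous c} -> chart_dom a (c t) -> chart_dom b (c t) ->
  is_derive t 1 (cmap a \o c) v ->
  is_derive t 1 (cmap b \o c) ('D_v (transition a b) (cmap a (c t))).
Proof.
move=> aA bA cc ac bc dX.
have := is_derive_comp_curve dX (transition_diff aA bA ac bc).
apply: near_eq_is_derive.
have N : \forall s \near t, chart_dom a (c s).
  by apply: cc; exact: open_near (open_chart_dom a) ac.
by apply: filterS N => s ds; rewrite /= /transition /= cmapK.
Qed.

(** Agreement extends to the right by local uniqueness, and passes to limits because [M] is
    Hausdorff and the velocities are continuous. *)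
Lemma geodesic_uniq a c1 c2 I1 I2 (t0 t1 : R) : atlas g a ->
  geodesic g I1 c1 -> geodesic g I2 c2 -> `[t0, t1] `<=` I1 -> `[t0, t1] `<=` I2 ->
  chart_dom a (c1 t0) -> c1 t0 = c2 t0 ->
  'D_1 (cmap a \o c1) t0 = 'D_1 (cmap a \o c2) t0 ->
  forall t, t0 <= t <= t1 -> c1 t = c2 t.
Proof.
move=> aA g1 g2 J1 J2 d0 c0 D0 t tI.
have [oI1 C1 _] := g1; have [oI2 C2 _] := g2; have [cc1 _] := C1; have [cc2 _] := C2.
have {}J1 s : t0 <= s <= t1 -> I1 s by move=> ?; apply: J1; rewrite /= in_itv.
have {}J2 s : t0 <= s <= t1 -> I2 s by move=> ?; apply: J2; rewrite /= in_itv.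
have t01 : t0 <= t1 by case/andP: tI => /le_trans; apply.
(* Velocities are compared in every chart at the point, so that the induction may change chart at
   each step. *)
pose P s := c1 s = c2 s /\ (forall b, atlas g b -> chart_dom b (c1 s) ->
  'D_1 (cmap b \o c1) s = 'D_1 (cmap b \o c2) s).
suff : P t by case.
have reg c I s b : geodesic g I c -> atlas g b -> I s -> chart_dom b (c s) ->
    derivable (cmap b \o c) s 1 /\ {for s, continuous ('D_1 (cmap b \o c))}.
  move=> gc bA Is ds; have [oI _ _] := gc.
  exact: Ck_curve_reg bA oI (geodesic_C1 gc) Is ds.
have I10 : I1 t0 by apply: J1; rewrite lexx.
have I20 : I2 t0 by apply: J2; rewrite lexx.
apply: (@real_induction _ P t0 t1 _ _ _ t tI).
- split; first exact: c0.
  move=> b bA db.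
  have [D1 _] := reg _ _ _ _ g1 aA I10 d0.
  have d0' : chart_dom a (c2 t0) by rewrite -c0.
  have db' : chart_dom b (c2 t0) by rewrite -c0.
  have [D2 _] := reg _ _ _ _ g2 aA I20 d0'.
  have [_ ->] := curve_chart_change aA bA (cc1 _ I10) d0 db (derivableP D1).
  have [_ ->] := curve_chart_change aA bA (cc2 _ I20) d0' db' (derivableP D2).
  by rewrite D0 c0.
- move=> s ts st H; have [|c12 D12] := H s; first by rewrite ts lexx.
  have [b [bA db]] := atlas_cover g (c1 s).
  have I1s : I1 s by apply: J1; rewrite ts ltW.
  have I2s : I2 s by apply: J2; rewrite ts ltW.
  have [e e0 He] := geodesic_local_uniq bA g1 g2 I1s I2s db c12 (D12 b bA db).
  exists e; first exact: e0.
  move=> u /andP[su ue] ut1.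
  split; first by apply: He; rewrite ltW.
  move=> b' b'A db'; apply: near_eq_derive.
  have : \forall v \near u, s < v /\ v < s + e.
    by apply: filterI; [exact: lt_nbhsr|exact: lt_nbhsl].
  by apply: filterS => v [sv ve]; rewrite /= He// ltW.
- move=> s ts st1 H.
  have I1s : I1 s by apply: J1; rewrite st1 ltW.
  have I2s : I2 s by apply: J2; rewrite st1 ltW.
  have E : c1 s = c2 s.
    apply: (@eq_left_limit _ _ c1 c2 t0 s (hausdorffM g) (cc1 s I1s) (cc2 s I2s) ts).
    by move=> u /H[].
  split; first exact: E.
  move=> b bA db.
  have [_ D1] := reg _ _ _ _ g1 bA I1s db.
  have [|_ D2] := reg _ _ _ _ g2 bA I2s; first by rewrite -E.
  have N : \forall u \near s, chart_dom b (c1 u).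
    by apply: (cc1 _ I1s); exact: open_near (open_chart_dom b) db.
  move: N => /nbhs_ballP[e /= e0 He].
  apply: (@eq_left_limit _ _ _ _ (Num.max t0 (s - e / 2)) s (@norm_hausdorff _ _) D1 D2).
  - by rewrite gt_max ts gtrBl divr_gt0.
  - move=> u /andP[]; rewrite ge_max => /andP[tu su] us.
    have [|_ ->//] := H u; first by rewrite tu.
    apply: He; rewrite /ball/= ger0_norm ?subr_ge0 ?(ltW us)// ltrBlDr -ltrBlDl.
    by apply: lt_le_trans su; rewrite ltrD2l ltrN2 ltr_pdivrMr// mulr_natr mulr2n ltrDl.
Qed.

(** The acceleration and the quadratic term of the geodesic equation both acquire the factor
    [k * k]. *)
Lemma geodesic_scale c I (k : R) : geodesic g I c ->
  geodesic g [set s | I (k * s)] (fun s => c (k * s)).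
Proof.
move=> gc; have [oI [cc CC] _] := gc.
have oS := @open_scale R I k oI.
have c' s : I (k * s) -> {for s, continuous (fun s => c (k * s))}.
  by move=> Is; apply: continuous_comp; [exact: mulrl_continuous|exact: cc].
have E a (f := cmap a \o c) : (cmap a \o (fun s => c (k * s))) = (fun s => 1 *: f (k * s)).
  by apply/funext => s; rewrite scale1r.
split; [exact: oS|split; first exact: c'|].
  move=> a aA; rewrite E.
  have oO := @curve_dom_open _ _ _ a c I oI cc.
  have := @Ck_scale _ _ 2 _ _ 1 k oO (CC a aA).
  by congr Ck.
move=> a t aA It dt X X' l.
have oO := @curve_dom_open _ _ _ a c I oI cc.
pose f := cmap a \o c.
have DX s : I (k * s) -> chart_dom a (c (k * s)) -> is_derive s 1 X (k *: 'D_1 f (k * s)).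
  move=> Is ds; have [dd _] := Ck_curve_reg aA oI (geodesic_C1 gc) Is ds.
  by have := @is_derive_scale _ _ f 1 k s 1 dd; rewrite /X E mul1r.
have D2 : is_derive t 1 X' ((k * k) *: - chr g a (f (k * t)) ('D_1 f (k * t)) ('D_1 f (k * t))).
  have [dd dE] := geodesic_eq aA gc It dt.
  have := @is_derive_scale _ _ ('D_1 f) k k t 1 dd.
  rewrite dE; apply: near_eq_is_derive.
  have nO := open_near (@open_scale R _ k oO) (conj It dt).
  by apply: filterS nO => s [Is ds]; have [_ XE] := DX s Is ds; rewrite -XE.
have [_ ->] := D2.
have XE : X' t = k *: 'D_1 f (k * t) by have [_ <-] := DX t It dt.
have := chrE g a (X t) (X' t) (X' t) l => <-.
by rewrite XE chrZl chrZr scalerA !mxE mulrN; apply: addNr.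
Qed.

End Uniq.

(** * Normal coordinates *)

Section NormalChart.
Variables (R : realType) (d : nat) (M : ptopologicalType).
Variable g : riemannianManifold R d M.
Implicit Types (c : R -> M) (I : set R) (u v w y : 'rV[R]_d).

Definition Q0 (p : M) : 'M[R]_d := metric g (chart_at g p) (cmap (chart_at g p) p).

Lemma chart_atP p : atlas g (chart_at g p) /\ chart_dom (chart_at g p) p.
Proof. exact: projT2 (cid (atlas_cover g p)). Qed.

Lemma innerE p u v : inner g p u v = bil (Q0 p) u v.
Proof. by rewrite bil_unlock. Qed.

Lemma Q0T p : (Q0 p)^T = Q0 p.
Proof. by have [aA dp] := chart_atP p; apply: metricT => //; exists p. Qed.

Lemma Q0_pos p u : u != 0 -> 0 < bil (Q0 p) u u.
Proof. by have [aA dp] := chart_atP p; apply: metric_pos => //; exists p. Qed.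

Lemma Q0_ge0 p u : 0 <= bil (Q0 p) u u.
Proof. by have [->|/(Q0_pos p)/ltW//] := eqVneq u 0; rewrite bil0l. Qed.

(** [normal_ball] with its chart exposed. The coordinates of this chart are vectors of the tangent
    space at [p], so radial lines are geodesics. *)
Definition normal_chart (p : M) (r : R) (a : chart R d M) :=
  [/\ atlas g a, chart_img a = [set v | inner g p v v < r ^+ 2] &
    forall v, inner g p v v < r ^+ 2 -> is_exp g p v (cinv a v)].

Variables (p : M) (r : R) (a : chart R d M).
Hypotheses (r0 : 0 < r) (na : normal_chart p r a).

Lemma normal_atlas : atlas g a. Proof. by case: na. Qed.

Lemma normal_img v : chart_img a v <-> bil (Q0 p) v v < r ^+ 2.
Proof. by case: na => _ -> _; rewrite -innerE. Qed.

Lemma normal_img0 : chart_img a 0.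
Proof. by apply/normal_img; rewrite bil0l exprn_gt0. Qed.

Lemma normal_imgZ t v : 0 <= t <= 1 -> chart_img a v -> chart_img a (t *: v).
Proof.
move=> /andP[t0 t1] /normal_img vr; apply/normal_img; rewrite bilZl bilZr mulrA.
by apply: le_lt_trans vr; rewrite ler_piMl ?Q0_ge0// mulr_ile1.
Qed.

(** The definition gives one geodesic for each vector [t *: v]. The rescaling s |-> c (t s) of the
    geodesic of [v] has initial velocity [t *: v], so by uniqueness the single geodesic [c] traces
    the whole ray. *)
Lemma normal_ray v : chart_img a v -> exists c I,
  [/\ geodesic g I c, `[0, 1] `<=` I, c 0 = p, velocity g c 0 = v &
      forall t, 0 <= t <= 1 -> c t = cinv a (t *: v)].
Proof.
move=> av; have [aA _ Hexp] := na.
have inn y : chart_img a y -> is_exp g p y (cinv a y).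
  by move=> /normal_img Hy; apply: Hexp; rewrite innerE.
have [c [I [J gc c0 vc c1]]] := inn v av.
exists c, I; split=> // t tI.
have [c' [I' [J' gc' c0' vc' c1']]] := inn (t *: v) (normal_imgZ tI av).
rewrite -c1'; have gs := geodesic_scale t gc.
have [cA cd] := chart_atP p.
have /andP[t0 t1] := tI.
have := @geodesic_uniq _ _ _ g (chart_at g p) (fun s => c (t * s)) c' _ I' 0 1 cA gs gc'.
move=> /(_ _ J' _ _ _ 1) H; have := H _ _ _ _ _; rewrite mulr1; apply.
- move=> s /=; rewrite in_itv/= => /andP[s0 s1]; apply: J; rewrite /= in_itv/=.
  by rewrite mulr_ge0//= mulr_ile1.
- by rewrite mulr0 c0.
- by rewrite mulr0 c0 c0'.
- have [oI [cc _] _] := gc.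
  have I0 : I 0 by apply: J; rewrite /= in_itv/= lexx ler01.
  have dd : derivable (cmap (chart_at g p) \o c) (t * 0) 1.
    rewrite mulr0; have [] := Ck_curve_reg cA oI (geodesic_C1 gc) I0 _ => //.
    by rewrite c0.
  have [_] := @is_derive_scale _ _ (cmap (chart_at g p) \o c) 1 t 0 1 dd.
  rewrite mul1r mulr0; rewrite /velocity c0 in vc; rewrite vc.
  rewrite /velocity c0' in vc'; rewrite vc' => <-.
  rewrite (_ : (fun s : R => 1 *: (cmap (chart_at g p) \o c) (t * s)) =
     cmap (chart_at g p) \o (fun s : R => c (t * s)))//.
  by apply/funext => s /=; rewrite scale1r.
- by rewrite ler01 lexx.
Qed.

Lemma normal_center : cinv a 0 = p.
Proof.
have [c [I [_ _ c0 _ H]]] := normal_ray normal_img0.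
by rewrite -c0 H ?lexx ?ler01// scaler0.
Qed.

Lemma normal_dom_center : chart_dom a p /\ cmap a p = 0.
Proof. by have [e dm] := cinvK normal_img0; rewrite -normal_center. Qed.

(** The chart image is open, so a ray can be prolonged past each of its points; every point then
    lies in the interior of a ray, where two-sided derivatives are available. *)
Lemma normal_star v : chart_img a v -> exists2 e, 0 < e & chart_img a ((1 + e) *: v).
Proof.
move=> av; have oU := @open_chart_imgE _ _ _ a.
have cz : {for (0 : R), continuous (fun s : R => v + s *: v)}.
  by have /is_derive_continuous := is_derive_line v v 0.
have : \forall s \near (0 : R), chart_img a (v + s *: v).
  have N0 : nbhs (v + 0 *: v) (chart_img a).
    by rewrite scale0r addr0; exact: (open_near oU av).
  exact: (cz _ N0).
move=> /nbhs_ballP[e /= e0 He]; exists (e / 2); first by rewrite divr_gt0.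
rewrite scalerDl scale1r; apply: He; rewrite /ball/= sub0r normrN ger0_norm ?divr_ge0 ?ltW//.
by rewrite ltr_pdivrMr// mulr_natr mulr2n ltrDl.
Qed.

(** The ray through [y] is a geodesic with constant coordinate velocity, so its acceleration term
    must vanish at [y]. *)
Lemma chr_radial y : chart_img a y -> chr g a y y y = 0.
Proof.
move=> ay; have [e e0 ev] := normal_star ay; pose v := (1 + e) *: y; pose t := (1 + e)^-1.
have e1 : 0 < 1 + e by rewrite addr_gt0.
have yE : y = t *: v by rewrite /t /v scalerA mulVf ?scale1r// gt_eqF.
have [c [I [gc J _ _ H]]] := normal_ray ev.
have t01 : 0 < t < 1 by rewrite /t invr_gt0 e1/= invf_lt1// ltrDl.
have N : \forall s \near t, 0 < s /\ s < 1.
  by case/andP: t01 => ? ?; apply: filterI; [exact: lt_nbhsr|exact: lt_nbhsl].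
have {}J s : 0 < s /\ s < 1 -> I s.
  by move=> [s0 s1]; apply: J; rewrite /= in_itv/= !ltW.
have NX (s : R) : 0 < s /\ s < 1 -> (cmap a \o c) s = s *: v /\ chart_dom a (c s).
  move=> [s0 s1]; have sI : 0 <= s <= 1 by rewrite !ltW.
  by rewrite /= (H s sI); have [-> ?] := cinvK (normal_imgZ sI ev).
have D (s : R) : 0 < s /\ s < 1 -> 'D_1 (cmap a \o c) s = v.
  move=> [s0 s1]; have N' : \forall u \near s, (fun u : R => u *: v) u = (cmap a \o c) u.
    have : \forall u \near s, 0 < u /\ u < 1.
      by apply: filterI; [exact: lt_nbhsr|exact: lt_nbhsl].
    by apply: filterS => u /NX[].
  by have [_] := near_eq_is_derive N' (is_derive_scalel v s).
have tI : 0 < t /\ t < 1 by exact/andP.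
have [Xt dt] := NX t tI.
have [_] := geodesic_eq normal_atlas gc (J t tI) dt.
have N2 : \forall u \near t, cst v u = 'D_1 (cmap a \o c) u by apply: filterS N => u /D.
have [_ ->] := near_eq_is_derive N2 (is_derive_cst v t 1).
rewrite D// => /esym/eqP; rewrite oppr_eq0 => /eqP.
rewrite /= in Xt; rewrite Xt -yE => E.
by rewrite {2 3}yE chrZl chrZr E !scaler0.
Qed.

(** The geodesic of [v] has velocity [v] at [p] both in the normal chart and in [chart_at g p]. The
    Jacobian of the change of charts therefore fixes every vector, and the transformation rule of
    the metric becomes an equality. *)
Lemma metric_center : metric g a 0 = Q0 p.
Proof.
have [cA cd] := chart_atP p; have [da d0] := normal_dom_center.
have := metric_transition normal_atlas cA da cd; rewrite d0 => ->.
set J := jacobian _ _.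
suff -> : J = 1%:M by rewrite trmx1 mulmx1 mul1mx.
have JE v : chart_img a v -> v *m J = v.
  move=> av; have [c [I [gc JI c0 vc H]]] := normal_ray av.
  have [oI [cc _] _] := gc.
  have I0 : I 0 by apply: JI; rewrite /= in_itv/= lexx ler01.
  have dc0 : chart_dom a (c 0) by rewrite c0.
  have [dX _] := Ck_curve_reg normal_atlas oI (geodesic_C1 gc) I0 dc0.
  have X0 : 'D_1 (cmap a \o c) 0 = v.
    have XE : is_derive (0:R) (1:R) (cmap a \o c) ('D_1 (cmap a \o c) 0) by exact: derivableP.
    have /derivable1_diffP dX' := dX.
    pose h := fun s : R => (cmap a \o c) s - s *: v.
    have dh : is_derive (0 : R) 1 h ('D_1 (cmap a \o c) 0 - v).
      by apply: is_deriveB; exact: is_derive_scalel.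
    have h0 s : 0 <= s <= 1 -> h s = 0.
      by move=> sI; rewrite /h /= (H s sI); have [-> _] := cinvK (normal_imgZ sI av); rewrite subrr.
    apply/eqP; rewrite -subr_eq0; have [dh1 <-] := dh; apply/eqP.
    (* The ray is known only for nonnegative times, so the derivative at 0 is computed as a limit
       from the right. *)
    rewrite /derive cvg_at_rightE; last exact: dh1.
    apply: cvg_lim; first exact: norm_hausdorff.
    have Ec : \forall s \near (0 : R)^'+, 0 = s^-1 *: ((h \o shift 0) (s *: 1) - h 0).
      near=> s; rewrite /= addr0 -[s *: 1]/(s * 1) mulr1 !h0 ?subrr ?scaler0// ?lexx ?ler01//.
      apply/andP; split; first by near: s; exact: nbhs_right_ge.
      by near: s; exact: nbhs_right_le.
    by apply: cvg_trans (near_eq_cvg Ec) _; exact: cvg_cst.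
  have dp : chart_dom (chart_at g p) (c 0) by rewrite c0.
  have := curve_chart_change normal_atlas cA (cc _ I0) dc0 dp (derivableP dX).
  rewrite X0 c0 d0 => -[_]; rewrite /velocity c0 in vc; rewrite vc => E.
  rewrite [RHS]E deriveEjacobian//.
  by rewrite -d0; exact: transition_diff normal_atlas cA da cd.
have JA v : v *m J = v.
  have [->|v0] := eqVneq v 0; first by rewrite mul0mx.
  have q0 := Q0_pos p v0.
  pose s := r / (2 * Num.sqrt (bil (Q0 p) v v)).
  have sq0 : 0 < Num.sqrt (bil (Q0 p) v v) by rewrite sqrtr_gt0.
  have s0 : 0 < s by rewrite divr_gt0// mulr_gt0.
  have : chart_img a (s *: v).
    apply/normal_img; rewrite bilZl bilZr mulrA -(sqr_sqrtr (ltW q0)).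
    have -> : s * s * Num.sqrt (bil (Q0 p) v v) ^+ 2 = (r / 2) ^+ 2.
      by rewrite /s; field; rewrite gt_eqF.
    by rewrite ltr_pXn2r// ?nnegrE ?divr_ge0 ?ltW// ltr_pdivrMr// mulr_natr mulr2n ltrDl.
  move=> /JE; rewrite -scalemxAl => /(congr1 ( *:%R s^-1)).
  by rewrite !scalerA mulVf ?gt_eqF// !scale1r.
by apply/row_matrixP => i; rewrite !rowE JA mulmx1.
Unshelve. all: by end_near.
Qed.

End NormalChart.

(** * Trigonometric functions of constant curvature *)

Lemma is_derive_mulc (R : realType) (c x : R) : is_derive x 1 ( *%R c) c.
Proof.
have := @is_deriveZ _ _ _ id c x 1 1 (is_derive_id _ _).
by move=> H; apply: (is_derive_eq H); rewrite /GRing.scale/= mulr1.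
Qed.

Section Trig.
Variables (R : realType) (kappa : R).

(** Domination by the coefficients of B exp(|kappa| x), a condition stable under termwise
    differentiation that gives convergence everywhere. *)
Definition exp_bounded (b : R ^nat) (B : R) :=
  forall n, `|b n| <= B * (`|kappa| ^+ n / n`!%:R).

Lemma exp_bounded_diffs b B : exp_bounded b B -> exp_bounded (pseries_diffs b) (B * `|kappa|).
Proof.
move=> bB n; rewrite /pseries_diffs normrM ger0_norm// -ler_pdivlMl//.
apply: le_trans (bB n.+1) _; rewrite factS natrM exprS le_eqVlt; apply/orP; left; apply/eqP.
by field; rewrite pnatr_eq0 -lt0n fact_gt0/=; have : (0:R) <= n%:R by []; lra.
Qed.

Lemma exp_bounded_cvg b B x : exp_bounded b B -> cvgn (pseries b x).
Proof.
move=> bB; apply: normed_cvg.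
apply: (@series_le_cvg _ _ (fun n => B * exp_coeff (`|kappa| * `|x|) n)) => [n|n|n|].
- exact: normr_ge0.
- have B0 : 0 <= B by have := bB 0%N; rewrite expr0 fact0 divr1 mulr1; exact: le_trans.
  by rewrite mulr_ge0// exp_coeff_ge0// mulr_ge0.
- rewrite /= normrM normrX mulrC.
  have -> : B * exp_coeff (`|kappa| * `|x|) n = `|x| ^+ n * (B * (`|kappa| ^+ n / n`!%:R)).
    by rewrite /exp_coeff/= exprMn; ring.
  by rewrite ler_wpM2l ?exprn_ge0.
- apply: is_cvg_seriesZ; exact: is_cvg_series_exp_coeff.
Qed.

(** Power series of sin(sqrt(kappa x)) / sqrt(kappa x) in the squared length [x]. In this variable
    the sign of [kappa] requires no case distinction and nothing is singular at the centre. *)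
Definition sn_coeff (n : nat) : R := (- kappa) ^+ n / ((2 * n).+1)`!%:R.

Lemma sn_coeff_bounded : exp_bounded sn_coeff 1.
Proof.
move=> n; rewrite mul1r /sn_coeff normrM normrX normrN ler_wpM2l ?exprn_ge0//.
rewrite ger0_norm ?invr_ge0// lef_pV2 ?posrE ?ltr0n ?fact_gt0// ler_nat.
by apply: leq_fact; lia.
Qed.

Definition sn0 (x : R) : R := limn (pseries sn_coeff x).
Definition sn1 (x : R) : R := limn (pseries (pseries_diffs sn_coeff) x).
Definition sn2 (x : R) : R := limn (pseries (pseries_diffs (pseries_diffs sn_coeff)) x).

Let b0 := sn_coeff_bounded.
Let b1 := exp_bounded_diffs b0.
Let b2 := exp_bounded_diffs b1.
Let b3 := exp_bounded_diffs b2.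

Lemma is_derive_sn0 (x : R) : is_derive x 1 sn0 (sn1 x).
Proof.
have := pseries_snd_diffs (@exp_bounded_cvg _ _ (`|x| + 1) b0) (@exp_bounded_cvg _ _ _ b1)
  (@exp_bounded_cvg _ _ _ b2); apply.
by rewrite [ltRHS]ger0_norm ?addr_ge0// ltrDl.
Qed.

Lemma is_derive_sn1 (x : R) : is_derive x 1 sn1 (sn2 x).
Proof.
have := pseries_snd_diffs (@exp_bounded_cvg _ _ (`|x| + 1) b1) (@exp_bounded_cvg _ _ _ b2)
  (@exp_bounded_cvg _ _ _ b3); apply.
by rewrite [ltRHS]ger0_norm ?addr_ge0// ltrDl.
Qed.

Lemma sn0_0 : sn0 0 = 1.
Proof.
rewrite /sn0; apply: cvg_lim => //; rewrite -(cvg_shiftS _).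
rewrite (_ : (fun _ => _) = cst 1); first exact: cvg_cst.
apply/funext => n; rewrite /pseries /series/= big_nat_recl//= expr0 mulr1.
rewrite /sn_coeff expr0 muln0 divr1.
by rewrite big1 ?addr0// => i _; rewrite expr0n/= mulr0.
Qed.

(** This is y'' = - kappa y for y(t) = t S(t^2), written in the variable x = t^2. *)
Lemma sn_ode x : 2 * x * sn2 x + 3 * sn1 x + kappa / 2 * sn0 x = 0.
Proof.
pose P0 := pseries sn_coeff x; pose P1 := pseries (pseries_diffs sn_coeff) x.
pose P2 := pseries (pseries_diffs (pseries_diffs sn_coeff)) x.
have c0 : P0 @ \oo --> sn0 x by apply: exp_bounded_cvg b0.
have c1 : P1 @ \oo --> sn1 x by apply: exp_bounded_cvg b1.
have c2 : P2 @ \oo --> sn2 x by apply: exp_bounded_cvg b2.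
(* Two of the partial sums are shifted by one index; the combination is then zero for each [n] and
   not only in the limit. *)
have cS : (fun n => 2 * x * P2 n + 3 * P1 n.+1 + kappa / 2 * P0 n.+1) @ \oo -->
    2 * x * sn2 x + 3 * sn1 x + kappa / 2 * sn0 x.
  apply: cvgD; first apply: cvgD; apply: cvgMr => //.
  - by rewrite cvg_shiftS.
  - by rewrite cvg_shiftS.
suff E : (fun n => 2 * x * P2 n + 3 * P1 n.+1 + kappa / 2 * P0 n.+1) = cst 0.
  by rewrite E in cS; have/(cvg_lim (@Rhausdorff R)) <- := cS; rewrite lim_cst.
apply/funext => n; rewrite /P2 /P1 /P0 /pseries /series/=.
have key m : 3 * pseries_diffs sn_coeff m + kappa / 2 * sn_coeff m =
    - (2 * m%:R * pseries_diffs sn_coeff m).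
  rewrite /pseries_diffs /sn_coeff (_ : (2 * m.+1).+1 = (2 * m).+3)%N; last by lia.
  rewrite !factS !natrM exprS.
  have -> : ((2 * m).+3)%:R = 2 * m%:R + 3 :> R by rewrite -!natr1 natrM; ring.
  have -> : ((2 * m).+2)%:R = 2 * m%:R + 2 :> R by rewrite -!natr1 natrM; ring.
  have -> : ((2 * m).+1)%:R = 2 * m%:R + 1 :> R by rewrite -!natr1 natrM; ring.
  have -> : (m.+1)%:R = m%:R + 1 :> R by rewrite -natr1.
  have m0 : (0 : R) <= m%:R by [].
  have f0 : ((2 * m)`!%:R : R) != 0 by rewrite pnatr_eq0 -lt0n fact_gt0.
  by field; rewrite f0/=; apply/and3P; split; lra.
rewrite -addrA.
have -> : 3 * (\sum_(0 <= k < n.+1) pseries_diffs sn_coeff k * x ^+ k) +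
   kappa / 2 * (\sum_(0 <= k < n.+1) sn_coeff k * x ^+ k) =
   - \sum_(0 <= k < n.+1) 2 * k%:R * pseries_diffs sn_coeff k * x ^+ k.
  rewrite !mulr_sumr -big_split -sumrN; apply: eq_bigr => k _ /=.
  have -> : 3 * (pseries_diffs sn_coeff k * x ^+ k) + kappa / 2 * (sn_coeff k * x ^+ k) =
    (3 * pseries_diffs sn_coeff k + kappa / 2 * sn_coeff k) * x ^+ k by ring.
  by rewrite key mulNr.
rewrite big_nat_recl//= mulr0 !mul0r add0r mulr_sumr -sumrB big1// => i _.
by rewrite /pseries_diffs exprS; ring.
Qed.

(** The derivative of t S(t^2) at t = sqrt x, that is cos(sqrt(kappa x)). *)
Definition cs0 (x : R) : R := sn0 x + 2 * x * sn1 x.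

Lemma is_derive_cs0 (x : R) : is_derive x 1 cs0 (- (kappa / 2 * sn0 x)).
Proof.
have H : is_derive x 1 (sn0 + ( *%R 2) * sn1)
   (sn1 x + ((2 * x) *: sn2 x + sn1 x *: 2)).
  have ds0 := is_derive_sn0 x; have ds1 := is_derive_sn1 x; have dm := is_derive_mulc 2 x.
  by apply: is_deriveD; apply: is_deriveM.
apply: (is_derive_eq H); rewrite /GRing.scale/=.
have E := sn_ode x; apply/eqP; rewrite -subr_eq0 opprK; apply/eqP; rewrite -E; ring.
Qed.

Lemma cs0_0 : cs0 0 = 1.
Proof. by rewrite /cs0 sn0_0 mulr0 mul0r addr0. Qed.

Lemma is_derive_const (f : R -> R) : (forall x : R, is_derive x 1 f 0) -> forall x, f x = f 0.
Proof. by move=> df x; exact: is_derive_0_is_cst. Qed.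

Lemma cs_sn_sqr x : cs0 x ^+ 2 + kappa * x * sn0 x ^+ 2 = 1.
Proof.
pose f := cs0 * cs0 + ( *%R kappa) * (sn0 * sn0).
have fE y : f y = cs0 y ^+ 2 + kappa * y * sn0 y ^+ 2 by [].
have df (y : R) : is_derive y 1 f 0.
  have H : is_derive y 1 f ((cs0 y *: (- (kappa / 2 * sn0 y)) + cs0 y *: (- (kappa / 2 * sn0 y))) +
     ((kappa * y) *: (sn0 y *: sn1 y + sn0 y *: sn1 y) + (sn0 y * sn0 y) *: kappa)).
    have ds := is_derive_sn0 y; have dc := is_derive_cs0 y; have dm := is_derive_mulc kappa y.
    by apply: is_deriveD; apply: is_deriveM.
  by apply: (is_derive_eq H); rewrite /GRing.scale/= /cs0; field.
rewrite -fE (is_derive_const df x) fE cs0_0 mulr0 mul0r addr0 expr1n//.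
Qed.

Lemma cs_sn_ratio (x : R) : cs0 x != 0 -> is_derive x 1 (fun x => sn0 x / cs0 x)
   ((sn1 x * cs0 x + kappa / 2 * sn0 x ^+ 2) / cs0 x ^+ 2).
Proof.
move=> c0; have ds := is_derive_sn0 x; have dc := is_derive_cs0 x; have [dc1 dc2] := dc.
have H : is_derive x 1 (sn0 * (fun y => (cs0 y)^-1))
   (sn0 x *: (- cs0 x ^- 2 *: - (kappa / 2 * sn0 x)) + (cs0 x)^-1 *: sn1 x).
  have dv : is_derive x 1 (fun y => (cs0 y)^-1) (- cs0 x ^- 2 *: - (kappa / 2 * sn0 x)).
    by split; [exact: derivableV|rewrite deriveV// dc2].
  by apply: is_deriveM.
by apply: (is_derive_eq H); rewrite /GRing.scale/=; field.
Qed.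

Let dsq (c t : R) (f df : R -> R) : (forall x : R, is_derive x 1 f (df x)) ->
  is_derive t 1 (fun t => f ((c * t) ^+ 2)) (2 * c ^+ 2 * t * df ((c * t) ^+ 2)).
Proof.
move=> fd; have H : is_derive t 1 (( *%R c) * ( *%R c)) ((c * t) *: c + (c * t) *: c).
  by have dm := is_derive_mulc c t; apply: is_deriveM.
have [d _] := fd ((c * t) ^+ 2).
have := @is_derive_comp_curve _ _ _ f _ t _ H; move=> /(_ _) K.
have /derivable1_diffP d' := d.
apply: (is_derive_eq (K d')).
have [_ ->] := derivable_dir1 ((c * t) *: c + (c * t) *: c) d.
by have [_ ->] := fd ((c * t) ^+ 2); rewrite /GRing.scale/=; ring.
Qed.

(* Both sides solve f'' = - 4 kappa f with the same initial data, in t = sqrt x. *)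
Lemma sn0_double (x : R) : 0 <= x -> sn0 (4 * x) = sn0 x * cs0 x.
Proof.
move=> x0.
pose D t := t * sn0 ((2 * t) ^+ 2) - t * (sn0 ((1 * t) ^+ 2) * cs0 ((1 * t) ^+ 2)).
pose D1 t := cs0 ((2 * t) ^+ 2) - (cs0 ((1 * t) ^+ 2) ^+ 2 - kappa * t ^+ 2 * sn0 ((1 * t) ^+ 2) ^+ 2).
have dD (t : R) : is_derive t 1 D (D1 t).
  have ds2 := dsq 2 t is_derive_sn0; have ds1 := dsq 1 t is_derive_sn0.
  have dc1 := dsq 1 t is_derive_cs0.
  rewrite (_ : D = id * (fun t => sn0 ((2 * t) ^+ 2)) - id *
      ((fun t => sn0 ((1 * t) ^+ 2)) * (fun t => cs0 ((1 * t) ^+ 2))))//.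
  by apply: is_derive_eq; rewrite /D1 /GRing.scale/= !fctE /cs0 /=; field.
have dD1 (t : R) : is_derive t 1 D1 (- (4 * kappa * D t)).
  have dc2 := dsq 2 t is_derive_cs0; have ds1 := dsq 1 t is_derive_sn0.
  have dc1 := dsq 1 t is_derive_cs0.
  have dm := is_derive_mulc kappa t.
  pose s1 := (fun t => sn0 ((1 * t) ^+ 2)); pose c1 := (fun t => cs0 ((1 * t) ^+ 2)).
  rewrite (_ : D1 = (fun t => cs0 ((2 * t) ^+ 2)) - (c1 * c1 - (( *%R kappa) * id) * (s1 * s1))); last first.
    apply/funext => u; change (D1 u = cs0 ((2 * u) ^+ 2) - (cs0 ((1 * u) ^+ 2) * cs0 ((1 * u) ^+ 2)
       - kappa * u * u * (sn0 ((1 * u) ^+ 2) * sn0 ((1 * u) ^+ 2)))).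
    by rewrite /D1; ring.
  have ds1' : is_derive t 1 s1 _ := ds1; have dc1' : is_derive t 1 c1 _ := dc1.
  by apply: is_derive_eq; rewrite /D /s1 /c1 /GRing.scale/= !fctE /cs0 /=; field.
have [->|xn0] := eqVneq x 0; first by rewrite mulr0 sn0_0 cs0_0 mulr1.
pose T := Num.sqrt x.
have T0 : 0 < T by rewrite sqrtr_gt0 lt_neqAle eq_sym xn0.
pose z (b : bool) := if b then D else D1.
pose dz (b : bool) t := if b then D1 t else - (4 * kappa * D t).
have : z true T = 0.
  apply: (@gronwall_family _ _ z dz (1 + 4 * `|kappa|) 0 T).
  - by rewrite addr_ge0 ?mulr_ge0.
  - by move=> [] t _; [exact: dD|exact: dD1].
  - move=> b t _; rewrite big_bool/= mulrDl mul1r mulrDr.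
    have K0 : 0 <= 4 * `|kappa| * `|D t| by rewrite !mulr_ge0.
    have K1 : 0 <= 4 * `|kappa| * `|D1 t| by rewrite !mulr_ge0.
    have := normr_ge0 (D t); have := normr_ge0 (D1 t).
    case: b => /=; first by lra.
    by rewrite normrN !normrM ger0_norm//; lra.
  - move=> b; apply: continuous_subspaceT => t.
    by case: b => /=; [exact: is_derive_continuous (dD t)|exact: is_derive_continuous (dD1 t)].
  - by case; rewrite /= /D /D1 ?mul0r ?subrr// !mulr0 expr0n/= cs0_0 !mulr0 !mul0r subr0 expr1n subrr.
  - by rewrite in_itv/= lexx ltW.
rewrite /z /D -mulrBr => /eqP; rewrite mulf_eq0 gt_eqF//= subr_eq0 => /eqP.
by rewrite mul1r exprMn sqr_sqrtr// expr2 -natrM.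
Qed.
End Trig.

Lemma is_derive_bil (R : realType) (V : normedModType R) (d : nat) (A : V -> 'M[R]_d)
    (u v : V -> 'rV[R]_d) x h dA du dv :
  is_derive x h A dA -> is_derive x h u du -> is_derive x h v dv ->
  is_derive x h (fun y => bil (A y) (u y) (v y))
    (bil dA (u x) (v x) + bil (A x) du (v x) + bil (A x) (u x) dv).
Proof.
move=> hA hu hv.
rewrite (_ : (fun _ => _) = (fun y => \sum_i \sum_j u y 0 i * A y i j * v y 0 j)); last first.
  by apply/funext => y; rewrite bilE.
have H i j : is_derive x h (fun y => u y 0 i * A y i j * v y 0 j)
   (du 0 i * A x i j * v x 0 j + u x 0 i * dA i j * v x 0 j + u x 0 i * A x i j * dv 0 j).
  have h1 := is_derive_coord 0 i hu; have h2 := is_derive_coord i j hA.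
  have h3 := is_derive_coord 0 j hv.
  have := @is_deriveM _ _ _ _ x h _ _ (@is_deriveM _ _ _ _ x h _ _ h1 h2) h3.
  move=> H; apply: (is_derive_eq H); rewrite !fctE /GRing.scale/=; ring.
have := @is_derive_bigsum _ _ _ _ (index_enum _) xpredT _ _ x h (fun i =>
   @is_derive_bigsum _ _ _ _ (index_enum _) xpredT _ _ x h (H i)).
move=> H'; apply: (is_derive_eq H').
rewrite !bilE -!big_split; apply: eq_bigr => i _; rewrite -!big_split; apply: eq_bigr => j _ /=.
by ring.
Qed.

Lemma derive0_cst (R : realType) (f : R -> R) (a b : R) : a <= b ->
  (forall t, t \in `]a, b[ -> is_derive t 1 f 0) -> {within `[a, b], continuous f} -> f b = f a.
Proof.
move=> ab df cf; have [c _] := @MVT_segment R f (fun=> 0) a b ab df cf.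
by rewrite mul0r => /eqP; rewrite subr_eq0 => /eqP.
Qed.

(** * Gauss lemma and Riccati equation along radial geodesics *)

Section Gauss.
Variables (R : realType) (d : nat) (M : ptopologicalType).
Variable g : riemannianManifold R d M.
Variables (p : M) (r : R) (a : chart R d M).
Hypotheses (r0 : 0 < r) (na : normal_chart g p r a).
Implicit Types (u v w y : 'rV[R]_d) (t : R).

Let aA := normal_atlas na.
Let oU := @open_chart_imgE R d M a.
Let G := metric g a.
Let Q := Q0 g p.
Let QT : Q^T = Q := Q0T g p.

Lemma is_derive_metric y h : chart_img a y -> is_derive y h G (dmetric g a y h).
Proof.
move=> ay; split; first exact/diff_derivable/metric_diff.
by rewrite dmetric_unlock.
Qed.

Lemma is_derive_metric_ray v t : chart_img a (t *: v) ->
  is_derive t 1 (fun s : R => G (s *: v)) (dmetric g a (t *: v) v).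
Proof.
move=> av; rewrite dmetric_unlock.
exact: is_derive_comp_curve (is_derive_scalel v t) (metric_diff aA av).
Qed.

(** Koszul's formula when the radial Christoffel term [chr y y] is zero. *)
Lemma dmetric_radial y w : chart_img a y ->
  bil (dmetric g a y w) y y = 2 * bil (dmetric g a y y) y w.
Proof.
move=> ay; have := bil_chr aA y y w ay; rewrite (chr_radial na ay) bil0l.
by move=> /esym/eqP; rewrite mulf_eq0 invr_eq0 pnatr_eq0/= => /eqP; lra.
Qed.

Lemma within_ray (f : R -> R) (df : R -> R) : (forall t, 0 <= t <= 1 -> is_derive t 1 f (df t)) ->
  {within `[0, 1], continuous f}.
Proof.
move=> fd; apply: continuous_in_subspaceT => s; rewrite inE/= in_itv/= => sI.
exact: is_derive_continuous (fd s sI).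
Qed.

(** Along the ray, [dmetric_radial] with [w] radial makes the derivative of the norm equal to twice
    itself, hence zero. *)
Lemma metric_radial_norm y : chart_img a y -> bil (G y) y y = bil Q y y.
Proof.
move=> ay; pose f t := bil (G (t *: y)) y y.
have fd t : 0 <= t <= 1 -> is_derive t 1 f (bil (dmetric g a (t *: y) y) y y).
  move=> tI; have at_ := normal_imgZ na tI ay.
  have H := is_derive_bil (is_derive_metric_ray at_) (is_derive_cst y t 1) (is_derive_cst y t 1).
  by apply: (is_derive_eq H); rewrite bil0l bil0r !addr0.
suff : f 1 = f 0 by rewrite /f scale1r scale0r {2}/G (metric_center r0 na).
apply: derive0_cst => //; last exact: within_ray fd.
move=> t; rewrite in_itv/= => /andP[t0 t1]; have tI : 0 <= t <= 1 by rewrite !ltW.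
have at_ := normal_imgZ na tI ay; apply: (is_derive_eq (fd t tI)).
have := dmetric_radial (t *: y) at_.
rewrite !(bilZl, bilZr) dmetricZ// bilZm => /eqP.
rewrite -subr_eq0 => /eqP E; apply: (mulfI (_ : t * t * t != 0)).
  by rewrite !mulf_neq0 // gt_eqF.
by rewrite mulr0; lra.
Qed.

Lemma dmetric_radial_norm y w : chart_img a y ->
  bil (dmetric g a y w) y y = 2 * (bil Q y w - bil (G y) y w).
Proof.
move=> ay.
have H : is_derive y w (fun z => bil (G z) z z) _ :=
  is_derive_bil (is_derive_metric w ay) (is_derive_id y w) (is_derive_id y w).
have H' : is_derive y w (fun z => bil Q z z) _ :=
  is_derive_bil (is_derive_cst Q y w) (is_derive_id y w) (is_derive_id y w).
have E : \forall z \near y, bil Q z z = bil (G z) z z.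
  by apply: filterS (open_near oU ay) => z az; rewrite metric_radial_norm.
have [_ E1] := near_eq_is_derive E H'; have [_ E2] := H; move: E1; rewrite E2.
rewrite (bil_symm w y QT) (bil_symm w y (metricT aA ay)) (_ : bil 0 y y = 0); first by lra.
by rewrite -(scale0r Q) bilZm mul0r.
Qed.

(** The function t (G(ty)(y, w) - Q(y, w)) has zero derivative: two evaluations of the derivative of
    the metric in direction [w], by Koszul's formula and by differentiating [metric_radial_norm],
    cancel its terms. It vanishes at t = 0. *)
Lemma gauss_lemma y w : chart_img a y -> bil (G y) y w = bil Q y w.
Proof.
move=> ay; pose f t := t * (bil (G (t *: y)) y w - bil Q y w).
have fd t : 0 <= t <= 1 -> is_derive t 1 f (t * bil (dmetric g a (t *: y) y) y w
    + (bil (G (t *: y)) y w - bil Q y w)).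
  move=> tI; have at_ := normal_imgZ na tI ay.
  have H := is_derive_bil (is_derive_metric_ray at_) (is_derive_cst y t 1) (is_derive_cst w t 1).
  have := @is_deriveM _ _ id _ t 1 _ _ (is_derive_id t 1) (@is_deriveB _ _ _ _ _ t 1 _ _ H (is_derive_cst (bil Q y w) t 1)).
  move=> H'; apply: (is_derive_eq H'); rewrite bil0l bil0r !addr0 subr0 /GRing.scale/=.
  by rewrite mulr1.
have := @derive0_cst _ f 0 1 ler01; rewrite /f scale1r mul0r mul1r => H.
apply/eqP; rewrite -subr_eq0; apply/eqP; apply: H; last exact: within_ray fd.
move=> t; rewrite in_itv/= => /andP[t0 t1]; have tI : 0 <= t <= 1 by rewrite !ltW.
have at_ := normal_imgZ na tI ay; apply: (is_derive_eq (fd t tI)).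
have := dmetric_radial w at_; have := dmetric_radial_norm w at_.
rewrite !(bilZl, bilZr) dmetricZ// bilZm => -> E.
apply: (mulfI (_ : 2 * t != 0)); first by rewrite mulf_neq0// ?pnatr_eq0// gt_eqF.
by rewrite mulr0; nra.
Qed.

(* The metric dual of chr y y is symmetric, being half the radial derivative of the metric *)
Lemma bil_chr_radial y w w' : chart_img a y ->
  bil (G y) (chr g a y y w) w' = 2^-1 * bil (dmetric g a y y) w w'.
Proof.
move=> ay.
have key u u' : bil (dmetric g a y u) y u' = bil Q u u' - bil (G y) u u'.
  have H : is_derive y u (fun z => bil (G z) z u') _ :=
    is_derive_bil (is_derive_metric u ay) (is_derive_id y u) (is_derive_cst u' y u).
  have H' : is_derive y u (fun z => bil Q z u') _ :=
    is_derive_bil (is_derive_cst Q y u) (is_derive_id y u) (is_derive_cst u' y u).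
  have E : \forall z \near y, bil Q z u' = bil (G z) z u'.
    by apply: filterS (open_near oU ay) => z az; rewrite gauss_lemma.
  have [_ E1] := near_eq_is_derive E H'; have [_ E2] := H; move: E1; rewrite E2.
  by rewrite !bil0r (_ : bil 0 y u' = 0); [lra|rewrite -(scale0r Q) bilZm mul0r].
rewrite bil_chr// key key (bil_symm w' w QT) (bil_symm w' w (metricT aA ay)).
by rewrite addrK.
Qed.

Hypothesis hd2 : (1 < d)%N.
Variable kappa : R.
Hypothesis hK : forall y u v, chart_img a y -> row_free (col_mx u v) ->
  sectional_curvature g a y u v = kappa.

Lemma chr_radial_ray v t : 0 < t -> chart_img a (t *: v) -> chr g a (t *: v) v v = 0.
Proof.
move=> t0 av; have := chr_radial na av; rewrite chrZl chrZr scalerA => /eqP.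
by rewrite scaler_eq0 mulf_eq0 gt_eqF//= => /eqP.
Qed.

Lemma bil_chr_ray v t w w' : 0 < t -> chart_img a (t *: v) ->
  bil (G (t *: v)) (chr g a (t *: v) v w) w' = 2^-1 * bil (dmetric g a (t *: v) v) w w'.
Proof.
move=> t0 av; have := bil_chr_radial w w' av; rewrite chrZl bilZl dmetricZ// bilZm => E.
by apply: (mulfI (_ : t != 0)); [rewrite gt_eqF|rewrite E; ring].
Qed.

Lemma bil_chr_ray_sym v t w w' : 0 < t -> chart_img a (t *: v) ->
  bil (G (t *: v)) (chr g a (t *: v) v w) w' = bil (G (t *: v)) w (chr g a (t *: v) v w').
Proof.
move=> t0 av; rewrite (bil_symm w _ (metricT aA av)) !bil_chr_ray//.
by rewrite (bil_symm w w' (dmetricT aA v av)).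
Qed.

Lemma bil_chr_swap v t w w' : 0 < t -> chart_img a (t *: v) ->
  bil (G (t *: v)) (chr g a (t *: v) v w) w' = bil (G (t *: v)) (chr g a (t *: v) v w') w.
Proof. by move=> t0 av; rewrite bil_chr_ray_sym// (bil_symm w _ (metricT aA av)). Qed.

Lemma bil_chr2 v t w w' : 0 < t -> chart_img a (t *: v) ->
  bil (G (t *: v)) (chr g a (t *: v) v (chr g a (t *: v) v w)) w' =
  bil (G (t *: v)) (chr g a (t *: v) v w) (chr g a (t *: v) v w').
Proof. by move=> t0 av; rewrite bil_chr_ray_sym. Qed.

Lemma chr0r y u : chr g a y u 0 = 0.
Proof. by have := chrZr g a y 0 u 0; rewrite !scale0r. Qed.

(** Derivative at s = 0 of the identity chr(z)(z, z) = 0 along z = y + s w. *)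
Lemma dchr_radial v t w : 0 < t -> chart_img a (t *: v) ->
  t *: dchr g a (t *: v) w v v = - (2 *: chr g a (t *: v) v w).
Proof.
move=> t0 av; set y := t *: v.
have E : \forall s \near (0 : R), 0 = chr g a (y + s *: w) (y + s *: w) (y + s *: w) :> 'rV[R]_d.
  have N0 : nbhs (y + 0 *: w) (chart_img a) by rewrite scale0r addr0; exact: (open_near oU av).
  have Nn : \forall s \near (0 : R), chart_img a (y + s *: w).
    exact: (is_derive_continuous (is_derive_line y w 0) N0).
  by apply: filterS Nn => s as_; rewrite (chr_radial na as_).
have D0 u u' : is_derive (0 : R) 1 (fun s : R => chr g a (y + s *: w) u u') (dchr g a y w u u').
  rewrite dchr_unlock.
  have df : differentiable (fun z => chr g a z u u') (y + 0 *: w).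
    by rewrite scale0r addr0; exact: chr_diff.
  by have := is_derive_comp_curve (is_derive_line y w 0) df; rewrite scale0r addr0.
have X : is_derive (0 : R) 1 (fun s : R => chr g a (y + s *: w) (y + s *: w) (y + s *: w))
    (dchr g a y w y y + 2 *: chr g a y y w).
  (* Only the terms of order at most one in [s] contribute; the quadratic one has zero derivative at
     0. *)
  have -> : (fun s : R => chr g a (y + s *: w) (y + s *: w) (y + s *: w)) =
    (fun s => chr g a (y + s *: w) y y) + ((fun s : R => s *: chr g a (y + s *: w) y w)
     + (fun s : R => s *: chr g a (y + s *: w) w y) + (fun s : R => (s * s) *: chr g a (y + s *: w) w w)).
    apply/funext => s; rewrite !fctE /= chrDl !chrDr !(chrZl, chrZr) scalerA.
    by rewrite -!scalerA -!addrA.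
  have zl (f : R -> 'rV[R]_d) (h : R -> R) df dh : is_derive (0 : R) 1 f df -> is_derive (0 : R) 1 h dh ->
      h 0 = 0 -> is_derive (0 : R) 1 (fun s => h s *: f s) (dh *: f 0).
    move=> [f1 f2] [h1 h2] h0.
    have /derivable_mxP f1' := f1.
    have dd : derivable (fun s => h s *: f s) 0 1.
      apply/derivable_mxP => i j.
      rewrite (_ : (fun _ => _) = h * (fun s => f s i j)); last by apply/funext => s; rewrite mxE.
      exact: (derivableM h1 (f1' i j)).
    split=> //; rewrite derive_mx//; apply/matrixP => i j; rewrite !mxE.
    rewrite (_ : (fun _ => _) = h * (fun s => f s i j)); last by apply/funext => s; rewrite mxE.
    by rewrite (deriveM h1 (f1' i j)) h0 h2 /GRing.scale/= mul0r add0r mulrC.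
  have i0 : is_derive (0 : R) 1 (fun s : R => s) 1 by exact: is_derive_id.
  have i2 : is_derive (0 : R) 1 (fun s : R => s * s) 0.
    have := @is_deriveM _ _ _ _ (0 : R) 1 _ _ i0 i0; move=> H; apply: (is_derive_eq H).
    by rewrite !scale0r addr0.
  have := @is_deriveD _ _ _ _ _ _ _ _ _ (D0 y y) (@is_deriveD _ _ _ _ _ _ _ _ _
    (@is_deriveD _ _ _ _ _ _ _ _ _ (zl _ _ _ _ (D0 y w) i0 erefl) (zl _ _ _ _ (D0 w y) i0 erefl))
    (zl _ _ _ _ (D0 w w) i2 (mul0r _))).
  move=> H; apply: (is_derive_eq H).
  by rewrite !scale0r !addr0 !scale1r (chr_sym aA w y av) scaler_nat mulr2n.
have [_ X2] := X; have [_ X3] := near_eq_is_derive E (is_derive_cst (0 : 'rV[R]_d) (0 : R) (1 : R)).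
move: X3; rewrite X2 => /eqP; rewrite addr_eq0 => /eqP.
have -> : dchr g a y w y y = (t * t) *: dchr g a y w v v.
  have d1 u u' : derivable (fun z => chr g a z u u') y w by apply/diff_derivable/chr_diff.
  rewrite !dchr_unlock (_ : (fun z => chr g a z y y) = (t * t) \*: (fun z => chr g a z v v)).
    by rewrite deriveZ.
  by apply/funext => z; rewrite /= /y chrZl chrZr scalerA.
rewrite chrZl -scalerA => H; apply: (scalerI (_ : t != 0)); first by rewrite gt_eqF.
by rewrite H scalerN !scalerA mulrC.
Qed.

Lemma dchr_sym y u v w : chart_img a y -> dchr g a y u v w = dchr g a y u w v.
Proof.
move=> ay; rewrite !dchr_unlock; apply: near_eq_derive.
by apply: filterS (open_near oU ay) => z az; rewrite chr_sym.
Qed.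

Lemma dmetric_ray v t w w' : 0 < t -> chart_img a (t *: v) ->
  bil (dmetric g a (t *: v) v) w w' = 2 * bil (G (t *: v)) (chr g a (t *: v) v w) w'.
Proof. by move=> t0 av; rewrite bil_chr_ray// mulrA divff ?pnatr_eq0// mul1r. Qed.

Lemma is_derive_chr_ray v t w : chart_img a (t *: v) ->
  is_derive t 1 (fun s : R => chr g a (s *: v) v w) (dchr g a (t *: v) v v w).
Proof.
move=> av; rewrite dchr_unlock.
exact: is_derive_comp_curve (is_derive_scalel v t) (chr_diff aA v w av).
Qed.

Lemma ray_near v t : 0 < t -> chart_img a (t *: v) ->
  \forall s \near t, 0 < s /\ chart_img a (s *: v).
Proof.
move=> t0 av; apply: filterI; first exact: lt_nbhsr.
exact: (is_derive_continuous (is_derive_scalel v t) (open_near oU av)).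
Qed.

(** Derivative along the ray of the symmetry of w |-> chr v w with respect to the metric; the terms
    containing the derivative of the metric are themselves symmetric and drop out. *)
Lemma bil_dchr_ray_sym v t w w' : 0 < t -> chart_img a (t *: v) ->
  bil (G (t *: v)) (dchr g a (t *: v) v v w) w' = bil (G (t *: v)) (dchr g a (t *: v) v v w') w.
Proof.
move=> t0 av; pose y := t *: v.
have D u u' : is_derive t 1 (fun s : R => bil (G (s *: v)) (chr g a (s *: v) v u) u') _ :=
  is_derive_bil (is_derive_metric_ray av) (is_derive_chr_ray u av) (is_derive_cst u' t 1).
have E : \forall s \near t, bil (G (s *: v)) (chr g a (s *: v) v w) w' =
    bil (G (s *: v)) (chr g a (s *: v) v w') w.
  apply: filterS (ray_near t0 av) => s [s0 as_].
  by rewrite bil_chr_ray_sym// (bil_symm w _ (metricT aA as_)).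
have [_ E1] := near_eq_is_derive E (D w w'); have [_ E2] := D w' w; move: E1; rewrite E2.
rewrite /cst !bil0r !addr0 !dmetric_ray// !bil_chr2//.
rewrite (bil_symm (chr g a (t *: v) v w') (chr g a (t *: v) v w) (metricT aA av)).
by move/addrI => ->.
Qed.

Lemma curvature_radial v t w : 0 < t -> chart_img a (t *: v) ->
  t *: curvature g a (t *: v) w v v = - (2 *: chr g a (t *: v) v w +
    t *: dchr g a (t *: v) v v w + t *: chr g a (t *: v) v (chr g a (t *: v) v w)).
Proof.
move=> t0 av; rewrite (curvatureE aA)// chr_radial_ray//.
rewrite chr0r addr0 (dchr_sym _ w v av) (chr_sym aA w v av) !scalerBr dchr_radial//.
by rewrite !opprD.
Qed.

(** The curvature hypothesis speaks of independent pairs. [w] is split into a multiple of [v] and a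
    part [u] orthogonal to [v]; if [u = 0] both sides vanish, the left one because radial
    Christoffel terms do. *)
Lemma constant_curvature_form v t w : 0 < t -> v != 0 -> chart_img a (t *: v) ->
  let B := bil (G (t *: v)) in
  B (curvature g a (t *: v) w v v) w = kappa * (B w w * B v v - B w v ^+ 2).
Proof.
move=> t0 v0 av B; have Bv : 0 < B v v by exact: metric_pos.
pose c := B w v / B v v; pose u := w - c *: v.
have wE : w = u + c *: v by rewrite subrK.
have uv : B u v = 0 by rewrite /B bilBl bilZl /c divfK ?subrr// gt_eqF.
have den0 u' k : B u' v = 0 -> B (u' + k *: v) (u' + k *: v) * B v v - B (u' + k *: v) v ^+ 2 = B u' u' * B v v.
  move=> u'v; have vu' : B v u' = 0 by rewrite /B (bil_symm v u' (metricT aA av)).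
  by move: u'v vu'; rewrite /B !(bilDl, bilDr, bilZl, bilZr) => -> ->; ring.
have den : B w w * B v v - B w v ^+ 2 = B u u * B v v by rewrite -(den0 u c uv) -wE.
have [u0|u0] := eqVneq u 0.
  rewrite den u0 /B bil0l mul0r mulr0.
  suff -> : curvature g a (t *: v) w v v = 0 by rewrite bil0l.
  apply: (scalerI (_ : t != 0)); first by rewrite gt_eqF.
  rewrite curvature_radial// scaler0.
  have Nw : chr g a (t *: v) v w = 0.
    by rewrite wE u0 add0r chrZr chr_radial_ray// scaler0.
  have dw : t *: dchr g a (t *: v) v v w = 0.
    rewrite dchr_sym// dchr_unlock.
    have -> : (fun z => chr g a z w v) = c \*: (fun z => chr g a z v v).
      by apply/funext => z; rewrite wE u0 add0r /= chrZl.
    rewrite deriveZ; last exact/diff_derivable/chr_diff.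
    rewrite -dchr_unlock scalerA mulrC -scalerA dchr_radial//.
    by rewrite chr_radial_ray// scaler0 oppr0 scaler0.
  by rewrite Nw dw scaler0 !add0r chr0r scaler0 oppr0.
have rf : row_free (col_mx w v).
  apply: inj_row_free => x; rewrite -[x]hsubmxK mul_row_col.
  rewrite (mx11_scalar (lsubmx x)) (mx11_scalar (rsubmx x)) !mul_scalar_mx.
  set xa := lsubmx x 0 0; set xb := rsubmx x 0 0 => H.
  have xa0 : xa = 0.
    apply/eqP; apply: contraT => xan; have wv : w = - (xb / xa) *: v.
      apply: (scalerI xan); rewrite scalerA mulrN mulrCA divff// mulr1.
      by rewrite scaleNr; apply/eqP; rewrite -addr_eq0 H.
    have cE : c = - (xb / xa) by rewrite /c /B wv bilZl mulfK ?gt_eqF.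
    by move: u0; rewrite /u cE -wv subrr eqxx.
  have xb0 : xb = 0.
    by move/eqP: H; rewrite xa0 scale0r add0r scaler_eq0 (negbTE v0) orbF => /eqP.
  by rewrite xa0 xb0 raddf0 row_mx0.
have := hK av rf; rewrite /sectional_curvature /gform -!bil_unlock -/B.
move=> /(congr1 ( *%R^~ (B w w * B v v - B w v ^+ 2))).
rewrite divfK// den mulf_neq0 ?gt_eqF//; exact: metric_pos.
Qed.

(** The operator w |-> chr v w plays the role of the shape operator of the geodesic spheres. Its
    derivative along the ray is the curvature operator up to lower terms; that operator is
    symmetric, so polarising [constant_curvature_form] determines it. *)
Lemma riccati v t w : 0 < t -> v != 0 -> chart_img a (t *: v) ->
  t *: dchr g a (t *: v) v v w =
  - (2 *: chr g a (t *: v) v w) - t *: chr g a (t *: v) v (chr g a (t *: v) v w)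
  - (t * kappa) *: (bil Q v v *: w - bil Q v w *: v).
Proof.
move=> t0 v0 av; set B := bil (G (t *: v)).
have sB u u' : B u u' = B u' u by exact: bil_symm (metricT aA av).
have gauss u : B v u = bil Q v u.
  have := gauss_lemma u av; rewrite !bilZl => /(mulfI (_ : t != 0)); apply.
  by rewrite gt_eqF.
pose T u u' := B (curvature g a (t *: v) u v v) u'.
have TE u u' : t * T u u' = - (2 * B (chr g a (t *: v) v u) u' + t * B (dchr g a (t *: v) v v u) u'
    + t * B (chr g a (t *: v) v (chr g a (t *: v) v u)) u').
  rewrite -bilZl curvature_radial// bilNl !bilDl !bilZl //.
have Tsym u u' : T u u' = T u' u.
  apply: (mulfI (_ : t != 0)); first by rewrite gt_eqF.
  rewrite !TE /B (bil_dchr_ray_sym u)// (bil_chr_swap u)// !bil_chr2//.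
  by rewrite (bil_symm (chr g a (t *: v) v u) _ (metricT aA av)).
have TD u u' u'' : T (u + u') u'' = T u u'' + T u' u''.
  apply: (mulfI (_ : t != 0)); first by rewrite gt_eqF.
  rewrite mulrDr !TE !chrDr.
  have -> : dchr g a (t *: v) v v (u + u') = dchr g a (t *: v) v v u + dchr g a (t *: v) v v u'.
    rewrite !dchr_unlock.
    have -> : (fun z => chr g a z v (u + u')) = (fun z => chr g a z v u) + (fun z => chr g a z v u').
      by apply/funext => z; rewrite chrDr.
    by rewrite deriveD//; exact/diff_derivable/chr_diff.
  by rewrite /B !bilDl; ring.
have TDr u u' u'' : T u'' (u + u') = T u'' u + T u'' u' by rewrite Tsym TD !(Tsym u'').
have Tquad u : T u u = kappa * (B u u * bil Q v v - bil Q v u ^+ 2).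
  by have := constant_curvature_form u t0 v0 av; rewrite /= -/B gauss (sB u v) gauss.
have Tform u u' : T u u' = kappa * (B u u' * bil Q v v - bil Q v u * bil Q v u').
  have := Tquad (u + u'); rewrite TD !TDr !Tquad (Tsym u' u) /B !(bilDl, bilDr) -/B (sB u' u).
  by move=> H; lra.
apply: (@posdef_inj _ _ (G (t *: v))) => [|u]; first by move=> u; exact: metric_pos.
have := TE w u; rewrite Tform !(bilBl, bilZl, bilNl) -/B gauss.
by move=> H; lra.
Qed.

End Gauss.

(** * The explicit metric of constant curvature in normal coordinates *)

Section MetricFormula.
Variables (R : realType) (d : nat) (M : ptopologicalType).
Variable g : riemannianManifold R d M.
Variables (p : M) (r : R) (a : chart R d M).
Hypotheses (r0 : 0 < r) (na : normal_chart g p r a).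
Hypothesis hd2 : (1 < d)%N.
Variable kappa : R.
Hypothesis hK : forall y u v, chart_img a y -> row_free (col_mx u v) ->
  sectional_curvature g a y u v = kappa.
Implicit Types (u v w y : 'rV[R]_d) (t : R).

Let aA := normal_atlas na.
Let oU := @open_chart_imgE R d M a.
Let G := metric g a.
Let Q := Q0 g p.
Let QT : Q^T = Q := Q0T g p.
Let sn := sn0 kappa.

Lemma is_derive_comp_sqr (f df : R -> R) (rho t : R) : (forall x : R, is_derive x 1 f (df x)) ->
  is_derive t 1 (fun s => f (s * s * rho)) (2 * t * rho * df (t * t * rho)).
Proof.
move=> fd; have i0 : is_derive t 1 (fun s : R => s) 1 by exact: is_derive_id.
have H := @is_deriveM _ _ _ _ t 1 _ _ (@is_deriveM _ _ _ _ t 1 _ _ i0 i0) (is_derive_cst rho t 1).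
have [dd _] := fd (t * t * rho); have /derivable1_diffP dd' := dd.
have := is_derive_comp_curve H dd' => K; apply: (is_derive_eq K).
have -> : ((fun s : R => s) * (fun s : R => s) * cst rho) t = t * t * rho by [].
have [_ ->] := derivable_dir1 (((fun s : R => s) * (fun s : R => s)) t *: 0 + cst rho t *: (t *: 1 + t *: 1)) dd.
by have [_ ->] := fd (t * t * rho); rewrite /GRing.scale/= mulr0 add0r; ring.
Qed.

Lemma continuous_bounded_itv (f : R -> R) : (forall t, 0 <= t <= 1 -> {for t, continuous f}) ->
  exists B, forall t, 0 <= t <= 1 -> `|f t| <= B.
Proof.
move=> cf; have [|c _ H] := @EVT_max R (fun t => `|f t|) 0 1 ler01.
  apply: continuous_in_subspaceT => s; rewrite inE/= in_itv/= => sI.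
  exact: cvg_norm (cf s sI).
by exists `|f c| => t tI; apply: H; rewrite in_itv.
Qed.

Lemma chr_ray_bound v : chart_img a v -> exists2 L, 0 <= L &
  forall t, 0 <= t <= 1 -> forall u i, `|chr g a (t *: v) v u 0 i| <= L * \sum_k `|u 0 k|.
Proof.
move=> av.
have bd (ijk : 'I_d * 'I_d * 'I_d) : exists B, forall t, 0 <= t <= 1 ->
    `|christoffel g a ijk.1.1 ijk.1.2 ijk.2 (t *: v)| <= B.
  apply: continuous_bounded_itv => t tI.
  have at_ := normal_imgZ na tI av.
  apply: (@continuous_comp _ _ _ (fun t : R => t *: v)).
    exact: is_derive_continuous (is_derive_scalel v t).
  exact: C1fun_continuous (christoffel_C1 _ _ _ aA) at_.
have [B HB] := choice bd.
have B0 ijk : 0 <= B ijk by apply: le_trans (HB ijk 0 _) => //; rewrite lexx ler01.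
pose L := \sum_ijk B ijk * `|v|.
have L0 : 0 <= L by apply: sumr_ge0 => k _; rewrite mulr_ge0.
exists (\sum_(j < d) L); first exact: sumr_ge0.
move=> t tI u i; rewrite chrE (le_trans (ler_norm_sum _ _ _))// mulr_suml.
apply: ler_sum => j _; rewrite (le_trans (ler_norm_sum _ _ _))// mulr_sumr.
apply: ler_sum => k _; have Hc := HB (i, j, k) t tI; rewrite /= in Hc.
move: Hc; move: (christoffel g a i j k (t *: v)) => x Hc; rewrite !normrM ler_wpM2r//.
rewrite /L (bigD1 (i, j, k))//= -[leLHS]addr0 lerD// ?sumr_ge0// => [|l _]; last by rewrite mulr_ge0.
by rewrite ler_pM//; exact: rV_coord_le.
Qed.

(** On vectors orthogonal to [v] the Riccati equation has the solution s'/s, where s(t) = S(t^2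
    rho). The defect s chr(v, w) - s' w, suitably weighted, satisfies a homogeneous linear system
    and starts at zero. *)
Lemma chr_perp v w t : v != 0 -> chart_img a v -> bil Q v w = 0 -> 0 < t <= 1 ->
  let rho := bil Q v v in
  sn (t * t * rho) *: chr g a (t *: v) v w = (2 * t * rho * sn1 kappa (t * t * rho)) *: w.
Proof.
move=> v0 av vw tI rho.
pose s t := sn (t * t * rho); pose sg t := 2 * t * rho * sn1 kappa (t * t * rho).
pose n t := chr g a (t *: v) v w; pose n' t := dchr g a (t *: v) v v w.
(* The weight [t * t] absorbs the singular term -2/t of the Riccati equation, leaving z' = - chr(v,
   z), which is regular at 0. *)
pose z (i : 'I_d) t := t * t * (s t * n t 0 i - sg t * w 0 i).
have sd (u : R) : is_derive u 1 s (sg u) by exact: is_derive_comp_sqr (@is_derive_sn0 _ kappa).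
have sgd (u : R) : is_derive u 1 sg (2 * rho * sn1 kappa (u * u * rho) +
     4 * u * u * rho * rho * sn2 kappa (u * u * rho)).
  have H1 := is_derive_comp_sqr rho u (@is_derive_sn1 _ kappa).
  have H2 := is_derive_mulc (2 * rho) u.
  have H := @is_deriveM _ _ _ _ u 1 _ _ H2 H1.
  have E : (( *%R (2 * rho)) * (fun s => sn1 kappa (s * s * rho))) = sg.
    by apply/funext => x; rewrite fctE /sg; ring.
  by rewrite -E; apply: (is_derive_eq H); rewrite /GRing.scale/=; ring.
pose dz (i : 'I_d) t := 2 * t * (s t * n t 0 i - sg t * w 0 i) + t * t * (sg t * n t 0 i + s t * n' t 0 i -
   (2 * rho * sn1 kappa (t * t * rho) + 4 * t * t * rho * rho * sn2 kappa (t * t * rho)) * w 0 i).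
have zd i (u : R) : 0 <= u <= 1 -> is_derive u 1 (z i) (dz i u).
  move=> uI; have au := normal_imgZ na uI av.
  have i0 : is_derive u 1 (fun s : R => s) 1 by exact: is_derive_id.
  have nd : is_derive u 1 (fun s => n s 0 i) (n' u 0 i).
    exact: is_derive_coord (is_derive_chr_ray na w au).
  have A := @is_deriveM _ _ _ _ u 1 _ _ (sd u) nd.
  have B := @is_deriveM _ _ _ _ u 1 _ _ (sgd u) (is_derive_cst (w 0 i) u 1).
  have C := @is_deriveM _ _ _ _ u 1 _ _ (@is_deriveM _ _ _ _ u 1 _ _ i0 i0)
    (@is_deriveB _ _ _ _ _ u 1 _ _ A B).
  by apply: (is_derive_eq C); rewrite !fctE /GRing.scale/= /dz /cst; ring.
have dzE i (u : R) : 0 < u <= 1 -> dz i u = - chr g a (u *: v) v (\row_k z k u) 0 i.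
  move=> /andP[u0 u1]; have uI : 0 <= u <= 1 by rewrite ltW.
  have au := normal_imgZ na uI av.
  have rE : \row_k z k u = (u * u * s u) *: n u - (u * u * sg u) *: w.
    by apply/rowP => k; rewrite !mxE /z; ring.
  have cN (x : 'rV[R]_d) : chr g a (u *: v) v (- x) = - chr g a (u *: v) v x.
    by rewrite -scaleN1r chrZr scaleN1r.
  rewrite rE chrDr cN !chrZr.
  have := riccati r0 na hK w u0 v0 au; rewrite vw scale0r subr0 -/Q -/rho.
  move=> /(congr1 (fun x : 'rV[R]_d => x 0 i)); rewrite !mxE -/(n u) -/(n' u).
  have ode := sn_ode kappa (u * u * rho); rewrite -/(sn (u * u * rho)) -/(s u) in ode.
  rewrite /dz.
  set X := chr g a (u *: v) v (n u) 0 i; set n1 := n u 0 i; set n2 := n' u 0 i.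
  set c1 := sn1 _ _; set c2 := sn2 _ _.
  rewrite -/c1 -/c2 in ode.
  have -> : sg u = 2 * u * rho * c1 by [].
  set S := s u in ode *; set w1 := w 0 i.
  move=> H.
  have -> : u * u * (2 * u * rho * c1 * n1 + S * n2 - (2 * rho * c1 + 4 * u * u * rho * rho * c2) * w1) =
    u * u * (2 * u * rho * c1 * n1 - (2 * rho * c1 + 4 * u * u * rho * rho * c2) * w1) + u * S * (u * n2) by ring.
  rewrite H.
  have -> : 4 * u * u * rho * rho * c2 = 2 * rho * (2 * (u * u * rho) * c2) by ring.
  have -> : 2 * (u * u * rho) * c2 = - (3 * c1) - kappa / 2 * S by lra.
  by field.
have [L L0 HL] := chr_ray_bound av.
have zz : forall i, z i t = 0.
  apply: (@gronwall_family _ _ z dz L 0 1) => //.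
  - by move=> i u; rewrite in_itv/= => /andP[/ltW u0 /ltW u1]; apply: zd; rewrite u0.
  - move=> i u; rewrite in_itv/= => /andP[u0 /ltW u1]; rewrite dzE ?u0// normrN.
    rewrite (le_trans (HL u _ _ i)) ?(ltW u0)// ler_wpM2l// le_eqVlt; apply/orP; left; apply/eqP.
    by apply: eq_bigr => k _; rewrite mxE.
  - move=> i; apply: continuous_in_subspaceT => u; rewrite inE/= in_itv/= => uI.
    exact: is_derive_continuous (zd i u uI).
  - by move=> i; rewrite /z !mul0r.
  - by rewrite in_itv/=; case/andP: tI => /ltW-> ->.
apply/rowP => i; have := zz i; rewrite /z => /eqP; rewrite !mulf_eq0 -orbA => /or3P[||].
- by case/andP: tI => /gt_eqF->.
- by case/andP: tI => /gt_eqF->.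
- by rewrite subr_eq0 => /eqP; rewrite !mxE.
Qed.

(** While s(t) = S(t^2 rho) stays positive, G(tv)(w, w') / s^2 is constant along the ray, because
    its logarithmic derivative is given by [chr_perp]. Positivity of s itself is proved on the way:
    at a first zero the metric would degenerate on [w], which is a statement on conjugate points. *)
Lemma metric_perp v w : v != 0 -> chart_img a v -> bil Q v w = 0 -> w != 0 ->
  0 < sn (bil Q v v) /\ forall w', bil (G v) w w' = sn (bil Q v v) ^+ 2 * bil Q w w'.
Proof.
move=> v0 av vw w0; pose rho := bil Q v v.
pose s t := sn (t * t * rho); pose sg t := 2 * t * rho * sn1 kappa (t * t * rho).
have sd (u : R) : is_derive u 1 s (sg u) by exact: is_derive_comp_sqr (@is_derive_sn0 _ kappa).
have cs (u : R) : {for u, continuous s} by exact: is_derive_continuous (sd u).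
pose q w' t := bil (G (t *: v)) w w'.
have qd w' t : 0 <= t <= 1 -> is_derive t 1 (q w') (bil (dmetric g a (t *: v) v) w w').
  move=> tI; have at_ := normal_imgZ na tI av.
  have H := is_derive_bil (is_derive_metric_ray na at_) (is_derive_cst w t 1) (is_derive_cst w' t 1).
  by apply: (is_derive_eq H); rewrite bil0l bil0r !addr0.
have key w' t : 0 <= t <= 1 -> (forall u : R, 0 <= u <= t -> 0 < s u) -> q w' t = s t ^+ 2 * q w' 0.
  move=> /andP[t0 t1] sp.
  pose f (u : R) := q w' u * ((s u)^-1 * (s u)^-1).
  pose df (u : R) := q w' u * ((s u)^-1 * (- (s u ^- 2) * sg u) + (s u)^-1 * (- (s u ^- 2) * sg u)) +
       (s u)^-1 * (s u)^-1 * bil (dmetric g a (u *: v) v) w w'.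
  have fd (u : R) : 0 <= u <= t -> is_derive u 1 f (df u).
    move=> /andP[u0 ut]; have su : s u != 0 by rewrite gt_eqF// sp ?u0.
    have [s1 s2] := sd u.
    have si : is_derive u 1 (fun x => (s x)^-1) (- (s u ^- 2) * sg u).
      by split; [exact: derivableV|rewrite deriveV// s2].
    have uI : 0 <= u <= 1 by rewrite u0 (le_trans ut).
    have H := @is_deriveM _ _ _ _ u 1 _ _ (qd w' u uI) (@is_deriveM _ _ _ _ u 1 _ _ si si).
    by apply: (is_derive_eq H); rewrite !fctE /GRing.scale/=.
  have : f t = f 0.
    apply: derive0_cst => // [u|].
      rewrite in_itv/= => /andP[u0 ut]; have su : 0 < s u by rewrite sp ?(ltW u0) ?ltW.
      have uI : 0 <= u <= t by rewrite !ltW.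
      apply: (is_derive_eq (fd u uI)); rewrite /df.
      have u01 : 0 <= u <= 1 by rewrite (ltW u0) (le_trans (ltW ut)).
      rewrite (dmetric_ray r0 na)//; last exact: (normal_imgZ na u01 av).
      have := @chr_perp v w u v0 av vw; rewrite u0 (le_trans (ltW ut))// => /(_ isT).
      rewrite /= -/rho -/(s u) -/(sg u) => /(congr1 (fun x => bil (G (u *: v)) x w')).
      rewrite !bilZl -/(q w' u) => E.
      have -> : bil (G (u *: v)) (chr g a (u *: v) v w) w' = sg u * q w' u / s u.
        by rewrite -E mulrC mulKf// gt_eqF.
      by field; rewrite gt_eqF.
    apply: continuous_in_subspaceT => u; rewrite inE/= in_itv/= => uI.
    exact: is_derive_continuous (fd u uI).
  have s0 : s 0 = 1 by rewrite /s !mul0r /sn sn0_0.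
  rewrite /f s0 invr1 !mulr1 => <-; field.
  by rewrite gt_eqF// sp// lexx t0.
have sp : forall t, 0 <= t <= 1 -> 0 < s t.
  apply: (@real_induction _ (fun t => 0 < s t)).
  - by rewrite /s !mul0r /sn sn0_0.
  - move=> t t0 t1 H; have st : 0 < s t by apply: H; rewrite t0 lexx.
    have /cvgrPdist_lt/(_ _ st) := cs t.
    move=> /nbhs_ballP[e /= e0 He]; exists e => // u /andP[tu ut] _.
    have := He u; rewrite /ball/= distrC ger0_norm ?subr_ge0 ?(ltW tu)// ltrBlDl => /(_ ut).
    by rewrite ltr_norml => /andP[_]; rewrite ltrBlDl ltrDr.
  - move=> t t0 t1 H.
    have tI : 0 <= t <= 1 by rewrite ltW.
    have E : q w t = s t ^+ 2 * q w 0.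
      (* The formula is known for times before [t] only; continuity carries it to [t], where q > 0
         forces s to be nonzero. *)
      apply: (@eq_left_limit _ _ (q w) (fun t => s t ^+ 2 * q w 0) 0 t (@norm_hausdorff _ _)) => //.
      - exact: is_derive_continuous (qd w t tI).
      - apply: for_continuousM; last exact: cst_continuous.
        exact: (for_continuousM (cs t) (cs t)).
      - move=> u /andP[u0 ut]; apply: key; first by rewrite u0 (le_trans (ltW ut)).
        by move=> x /andP[x0 xu]; apply: H; rewrite x0 (le_lt_trans xu).
    have q0 : 0 < q w t by apply: metric_pos => //; exact: (normal_imgZ na tI av).
    have sn0' : s t != 0.
      by apply: contraTneq q0 => st; rewrite E st expr0n/= mul0r ltxx.
    have s0 : 0 <= s t.
      rewrite leNgt; apply/negP => st.
      have /cvgrPdist_lt/(_ (- s t)) := cs t; rewrite oppr_gt0 => /(_ st).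
      move=> /nbhs_ballP[e /= e0 He].
      pose u := Num.max 0 (t - e / 2).
      have ut : 0 <= u < t by rewrite /u le_max lexx/= gt_max t0 gtrBl divr_gt0.
      have : ball t e u.
        rewrite /ball/= ger0_norm ?subr_ge0; last by case/andP: ut => _ /ltW.
        rewrite ltrBlDr -ltrBlDl /u lt_max; apply/orP; right.
        by rewrite ltrD2l ltrN2 ltr_pdivrMr// mulr_natr mulr2n ltrDl.
      move=> /He; rewrite ltr_norml => /andP[+ _]; rewrite opprK ltrBrDl.
      by have := H u ut; lra.
    by rewrite lt_neqAle eq_sym sn0'.
have s1 : s 1 = sn rho by rewrite /s !mul1r.
have I1 : 0 <= (1 : R) <= 1 by rewrite ler01 lexx.
split; first by rewrite -s1 sp.
move=> w'; have := key w' 1 I1 => /(_ sp).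
by rewrite /q scale1r scale0r /G (metric_center r0 na) s1.
Qed.

Lemma exists_perp v : v != 0 -> exists2 w, bil Q v w = 0 & w != 0.
Proof.
move=> v0; have rp : 0 < bil Q v v by exact: Q0_pos.
pose pr u := u - (bil Q v u / bil Q v v) *: v.
have prv u : bil Q v (pr u) = 0 by rewrite /pr bilBr bilZr divfK ?subrr// gt_eqF.
pose i0 : 'I_d := Ordinal (ltnW hd2); pose i1 : 'I_d := Ordinal hd2.
have [e0|] := eqVneq (pr (delta_mx 0 i0)) 0; last by exists (pr (delta_mx 0 i0)).
have [e1|] := eqVneq (pr (delta_mx 0 i1)) 0; last by exists (pr (delta_mx 0 i1)).
move: e0 e1; rewrite /pr; set c0 := _ / _; set c1 := _ / _ => /eqP; rewrite subr_eq0 => /eqP e0.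
move=> /eqP; rewrite subr_eq0 => /eqP e1.
have : c1 *: (delta_mx 0 i0 : 'rV[R]_d) = c0 *: delta_mx 0 i1.
  by rewrite e0 e1 !scalerA mulrC.
move=> /rowP/(_ i0); rewrite !mxE !eqxx/= mulr1 mulr0 => c10.
by move: e1; rewrite c10 scale0r => /rowP/(_ i1)/eqP; rewrite !mxE !eqxx oner_eq0.
Qed.

Lemma sn_gt0 v : chart_img a v -> 0 < sn (bil Q v v).
Proof.
move=> av; have [->|v0] := eqVneq v 0; first by rewrite bil0l /sn sn0_0.
by have [w vw w0] := exists_perp v0; have [] := metric_perp v0 av vw w0.
Qed.

(** The quotient (1 - S(rho)^2) / rho written without division, hence also defined at the centre. *)
Definition metric_h (rho : R) : R :=
  4 * sn rho * sn1 kappa rho + 4 * sn1 kappa rho ^+ 2 * rho + kappa * sn rho ^+ 2.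

Lemma metric_hE rho : rho * metric_h rho = 1 - sn rho ^+ 2.
Proof.
by have := cs_sn_sqr kappa rho; rewrite /metric_h /cs0 -/sn; lra.
Qed.

(** [u] is split into a radial part, governed by the Gauss lemma, and an orthogonal one, governed by
    [metric_perp]. *)
Lemma metric_formula v u w : chart_img a v ->
  bil (G v) u w = sn (bil Q v v) ^+ 2 * bil Q u w
    + metric_h (bil Q v v) * (bil Q v u * bil Q v w).
Proof.
move=> av; have [->|v0] := eqVneq v 0.
  by rewrite /G (metric_center r0 na) -/Q !bil0l !mulr0 addr0 /sn sn0_0 expr1n mul1r.
have rp : 0 < bil Q v v by exact: Q0_pos.
pose k := bil Q v u / bil Q v v; pose u' := u - k *: v.
have vu' : bil Q v u' = 0 by rewrite /u' bilBr bilZr /k divfK ?subrr// gt_eqF.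
have Gu' x : bil (G v) u' x = sn (bil Q v v) ^+ 2 * bil Q u' x.
  have [->|u0] := eqVneq u' 0; first by rewrite !bil0l mulr0.
  by have [_ ->] := metric_perp v0 av vu' u0.
have uE : u = u' + k *: v by rewrite subrK.
rewrite {1}uE bilDl bilZl Gu' (gauss_lemma r0 na w av) -/Q.
rewrite {1}/u' bilBl bilZl.
have hE : metric_h (bil Q v v) = (1 - sn (bil Q v v) ^+ 2) / bil Q v v.
  by rewrite -metric_hE mulrC mulKf// gt_eqF.
by rewrite hE /k; field; rewrite gt_eqF.
Qed.

End MetricFormula.

(** * Beltrami's map *)

Lemma bil0m (R : realType) (d : nat) (u w : 'rV[R]_d) : bil 0 u w = 0.
Proof. by rewrite -(scale0r (0 : 'M[R]_d)) bilZm mul0r. Qed.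

Lemma is_derive_comp_R (R : realType) (V : normedModType R) (f : R -> R) df (k : V -> R) (x v : V) dk :
  is_derive (k x) 1 f df -> is_derive x v k dk ->
  is_derive x v (f \o k) (dk * df).
Proof.
move=> [fd1 fd2] [kd1 kd2].
pose c (t : R) := k (t *: v + x).
have kc : is_derive (0 : R) 1 c dk.
  split; first by move/derivable1P: kd1.
  rewrite -kd2 /derive; suff -> : (fun h : R => h^-1 *: ((c \o shift 0) (h *: 1) - c 0)) =
      (fun h : R => h^-1 *: ((k \o shift x) (h *: v) - k x)) by [].
  apply/funext => t.
  by rewrite /c /= addr0 -[t *: 1]/(t * 1) mulr1 scale0r add0r.
have c0 : c 0 = k x by rewrite /c scale0r add0r.
have /derivable1_diffP fd1' := fd1; rewrite -c0 in fd1'.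
have := is_derive_comp_curve kc fd1'; rewrite c0 => -[H1 H2].
have e : is_derive x v (f \o k) ('D_dk f (k x)).
  split; first by apply/derivable1P.
  rewrite -H2 /derive; suff -> : (fun h : R => h^-1 *: (((f \o c) \o shift 0) (h *: 1) - (f \o c) 0)) =
      (fun h : R => h^-1 *: (((f \o k) \o shift x) (h *: v) - (f \o k) x)) by [].
  apply/funext => t.
  by rewrite /c /= addr0 -[t *: 1]/(t * 1) mulr1 scale0r add0r.
apply: (is_derive_eq e).
by have [_ ->] := derivable_dir1 dk fd1; rewrite fd2.
Qed.

Section Beltrami.
Variables (R : realType) (d : nat) (M : ptopologicalType).
Variable g : riemannianManifold R d M.
Variables (p : M) (r : R) (a : chart R d M).
Hypotheses (r0 : 0 < r) (na : normal_chart g p r a).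
Hypothesis hd2 : (1 < d)%N.
Variable kappa : R.
Hypothesis hK : forall y u v, chart_img a y -> row_free (col_mx u v) ->
  sectional_curvature g a y u v = kappa.
Implicit Types (u v w y : 'rV[R]_d).

Let aA := normal_atlas na.
Let oU := @open_chart_imgE R d M a.
Let G := metric g a.
Let Q := Q0 g p.
Let QT : Q^T = Q := Q0T g p.
Let S := sn0 kappa.
Let S1 := sn1 kappa.
Let S2 := sn2 kappa.
Let C := cs0 kappa.
Let h := metric_h kappa.

Definition metric_dh (x : R) : R :=
  8 * S1 x ^+ 2 + 4 * S x * S2 x + 8 * S1 x * S2 x * x + 2 * kappa * S x * S1 x.

Lemma is_derive_metric_h (x : R) : is_derive x 1 h (metric_dh x).
Proof.
have d0 := @is_derive_sn0 _ kappa x; have d1 := @is_derive_sn1 _ kappa x.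
have i0 : is_derive x 1 (fun s : R => s) 1 by exact: is_derive_id.
have E : h = (( *%R 4) \o (S * S1)) + (( *%R 4) \o (S1 * S1 * (fun s : R => s))) + (( *%R kappa) \o (S * S)).
  by apply/funext => s; rewrite !fctE /= /h /metric_h -/S -/S1; ring.
have mc (c : R) f df : is_derive x 1 f df -> is_derive x 1 (( *%R c) \o f) (c * df).
  by move=> fd; have := @is_deriveZ _ _ _ f c x 1 _ fd.
have A := mc 4 _ _ (@is_deriveM _ _ _ _ x 1 _ _ d0 d1).
have B := mc 4 _ _ (@is_deriveM _ _ _ _ x 1 _ _ (@is_deriveM _ _ _ _ x 1 _ _ d1 d1) i0).
have D := mc kappa _ _ (@is_deriveM _ _ _ _ x 1 _ _ d0 d0).
rewrite E; have H := @is_deriveD _ _ _ _ _ x 1 _ _ (@is_deriveD _ _ _ _ _ x 1 _ _ A B) D.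
by apply: (is_derive_eq H); rewrite !fctE /GRing.scale/= /metric_dh -/S -/S1 -/S2; ring.
Qed.

Lemma dmetric_formula x c u w : chart_img a x ->
  let rho := bil Q x x in
  bil (dmetric g a x c) u w = 4 * S rho * S1 rho * bil Q x c * bil Q u w
    + 2 * metric_dh rho * bil Q x c * (bil Q x u * bil Q x w)
    + h rho * (bil Q c u * bil Q x w + bil Q x u * bil Q c w).
Proof.
move=> ax rho.
have L : is_derive x c (fun z => bil (G z) u w) (bil (dmetric g a x c) u w).
  have H := is_derive_bil (is_derive_metric na c ax) (is_derive_cst u x c) (is_derive_cst w x c).
  by apply: (is_derive_eq H); rewrite bil0l bil0r !addr0.
have dr : is_derive x c (fun z => bil Q z z) (2 * bil Q x c).
  have H := is_derive_bil (is_derive_cst Q x c) (is_derive_id x c) (is_derive_id x c).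
  by apply: (is_derive_eq H); rewrite bil0m add0r (bil_symm c x QT); ring.
have dl v : is_derive x c (fun z => bil Q z v) (bil Q c v).
  have H := is_derive_bil (is_derive_cst Q x c) (is_derive_id x c) (is_derive_cst v x c).
  by apply: (is_derive_eq H); rewrite bil0m bil0r add0r addr0.
have dS := is_derive_comp_R (@is_derive_sn0 _ kappa _) dr.
have dh := is_derive_comp_R (is_derive_metric_h _) dr.
have A := @is_deriveM _ _ _ _ x c _ _ (@is_deriveM _ _ _ _ x c _ _ dS dS) (is_derive_cst (bil Q u w) x c).
have B := @is_deriveM _ _ _ _ x c _ _ dh (@is_deriveM _ _ _ _ x c _ _ (dl u) (dl w)).
have RR := @is_deriveD _ _ _ _ _ x c _ _ A B.
have E : \forall z \near x, ((S \o (fun z => bil Q z z)) * (S \o (fun z => bil Q z z)) * cst (bil Q u w) +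
   (h \o (fun z => bil Q z z)) * ((fun z => bil Q z u) * (fun z => bil Q z w))) z = bil (G z) u w.
  apply: filterS (open_near oU ax) => z az; rewrite !fctE /=.
  by rewrite (metric_formula r0 na hK u w az) expr2.
have [_ L2] := L; have [_] := near_eq_is_derive E RR; rewrite L2 => ->.
by rewrite !fctE /GRing.scale/= -/rho -/S -/S1 /cst; ring.
Qed.

(** Koszul's formula with both the metric and its derivative explicit. The acceleration stays
    implicit on the left, so the metric is never inverted. *)
Lemma geodesic_accel x V (A := - chr g a x V V) : chart_img a x ->
  let rho := bil Q x x in let al := bil Q x V in let be := bil Q V V in
  S rho ^+ 2 *: A + (h rho * bil Q x A) *: x =
  - (4 * S rho * S1 rho * al) *: V +
  (2 * S rho * S1 rho * be - h rho * be - metric_dh rho * al ^+ 2) *: x.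
Proof.
move=> ax rho al be; apply: (@posdef_inj _ _ Q) => [u|w]; first exact: Q0_pos.
have := bil_chr aA V V w ax; rewrite -[X in bil _ X w]opprK -/A bilNl -/G.
rewrite (metric_formula r0 na hK A w ax) !(dmetric_formula _ _ _ ax) -/rho -/S -/h -/al -/be.
rewrite !bilDl !bilZl -/al -/be => H.
have sVw : bil Q w V = bil Q V w by exact: bil_symm.
rewrite sVw in H.
have -> : S rho ^+ 2 * bil Q A w + h rho * bil Q x A * bil Q x w =
   - - (S rho ^+ 2 * bil Q A w + h rho * (bil Q x A * bil Q x w)) by ring.
by rewrite H; field.
Qed.

(** The gnomonic projection: the radius r is replaced by tan(sqrt(kappa) r) / sqrt(kappa), extended
    to all signs of the curvature. *)
Definition bel v : 'rV[R]_d := (S (bil Q v v) / C (bil Q v v)) *: v.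

Section Along.
Variables (c : R -> M) (I : set R).
Hypothesis gc : geodesic g I c.
Let X := cmap a \o c.
Let V := 'D_1 X.
Let A t := - chr g a (X t) (V t) (V t).
Let rho t := bil Q (X t) (X t).

Let dX t : I t -> chart_dom a (c t) -> is_derive t 1 X (V t).
Proof.
move=> It dt; have [oI _ _] := gc.
by have [D _] := Ck_curve_reg aA oI (geodesic_C1 gc) It dt; exact: derivableP.
Qed.

Let dV t : I t -> chart_dom a (c t) -> is_derive t 1 V (A t).
Proof. by move=> It dt; exact: (geodesic_eq aA gc It dt). Qed.

(* y = S(rho) X satisfies C(rho) y'' = C(rho)'' y, so the Wronskian-like vector below is constant *)
Definition bel_dir t : 'rV[R]_d :=
  C (rho t) *: ((2 * S1 (rho t) * bil Q (X t) (V t)) *: X t + S (rho t) *: V t)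
  + (kappa * S (rho t) * bil Q (X t) (V t) * S (rho t)) *: X t.

(** Once the acceleration is substituted, S'', [metric_h] and [kappa] are eliminated by the
    differential equation, by [metric_hE] and by C^2 + kappa rho S^2 = 1; what remains is a rational
    identity. *)
Lemma bel_dir_derive t i : I t -> chart_dom a (c t) -> 0 < C (rho t) ->
  is_derive t 1 (fun t => bel_dir t 0 i) 0.
Proof.
move=> It dt Cp; have ax : chart_img a (X t) by exact: curve_img.
have hX := dX It dt; have hV := dV It dt.
pose al s := bil Q (X s) (V s).
have dr : is_derive t 1 rho (2 * al t).
  have H := is_derive_bil (is_derive_cst Q t 1) hX hX.
  by apply: (is_derive_eq H); rewrite bil0m add0r (bil_symm (V t) (X t) QT) -/(al t); ring.
have dal : is_derive t 1 al (bil Q (V t) (V t) + bil Q (X t) (A t)).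
  have H := is_derive_bil (is_derive_cst Q t 1) hX hV.
  by apply: (is_derive_eq H); rewrite bil0m add0r.
have dS := is_derive_comp_R (@is_derive_sn0 _ kappa _) dr.
have dS1 := is_derive_comp_R (@is_derive_sn1 _ kappa _) dr.
have dC := is_derive_comp_R (@is_derive_cs0 _ kappa _) dr.
have xi := is_derive_coord 0 i hX; have vi := is_derive_coord 0 i hV.
have P1 := @is_deriveM _ _ _ _ t 1 _ _ (@is_deriveM _ _ _ _ t 1 _ _ dS1 dal) xi.
have P2 := @is_deriveM _ _ _ _ t 1 _ _ dS vi.
have P3 := @is_deriveM _ _ _ _ t 1 _ _ dC (@is_deriveD _ _ _ _ _ t 1 _ _ (@is_deriveD _ _ _ _ _ t 1 _ _ P1 P1) P2).
have P4 := @is_deriveM _ _ _ _ t 1 _ _ (@is_deriveM _ _ _ _ t 1 _ _ (@is_deriveM _ _ _ _ t 1 _ _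
   (is_derive_cst kappa t 1) (@is_deriveM _ _ _ _ t 1 _ _ dS dal)) dS) xi.
have H := @is_deriveD _ _ _ _ _ t 1 _ _ P3 P4.
have E : (fun t => bel_dir t 0 i) =
  (cs0 kappa \o rho) * ((sn1 kappa \o rho) * al * (fun s => X s 0 i) + (sn1 kappa \o rho) * al * (fun s => X s 0 i) +
    (sn0 kappa \o rho) * (fun s => V s 0 i)) +
  cst kappa * ((sn0 kappa \o rho) * al) * (sn0 kappa \o rho) * (fun s => X s 0 i).
  by apply/funext => s; rewrite !fctE /= /bel_dir !mxE /al /cst -/S -/S1 -/C; ring.
rewrite E; apply: (is_derive_eq H).
rewrite !fctE /cst /GRing.scale/= -/S -/S1 -/S2 -/C.
have acc := geodesic_accel (V t) ax; rewrite /= -/(A t) -/(rho t) -/(al t) in acc.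
have hE := metric_hE kappa (rho t); rewrite -/S -/h in hE.
have Sp : 0 < S (rho t) by exact: (sn_gt0 r0 na hd2 hK ax).
have xA : bil Q (X t) (A t) = - (4 * S (rho t) * S1 (rho t) * al t ^+ 2) +
   (2 * S (rho t) * S1 (rho t) * bil Q (V t) (V t) - h (rho t) * bil Q (V t) (V t)
     - metric_dh (rho t) * al t ^+ 2) * rho t.
  move: acc => /(congr1 (bil Q (X t))); rewrite !bilDr !bilZr -/(rho t) -/(al t).
  set zz := bil Q (X t) (A t) => acc.
  have -> : zz = S (rho t) ^+ 2 * zz + h (rho t) * zz * rho t.
    have -> : S (rho t) ^+ 2 * zz + h (rho t) * zz * rho t = (S (rho t) ^+ 2 + rho t * h (rho t)) * zz by ring.
    by rewrite hE; ring.
  by rewrite acc; ring.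
have Ai : S (rho t) ^+ 2 * A t 0 i + h (rho t) * bil Q (X t) (A t) * X t 0 i =
    - (4 * S (rho t) * S1 (rho t) * al t) * V t 0 i +
    (2 * S (rho t) * S1 (rho t) * bil Q (V t) (V t) - h (rho t) * bil Q (V t) (V t)
     - metric_dh (rho t) * al t ^+ 2) * X t 0 i.
  move: acc {xA}; move: (A t) => At /(congr1 (fun y : 'rV[R]_d => y 0 i)).
  by rewrite !mxE mulNr.
(* The elimination divides by [rho t], so passage through the centre is treated apart. *)
have [X0|Xn0] := eqVneq (X t) 0.
  have al0 : al t = 0 by rewrite /al X0 bil0l.
  have Ai0 : A t 0 i = 0.
    have xi0 : X t 0 i = 0 by rewrite X0 mxE.
    move: Ai; rewrite al0 xi0; move: (A t 0 i) => z.
    rewrite !(mulr0, mul0r, oppr0, addr0) => /eqP.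
    by rewrite mulf_eq0 expf_eq0/= gt_eqF//= => /eqP.
  by rewrite Ai0 al0 X0 !mxE; ring.
have rp : 0 < rho t by exact: Q0_pos.
have ode := sn_ode kappa (rho t); rewrite -/S -/S1 -/S2 in ode.
have CE : C (rho t) = S (rho t) + 2 * rho t * S1 (rho t) by [].
have sq := cs_sn_sqr kappa (rho t); rewrite -/C -/S in sq.
have AiE : A t 0 i = (- (4 * S (rho t) * S1 (rho t) * al t) * V t 0 i +
   (2 * S (rho t) * S1 (rho t) * bil Q (V t) (V t) - h (rho t) * bil Q (V t) (V t) -
   metric_dh (rho t) * al t ^+ 2) * X t 0 i - h (rho t) * bil Q (X t) (A t) * X t 0 i) / S (rho t) ^+ 2.
  by rewrite -Ai; field; rewrite gt_eqF.
have hE' : h (rho t) = (1 - S (rho t) ^+ 2) / rho t by rewrite -hE mulrC mulKf// gt_eqF.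
have S2E : S2 (rho t) = (- (3 * S1 (rho t)) - kappa / 2 * S (rho t)) / (2 * rho t).
  have -> : - (3 * S1 (rho t)) - kappa / 2 * S (rho t) = 2 * rho t * S2 (rho t) by lra.
  by rewrite mulrC mulKf// mulf_neq0// ?pnatr_eq0// gt_eqF.
(* Solving for [kappa] instead of S or C avoids square roots and leaves a goal for [field]. *)
have kE : kappa = (1 - C (rho t) ^+ 2) / (rho t * S (rho t) ^+ 2).
  have -> : 1 - C (rho t) ^+ 2 = kappa * (rho t * S (rho t) ^+ 2) by rewrite -sq; ring.
  by rewrite mulfK// mulf_neq0// ?expf_neq0// gt_eqF.
rewrite AiE xA hE' /metric_dh S2E.
move: rp Sp CE kE.
set s := S (rho t); set s1 := S1 (rho t); set ro := rho t; set cc := C ro.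
set alp := al t; set bb := bil Q (V t) (V t); set x := X t 0 i; set vv := V t 0 i.
move=> rp Sp CE kE; rewrite kE CE; field.
by rewrite !gt_eqF.
Qed.

End Along.
End Beltrami.

Lemma itv_bounded (R : realType) (f : R -> R) (b : R) : 0 <= b ->
  (forall t, 0 <= t <= b -> {for t, continuous f}) ->
  exists2 B, 0 < B & forall t, 0 <= t <= b -> `|f t| <= B.
Proof.
move=> b0 fc; have W : {within `[0, b], continuous (fun t => `|f t|)}.
  apply: continuous_in_subspaceT => t; rewrite inE/= in_itv/= => tb.
  by apply: continuous_comp; [exact: fc | exact: norm_continuous].
have [c _ hc] := EVT_max b0 W; exists (`|f c| + 1); first by rewrite ltr_wpDl.
by move=> t tb; rewrite (le_trans (hc t _))// ?lerDl// in_itv.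
Qed.

Lemma itv_lower (R : realType) (f : R -> R) (b : R) : 0 <= b ->
  (forall t, 0 <= t <= b -> {for t, continuous f}) ->
  (forall t, 0 <= t <= b -> 0 < f t) ->
  exists2 m, 0 < m & forall t, 0 <= t <= b -> m <= f t.
Proof.
move=> b0 fc fp; have W : {within `[0, b], continuous f}.
  by apply: continuous_in_subspaceT => t; rewrite inE/= in_itv/= => tb; exact: fc.
have [c cb hc] := EVT_min b0 W; exists (f c); first by apply: fp; rewrite in_itv in cb.
by move=> t tb; apply: hc; rewrite in_itv.
Qed.

(** Each coordinate is a pairing u_i = A(u, e_i) with e_i a row of the inverse matrix, so
    Cauchy-Schwarz bounds the sup norm by the form with an explicit constant. *)
Lemma posdef_norm (R : realType) (d : nat) (A : 'M[R]_d) : A^T = A ->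
  (forall u, u != 0 -> 0 < bil A u u) ->
  exists2 c, 0 < c & forall u v : 'rV[R]_d,
    `|u| ^+ 2 <= c * bil A u u /\ `|bil A u v| <= c * `|u| * `|v|.
Proof.
move=> AT Ap; have Au := posdef_unitmx Ap.
pose e i := delta_mx 0 i *m invmx A : 'rV[R]_d.
have eE i (u : 'rV[R]_d) : u 0 i = bil A u (e i).
  rewrite bil_unlock /e trmx_mul trmx_inv AT -mulmxA (mulmxA A) mulmxV// mul1mx trmx_delta.
  by rewrite -colE mxE.
have Ap0 (u : 'rV[R]_d) : 0 <= bil A u u.
  by have [->|/Ap/ltW//] := eqVneq u 0; rewrite bil0l.
pose c1 := \sum_i bil A (e i) (e i); pose c2 := \sum_i \sum_j `|A i j|.
have c10 : 0 <= c1 by apply: sumr_ge0 => i _; exact: Ap0.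
have c20 : 0 <= c2 by do 2 (apply: sumr_ge0 => ? _).
exists (1 + c1 + c2); first by rewrite -addrA ltr_wpDr ?addr_ge0.
move=> u v; split.
  have K : `|u| <= Num.sqrt ((1 + c1 + c2) * bil A u u).
    apply: rV_norm_le; first exact: sqrtr_ge0.
    move=> i; rewrite -sqrtr_sqr ler_sqrt ?mulr_ge0 ?addr_ge0// eE.
    rewrite (le_trans (bil_CS u (e i) AT Ap))// mulrC ler_wpM2r//.
    have L : bil A (e i) (e i) <= c1.
      by rewrite /c1 (bigD1 i)//= lerDl; apply: sumr_ge0 => j _.
    by rewrite -addrA addrCA (le_trans L)// lerDl addr_ge0.
  rewrite -[leRHS]sqr_sqrtr ?mulr_ge0 ?addr_ge0//.
  by rewrite ler_sqr// nnegrE ?sqrtr_ge0.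
have B : `|bil A u v| <= c2 * `|u| * `|v|.
  rewrite bilE (le_trans (ler_norm_sum _ _ _))// /c2 !mulr_suml ler_sum// => i _.
  rewrite (le_trans (ler_norm_sum _ _ _))// !mulr_suml ler_sum// => j _.
  rewrite !normrM [`|u 0 i| * _]mulrC.
  by rewrite ler_pM// ?mulr_ge0// ?ler_wpM2l// rV_coord_le.
rewrite (le_trans B)// ler_wpM2r// ler_wpM2r//.
by rewrite lerDr addr_ge0.
Qed.

Lemma mvt01 (R : realType) (f df : R -> R) :
  (forall t : R, 0 <= t <= 1 -> is_derive t 1 f (df t)) ->
  exists2 t, 0 <= t <= 1 & f 1 - f 0 = df t.
Proof.
move=> hf; have [||t /itvP tb ->] := @MVT_segment R f df 0 1 ler01.
- by move=> t; rewrite in_itv/= => /andP[/ltW t0 /ltW t1]; apply: hf; rewrite t0.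
- apply: continuous_in_subspaceT => t; rewrite inE/= in_itv/= => tb.
  exact: is_derive_continuous (hf _ tb).
by exists t; rewrite ?tb// subr0 mulr1.
Qed.

(** * Bi-Lipschitz bounds for Beltrami's map and for the metric *)

Section Model.
Variables (R : realType) (d : nat) (M : ptopologicalType).
Variable g : riemannianManifold R d M.
Variables (p : M) (r : R) (a : chart R d M).
Hypotheses (r0 : 0 < r) (na : normal_chart g p r a).
Hypothesis hd2 : (1 < d)%N.
Variable kappa : R.
Hypothesis hK : forall y u v, chart_img a y -> row_free (col_mx u v) ->
  sectional_curvature g a y u v = kappa.
Implicit Types (v w V : 'rV[R]_d).

Let aA := normal_atlas na.
Let G := metric g a.
Let Q := Q0 g p.
Let QT : Q^T = Q := Q0T g p.
Let S := sn0 kappa.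
Let S1 := sn1 kappa.
Let C := cs0 kappa.
Let h := metric_h kappa.
Let blt := bel g p kappa.

Lemma Q_scale (x : R) : 0 <= x -> exists v, bil Q v v = x.
Proof.
move=> x0; pose i0 := Ordinal (ltnW hd2).
pose e := delta_mx 0 i0 : 'rV[R]_d.
have en : e != 0.
  by apply/eqP => /(congr1 (fun y : 'rV[R]_d => y 0 i0)); rewrite !mxE !eqxx => /eqP; rewrite oner_eq0.
have qp := Q0_pos g p en; rewrite -/Q in qp.
exists (Num.sqrt (x / bil Q e e) *: e).
by rewrite bilZl bilZr mulrA -expr2 sqr_sqrtr ?divr_ge0 ?(ltW qp)// divfK ?gt_eqF.
Qed.

(** S > 0 up to squared radius [r ^+ 2], and S(4x) = S(x) C(x), so C > 0 up to half the radius. This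
    is the origin of the bound [R1 < r / 2]. *)
Lemma sn_cs_gt0 (x : R) : 0 <= x -> x < (r / 2) ^+ 2 -> 0 < S x /\ 0 < C x.
Proof.
move=> x0 xr.
have pos y : 0 <= y -> y < r ^+ 2 -> 0 < S y.
  move=> y0 yr; have [v vy] := Q_scale y0.
  by rewrite -vy; apply: (sn_gt0 r0 na hd2 hK); apply/(normal_img na); rewrite -/Q vy.
have xr4 : 4 * x < r ^+ 2.
  have -> : r ^+ 2 = 4 * (r / 2) ^+ 2 by field.
  by rewrite ltr_pM2l.
have Sx : 0 < S x by apply: pos => //; lra.
split=> //; have := pos (4 * x); rewrite /S sn0_double// pmulr_rgt0//; apply => //.
by rewrite mulr_ge0.
Qed.

Definition ratio_d (x : R) : R := (S1 x * C x + kappa / 2 * S x ^+ 2) / C x ^+ 2.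

(** The differential of [bel] at [x] applied to [V]. *)
Definition dbel (x V : 'rV[R]_d) : 'rV[R]_d :=
  (S (bil Q x x) / C (bil Q x x)) *: V + (2 * ratio_d (bil Q x x) * bil Q x V) *: x.

Lemma is_derive_Qsqr (X : R -> 'rV[R]_d) V (t : R) : is_derive t 1 X V ->
  is_derive t 1 (fun s => bil Q (X s) (X s)) (2 * bil Q (X t) V).
Proof.
move=> hX; have H := is_derive_bil (is_derive_cst Q t 1) hX hX.
by apply: (is_derive_eq H); rewrite bil0m add0r (bil_symm V (X t) QT); ring.
Qed.

Lemma is_derive_ratio (X : R -> 'rV[R]_d) V (t : R) (k : R -> R) dk : is_derive t 1 X V ->
  is_derive t 1 k dk -> 0 < C (bil Q (X t) (X t)) ->
  is_derive t 1 (fun s => S (bil Q (X s) (X s)) / C (bil Q (X s) (X s)) * k s)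
    (2 * ratio_d (bil Q (X t) (X t)) * bil Q (X t) V * k t
     + S (bil Q (X t) (X t)) / C (bil Q (X t) (X t)) * dk).
Proof.
move=> hX hk Cp; have dr := is_derive_Qsqr hX.
have ds := @is_derive_comp_R R R _ _ (fun s => bil Q (X s) (X s)) t 1 _ (cs_sn_ratio (lt0r_neq0 Cp)) dr.
have H := @is_deriveM _ _ _ _ t 1 _ _ ds hk.
apply: (is_derive_eq H); rewrite /GRing.scale/= /ratio_d -/S -/S1 -/C; ring.
Qed.

Lemma is_derive_bel (X : R -> 'rV[R]_d) V (t : R) i : is_derive t 1 X V ->
  0 < C (bil Q (X t) (X t)) ->
  is_derive t 1 (fun s => blt (X s) 0 i) (dbel (X t) V 0 i).
Proof.
move=> hX Cp; have H := is_derive_ratio hX (is_derive_coord 0 i hX) Cp.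
have -> : (fun s => blt (X s) 0 i) = (fun s => S (bil Q (X s) (X s)) / C (bil Q (X s) (X s)) * X s 0 i).
  by apply/funext => s; rewrite /blt /bel !mxE.
by apply: (is_derive_eq H); rewrite /dbel !mxE; ring.
Qed.

Lemma Q_convex v w (t b : R) : 0 <= t <= 1 -> bil Q v v <= b -> bil Q w w <= b ->
  bil Q (w + t *: (v - w)) (w + t *: (v - w)) <= b.
Proof.
move=> /andP[t0 t1] vb wb; have := Q0_ge0 g p (v - w); rewrite -/Q.
rewrite !(bilDl, bilDr, bilNl, bilNr, bilZl, bilZr) (bil_symm w v QT).
move: vb wb; set A := bil Q v v; set B := bil Q v w; set D := bil Q w w => vb wb P.
have t10 : 0 <= 1 - t by rewrite subr_ge0.
have : 0 <= t * (1 - t) * (A - B + (- B - - D)) := mulr_ge0 (mulr_ge0 t0 t10) P.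
have : t * A <= t * b by rewrite ler_wpM2l.
have : (1 - t) * D <= (1 - t) * b by rewrite ler_wpM2l// subr_ge0.
by lra.
Qed.

Variable R1 : R.
Hypotheses (R1p : 0 < R1) (R1r : R1 < r / 2).

Let R1sq x : 0 <= x <= R1 ^+ 2 -> 0 < S x /\ 0 < C x.
Proof.
move=> /andP[x0 xR]; apply: sn_cs_gt0 => //; rewrite (le_lt_trans xR)//.
by rewrite ltr_pXn2r// nnegrE ltW// divr_gt0.
Qed.

Lemma model_bounds : exists m B : R, [/\ 0 < m, 0 < B & forall x, 0 <= x <= R1 ^+ 2 ->
  [/\ m <= S x <= B, m <= C x <= B, `|h x| <= B & `|ratio_d x| <= B]].
Proof.
have b0 : 0 <= R1 ^+ 2 by exact: sqr_ge0.
have cS x : {for x, continuous S} by exact: is_derive_continuous (is_derive_sn0 kappa x).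
have cS1 x : {for x, continuous S1} by exact: is_derive_continuous (is_derive_sn1 kappa x).
have cC x : {for x, continuous C} by exact: is_derive_continuous (is_derive_cs0 kappa x).
have ch x : {for x, continuous h} by exact: is_derive_continuous (is_derive_metric_h kappa x).
have cr x : 0 <= x <= R1 ^+ 2 -> {for x, continuous ratio_d}.
  move=> /R1sq[_ Cp]; apply: for_continuousM.
    apply: for_continuousD; first exact: for_continuousM.
    by apply: for_continuousM; [exact: cst_continuous|exact: for_continuousM].
  apply: (@for_continuousV _ _ (fun y => C y ^+ 2)); first exact: for_continuousM.
  by rewrite expf_neq0// gt_eqF.
have [m1 m1p h1] := itv_lower b0 (fun x _ => cS x) (fun x xb => (R1sq xb).1).
have [m2 m2p h2] := itv_lower b0 (fun x _ => cC x) (fun x xb => (R1sq xb).2).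
have [B1 B1p k1] := itv_bounded b0 (fun x _ => cS x).
have [B2 B2p k2] := itv_bounded b0 (fun x _ => cC x).
have [B3 B3p k3] := itv_bounded b0 (fun x _ => ch x).
have [B4 B4p k4] := itv_bounded b0 cr.
exists (Num.min m1 m2), (B1 + B2 + B3 + B4); split.
- by rewrite lt_min m1p.
- by rewrite !addr_gt0.
move=> x xb; have [SS CC] := R1sq xb.
have := k1 _ xb; have := k2 _ xb; have := k3 _ xb; have := k4 _ xb.
rewrite (gtr0_norm SS) (gtr0_norm CC) => l4 l3 l2 l1.
rewrite !ge_min h1// h2// !orbT /=; split; lra.
Qed.

(** The differential of Beltrami's map is symmetric for [Q], with eigenvalue S/C across the ray and
    C^(-2) along it; both are bounded below on the compact ball. *)
Lemma dbel_lower : exists2 m, 0 < m & forall x V, bil Q x x <= R1 ^+ 2 ->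
  m * bil Q V V <= bil Q (dbel x V) V.
Proof.
have [m [B [mp Bp H]]] := model_bounds.
exists (Num.min (m / B) (B ^- 2)); first by rewrite lt_min divr_gt0// invr_gt0 exprn_gt0.
move=> x V xR; have x0 := Q0_ge0 g p x; have V0 := Q0_ge0 g p V; rewrite -/Q in x0 V0.
have xb : 0 <= bil Q x x <= R1 ^+ 2 by rewrite x0.
have [/andP[mS SB] /andP[mC CB] _ _] := H _ xb; have [Sp Cp] := R1sq xb.
have -> : bil Q (dbel x V) V = S (bil Q x x) / C (bil Q x x) * bil Q V V + 2 * ratio_d (bil Q x x) * bil Q x V ^+ 2.
  by rewrite /dbel bilDl !bilZl; ring.
have CS := bil_CS x V QT (Q0_pos g p); rewrite -/Q in CS.
have E : S (bil Q x x) / C (bil Q x x) + 2 * bil Q x x * ratio_d (bil Q x x) = C (bil Q x x) ^- 2.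
  have := cs_sn_sqr kappa (bil Q x x); rewrite -/C -/S => sq.
  have CE : C (bil Q x x) = S (bil Q x x) + 2 * bil Q x x * S1 (bil Q x x) by [].
  apply: (@mulIf _ (C (bil Q x x) ^+ 2)); first by rewrite expf_neq0// gt_eqF.
  rewrite mulVf ?expf_neq0 ?gt_eqF// -[RHS]sq /ratio_d.
  move: Cp; rewrite CE; set s := S _; set s1 := S1 _; set ro := bil Q x x => Cp; field.
  by rewrite gt_eqF.
have t1 : m / B <= S (bil Q x x) / C (bil Q x x).
  by rewrite ler_pM ?invr_ge0 ?(ltW mp) ?(ltW Bp)// lef_pV2.
have t2 : B ^- 2 <= C (bil Q x x) ^- 2.
  by rewrite lef_pV2 ?posrE ?exprn_gt0// ler_pXn2r// nnegrE ltW.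
(* If the radial correction is nonnegative it may be dropped; otherwise Cauchy-Schwarz bounds it by
   its value on radial vectors. *)
have [rp|rn] := leP 0 (ratio_d (bil Q x x)).
  have P : 0 <= 2 * ratio_d (bil Q x x) * bil Q x V ^+ 2 by rewrite mulr_ge0 ?sqr_ge0// mulr_ge0.
  rewrite -[leLHS]addr0 lerD// ler_wpM2r// ge_min t1//.
apply: (@le_trans _ _ (C (bil Q x x) ^- 2 * bil Q V V)).
  by rewrite ler_wpM2r// ge_min t2 orbT.
rewrite -E mulrDl lerD2l.
have := ler_wnM2l (ltW rn) CS; move: (ratio_d _) => q; lra.
Qed.

(** Upper bound: mean value theorem along the segment, which stays in the convex [Q]-ball. Lower
    bound: the same theorem for the pairing with [v - w], where [dbel_lower] makes the map strongly
    monotone. *)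
Lemma bel_norm : exists2 L, 0 < L & forall v w, bil Q v v <= R1 ^+ 2 -> bil Q w w <= R1 ^+ 2 ->
  [/\ `|blt v - blt w| <= L * `|v - w|, `|v - w| <= L * `|blt v - blt w| &
      forall V, `|V| <= L * `|dbel v V|].
Proof.
have [m mp Hm] := dbel_lower; have [m1 [B [m1p Bp HB]]] := model_bounds.
have [c cp Hc] := posdef_norm QT (Q0_pos g p).
have inv D E : m * bil Q D D <= bil Q E D -> `|D| <= c * c / m * `|E|.
  move=> H; have [h1 _] := Hc D 0; have [_ h2] := Hc E D.
  have [->|Dn] := eqVneq D 0.
    by rewrite normr0 mulr_ge0// divr_ge0// ?mulr_ge0// ltW.
  have Dp : 0 < `|D| by rewrite normr_gt0.
  rewrite -(ler_pM2r Dp) -expr2 (le_trans h1)//.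
  have : m * bil Q D D <= c * `|E| * `|D| by rewrite (le_trans H)// (le_trans (ler_norm _)).
  rewrite -ler_pdivlMl// => K; rewrite (le_trans (ler_wpM2l (ltW cp) K))// le_eqVlt.
  by apply/orP; left; apply/eqP; field; rewrite gt_eqF.
pose Rn := Num.sqrt (c * R1 ^+ 2).
have nx x : bil Q x x <= R1 ^+ 2 -> `|x| <= Rn.
  move=> xR; have [h1 _] := Hc x 0.
  rewrite -[`|x|]normr_id -sqrtr_sqr ler_sqrt; last by rewrite mulr_ge0 ?sqr_ge0// ltW.
  by rewrite (le_trans h1)// ler_wpM2l// ltW.
pose L2 := B / m1 + 2 * B * (c * Rn) * Rn.
have L20 : 0 <= L2 by rewrite addr_ge0 ?mulr_ge0 ?sqrtr_ge0 ?invr_ge0 ?ltW.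
have L10 : 0 < c * c / m by rewrite divr_gt0// mulr_gt0.
have up x V i : bil Q x x <= R1 ^+ 2 -> `|dbel x V 0 i| <= L2 * `|V|.
  move=> xR; have x0 := Q0_ge0 g p x; rewrite -/Q in x0.
  have xb : 0 <= bil Q x x <= R1 ^+ 2 by rewrite x0.
  have [/andP[mS SB] /andP[mC CB] _ rB] := HB _ xb; have [Sp Cp] := R1sq xb.
  rewrite /dbel !mxE; move: (ratio_d _) rB => rd rB; rewrite (le_trans (ler_normD _ _))// /L2 [leRHS]mulrDl lerD// !normrM.
    rewrite ler_pM ?rV_coord_le ?mulr_ge0// normfV (gtr0_norm Sp) (gtr0_norm Cp).
    by rewrite ler_pM ?invr_ge0 ?(ltW Sp) ?(ltW Cp)// lef_pV2.
  have [_ h2] := Hc x V; have xi := le_trans (rV_coord_le x i) (nx _ xR).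
  have K1 : `|bil Q x V| <= c * Rn * `|V|.
    by rewrite (le_trans h2)// ler_wpM2r// ler_wpM2l ?(ltW cp)// nx.
  rewrite normr_nat; apply: (@le_trans _ _ (2 * B * (c * Rn * `|V|) * Rn)); last by rewrite le_eqVlt; apply/orP; left; apply/eqP; ring.
  by rewrite ler_pM// ?mulr_ge0// ler_pM// ?mulr_ge0// ler_wpM2l.
exists (c * c / m + L2) => [|v w vR wR]; first by rewrite ltr_wpDr.
pose X t := w + t *: (v - w).
have hX (t : R) : is_derive t 1 X (v - w) by exact: is_derive_line.
have XR t : 0 <= t <= 1 -> bil Q (X t) (X t) <= R1 ^+ 2 by move=> t01; exact: Q_convex.
have XC t : 0 <= t <= 1 -> 0 < C (bil Q (X t) (X t)).
  by move=> t01; apply: (R1sq _).2; rewrite Q0_ge0/= XR.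
have X0 : X 0 = w by rewrite /X scale0r addr0.
have X1 : X 1 = v by rewrite /X scale1r addrC subrK.
split.
- apply: rV_norm_le => [|i]; first by rewrite mulr_ge0// addr_ge0// ltW.
  have [t tb] := mvt01 (fun t tb => is_derive_bel i (hX t) (XC t tb)).
  rewrite X0 X1 => e; have -> : (blt v - blt w) 0 i = dbel (X t) (v - w) 0 i by rewrite -e !mxE.
  rewrite (le_trans (up _ _ _ (XR _ tb)))// ler_wpM2r// lerDr ltW//.
- rewrite (@le_trans _ _ (c * c / m * `|blt v - blt w|))// ?ler_wpM2r// ?lerDl//.
  apply: inv; have lW (t : R) : is_derive t 1 (fun s => bil Q (X s) (v - w)) (bil Q (v - w) (v - w)).
    have H := is_derive_bil (is_derive_cst Q t 1) (hX t) (is_derive_cst (v - w) t 1).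
    by apply: (is_derive_eq H); rewrite bil0m add0r bil0r addr0.
  have [t tb] := mvt01 (fun t tb => is_derive_ratio (hX t) (lW t) (XC t tb)).
  rewrite X0 X1; set l := (X in X - _ = _); set l' := (X in _ - X = _).
  have -> : l - l' = bil Q (blt v - blt w) (v - w) by rewrite /l /l' /blt /bel [RHS]bilBl !bilZl.
  move=> ->; rewrite (le_trans (Hm _ (v - w) (XR _ tb)))//.
  by rewrite /dbel [leLHS]bilDl !bilZl le_eqVlt; apply/orP; left; apply/eqP; ring.
move=> V; rewrite (@le_trans _ _ (c * c / m * `|dbel v V|))// ?ler_wpM2r// ?lerDl//.
by apply: inv; exact: Hm.
Qed.

(** The metric has eigenvalue 1 along the ray and S^2 across it, relative to [Q]; only uniform
    bounds of these are kept. *)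
Lemma metric_norm : exists2 L, 0 < L & forall x V, bil Q x x <= R1 ^+ 2 ->
  `|V| ^+ 2 <= L * bil (G x) V V /\ bil (G x) V V <= L * `|V| ^+ 2.
Proof.
have [m [B [mp Bp HB]]] := model_bounds.
have [c cp Hc] := posdef_norm QT (Q0_pos g p).
pose m' := Num.min 1 (m ^+ 2).
have m'p : 0 < m' by rewrite lt_min ltr01/= exprn_gt0.
pose B' := (B ^+ 2 + B * R1 ^+ 2).
have B'p : 0 < B' by rewrite ltr_pwDl ?exprn_gt0// mulr_ge0 ?sqr_ge0// ltW.
exists (c / m' + B' * c); first by rewrite addr_gt0// ?divr_gt0// mulr_gt0.
move=> x V xR; have x0 := Q0_ge0 g p x; have V0 := Q0_ge0 g p V; rewrite -/Q in x0 V0.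
have xb : 0 <= bil Q x x <= R1 ^+ 2 by rewrite x0.
have [/andP[mS SB] _ hB _] := HB _ xb; have [Sp Cp] := R1sq xb.
have ax : chart_img a x.
  apply/(normal_img na); rewrite (le_lt_trans xR)// ltr_pXn2r// ?nnegrE ?ltW//.
  by rewrite (lt_trans R1r)// ltr_pdivrMr// ltr_pMr// ltr1n.
have E := metric_formula r0 na hK V V ax; rewrite -/Q -/S -/h -/(G x) -expr2 in E.
have CS := bil_CS x V QT (Q0_pos g p); rewrite -/Q in CS.
have hE := metric_hE kappa (bil Q x x); rewrite -/S -/h in hE.
have CS0 := sqr_ge0 (bil Q x V).
have lo : m' * bil Q V V <= bil (G x) V V.
  rewrite E; have [hp|hn] := leP 0 (h (bil Q x x)).
    apply: ler_wpDr; first exact: mulr_ge0.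
    rewrite ler_wpM2r// ge_min; apply/orP; right.
    by rewrite ler_pXn2r// nnegrE ltW.
  apply: (@le_trans _ _ (1 * bil Q V V)); first by rewrite ler_wpM2r// ge_min lexx.
  have := ler_wnM2l (ltW hn) CS; rewrite mulrA [h _ * bil Q x x]mulrC hE; lra.
have hi : bil (G x) V V <= B' * bil Q V V.
  rewrite E [leRHS]mulrDl lerD// ?ler_wpM2r// ?ler_pXn2r// ?nnegrE ?(ltW Sp) ?(ltW Bp)//.
  apply: (@le_trans _ _ (B * bil Q x V ^+ 2)).
    by rewrite ler_wpM2r// (le_trans (ler_norm _)).
  rewrite -mulrA ler_wpM2l ?(ltW Bp)// (le_trans CS)// ler_wpM2r//.
have G0 : 0 <= bil (G x) V V by rewrite (le_trans _ lo)// mulr_ge0// ltW.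
have [h1 _] := Hc V 0; have [_ h2] := Hc V V.
split.
  rewrite (le_trans h1)// mulrDl -[leLHS]addr0 lerD//; last by rewrite !mulr_ge0// ltW.
  by rewrite -mulrA ler_wpM2l ?(ltW cp)// ler_pdivlMl.
rewrite (le_trans hi)// [leRHS]mulrDl -[leLHS]add0r lerD//.
  by rewrite mulr_ge0 ?sqr_ge0// ltW// divr_gt0.
rewrite -mulrA ler_wpM2l ?(ltW B'p)//.
by rewrite (le_trans (ler_norm _))// (le_trans h2)// expr2 mulrA.
Qed.

End Model.

Lemma rV_norm_attained (R : realType) (d : nat) (e : 'rV[R]_d) : (0 < d)%N ->
  exists i, `|e| = `|e 0 i|.
Proof.
move=> d0; have [->|en] := eqVneq e 0; first by exists (Ordinal d0); rewrite mxE !normr0.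
have : mx_norm e != 0 by rewrite -[mx_norm e]/`|e| normr_eq0.
by move=> /mx_norm_neq0[[k i]] /= H; exists i; rewrite -(ord1 k).
Qed.

Lemma derive0_cst_cc (R : realType) (f : R -> R) (a b : R) :
  (forall t : R, a <= t <= b -> is_derive t 1 f 0) -> forall t, a <= t <= b -> f t = f a.
Proof.
move=> hf t /andP[at_ tb]; apply: derive0_cst => // [s|].
  rewrite in_itv/= => /andP[as_ st]; apply: hf.
  by rewrite (ltW as_) (ltW (lt_le_trans st tb)).
apply: continuous_in_subspaceT => s; rewrite inE/= in_itv/= => /andP[as_ st].
by apply: is_derive_continuous; apply: hf; rewrite as_ (le_trans st tb).
Qed.

Section ModelLine.
Variables (R : realType) (d : nat) (M : ptopologicalType).
Variable g : riemannianManifold R d M.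
Variables (p : M) (r : R) (a : chart R d M).
Hypotheses (r0 : 0 < r) (na : normal_chart g p r a).
Hypothesis hd2 : (1 < d)%N.
Variable kappa : R.
Hypothesis hK : forall y u v, chart_img a y -> row_free (col_mx u v) ->
  sectional_curvature g a y u v = kappa.

Let Q := Q0 g p.
Let C := cs0 kappa.
Let blt := bel g p kappa.
Let dblt := dbel g p kappa.

Variable R1 : R.
Hypotheses (R1p : 0 < R1) (R1r : R1 < r / 2).

(** The velocity of the image curve is C^(-2) times the constant vector [bel_dir], so the image is
    straight. [i] is a coordinate where this vector is largest, which normalises [w]; the last
    clause says that this coordinate moves monotonically, at the rate of the sup norm of the image
    velocity. *)
Lemma bel_line c I s t (X := cmap a \o c) : geodesic g I c -> s <= t -> `[s, t] `<=` I ->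
  (forall u, s <= u <= t -> chart_dom a (c u) /\ bil Q (X u) (X u) <= R1 ^+ 2) ->
  exists (i : 'I_d) (w : 'rV[R]_d), [/\ w 0 i = 1, forall j, `|w 0 j| <= 1,
    forall u, s <= u <= t -> blt (X u) - blt (X s) = (blt (X u) 0 i - blt (X s) 0 i) *: w &
    exists sg : R, `|sg| = 1 /\ forall u, s <= u <= t ->
      is_derive u 1 (fun u => blt (X u) 0 i) (sg * `|dblt (X u) ('D_1 X u)|)].
Proof.
move=> gc st stI hX; have [oI _ _] := gc.
have aA := normal_atlas na.
have Iu u : s <= u <= t -> I u by move=> hu; apply: stI; rewrite /= in_itv.
have Cp u : s <= u <= t -> 0 < C (bil Q (X u) (X u)).
  move=> hu; apply: (sn_cs_gt0 r0 na hd2 hK (Q0_ge0 g p (X u)) _).2.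
  rewrite (le_lt_trans (hX u hu).2)// ltr_pXn2r// nnegrE ltW// divr_gt0//.
pose e := bel_dir g p a kappa c s.
have dirE u : s <= u <= t -> bel_dir g p a kappa c u = e.
  move=> hu; apply/rowP => i; have D v : s <= v <= t ->
      is_derive v 1 (fun v => bel_dir g p a kappa c v 0 i) 0.
    by move=> hv; apply: (bel_dir_derive r0 na hd2 hK gc i (Iu _ hv) (hX _ hv).1); exact: Cp.
  exact: (derive0_cst_cc D).
have dbelE u : s <= u <= t -> dblt (X u) ('D_1 X u) = (C (bil Q (X u) (X u)) ^- 2) *: e.
  move=> hu; rewrite -(dirE _ hu) /dblt /dbel /ratio_d /bel_dir -/Q -/X -/C.
  have Cu := Cp _ hu; apply/rowP => j; rewrite !mxE.
  move: Cu; set cc := C _; set s0 := sn0 _ _; set s1 := sn1 _ _ => Cu; field.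
  by rewrite gt_eqF.
have dX u : s <= u <= t -> is_derive u 1 X ('D_1 X u).
  move=> hu; apply: derivableP.
  by have [] := Ck_curve_reg aA oI (geodesic_C1 gc) (Iu _ hu) (hX _ hu).1.
have db i u : s <= u <= t -> is_derive u 1 (fun u => blt (X u) 0 i) (C (bil Q (X u) (X u)) ^- 2 * e 0 i).
  move=> hu; have := is_derive_bel i (dX _ hu) (Cp _ hu).
  by rewrite -/dblt dbelE// mxE.
have [i ei] := rV_norm_attained e (ltnW hd2).
(* With zero direction the image is a single point, and the basis vector of the chosen coordinate
   serves as [w]. *)
have [e0|en] := eqVneq e 0.
  exists i, (delta_mx 0 i); have bc j u : s <= u <= t -> blt (X u) 0 j = blt (X s) 0 j.
    move=> hu; apply: (@derive0_cst_cc _ (fun u => blt (X u) 0 j) s t _ u hu) => v hv; apply: (is_derive_eq (db j v hv)).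
    by rewrite e0 mxE mulr0.
  split.
  - by rewrite mxE !eqxx.
  - by move=> j; rewrite mxE eqxx/=; case: eqP => _; rewrite ?normr0 ?normr1.
  - move=> u hu; have -> : blt (X u) = blt (X s) by apply/rowP => j; exact: bc.
    by rewrite !subrr scale0r.
  - exists 1; split=> [|u hu]; first exact: normr1.
    by apply: (is_derive_eq (db i u hu)); rewrite dbelE// e0 scaler0 mxE normr0 !mulr0.
have ein : e 0 i != 0 by rewrite -normr_eq0 -ei normr_eq0.
exists i, ((e 0 i)^-1 *: e); split.
- by rewrite mxE mulVf.
- move=> j; rewrite mxE normrM normfV ler_pdivrMl ?normr_gt0// mulr1 -ei.
  exact: rV_coord_le.
- move=> u hu; apply/rowP => j.
  have D v : s <= v <= t -> is_derive v 1 (fun v => blt (X v) 0 j * e 0 i - blt (X v) 0 i * e 0 j) 0.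
    move=> hv.
    have mc (k : R) (f : R -> R) (df : R) : is_derive v 1 f df -> is_derive v 1 (fun x => f x * k) (df * k).
      move=> fd; have -> : (fun x => f x * k) = k *: f.
        by apply/funext => x; rewrite fctE mulrC.
      by apply: (is_derive_eq (@is_deriveZ _ _ _ f k v 1 _ fd)); rewrite mulrC.
    have H := @is_deriveB _ _ _ _ _ v 1 _ _ (mc (e 0 i) _ _ (db j v hv)) (mc (e 0 j) _ _ (db i v hv)).
    by apply: (is_derive_eq H); ring.
  have := derive0_cst_cc D hu => /= E.
  have -> : (blt (X u) - blt (X s)) 0 j = blt (X u) 0 j - blt (X s) 0 j by rewrite !mxE.
  rewrite [RHS]mxE [X in _ * X]mxE; apply: (mulIf ein).
  move: E; move: (blt (X u) 0 j) (blt (X u) 0 i) (blt (X s) 0 j) (blt (X s) 0 i) => x1 x2 x3 x4 E.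
  have -> : (x2 - x4) * ((e 0 i)^-1 * e 0 j) * e 0 i = (x2 - x4) * e 0 j by field.
  by move: E; lra.
exists (Num.sg (e 0 i)); split; first by rewrite normr_sg ein.
move=> u hu; apply: (is_derive_eq (db i u hu)); rewrite dbelE// normrZ ei.
rewrite (gtr0_norm (_ : 0 < C (bil Q (X u) (X u)) ^- 2)); last by rewrite invr_gt0 exprn_gt0// Cp.
by rewrite mulrCA -numEsg.
Qed.

End ModelLine.

(** * Length and distance *)

Section Length.
Variables (R : realType) (d : nat) (M : ptopologicalType).
Variable g : riemannianManifold R d M.
Implicit Types (a b : chart R d M) (c : R -> M) (I : set R) (x y z : M).

Definition speed c (t : R) : R := Num.sqrt (inner g (c t) (velocity g c t) (velocity g c t)).

Lemma speed_ge0 c t : 0 <= speed c t. Proof. exact: sqrtr_ge0. Qed.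

(** [velocity] uses a chart that varies with the point; the transformation rule of the metric allows
    the speed to be read in any fixed chart. *)
Lemma speed_chart a c I t : atlas g a -> open I -> Ck_curve g 1 I c -> I t ->
  chart_dom a (c t) ->
  speed c t = Num.sqrt (bil (metric g a (cmap a (c t))) ('D_1 (cmap a \o c) t) ('D_1 (cmap a \o c) t)).
Proof.
move=> aA oI Cc It ac; have [bA bc] := chart_atP g (c t); set b := chart_at g (c t) in bA bc.
have [dX _] := Ck_curve_reg aA oI Cc It ac.
have cc := Cc.1 t It.
have [_ E] := curve_chart_change aA bA cc ac bc (derivableP dX).
rewrite /speed innerE /Q0 -/b /velocity -/b E; congr Num.sqrt.
have /= -> := metric_transition aA bA ac bc.
rewrite (deriveEjacobian _ (transition_diff aA bA ac bc)).
by rewrite !bil_unlock trmx_mul !mulmxA.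
Qed.

Lemma speed_continuous c I t : open I -> Ck_curve g 1 I c -> I t -> {for t, continuous (speed c)}.
Proof.
move=> oI Cc It; have [aA ac] := chart_atP g (c t); set a := chart_at g (c t) in aA ac.
have cc := Cc.1 t It.
have N : \forall s \near t, chart_dom a (c s).
  by apply: cc; exact: open_near (open_chart_dom a) ac.
apply: (@continuous_near_eq _ _ (fun s => Num.sqrt (bil (metric g a (cmap a (c s)))
   ('D_1 (cmap a \o c) s) ('D_1 (cmap a \o c) s)))).
  by apply: (filterS _ (filterI N (open_near oI It))) => s [ds Is]; rewrite (speed_chart aA oI Cc).
have [dX cV] := Ck_curve_reg aA oI Cc It ac.
apply: (@continuous_comp _ _ _ _ Num.sqrt); last exact: sqrt_continuous.
have -> : (fun s => bil (metric g a (cmap a (c s))) ('D_1 (cmap a \o c) s) ('D_1 (cmap a \o c) s)) =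
  (fun s => \sum_i \sum_j 'D_1 (cmap a \o c) s 0 i * metric g a (cmap a (c s)) i j * 'D_1 (cmap a \o c) s 0 j).
  by apply/funext => s; rewrite bilE.
have cX : {for t, continuous (cmap a \o c)} by apply: is_derive_continuous (derivableP dX).
have ci i : {for t, continuous (fun s => 'D_1 (cmap a \o c) s 0 i)}.
  exact: (@continuous_comp _ _ _ ('D_1 (cmap a \o c)) (fun y : 'rV[R]_d => y 0 i) t cV (@coord_continuous _ _ _ 0 i _)).
apply: cvg_bigsum => i; apply: cvg_bigsum => j.
have cG : {for t, continuous (fun s => metric g a (cmap a (c s)) i j)}.
  have cy : {for (cmap a \o c) t, continuous (fun y : 'rV[R]_d => metric g a y i j)}.
    by apply: differentiable_continuous; apply: metric_diff_entry => //; exact: curve_img.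
  exact: (continuous_comp cX cy).
exact: (for_continuousM (for_continuousM (ci i) cG) (ci j)).
Qed.

Lemma open_itv_extend I (s t : R) : open I -> s <= t -> `[s, t] `<=` I ->
  exists2 e : R, 0 < e & `[s - e, t + e] `<=` I.
Proof.
move=> oI st sI.
have Is : I s by apply: sI; rewrite /= in_itv/= lexx.
have It : I t by apply: sI; rewrite /= in_itv/= lexx st.
have /nbhs_ballP[e1 /= e1p h1] := open_near oI Is.
have /nbhs_ballP[e2 /= e2p h2] := open_near oI It.
exists (Num.min e1 e2 / 2); first by rewrite divr_gt0// lt_min e1p.
have mp : 0 < Num.min e1 e2 by rewrite lt_min e1p.
have l1 : Num.min e1 e2 <= e1 by rewrite ge_min lexx.
have l2 : Num.min e1 e2 <= e2 by rewrite ge_min lexx orbT.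
move=> u; rewrite /= in_itv/= => /andP[u1 u2].
have [us|su] := ltP u s.
  by apply: h1; rewrite /ball/= ltr_norml; apply/andP; split; lra.
have [tu|ut] := ltP t u.
  by apply: h2; rewrite /ball/= ltr_norml; apply/andP; split; lra.
by apply: sI; rewrite /= in_itv/= su.
Qed.

(** The primitive starts a little before [s] and the integrand is continuous a little beyond [t], so
    it has two-sided derivatives at both endpoints. *)
Lemma length_primitive c I (s t : R) : open I -> Ck_curve g 1 I c -> s <= t -> `[s, t] `<=` I ->
  exists L : R -> R, (forall u : R, s <= u <= t -> is_derive u 1 L (speed c u)) /\
    forall s' t', s <= s' -> s' <= t' -> t' <= t -> curve_length g c s' t' = (L t' - L s')%:E.
Proof.
move=> oI Cc st sI; have [e ep eI] := open_itv_extend oI st sI.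
have cs u : s - e <= u <= t + e -> {for u, continuous (speed c)}.
  by move=> hu; apply: (speed_continuous oI Cc); apply: eI; rewrite /= in_itv.
have ci : lebesgue_measure.-integrable `[s - e, t + e] (EFin \o (speed c)).
  apply: continuous_compact_integrable; first exact: segment_compact.
  by apply: continuous_in_subspaceT => u; rewrite inE/= in_itv/=; exact: cs.
pose L (x : R) := (\int[lebesgue_measure]_(u in `[s - e, x]) speed c u)%R.
have hL u : s <= u <= t -> is_derive u 1 L (speed c u).
  move=> /andP[su ut]; have uin : s - e <= u <= t + e by apply/andP; split; lra.
  have h1 : u < t + e by lra.
  have h2 : s - e < u by lra.
  have [D1 D2] := continuous_FTC1_closed h1 ci h2 (cs _ uin).
  by rewrite -D2 derive1E; exact: derivableP.
exists L; split=> // s' t' ss' st' tt'.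
rewrite /curve_length -/(speed c _).
have [->|stn] := eqVneq s' t'; first by rewrite set_itv1 integral_set1 subrr.
have st'' : s' < t' by rewrite lt_neqAle stn.
have inI u : s' <= u <= t' -> s <= u <= t by move=> /andP[h1 h2]; rewrite (le_trans ss' h1) (le_trans h2).
have cL u : s' <= u <= t' -> {for u, continuous L}.
  by move=> /inI hu; exact: is_derive_continuous (hL _ hu).
rewrite EFinB; apply: continuous_FTC2 => //.
- apply: continuous_in_subspaceT => u; rewrite inE/= in_itv/= => /inI /andP[h1 h2].
  by apply: cs; apply/andP; split; lra.
- split.
  + move=> u; rewrite in_itv/= => /andP[/ltW h1 /ltW h2].
    by have [] := hL u (inI _ (introT andP (conj h1 h2))).
  + by apply: cvg_at_right_filter; apply: cL; rewrite lexx.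
  + by apply: cvg_at_left_filter; apply: cL; rewrite lexx st'.
- move=> u; rewrite in_itv/= => /andP[/ltW h1 /ltW h2].
  by rewrite derive1E; have [_ ->] := hL u (inI _ (introT andP (conj h1 h2))).
Qed.

Lemma curve_length_ge0 c (s t : R) : (0 <= curve_length g c s t)%E.
Proof. by apply: integral_ge0 => u _; rewrite lee_fin sqrtr_ge0. Qed.

Lemma joined_ge0 x y l : joined g x y l -> (0 <= l)%E.
Proof. by elim=> // c s t I z l' _ _ _ _ _ l0; rewrite adde_ge0// curve_length_ge0. Qed.

Lemma joined_trans x y z l l' : joined g x y l -> joined g y z l' -> joined g x z (l + l')%E.
Proof.
move=> J; elim: J z l' => {x y l} [x z l'|c s t I y l st oI sI Cc _ IH z l' J].
  by rewrite add0e.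
by rewrite -addeA; apply: joined_cons; eauto.
Qed.

Lemma joined_curve c I (s t : R) : open I -> Ck_curve g 1 I c -> s <= t -> `[s, t] `<=` I ->
  joined g (c s) (c t) (curve_length g c s t).
Proof.
move=> oI Cc st sI; rewrite -[curve_length _ _ _ _]adde0.
by apply: (joined_cons st oI sI Cc); exact: joined_refl.
Qed.

Lemma reverse_curve c I : open I -> Ck_curve g 1 I c ->
  open [set s | I (-1 * s)] /\ Ck_curve g 1 [set s | I (-1 * s)] (fun s => c (-1 * s)).
Proof.
move=> oI [cc Cc]; have oI' : open [set s : R | I (-1 * s)] by exact: open_scale.
split; first exact: oI'.
split=> [t It|a aA].
  apply: (@continuous_comp _ _ _ (fun s : R => -1 * s) c t); last exact: cc.
  by apply: for_continuousM; [exact: cst_continuous|exact: cvg_id].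
have H := Ck_scale 1 (-1) (curve_dom_open oI cc) (Cc a aA).
have E : (fun s : R => 1 *: (cmap a \o c) (-1 * s)) = cmap a \o (fun s : R => c (-1 * s)).
  by apply/funext => s; rewrite scale1r.
by rewrite E in H.
Qed.

Lemma speed_reverse c I (t : R) : open I -> Ck_curve g 1 I c -> I (-1 * t) ->
  speed (fun s => c (-1 * s)) t = speed c (-1 * t).
Proof.
move=> oI Cc It; have [oI' Cc'] := reverse_curve oI Cc.
have [aA ac] := chart_atP g (c (-1 * t)).
rewrite (speed_chart aA oI Cc It ac) (speed_chart aA oI' Cc' It ac).
have [dX _] := Ck_curve_reg aA oI Cc It ac.
have [_] := is_derive_scale 1 1 dX.
set f := (fun s0 => _); have -> : f = cmap (chart_at g (c (-1 * t))) \o (fun s => c (-1 * s)).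
  by apply/funext => s; rewrite /f scale1r.
by move=> ->; rewrite mul1r scaleN1r bilNl bilNr opprK.
Qed.

(** Every piece is run backwards through t |-> -t, with the matching substitution in the length
    integral. *)
Lemma joined_sym x y l : joined g x y l -> joined g y x l.
Proof.
elim=> {x y l} [x|c s t I z l st oI sI Cc J IH]; first exact: joined_refl.
rewrite addeC; apply: (joined_trans IH).
have [oI' Cc'] := reverse_curve oI Cc.
have -> : curve_length g c s t = curve_length g (fun s => c (-1 * s)) (- t) (- s).
  have /= := @integration_by_substitution_oppr R (speed c) (- t) (- s).
  rewrite lerN2 !opprK => /(_ st) E.
  rewrite (_ : curve_length g c s t = (\int[lebesgue_measure]_(x in `[s, t]) (speed c x)%:E)%E); last by reflexivity.
  rewrite {}E.
    rewrite /curve_length; apply: eq_integral => u; rewrite inE/= in_itv/= => /andP[u1 u2].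
    rewrite -!/(speed _ _) (speed_reverse oI Cc) ?mulN1r//.
    by apply: sI; rewrite /= in_itv/=; apply/andP; split; lra.
  by apply: continuous_in_subspaceT => u; rewrite inE/= => /sI Iu; exact: (speed_continuous oI Cc).
have K (u : R) : c u = (fun s => c (-1 * s)) (- u) by rewrite /= mulN1r opprK.
rewrite (K s) (K t); apply: (joined_curve oI' Cc'); first by rewrite lerN2.
by move=> u; rewrite /= in_itv/= => /andP[u1 u2]; apply: sI; rewrite /= in_itv/=; apply/andP; split; lra.
Qed.

(** The piece in which the accumulated length reaches [b] is cut by the intermediate value theorem.
    The [maxe 0] covers paths shorter than [b]. *)
Lemma joined_split x z l (b : R) : joined g x z l -> (0 <= b)%R ->
  exists y l1 l2, [/\ joined g x y l1, joined g y z l2, (l1 <= b%:E)%E & (l2 <= maxe 0 (l - b%:E))%E].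
Proof.
move=> J; elim: J b => {x z l} [x b b0|c s t I z l st oI sI Cc J IH b b0].
  exists x, 0%E, 0%E; split; [exact: joined_refl|exact: joined_refl|by rewrite lee_fin|].
  by rewrite le_max lexx.
have [L [dL lE]] := length_primitive oI Cc st sI.
have cL : {within `[s, t], continuous L}.
  by apply: continuous_in_subspaceT => u; rewrite inE/= in_itv/= => hu; exact: is_derive_continuous (dL _ hu).
have L0 : 0 <= L t - L s by rewrite -lee_fin -lE// curve_length_ge0.
have l0 := joined_ge0 J.
have [Lb|bL] := leP (L t - L s) b.
  have [|y [l1 [l2 [J1 J2 h1 h2]]]] := IH (b - (L t - L s)); first by rewrite subr_ge0.
  exists y, (curve_length g c s t + l1)%E, l2; split => //.
  - by apply: (joined_cons st oI sI Cc).
  - rewrite lE//; have := leeD2l (L t - L s)%:E h1; rewrite -EFinD.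
    by have -> : L t - L s + (b - (L t - L s)) = b by ring.
  - rewrite lE// (le_trans h2)//.
    have -> // : (l - (b - (L t - L s))%:E = (L t - L s)%:E + l - b%:E)%E.
    by move: (l) => [l'| |] //; rewrite -!(EFinB, EFinD); congr _%:E; ring.
have [|u uI /eqP] := @IVT R L s t (L s + b) st cL.
  have h : L s + b <= L t by lra.
  by rewrite ge_min le_max lerDl b0 h orbT.
rewrite in_itv/= in uI; move: (uI) => /andP[su ut].
rewrite eq_sym -subr_eq0 => /eqP Lu.
exists (c u), b%:E, (curve_length g c u t + l)%E.
have I1 : `[s, u] `<=` I by move=> v; rewrite /= in_itv/= => /andP[h1 h2]; apply: sI; rewrite /= in_itv/= h1 (le_trans h2).
have I2 : `[u, t] `<=` I by move=> v; rewrite /= in_itv/= => /andP[h1 h2]; apply: sI; rewrite /= in_itv/= h2 (le_trans su).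
split => //.
- have -> : b%:E = curve_length g c s u by rewrite lE//; congr _%:E; lra.
  exact: (joined_curve oI Cc).
- exact: (joined_cons ut oI I2 Cc).
- rewrite le_max; apply/orP; right; rewrite !lE// addeAC -EFinB leeD2r// lee_fin.
  by lra.
Qed.

Lemma gdist_le x y l : joined g x y l -> (gdist g x y <= l)%E.
Proof. by move=> J; apply: ereal_inf_lbound. Qed.

Lemma gdist_joined x y (b : \bar R) : (gdist g x y < b)%E -> exists2 l, joined g x y l & (l < b)%E.
Proof. by move=> /ereal_inf_lt[l J lb]; exists l. Qed.

Lemma gdist_ge0 x y : (0 <= gdist g x y)%E.
Proof. by apply: le_ereal_inf_tmp => l /= J; exact: joined_ge0 J. Qed.

Lemma gdist_triangle x y z : (gdist g x z <= gdist g x y + gdist g y z)%E.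
Proof.
have [->|fy] := eqVneq (gdist g x y) +oo%E; first by rewrite addye ?leey// gt_eqF// (lt_le_trans _ (gdist_ge0 _ _)).
have [->|fz] := eqVneq (gdist g y z) +oo%E; first by rewrite addey ?leey// gt_eqF// (lt_le_trans _ (gdist_ge0 _ _)).
have f1 : gdist g x y \is a fin_num by rewrite ge0_fin_numE ?gdist_ge0// ltey.
have f2 : gdist g y z \is a fin_num by rewrite ge0_fin_numE ?gdist_ge0// ltey.
apply/lee_addgt0Pr => e e0.
have [|l1 J1 h1] := @gdist_joined x y (gdist g x y + (e / 2)%:E); first by rewrite lteDl// lte_fin divr_gt0.
have [|l2 J2 h2] := @gdist_joined y z (gdist g y z + (e / 2)%:E); first by rewrite lteDl// lte_fin divr_gt0.
apply: (le_trans (gdist_le (joined_trans J1 J2))).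
have -> : (gdist g x y + gdist g y z + e%:E = (gdist g x y + (e / 2)%:E) + (gdist g y z + (e / 2)%:E))%E.
  by rewrite addeACA -EFinD -splitr.
by apply: leeD; exact: ltW.
Qed.

End Length.

Lemma nondecreasing_cc (R : realType) (f df : R -> R) (s t : R) : s <= t ->
  (forall u : R, s <= u <= t -> is_derive u 1 f (df u)) ->
  (forall u : R, s <= u <= t -> 0 <= df u) -> f s <= f t.
Proof.
move=> st hf h0; have [||u uI E] := @MVT_segment R f df s t st.
- by move=> u; rewrite in_itv/= => /andP[/ltW h1 /ltW h2]; apply: hf; rewrite h1.
- apply: continuous_in_subspaceT => u; rewrite inE/= in_itv/= => hu.
  exact: is_derive_continuous (hf _ hu).
rewrite -subr_ge0 E mulr_ge0 ?subr_ge0// h0//; by rewrite in_itv in uI.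
Qed.

Lemma derive_le_dist (R : realType) (f df L dL : R -> R) (s t : R) : s <= t ->
  (forall u : R, s <= u <= t -> is_derive u 1 f (df u)) ->
  (forall u : R, s <= u <= t -> is_derive u 1 L (dL u)) ->
  (forall u : R, s <= u <= t -> `|df u| <= dL u) -> `|f t - f s| <= L t - L s.
Proof.
move=> st hf hL hle; rewrite ler_norml; apply/andP; split.
  have : L s + f s <= L t + f t.
    apply: (@nondecreasing_cc _ (L + f) (fun u => dL u + df u)) => // u hu.
      exact: (@is_deriveD _ _ _ _ _ u 1 _ _ (hL _ hu) (hf _ hu)).
    by have := hle _ hu; rewrite ler_norml => /andP[h _]; lra.
  by lra.
have : L s - f s <= L t - f t.
  apply: (@nondecreasing_cc _ (L - f) (fun u => dL u - df u)) => // u hu.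
    exact: (@is_deriveB _ _ _ _ _ u 1 _ _ (hL _ hu) (hf _ hu)).
  by have := hle _ hu; rewrite ler_norml => /andP[_ h]; lra.
by lra.
Qed.

(** * Curves and distances inside a normal ball *)

Section NormalBall.
Variables (R : realType) (d : nat) (M : ptopologicalType).
Variable g : riemannianManifold R d M.
Variables (p : M) (r : R) (a : chart R d M).
Hypotheses (r0 : 0 < r) (na : normal_chart g p r a).
Implicit Types (x y z : M) (c : R -> M) (I : set R).

Let aA := normal_atlas na.
Let oU := @open_chart_imgE R d M a.
Let G := metric g a.
Let Q := Q0 g p.
Let QT : Q^T = Q := Q0T g p.

Definition nrho x : R := bil Q (cmap a x) (cmap a x).

Lemma nrho_ge0 x : 0 <= nrho x. Proof. exact: Q0_ge0. Qed.

Definition nball (b : R) : set M := [set x | chart_dom a x /\ nrho x <= b].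

Lemma Qsqr_continuous : continuous (fun v : 'rV[R]_d => bil Q v v).
Proof.
move=> v.
have -> : (fun v : 'rV[R]_d => bil Q v v) = (fun v => \sum_i \sum_j v 0 i * Q i j * v 0 j).
  by apply/funext => w; rewrite bilE.
apply: (@cvg_bigsum _ _ _ (nbhs v)) => i; apply: (@cvg_bigsum _ _ _ (nbhs v)) => j.
have ci k : {for v, continuous (fun s : 'rV[R]_d => s 0 k)} by exact: coord_continuous.
exact: (for_continuousM (for_continuousM (ci i) (@cst_continuous _ _ (Q i j) v)) (ci j)).
Qed.

Lemma Qball_compact (b : R) : compact [set v : 'rV[R]_d | bil Q v v <= b].
Proof.
apply: bounded_closed_compact.
  have [k kp hk] := posdef_norm QT (Q0_pos g p).
  exists (Num.sqrt (k * `|b|)); split; first exact: num_real.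
  move=> B hB v /= vb; rewrite (le_trans _ (ltW hB))//.
  rewrite -[`|v|]normr_id -sqrtr_sqr ler_sqrt; last by rewrite mulr_ge0// ltW.
  by rewrite (le_trans (hk v v).1)// ler_wpM2l ?(ltW kp)// (le_trans vb)// ler_norm.
have -> : [set v : 'rV[R]_d | bil Q v v <= b] = (fun v => bil Q v v) @^-1` [set x | x <= b] by [].
by apply: closed_comp; [move=> v _; exact: Qsqr_continuous|exact: closed_le].
Qed.

Lemma nballE (b : R) : b < r ^+ 2 -> nball b = cinv a @` [set v | bil Q v v <= b].
Proof.
move=> br; apply/seteqP; split=> [x [dx xb]|_ [v vb <-]].
  by exists (cmap a x) => //; rewrite cmapK.
have av : chart_img a v by apply/(normal_img na); exact: le_lt_trans vb br.
have [h1 h2] := cinvK av; split=> //.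
by rewrite /nrho h1.
Qed.

Lemma nball_compact (b : R) : b < r ^+ 2 -> compact (nball b).
Proof.
move=> br; rewrite nballE//; apply: continuous_compact; last exact: Qball_compact.
apply: continuous_in_subspaceT => v; rewrite inE/= => vb.
by apply: cinv_continuous; apply/(normal_img na); exact: le_lt_trans vb br.
Qed.

Lemma nball_closed (b : R) : b < r ^+ 2 -> closed (nball b).
Proof. by move=> /nball_compact; apply: compact_closed; exact: hausdorffM g. Qed.

Section Curve.
Variables (c : R -> M) (I : set R) (s t : R) (L : R -> R) (w : R).
Hypotheses (oI : open I) (Cc : Ck_curve g 1 I c) (sI : `[s, t] `<=` I) (w0 : 0 < w).
Hypothesis dL : forall u : R, s <= u <= t -> is_derive u 1 L (speed g c u).
Let X := cmap a \o c.

(** By the Gauss lemma and Cauchy-Schwarz for the metric, the radius changes no faster than arc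
    length. The shift [w] keeps the square root differentiable at the centre. *)
Lemma curve_radial u : s <= u <= t -> (forall v : R, s <= v <= u -> chart_dom a (c v)) ->
  `|Num.sqrt (nrho (c u) + w) - Num.sqrt (nrho (c s) + w)| <= L u - L s.
Proof.
move=> /andP[su ut] hd.
have inI v : s <= v <= u -> s <= v <= t by move=> /andP[h1 h2]; rewrite h1 (le_trans h2).
have Iv v : s <= v <= u -> I v by move=> /inI h; apply: sI; rewrite /= in_itv.
have dX v : s <= v <= u -> is_derive v 1 X ('D_1 X v).
  by move=> hv; apply: derivableP; have [] := Ck_curve_reg aA oI Cc (Iv _ hv) (hd _ hv).
have rp v : 0 < nrho (c v) + w by rewrite ltr_wpDl// nrho_ge0.
apply: (derive_le_dist su (df := fun v => 2 * bil Q (X v) ('D_1 X v) * (2 * Num.sqrt (nrho (c v) + w))^-1)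
   (f := fun v => Num.sqrt (nrho (c v) + w)) (dL := speed g c)) => [v hv|v hv|v hv].
- have H := @is_deriveD _ _ _ _ _ v 1 _ _ (is_derive_Qsqr g p (dX v hv)) (is_derive_cst w v 1).
  have K := @is_derive_comp_R R _ _ _ _ v 1 _ (is_derive1_sqrt (rp v)) H.
  by apply: (is_derive_eq K); rewrite addr0.
- by apply: dL; exact: inI.
have ax : chart_img a (X v) by apply: curve_img; exact: hd.
rewrite (speed_chart aA oI Cc (Iv _ hv) (hd _ hv)) -/X -/G.
have sp : 0 < Num.sqrt (nrho (c v) + w) by rewrite sqrtr_gt0.
rewrite invfM mulrACA divff// mul1r normrM normfV (gtr0_norm sp) ler_pdivrMr//.
have G0 : 0 <= bil (G (X v)) ('D_1 X v) ('D_1 X v).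
  by have [->|/(metric_pos aA ax)/ltW//] := eqVneq ('D_1 X v) 0; rewrite bil0l.
rewrite -sqrtrM// -sqrtr_sqr ler_sqrt; last by rewrite mulr_ge0// ltW.
rewrite -/Q -(gauss_lemma r0 na _ ax) -/G.
rewrite (le_trans (bil_CS _ _ (metricT aA ax) (fun u => metric_pos aA ax)))//.
rewrite -/G (metric_radial_norm r0 na ax) mulrC ler_wpM2l// -/Q.
by rewrite lerDl ltW.
Qed.

(** A curve too short to reach radius [R2] cannot leave the chart: before a first exit time it stays
    in a closed ball of the chart, which is compact and therefore closed in [M], so the exit point
    would belong to it too. *)
Lemma curve_escape (R2 : R) : 0 < R2 -> R2 < r -> s <= t -> chart_dom a (c s) ->
  Num.sqrt (nrho (c s) + w) + (L t - L s) <= R2 ->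
  forall u, s <= u <= t -> chart_dom a (c u).
Proof.
move=> R20 R2r st ds hb; have cI u : s <= u <= t -> {for u, continuous c}.
  by move=> hu; apply: Cc.1; apply: sI; rewrite /= in_itv.
apply: real_induction => // [u su ut h|u su ut h].
  have uin : s <= u <= t by rewrite su ltW.
  have N : \forall v \near u, chart_dom a (c v).
    by apply: (cI _ uin); apply: open_near (open_chart_dom a) _; apply: h; rewrite su lexx.
  move/nbhs_ballP : N => [e /= ep he]; exists e => // v /andP[h1 h2] _.
  by apply: he; rewrite /ball/= distrC ger0_norm; lra.
have Lmono v : s <= v <= t -> L v <= L t.
  move=> /andP[sv vt]; apply: (nondecreasing_cc vt (df := speed g c)) => x /andP[h1 h2].
    by apply: dL; rewrite h2 (le_trans sv).
  exact: speed_ge0.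
have inb v : s <= v < u -> nball (R2 ^+ 2) (c v).
  move=> /andP[sv vu]; split; first by apply: h; rewrite sv.
  have vt : v <= t by exact: ltW (lt_le_trans vu ut).
  have vin : s <= v <= t by rewrite sv.
  have K : `|Num.sqrt (nrho (c v) + w) - Num.sqrt (nrho (c s) + w)| <= L v - L s.
    by apply: curve_radial => // x /andP[h1 h2]; apply: h; rewrite h1 (le_lt_trans h2).
  have K2 : Num.sqrt (nrho (c v) + w) <= R2.
    by have := Lmono _ vin; have := ler_normlW K; lra.
  have : nrho (c v) + w <= R2 ^+ 2.
    rewrite -(@sqr_sqrtr _ (nrho (c v) + w)); last by rewrite addr_ge0 ?nrho_ge0// ltW.
    by rewrite ler_pXn2r// nnegrE ?sqrtr_ge0// ltW.
  by move=> hh; rewrite (le_trans _ hh)// lerDl ltW.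
have R2r2 : R2 ^+ 2 < r ^+ 2 by rewrite ltr_pXn2r// nnegrE ltW.
suff [] : nball (R2 ^+ 2) (c u) by [].
apply: contrapT => nb.
have uin : s <= u <= t by rewrite (ltW su).
have N : \forall v \near u, (~` nball (R2 ^+ 2)) (c v).
  by apply: (cI _ uin); apply: open_near nb; apply: closed_openC; exact: nball_closed.
move/nbhs_ballP : N => [e /= ep he].
pose v := Num.max s (u - e / 2).
have vu : v < u by rewrite gt_max su/=; lra.
have sv : s <= v by rewrite le_max lexx.
have uv : u - e / 2 <= v by rewrite le_max lexx orbT.
by apply: (he v); [rewrite /ball/= ger0_norm; lra|apply: inb; rewrite sv].
Qed.

End Curve.

Variables (R1 Lm : R).
Hypotheses (R1p : 0 < R1) (R1r : R1 < r) (Lmp : 0 < Lm).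
Hypothesis hLm : forall v V : 'rV[R]_d, bil Q v v <= R1 ^+ 2 ->
  `|V| ^+ 2 <= Lm * bil (G v) V V /\ bil (G v) V V <= Lm * `|V| ^+ 2.

Lemma curve_coord c I s t L i : open I -> Ck_curve g 1 I c -> s <= t -> `[s, t] `<=` I ->
  (forall u : R, s <= u <= t -> is_derive u 1 L (speed g c u)) ->
  (forall u, s <= u <= t -> nball (R1 ^+ 2) (c u)) ->
  `|cmap a (c t) 0 i - cmap a (c s) 0 i| <= Num.sqrt Lm * (L t - L s).
Proof.
move=> oI Cc st sI dL hb; pose X := cmap a \o c.
have Iv v : s <= v <= t -> I v by move=> h; apply: sI; rewrite /= in_itv.
rewrite mulrBr; apply: (derive_le_dist st (f := fun v => X v 0 i) (df := fun v => 'D_1 X v 0 i)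
  (L := fun v => Num.sqrt Lm * L v) (dL := fun v => Num.sqrt Lm * speed g c v)) => v hv.
- apply: is_derive_coord; apply: derivableP.
  by have [] := Ck_curve_reg aA oI Cc (Iv _ hv) (hb _ hv).1.
- exact: (@is_deriveZ _ _ _ L (Num.sqrt Lm) v 1 _ (dL _ hv)).
have [dv rv] := hb _ hv; rewrite (le_trans (rV_coord_le _ _))//.
rewrite (speed_chart aA oI Cc (Iv _ hv) dv) -/X -/G -sqrtrM ?(ltW Lmp)//.
rewrite -[`|_|]normr_id -sqrtr_sqr ler_sqrt; first exact: (hLm _ rv).1.
by rewrite (le_trans _ (hLm ('D_1 X v) rv).1)// sqr_ge0.
Qed.

Lemma joined_nball_w x z l (b w : R) : 0 < w -> joined g x z l -> (l <= b%:E)%E ->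
  chart_dom a x -> Num.sqrt (nrho x + w) + b <= R1 ->
  [/\ chart_dom a z, Num.sqrt (nrho z + w) <= Num.sqrt (nrho x + w) + b &
      forall i, `|cmap a z 0 i - cmap a x 0 i| <= Num.sqrt Lm * b].
Proof.
move=> w0 J; elim: J b => {x z l} [x b|c s t I z l st oI sI Cc J IH b].
  rewrite lee_fin => b0 dx _; split=> //; first by rewrite lerDl.
  by move=> i; rewrite subrr normr0 mulr_ge0 ?sqrtr_ge0.
have [L [dL lE]] := length_primitive oI Cc st sI.
rewrite lE// => lb ds hb; have l0 := joined_ge0 J.
have Ls : 0 <= L t - L s by rewrite -lee_fin -lE// curve_length_ge0.
have l1 : (l <= (b - (L t - L s))%:E)%E by rewrite EFinB leeBrDl.
have b0 : 0 <= b - (L t - L s) by rewrite -lee_fin (le_trans l0).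
have hb' : Num.sqrt (nrho (c s) + w) + (L t - L s) <= R1 by lra.
have E := curve_escape oI Cc sI w0 dL R1p R1r st ds hb'.
have K u : s <= u <= t -> `|Num.sqrt (nrho (c u) + w) - Num.sqrt (nrho (c s) + w)| <= L u - L s.
  move=> hu; apply: (curve_radial oI Cc sI w0 dL hu) => v /andP[h1 h2].
  by apply: E; rewrite h1 (le_trans h2)//; case/andP: hu.
have tin : s <= t <= t by rewrite st lexx.
have Kt := ler_normlW (K _ tin).
have [||dz h1 h2] := IH _ l1; first exact: E.
  by lra.
split=> //; first by lra.
move=> i; have nb u : s <= u <= t -> nball (R1 ^+ 2) (c u).
  move=> hu; split; first exact: E.
  have Lu : L u <= L t.
    have /andP[su ut] := hu.
    apply: (nondecreasing_cc ut (df := speed g c)) => x /andP[k1 k2].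
      by apply: dL; rewrite k2 (le_trans su).
    exact: speed_ge0.
  have Ku := ler_normlW (K _ hu).
  have : Num.sqrt (nrho (c u) + w) <= R1 by lra.
  rewrite -(ler_pXn2r (n := 2))// ?nnegrE ?sqrtr_ge0 ?(ltW R1p)//.
  by rewrite sqr_sqrtr ?addr_ge0 ?nrho_ge0 ?(ltW w0)//; lra.
have C := curve_coord i oI Cc st sI dL nb.
have -> : cmap a z 0 i - cmap a (c s) 0 i = (cmap a z 0 i - cmap a (c t) 0 i) + (cmap a (c t) 0 i - cmap a (c s) 0 i) by ring.
rewrite (le_trans (ler_normD _ _))//; have := h2 i; lra.
Qed.

Lemma sqrtr_addr_le (x y : R) : 0 <= x -> 0 <= y -> Num.sqrt (x + y) <= Num.sqrt x + Num.sqrt y.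
Proof.
move=> x0 y0; rewrite -[leRHS]ger0_norm ?addr_ge0 ?sqrtr_ge0// -sqrtr_sqr ler_sqrt ?sqr_ge0//.
rewrite sqrrD !sqr_sqrtr// addrAC lerDl mulrn_wge0// mulr_ge0 ?sqrtr_ge0//.
Qed.

(** The regularising shift is taken as [e ^+ 2] with [e] arbitrarily small, so it disappears from
    the conclusion; the strict inequality leaves room for it. *)
Lemma joined_nball x z l (b : R) : joined g x z l -> (l <= b%:E)%E ->
  chart_dom a x -> Num.sqrt (nrho x) + b < R1 ->
  [/\ chart_dom a z, Num.sqrt (nrho z) <= Num.sqrt (nrho x) + b &
      `|cmap a z - cmap a x| <= Num.sqrt Lm * b].
Proof.
move=> J lb dx hb; have b0 : 0 <= b by rewrite -lee_fin (le_trans (joined_ge0 J)).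
have W e : 0 < e -> e <= R1 - (Num.sqrt (nrho x) + b) ->
  [/\ chart_dom a z, Num.sqrt (nrho z) <= Num.sqrt (nrho x) + b + e &
      forall i, `|cmap a z 0 i - cmap a x 0 i| <= Num.sqrt Lm * b].
  move=> ep he; have w0 : 0 < e ^+ 2 by rewrite exprn_gt0.
  have h1 : Num.sqrt (nrho x + e ^+ 2) <= Num.sqrt (nrho x) + e.
    by rewrite (le_trans (sqrtr_addr_le (nrho_ge0 x) (ltW w0)))// sqrtr_sqr ger0_norm ?(ltW ep).
  have [|dz h2 h3] := joined_nball_w w0 J lb dx; first by lra.
  split=> //; have : Num.sqrt (nrho z) <= Num.sqrt (nrho z + e ^+ 2).
    by rewrite ler_sqrt ?lerDl ?(ltW w0)// addr_ge0 ?nrho_ge0// ltW.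
  by lra.
have [||dz _ h] := W (R1 - (Num.sqrt (nrho x) + b)) => //; first by lra.
split=> //.
  apply/ler_addgt0Pr => e ep.
  have [||_ k _] := W (Num.min e (R1 - (Num.sqrt (nrho x) + b))).
  - by rewrite lt_min ep/=; lra.
  - by rewrite ge_min lexx orbT.
  by rewrite (le_trans k)// lerD2l ge_min lexx.
by apply: rV_norm_le => [|i]; rewrite ?mulr_ge0 ?sqrtr_ge0// !mxE.
Qed.

Lemma line_curve (v v' : 'rV[R]_d) (I := [set t : R | chart_img a (v + t *: (v' - v))])
    (c := fun t : R => cinv a (v + t *: (v' - v))) : open I /\ Ck_curve g 1 I c.
Proof.
have dl t := is_derive_line v (v' - v) t.
have cl t : {for t, continuous (fun t : R => v + t *: (v' - v))} := is_derive_continuous (dl t).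
have oI : open I.
  by rewrite openE => t It; apply: (cl t); exact: open_near oU It.
have cc t : I t -> {for t, continuous c}.
  by move=> It; exact: (continuous_comp (cl t) (cinv_continuous It)).
split; first exact: oI.
split=> [t It|b bA]; first exact: cc.
have [S _] := atlas_compatible aA bA.
pose T := transition a b; pose U := cmap a @` (chart_dom a `&` chart_dom b).
have oT : open U by exact: transition_open.
have inU t : I t -> chart_dom b (c t) -> U (v + t *: (v' - v)).
  move=> It bt; have [h1 h2] := cinvK It; exists (c t) => //.
have dT t : I t -> chart_dom b (c t) -> differentiable T (v + t *: (v' - v)).
  by move=> It bt; exact: (smooth_differentiable oT S (inU _ It bt)).
have D t : I t -> chart_dom b (c t) ->
    is_derive t 1 (cmap b \o c) ('D_(v' - v) T (v + t *: (v' - v))).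
  by move=> It bt; exact: (is_derive_comp_curve (dl t) (dT _ It bt)).
have oA : open (I `&` c @^-1` chart_dom b) := curve_dom_open oI cc.
split=> [t [It bt]|k]; first exact: is_derive_continuous (D _ It bt).
split=> [t [It bt]|].
  by have [h1 _] := D _ It bt; have [] := derivable_dir1 k h1.
split=> // t [It bt].
apply: (@continuous_near_eq R _ (fun t : R => k *: 'D_(v' - v) T (v + t *: (v' - v)))).
  apply: filterS (open_near oA (conj It bt)) => u [Iu bu].
  by have [h1 h2] := D _ Iu bu; have [_ ->] := derivable_dir1 k h1; rewrite h2.
have cD : {for (v + t *: (v' - v)), continuous ('D_(v' - v) T)}.
  by apply: (smooth_continuous (smooth_derive (v' - v) S)); exact: inU.
by apply: cvgZr; exact: (continuous_comp (cl t) cD).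
Qed.

(** The straight coordinate segment is a competitor: it stays in the ball by convexity of [Q], and
    its speed is at most [Num.sqrt Lm] times its coordinate length. *)
Lemma gdist_nball x y : nball (R1 ^+ 2) x -> nball (R1 ^+ 2) y ->
  (gdist g x y <= (Num.sqrt Lm * `|cmap a y - cmap a x|)%:E)%E.
Proof.
move=> [dx xb] [dy yb]; set v := cmap a x; set v' := cmap a y.
have [oI Cc] := line_curve v v'; set I := [set t : R | _] in oI Cc; set c := (fun t : R => _) in Cc.
have R12 : R1 ^+ 2 < r ^+ 2 by rewrite ltr_pXn2r// nnegrE ltW.
have nb t : 0 <= t <= 1 -> bil Q (v + t *: (v' - v)) (v + t *: (v' - v)) <= R1 ^+ 2.
  by move=> t01; exact: Q_convex.
have It t : 0 <= t <= 1 -> I t by move=> t01; apply/(normal_img na); exact: le_lt_trans (nb _ t01) R12.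
have sI : `[0, 1] `<=` I by move=> t; rewrite /= in_itv/=; exact: It.
have c0 : c 0 = x by rewrite /c scale0r addr0 /v cmapK.
have c1 : c 1 = y by rewrite /c scale1r addrC subrK /v' cmapK.
rewrite -c0 -c1 (le_trans (gdist_le (joined_curve oI Cc ler01 sI)))//.
have [L [dL ->]] := length_primitive oI Cc ler01 sI => //.
have [t t01 ->] := mvt01 dL; rewrite lee_fin.
have dt : chart_dom a (c t) by have [] := cinvK (It _ t01).
rewrite (speed_chart aA oI Cc (It _ t01) dt).
have -> : 'D_1 (cmap a \o c) t = v' - v.
  have N : \forall u \near t, v + u *: (v' - v) = (cmap a \o c) u.
    by apply: filterS (open_near oI (It _ t01)) => u Iu; rewrite /= /c; have [-> _] := cinvK Iu.
  by have [_ ->] := near_eq_is_derive N (is_derive_line v (v' - v) t).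
have -> : cmap a (c t) = v + t *: (v' - v) by rewrite /c; have [-> _] := cinvK (It _ t01).
rewrite -[X in _ <= _ * X]normr_id -sqrtr_sqr -sqrtrM ?(ltW Lmp)// ler_sqrt; last by rewrite mulr_ge0 ?sqr_ge0// ltW.
exact: (hLm _ (nb _ t01)).2.
Qed.

End NormalBall.

(** * Compact neighbourhoods, finite covers and closedness of tubes *)

Section Cover.
Variables (R : realType) (d : nat) (M : ptopologicalType).
Variable g : riemannianManifold R d M.
Hypothesis hd2 : (1 < d)%N.
Variable kappa : R.
Hypothesis hK : forall a y (u v : 'rV[R]_d), atlas g a -> chart_img a y ->
  row_free (col_mx u v) -> sectional_curvature g a y u v = kappa.
Variables (R1 : R) (nc : M -> chart R d M) (nr : M -> R).
Hypotheses (R1p : 0 < R1) (hnr : forall p, R1 < nr p / 2).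
Hypothesis hnc : forall p, normal_chart g p (nr p) (nc p).
Implicit Types (x y z p : M) (K : set M).

Let nr0 p : 0 < nr p.
Proof. by have := hnr p; have := R1p; lra. Qed.

Let R1nr p : R1 < nr p.
Proof. by have := hnr p; have := R1p; lra. Qed.

Let hKp p : forall (y u v : 'rV[R]_d), chart_img (nc p) y -> row_free (col_mx u v) ->
  sectional_curvature g (nc p) y u v = kappa.
Proof. by move=> y u v; apply: hK; exact: normal_atlas (hnc p). Qed.

Definition rho p x : R := nrho g p (nc p) x.
Definition ball_at p (b : R) : set M := nball g p (nc p) (b ^+ 2).

Lemma rho_center p : chart_dom (nc p) p /\ rho p p = 0.
Proof.
have [h1 h2] := normal_dom_center (nr0 p) (hnc p); split=> //.
by rewrite /rho /nrho h2 bil0l.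
Qed.

Lemma open_ball_at p (b : R) : open [set x | chart_dom (nc p) x /\ rho p x < b].
Proof.
rewrite openE => x [dx xb]; apply: filterI; first exact: open_near (open_chart_dom _) dx.
have cr : {for x, continuous (rho p)}.
  have cq : {for cmap (nc p) x, continuous (fun v : 'rV[R]_d => bil (Q0 g p) v v)} := @Qsqr_continuous _ _ _ g p _.
  exact: (continuous_comp (cmap_continuous dx) cq).
have xb' : [set z | z < b] (rho p x) by [].
exact: cr (open_near (@open_lt _ b) xb').
Qed.

Lemma joined_ball p x z l (b : R) : joined g x z l -> (l <= b%:E)%E ->
  chart_dom (nc p) x -> Num.sqrt (rho p x) + b < R1 ->
  chart_dom (nc p) z /\ Num.sqrt (rho p z) <= Num.sqrt (rho p x) + b.
Proof.
move=> J lb dx hb; have [Lm Lmp hLm] := metric_norm (nr0 p) (hnc p) hd2 (@hKp p) R1p (hnr p).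
by have [] := joined_nball (nr0 p) (hnc p) R1p (R1nr p) Lmp hLm J lb dx hb.
Qed.

Lemma ball_at_cover K (b : R) : compact K -> 0 < b ->
  exists ps : seq M, forall x, K x -> exists2 p, p \in ps & chart_dom (nc p) x /\ rho p x < b.
Proof.
rewrite compact_cover => cK b0.
have [|x Kx|D _ hD] := cK M setT (fun p => [set x | chart_dom (nc p) x /\ rho p x < b]).
- by move=> p _; exact: open_ball_at.
- by exists x => //; have [h1 h2] := rho_center x; split=> //; rewrite h2.
by exists (finmap.enum_fset D) => x /hD [p /= pD h]; exists p.
Qed.

Lemma seq_compact (I : eqType) (s : seq I) (A : I -> set M) : (forall i, i \in s -> compact (A i)) ->
  compact [set x | exists2 i, i \in s & A i x].
Proof.
elim: s => [|i s IH] cA.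
  by have -> : [set x | exists2 i, i \in [::] & A i x] = set0; [apply/seteqP; split=> x // []|exact: compact0].
have -> : [set x | exists2 j, j \in i :: s & A j x] = A i `|` [set x | exists2 j, j \in s & A j x].
  apply/seteqP; split=> x.
    by case=> j; rewrite inE => /orP[/eqP-> ?|js ?]; [left|right; exists j].
  by case=> [?|[j js ?]]; [exists i; rewrite ?mem_head|exists j; rewrite // inE js orbT].
apply: compactU; first by apply: cA; rewrite mem_head.
by apply: IH => j js; apply: cA; rewrite inE js orbT.
Qed.

(** A path of length [b] is cut into steps of length R1 / 4. One step from a compact set stays in
    finitely many closed normal balls of radius [R1], a compact set again, because the radii of the
    normal balls exceed [R1] at every point. *)
Lemma compact_thicken K (b : R) : compact K -> exists2 K', compact K' &
  forall y x l, K y -> joined g y x l -> (l <= b%:E)%E -> K' x.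
Proof.
move=> cK; have [s s0 sE] : exists2 s, 0 < s & s = R1 / 4 by exists (R1 / 4); rewrite ?divr_gt0.
have step K1 : compact K1 -> exists2 K2, compact K2 &
    forall y x l, K1 y -> joined g y x l -> (l <= s%:E)%E -> K2 x.
  move=> cK1; have [|ps hps] := ball_at_cover (b := s ^+ 2) cK1; first by rewrite exprn_gt0.
  exists [set x | exists2 p, p \in ps & ball_at p R1 x].
    apply: seq_compact => p _; apply: (nball_compact (hnc p)).
    by rewrite ltr_pXn2r// ?nnegrE ?(ltW R1p) ?(ltW (nr0 p)).
  move=> y x l K1y J ls; have [p pps [dy ry]] := hps _ K1y.
  have sy : Num.sqrt (rho p y) <= s.
    by rewrite -[s]ger0_norm ?(ltW s0)// -sqrtr_sqr ler_sqrt ?sqr_ge0// ltW.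
  have [|dx rx] := joined_ball J ls dy; first by have := R1p; lra.
  exists p => //; split=> //; rewrite -/(rho p x) -(@sqr_sqrtr _ (rho p x)) ?nrho_ge0//.
  have rR : Num.sqrt (rho p x) <= R1 by have := R1p; lra.
  by rewrite ler_pXn2r// ?nnegrE ?sqrtr_ge0 ?(ltW R1p).
have [k hk] : exists k : nat, b <= s * k%:R.
  exists (Num.bound `|b / s|); have := archi_boundP (normr_ge0 (b / s)).
  by move=> /ltW h; rewrite mulrC -ler_pdivrMr//; exact: le_trans (ler_norm _) h.
have main n : exists2 K', compact K' & forall y x l, K y -> joined g y x l -> (l <= (s * n%:R)%:E)%E -> K' x.
  elim: n => [|n [K1 cK1 h1]].
    have [K2 cK2 h2] := step K cK; exists K2 => // y x l Ky J.
    rewrite mulr0 => l0; apply: (h2 y x l) => //; apply: (le_trans l0).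
    by rewrite lee_fin ltW.
  have [K2 cK2 h2] := step K1 cK1; exists K2 => // y x l Ky J hl.
  have sn0 : 0 <= s * n%:R by rewrite mulr_ge0// ltW.
  have [z [l1 [l2 [J1 J2 e1 e2]]]] := joined_split J sn0.
  apply: (h2 z x l2 (h1 y z l1 Ky J1 e1) J2); apply: (le_trans e2).
  rewrite ge_max; apply/andP; split; first by rewrite lee_fin ltW.
  rewrite leeBlDr//.
  by apply: (le_trans hl); rewrite -EFinD lee_fin -natr1; lra.
have [K' cK' h'] := main k; exists K' => // y x l Ky J lb.
by apply: (h' y x l Ky J); rewrite (le_trans lb)// lee_fin.
Qed.

Lemma finite_cover K (b eta : R) : compact K -> 0 < eta ->
  exists ps : seq M, forall y x l, K y -> joined g y x l -> (l <= b%:E)%E ->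
    exists2 p, p \in ps & chart_dom (nc p) x /\ rho p x < eta.
Proof.
move=> cK eta0; have [K' cK' h'] := compact_thicken b cK.
have [ps hps] := ball_at_cover cK' eta0; exists ps => y x l Ky J lb.
by apply: hps; exact: h' Ky J lb.
Qed.

(** The topology of [M] is at least as fine as that of the distance; this makes tubes closed, hence
    Borel. *)
Lemma gdist_near y (e : R) : 0 < e -> \forall y' \near y, (gdist g y y' < e%:E)%E.
Proof.
move=> e0; have [Lm Lmp hLm] := metric_norm (nr0 y) (hnc y) hd2 (@hKp y) R1p (hnr y).
have [dy ry] := rho_center y; have [_ cy] := normal_dom_center (nr0 y) (hnc y).
have R12 : 0 < R1 ^+ 2 by rewrite exprn_gt0.
have N1 : \forall y' \near y, chart_dom (nc y) y' /\ rho y y' < R1 ^+ 2.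
  by apply: (@open_near _ _ y (open_ball_at y _)); split=> //; rewrite ry.
pose e' := e / (Num.sqrt Lm + 1).
have sp : 0 < Num.sqrt Lm + 1 by rewrite ltr_wpDl// sqrtr_ge0.
have e'0 : 0 < e' by rewrite divr_gt0.
have N2 : \forall y' \near y, `|cmap (nc y) y' - cmap (nc y) y| < e'.
  have /cvgrPdist_lt/(_ e' e'0) := cmap_continuous dy.
  by apply: filterS => y'; rewrite distrC.
apply: (filterS _ (filterI N1 N2)) => y' [[dy' ry'] h].
have b1 : nball g y (nc y) (R1 ^+ 2) y by split=> //; rewrite -/(rho y y) ry ltW.
have b2 : nball g y (nc y) (R1 ^+ 2) y' by split=> //; exact: ltW.
have H := gdist_nball (nr0 y) (hnc y) R1p (R1nr y) Lmp hLm b1 b2.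
apply: (le_lt_trans H).
rewrite lte_fin; apply: (@le_lt_trans _ _ (Num.sqrt Lm * e')); first by rewrite ler_wpM2l ?sqrtr_ge0// ltW.
by rewrite /e' mulrCA gtr_pMr// ltr_pdivrMr// mul1r ltrDl.
Qed.

Lemma tube_closed (delta : R) (gam : set M) : closed (tube g delta gam).
Proof.
rewrite -openC openE => y /negP; rewrite -ltNge => hy.
have [e e0 he] : exists2 e : R, 0 < e & ((delta + e + e)%:E <= gdist_set g y gam)%E.
  case: (gdist_set g y gam) hy => [b| |] //.
    rewrite lte_fin => hb; exists ((b - delta) / 2); first by rewrite divr_gt0// subr_gt0.
    by rewrite lee_fin; lra.
  by move=> _; exists 1 => //; rewrite leey.
apply: filterS (gdist_near y e0) => y' hy' /= ty'; move: he; apply/negP; rewrite -ltNge.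
have : (gdist_set g y' gam < (delta + e)%:E)%E by apply: (le_lt_trans ty'); rewrite lte_fin ltrDl.
move=> /ereal_inf_lt[_ [z gz <-] hz].
apply: (@le_lt_trans _ _ (gdist g y z)); first by apply: ereal_inf_lbound; exists z.
apply: (le_lt_trans (gdist_triangle g y y' z)).
by rewrite addrC EFinD; apply: lteD.
Qed.

End Cover.

(** * Volume *)

(* Nonnegative integrals are suprema over simple functions, hence monotone without measurability. *)
Lemma le_integral_ge0 (dd : measure_display) (T : measurableType dd) (R : realType)
  (mu : {measure set T -> \bar R}) (D : set T) (f h : T -> \bar R) :
  (forall x, D x -> 0 <= f x)%E -> (forall x, D x -> f x <= h x)%E ->
  (\int[mu]_(x in D) f x <= \int[mu]_(x in D) h x)%E.
Proof.
move=> f0 fh; have h0 x : D x -> (0 <= h x)%E by move=> Dx; exact: le_trans (f0 _ Dx) (fh _ Dx).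
rewrite !ge0_integralE//; apply: le_ereal_sup => _ [k /= kf <-]; exists k => //= x.
rewrite (le_trans (kf x))// !patchE; case: ifP => //; rewrite inE; exact: fh.
Qed.

Lemma integral_rV_ge0 (R : realType) n (F : 'rV[R]_n -> \bar R) : (forall y, 0 <= F y)%E ->
  (0 <= integral_rV F)%E.
Proof.
elim: n F => [|n IH] F F0 /=; first exact: F0.
by apply: integral_ge0 => t _; apply: IH => y; exact: F0.
Qed.

Lemma integral_rV_le (R : realType) n (F G : 'rV[R]_n -> \bar R) : (forall y, 0 <= F y)%E ->
  (forall y, F y <= G y)%E -> (integral_rV F <= integral_rV G)%E.
Proof.
elim: n F G => [|n IH] F G F0 FG /=; first exact: FG.
apply: le_integral_ge0 => t _; first by apply: integral_rV_ge0 => y; exact: F0.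
by apply: IH => y; [exact: F0|exact: FG].
Qed.

Definition rbox (R : realType) n (c : 'rV[R]_n) (s : R) : set 'rV[R]_n :=
  [set y | forall i, `|c 0 i - y 0 i| < s].

(** The indicator of a box is a product over coordinates, so each integration contributes a factor
    [s *+ 2] and leaves a box of one dimension less. *)
Lemma integral_rV_box (R : realType) n (c : 'rV[R]_n) (s k : R) : 0 <= s -> 0 <= k ->
  integral_rV (fun y => (k * \1_(rbox c s) y)%:E) = (k * (s *+ 2) ^+ n)%:E.
Proof.
move=> s0; elim: n c k => [|n IH] c k k0 /=.
  by rewrite indicE mem_set ?mulr1// => -[].
transitivity (\int[lebesgue_measure]_(t in [set: R]) (k * (s *+ 2) ^+ n * \1_(ball (c 0 ord0) s) t)%:E)%E.
  apply: eq_integral => t _; rewrite mulrAC -(IH (rsubmx (c : 'rV[R]_(1 + n))) (k * \1_(ball (c 0 ord0) s) t)).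
    congr integral_rV; apply/funext => y; rewrite -mulrA; congr (k * _)%:E.
    have eL : (row_mx (const_mx t : 'rV[R]_1) y : 'rV[R]_(1 + n)) 0 ord0 = t.
      by have -> : ord0 = @lshift 1 n ord0 by [exact/val_inj]; rewrite row_mxEl mxE.
    have eR i : (row_mx (const_mx t : 'rV[R]_1) y : 'rV[R]_(1 + n)) 0 (rshift 1 i) = y 0 i by rewrite row_mxEr.
    have cR i : rsubmx (c : 'rV[R]_(1 + n)) 0 i = c 0 (rshift 1 i) by rewrite mxE.
    rewrite !indicE -natrM mulnb; congr (_%:R); congr nat_of_bool.
    apply/idP/andP; rewrite !inE.
      move=> h; split; first by have := h ord0; rewrite eL.
      by move=> i; have := h (rshift 1 i); rewrite eR cR.
    move=> [h1 h2] i; have [->|[j ->]] : i = ord0 \/ exists j, i = rshift 1 j.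
    - by case: (@split_ordP 1 n i) => j ->; [left; apply/val_inj; rewrite /= (ord1 j)|right; exists j].
    - by rewrite eL.
    - by rewrite eR -cR; exact: h2.
  by rewrite mulr_ge0// indicE.
under eq_integral do rewrite EFinM.
rewrite ge0_integralZl_EFin//; last 2 first.
- by apply/measurable_EFinP/measurable_indic; exact: measurable_ball.
- by rewrite mulr_ge0// exprn_ge0// mulrn_wge0.
rewrite integral_indic//; last exact: measurable_ball.
rewrite setIT; transitivity ((k * (s *+ 2) ^+ n)%:E * (s *+ 2)%:E)%E.
  by congr (_ * _)%E; exact: lebesgue_measure_ball.
by rewrite -EFinM exprSr mulrA.
Qed.

(** Along the segment from the identity to [A] all matrices are positive definite, so the
    determinant never vanishes and keeps the sign it has at the identity. *)
Lemma posdef_det_gt0 (R : realType) (d : nat) (A : 'M[R]_d) :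
  (forall u, u != 0 -> 0 < bil A u u) -> 0 < \det A.
Proof.
move=> Ap; pose B (t : R) : 'M[R]_d := (1 - t) *: 1%:M + t *: A.
have I1 (u : 'rV[R]_d) : u != 0 -> 0 < bil 1%:M u u.
  move=> un; have [i ui] : exists i, u 0 i != 0.
    apply/existsP; apply: contraNT un; rewrite negb_exists => /forallP h.
    by apply/eqP/rowP => i; rewrite mxE; have := h i; rewrite negbK => /eqP.
  rewrite bil_unlock mulmx1 mxE (bigD1 i)//= ltr_pwDl//.
    by rewrite mxE -expr2 exprn_even_gt0//= ui.
  by apply: sumr_ge0 => j _; rewrite mxE -expr2 sqr_ge0.
have Bu t : 0 <= t <= 1 -> \det (B t) != 0.
  move=> /andP[t0 t1]; have : B t \in unitmx.
    apply: posdef_unitmx => u un; rewrite /B bilDm !bilZm.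
    have := I1 u un; have := Ap u un => h1 h2.
    have [->|tn] := eqVneq t 0; first by rewrite subr0 mul1r mul0r addr0.
    by rewrite ltr_wpDl ?mulr_ge0 ?subr_ge0 ?(ltW h2)// mulr_gt0// lt0r tn.
  by rewrite unitmxE unitfE.
have cB : {within `[0, 1], continuous (fun t => \det (B t))}.
  apply: continuous_in_subspaceT => t _; apply: differentiable_continuous.
  apply: differentiable_det => i j; apply/derivable1_diffP.
  have -> : (fun t => B t i j) = (fun t : R => (1 - t) * (1%:M : 'M[R]_d) i j + t * A i j).
    by apply/funext => s; rewrite /B !mxE.
  by apply: derivableD; apply: derivableM => //; apply: derivableB.
have B0 : \det (B 0) = 1 by rewrite /B subr0 scale1r scale0r addr0 det1.
have B1 : \det (B 1) = \det A by rewrite /B subrr scale0r add0r scale1r.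
rewrite ltNge; apply/negP => An.
have [|t tI t0] := @IVT R (fun t => \det (B t)) 0 1 0 ler01 cB.
  by rewrite B0 B1 ge_min le_max An ler01 orbT.
by have := Bu t; rewrite in_itv/= in tI; rewrite t0 eqxx => /(_ tI).
Qed.

Section Volume.
Variables (R : realType) (d : nat) (M : ptopologicalType).
Variable g : riemannianManifold R d M.
Variables (mu : {measure set (borel M) -> \bar R}).
Hypothesis hmu : is_riemannian_volume g mu.

Lemma open_borel (A : set (borel M)) : @open M A -> measurable A.
Proof. exact: sub_sigma_algebra. Qed.

Lemma closed_borel (A : set (borel M)) : @closed M A -> measurable A.
Proof.
move=> cA; rewrite -[A]setCK; apply: measurableC; apply: open_borel.
exact: closed_openC.
Qed.

Lemma volume_le a (A : set (borel M)) (c : 'rV[R]_d) (s B : R) : atlas g a -> measurable A ->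
  A `<=` chart_dom a -> 0 <= s -> 0 <= B ->
  (forall x, A x -> rbox c s (cmap a x) /\ Num.sqrt (\det (metric g a (cmap a x))) <= B) ->
  (mu A <= (B * (s *+ 2) ^+ d)%:E)%E.
Proof.
move=> aA mA Ad s0 B0 hA; rewrite (hmu aA mA Ad) -(integral_rV_box c)//.
apply: integral_rV_le => y; rewrite lee_fin ?mulr_ge0 ?sqrtr_ge0// !indicE.
have [|yA] := boolP (y \in cmap a @` A); last by rewrite mul0r mulr_ge0.
rewrite inE => -[x Ax <-]; have [h1 h2] := hA x Ax.
by rewrite mem_set// mul1r mulr1.
Qed.

Lemma volume_ge a (A : set (borel M)) (c : 'rV[R]_d) (s b : R) : atlas g a -> measurable A ->
  A `<=` chart_dom a -> 0 <= s -> 0 <= b ->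
  (forall y, rbox c s y -> (cmap a @` A) y /\ b <= Num.sqrt (\det (metric g a y))) ->
  ((b * (s *+ 2) ^+ d)%:E <= mu A)%E.
Proof.
move=> aA mA Ad s0 b0 hA; rewrite (hmu aA mA Ad) -(integral_rV_box c)//.
apply: integral_rV_le => y; rewrite lee_fin ?mulr_ge0// !indicE.
have [|yA] := boolP (y \in rbox c s); last by rewrite mulr0 mulr_ge0 ?sqrtr_ge0.
by rewrite inE => /hA[h1 h2]; rewrite mem_set// mul1r mulr1.
Qed.

(** The density is continuous and positive on a compact ball. The sum of its maximum and of the
    inverse of its minimum serves for both inequalities. *)
Lemma volume_density p r a (b : R) : 0 < r -> normal_chart g p r a -> b < r ^+ 2 ->
  exists2 B, 0 < B & forall v, bil (Q0 g p) v v <= b ->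
    B^-1 <= Num.sqrt (\det (metric g a v)) <= B.
Proof.
move=> r0 na br; have aA := normal_atlas na.
have ax v : bil (Q0 g p) v v <= b -> chart_img a v.
  by move=> vb; apply/(normal_img na); exact: le_lt_trans vb br.
pose f v := Num.sqrt (\det (metric g a v)).
have fp v : bil (Q0 g p) v v <= b -> 0 < f v.
  by move=> /ax av; rewrite sqrtr_gt0; apply: posdef_det_gt0 => u; exact: metric_pos.
have cf : {within [set v | bil (Q0 g p) v v <= b], continuous f}.
  apply: continuous_in_subspaceT => v; rewrite inE/= => /ax av.
  have cd : {for v, continuous (fun v => \det (metric g a v))}.
    apply: differentiable_continuous; apply: differentiable_det => i j.
    exact: metric_diff_entry.
  exact: (continuous_comp cd (@sqrt_continuous _ _)).
have [b0|b0] := leP 0 b; last first.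
  by exists 1 => // v /le_lt_trans/(_ b0); rewrite ltNge Q0_ge0.
have ne : [set v | bil (Q0 g p) v v <= b] !=set0 by exists 0; rewrite /= bil0l.
have [v1 h1 k1] := compact_EVT_max ne (@Qball_compact _ _ _ g p b) cf.
have [v2 h2 k2] := compact_EVT_min ne (@Qball_compact _ _ _ g p b) cf.
have p1 := fp _ (set_mem h1); have p2 := fp _ (set_mem h2).
exists (f v1 + (f v2)^-1) => [|v vb]; first by rewrite addr_gt0// invr_gt0.
apply/andP; split; last by rewrite (le_trans (k1 v _))// ?inE// lerDl invr_ge0 ltW.
rewrite -[leRHS]invrK lef_pV2 ?posrE ?addr_gt0 ?invr_gt0 ?p1 ?p2 ?fp//.
apply: (@le_trans _ _ (f v2)^-1); last by rewrite lerDr ltW.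
change ((f v)^-1 <= (f v2)^-1); rewrite lef_pV2; first exact: k2 v (mem_set vb).
  by rewrite posrE fp.
by rewrite posrE.
Qed.

End Volume.

(** * Tubes near a point *)

Section LocalModel.
Variables (R : realType) (d : nat) (M : ptopologicalType).
Variable g : riemannianManifold R d M.
Hypothesis hd2 : (1 < d)%N.
Variable kappa : R.
Hypothesis hK : forall a y (u v : 'rV[R]_d), atlas g a -> chart_img a y ->
  row_free (col_mx u v) -> sectional_curvature g a y u v = kappa.
Variables (mu : {measure set (borel M) -> \bar R}).
Hypothesis hmu : is_riemannian_volume g mu.
Variables (R1 alpha : R) (nc : M -> chart R d M) (nr : M -> R).
Hypotheses (alpha0 : 0 < alpha) (alphaR1 : alpha < R1) (hnr : forall p, R1 < nr p / 2).
Hypothesis hnc : forall p, normal_chart g p (nr p) (nc p).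
Implicit Types (x y z : M) (I : set R).

Let R1p : 0 < R1. Proof. exact: lt_trans alpha0 alphaR1. Qed.

Variable p : M.
Let a := nc p.
Let r := nr p.
Let na : normal_chart g p r a := hnc p.
Let R1r2 : R1 < r / 2 := hnr p.
Let r0 : 0 < r. Proof. by have := R1r2; have := R1p; lra. Qed.
Let R1r : R1 < r. Proof. by have := R1r2; have := R1p; lra. Qed.
Let hKa : forall (y u v : 'rV[R]_d), chart_img a y -> row_free (col_mx u v) ->
  sectional_curvature g a y u v = kappa.
Proof. by move=> y u v; apply: hK; exact: normal_atlas na. Qed.
Let Q := Q0 g p.
Let D : set M := ball_at g nc p R1.

Definition lmap x : 'rV[R]_d := bel g p kappa (cmap a x).

(** Half-open grid cells in Beltrami coordinates, so that they are disjoint and cover; their integer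
    labels become the points of the incidence problem. *)
Definition cell (delta : R) (z : 'I_d -> int) : set M :=
  [set x | D x /\ forall i, (z i)%:~R * delta <= lmap x 0 i < (z i + 1)%:~R * delta].

Variables (Lb Lm B cq : R).
Hypotheses (Lbp : 0 < Lb) (Lmp : 0 < Lm) (Bp : 0 < B) (cqp : 0 < cq).
Hypothesis hLb : forall v w : 'rV[R]_d, bil Q v v <= R1 ^+ 2 -> bil Q w w <= R1 ^+ 2 ->
  [/\ `|bel g p kappa v - bel g p kappa w| <= Lb * `|v - w|,
      `|v - w| <= Lb * `|bel g p kappa v - bel g p kappa w| &
      forall V, `|V| <= Lb * `|dbel g p kappa v V|].
Hypothesis hLm : forall v V : 'rV[R]_d, bil Q v v <= R1 ^+ 2 ->
  `|V| ^+ 2 <= Lm * bil (metric g a v) V V /\ bil (metric g a v) V V <= Lm * `|V| ^+ 2.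
Hypothesis hB : forall v : 'rV[R]_d, bil Q v v <= R1 ^+ 2 ->
  B^-1 <= Num.sqrt (\det (metric g a v)) <= B.
Hypothesis hcq : forall u v : 'rV[R]_d,
  `|u| ^+ 2 <= cq * bil Q u u /\ `|bil Q u v| <= cq * `|u| * `|v|.

Let R12 : R1 ^+ 2 < r ^+ 2.
Proof. by rewrite ltr_pXn2r// nnegrE ltW. Qed.

Let Dclosed : closed D. Proof. exact: (nball_closed na R12). Qed.

Lemma lmap_bound x : D x -> `|lmap x| <= Lb * Num.sqrt (cq * R1 ^+ 2).
Proof.
move=> [dx rx]; have R10 : bil Q 0 0 <= R1 ^+ 2 by rewrite bil0l sqr_ge0.
have [h _ _] := hLb rx R10.
have b0 : bel g p kappa 0 = 0 by rewrite /bel scaler0.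
rewrite b0 !subr0 in h; apply: (le_trans h); rewrite ler_wpM2l ?(ltW Lbp)//.
rewrite -[`|cmap _ x|]normr_id -sqrtr_sqr ler_sqrt; last by rewrite mulr_ge0 ?sqr_ge0// ltW.
by rewrite (le_trans (hcq (cmap a x) 0).1)// ler_wpM2l// ltW.
Qed.

Let lt_open (i : 'I_d) (b : R) : open [set x | [/\ chart_dom a x, nrho g p a x < (r / 2) ^+ 2 & lmap x 0 i < b]].
Proof.
rewrite openE => x [dx rx xb].
have N1 : \forall y \near x, chart_dom a y /\ rho g nc p y < (r / 2) ^+ 2.
  exact: (@open_near _ _ x (@open_ball_at _ _ _ _ _ p ((r / 2) ^+ 2))).
have cc := cmap_continuous dx.
have cq' : {for cmap a x, continuous (fun v : 'rV[R]_d => bil Q v v)} := @Qsqr_continuous _ _ _ g p _.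
have [Sp Cp] := sn_cs_gt0 r0 na hd2 hKa (Q0_ge0 g p (cmap a x)) rx.
have cb : {for x, continuous (fun y => lmap y 0 i)}.
  have -> : (fun y => lmap y 0 i) = (fun y => sn0 kappa (nrho g p a y) / cs0 kappa (nrho g p a y) * cmap a y 0 i).
    by apply/funext => y; rewrite /lmap /bel mxE.
  have cr : {for x, continuous (nrho g p a)} := continuous_comp cc cq'.
  apply: for_continuousM.
    apply: for_continuousM.
      exact: continuous_comp cr (is_derive_continuous (is_derive_sn0 kappa _)).
    apply: for_continuousV; last by rewrite gt_eqF.
    exact: continuous_comp cr (is_derive_continuous (is_derive_cs0 kappa _)).
  have ci : {for cmap a x, continuous (fun s : 'rV[R]_d => s 0 i)} by exact: coord_continuous.
  exact: continuous_comp cc ci.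
have xb' : [set z | z < b] (lmap x 0 i) by [].
have N2 := cb _ (open_near (@open_lt _ b) xb').
by apply: (filterS _ (filterI N1 N2)) => y [[dy ry] yb].
Qed.

(** [lmap] is only known to be continuous where C > 0, so its sublevel sets are taken within the
    open ball of radius [r / 2], which contains [D]. *)
Lemma cell_measurable (delta : R) (z : 'I_d -> int) : measurable (cell delta z : set (borel M)).
Proof.
pose V i b := [set x | [/\ chart_dom a x, nrho g p a x < (r / 2) ^+ 2 & lmap x 0 i < b]].
have Din x : D x -> chart_dom a x /\ nrho g p a x < (r / 2) ^+ 2.
  move=> [dx rx]; split=> //; rewrite (le_lt_trans rx)// ltr_pXn2r// nnegrE ltW// divr_gt0//.
have -> : cell delta z = D `&` \bigcap_(i in [set: 'I_d]) (V i ((z i + 1)%:~R * delta) `\` V i ((z i)%:~R * delta)).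
  apply/seteqP; split=> x.
    move=> [Dx h]; split=> // i _; have [dx rx] := Din x Dx; have /andP[h1 h2] := h i.
    by split; [split|move=> [_ _]; rewrite ltNge h1].
  move=> [Dx h]; split=> // i; have [dx rx] := Din x Dx.
  have [[_ _ h1] h2] := h i I; rewrite h1 andbT leNgt; apply/negP => h3.
  by apply: h2; split.
apply: measurableI; first exact: closed_borel.
apply: fin_bigcap_measurable => // i _.
by apply: measurableD; apply: open_borel; exact: lt_open.
Qed.

Lemma cell_volume (delta : R) (z : 'I_d -> int) : 0 < delta ->
  (mu (cell delta z) <= (B * (2 * Lb * delta *+ 2) ^+ d)%:E)%E.
Proof.
move=> dp; have b0 : 0 <= B * (2 * Lb * delta *+ 2) ^+ d.
  by rewrite mulr_ge0 ?(ltW Bp)// exprn_ge0// mulrn_wge0// !mulr_ge0// ltW.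
have [[x0 [Dx0 h0]]|ne] := pselect (cell delta z !=set0); last first.
  have -> : cell delta z = set0.
    by apply/seteqP; split=> x // hx; exfalso; apply: ne; exists x.
  by rewrite measure0 lee_fin.
apply: (@volume_le _ _ _ _ _ hmu a _ (cmap a x0)) => //.
- exact: normal_atlas na.
- exact: cell_measurable.
- by move=> x [[]].
- by rewrite !mulr_ge0// ltW.
- exact: ltW.
move=> x [Dx h]; split; last by have /andP[] := hB Dx.2.
move=> i; have [_ h2 _] := hLb Dx0.2 Dx.2.
have -> : cmap a x0 0 i - cmap a x 0 i = (cmap a x0 - cmap a x) 0 i by rewrite !mxE.
apply: (le_lt_trans (rV_coord_le _ _)); apply: (le_lt_trans h2).
apply: (@le_lt_trans _ _ (Lb * delta)); last by rewrite -mulrA ltr_pMl ?mulr_gt0// ltr1n.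
rewrite ler_wpM2l ?(ltW Lbp)//; apply: rV_norm_le; first exact: ltW.
move=> j; have := h0 j; have := h j; rewrite intrD /lmap !mxE mulrDl mul1r => /andP[k1 k2] /andP[k3 k4].
by rewrite ler_norml; apply/andP; split; lra.
Qed.

Lemma joined_on_curve c I (s t u v : R) : open I -> Ck_curve g 1 I c -> `[s, t] `<=` I ->
  s <= u <= t -> s <= v <= t -> exists2 l, joined g (c u) (c v) l & (l <= curve_length g c s t)%E.
Proof.
move=> oI Cc sI; wlog uv : u v / u <= v => [W hu hv|/andP[su ut] /andP[sv vt]].
  have [uv|/ltW vu] := leP u v; first exact: W.
  by have [l J lb] := W v u vu hv hu; exists l => //; exact: joined_sym.
have st : s <= t by exact: le_trans su ut.
have [L [dL lE]] := length_primitive oI Cc st sI.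
exists (curve_length g c u v).
  apply: joined_curve oI Cc uv _ => w; rewrite /= in_itv/= => /andP[h1 h2]; apply: sI.
  by rewrite /= in_itv/= (le_trans su h1) (le_trans h2 vt).
have mono (x y : R) : s <= x -> x <= y -> y <= t -> L x <= L y.
  move=> sx xy yt; apply: (nondecreasing_cc xy (df := speed g c)) => w /andP[h1 h2].
    by apply: dL; rewrite (le_trans sx h1) (le_trans h2 yt).
  exact: speed_ge0.
by rewrite !lE// lee_fin lerB// mono.
Qed.

Variable e0 : R.
Hypotheses (e0p : 0 < e0) (e0R : e0 + alpha + e0 < R1).

Lemma segment_near gam x : chart_dom a x -> nrho g p a x < e0 ^+ 2 ->
  geodesic_segment g alpha gam -> gam x ->
  forall z, gam z -> chart_dom a z /\ Num.sqrt (nrho g p a z) <= e0 + alpha.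
Proof.
move=> dx rx [c [s [t [I [st sI gc len ->]]]]] [u /= uI cu] z [v /= vI cv].
rewrite in_itv/= in uI; rewrite in_itv/= in vI; have [oI _ _] := gc.
have [l J lb] := joined_on_curve oI (geodesic_C1 gc) sI uI vI.
rewrite len cu cv in J lb.
have sx : Num.sqrt (nrho g p a x) <= e0.
  by rewrite -[e0]ger0_norm ?(ltW e0p)// -sqrtr_sqr ler_sqrt ?sqr_ge0// ltW.
have [|dz h _] := joined_nball r0 na R1p R1r Lmp hLm J lb dx; first by have := e0R; have := e0p; lra.
by split=> //; lra.
Qed.

(** The infimum defining the distance need not be attained, hence a point of the segment within
    [2 * delta] instead of [delta]. *)
Lemma tube_near gam x delta : chart_dom a x -> nrho g p a x < e0 ^+ 2 ->
  geodesic_segment g alpha gam -> gam x -> 0 < delta -> 2 * delta < e0 ->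
  forall y, tube g delta gam y -> D y /\ exists2 z, gam z & D z /\ `|lmap y - lmap z| <= Lb * (Num.sqrt Lm * (2 * delta)).
Proof.
move=> dx rx hg gx dp de y ty; have : (gdist_set g y gam < (2 * delta)%:E)%E.
  by apply: (le_lt_trans ty); rewrite lte_fin ltr_pMl// ltr1n.
move=> /ereal_inf_lt[_ [z gz <-] /gdist_joined[l J lb]].
have [dz rz] := segment_near dx rx hg gx gz.
have inD (w : M) : chart_dom a w -> Num.sqrt (nrho g p a w) <= R1 -> D w.
  move=> dw rw; split=> //; rewrite -(@sqr_sqrtr _ (nrho g p a w)) ?nrho_ge0//.
  by rewrite ler_pXn2r// nnegrE ?sqrtr_ge0// ltW.
have [|dy ry h] := joined_nball r0 na R1p R1r Lmp hLm (joined_sym J) (ltW lb) dz; first by have := e0R; lra.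
have Dy : D y by apply: inD => //; have := e0R; lra.
have Dz : D z by apply: inD => //; have := e0R; have := e0p; lra.
split=> //; exists z => //; split=> //.
have [h1 _ _] := hLb Dy.2 Dz.2.
by apply: (le_trans h1); rewrite ler_wpM2l// ltW.
Qed.

Lemma segment_line gam x : chart_dom a x -> nrho g p a x < e0 ^+ 2 ->
  geodesic_segment g alpha gam -> gam x ->
  exists (i : 'I_d) (w : 'rV[R]_d), [/\ w 0 i = 1, forall j, `|w 0 j| <= 1,
    forall y z, gam y -> gam z -> lmap y - lmap z = (lmap y 0 i - lmap z 0 i) *: w &
    exists (z0 : M) (sg : R), [/\ gam z0, `|sg| = 1 & forall b, 0 <= b <= alpha / (Lb * Num.sqrt Lm) ->
      exists2 z, gam z & sg * (lmap z 0 i - lmap z0 0 i) = b]].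
Proof.
move=> dx rx hg gx; have near_x := segment_near dx rx hg gx.
have [c [s [t [I [st sI gc len gE]]]]] := hg; have [oI _ _] := gc.
have inb u : s <= u <= t -> chart_dom a (c u) /\ bil Q (cmap a (c u)) (cmap a (c u)) <= R1 ^+ 2.
  move=> hu; have [|du ru] := near_x (c u); first by rewrite gE; exists u; rewrite //= in_itv.
  split=> //; rewrite -/(nrho g p a (c u)) -(@sqr_sqrtr _ (nrho g p a (c u))) ?nrho_ge0//.
  by rewrite ler_pXn2r// ?nnegrE ?sqrtr_ge0 ?(ltW R1p)//; have := e0R; have := e0p; lra.
have [i [w [wi w1 lin [sg [sg1 dsg]]]]] := bel_line r0 na hd2 hKa R1p R1r2 gc st sI inb.
exists i, w; split=> //.
  move=> y z; rewrite gE => -[u /= uI <-] [v /= vI <-]; rewrite in_itv/= in uI; rewrite in_itv/= in vI.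
  have /= hu := lin u uI; have /= hv := lin v vI.
  rewrite /lmap; have E (A1 A2 A3 : 'rV[R]_d) : A1 - A2 = (A1 - A3) - (A2 - A3) by rewrite opprB addrA subrK.
  rewrite (E _ _ (bel g p kappa (cmap a (c s)))) hu hv -scalerBl; congr (_ *: _); ring.
exists (c s), sg; split=> //; first by rewrite gE; exists s; rewrite //= in_itv/= lexx.
have [L [dL lE]] := length_primitive oI (geodesic_C1 gc) st sI.
have LE : L t - L s = alpha by have := lE s t (lexx _) st (lexx _); rewrite len => -[->].
pose f u := sg * lmap (c u) 0 i.
have df u : s <= u <= t -> is_derive u 1 f `|dbel g p kappa (cmap a (c u)) ('D_1 (cmap a \o c) u)|.
  move=> hu; have H := @is_deriveZ _ _ _ _ sg u 1 _ (dsg u hu).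
  apply: (is_derive_eq H); rewrite /GRing.scale/= mulrA.
  have -> : sg * sg = 1 by rewrite -expr2 -[sg ^+ 2]real_normK ?num_real// sg1 expr1n.
  by rewrite mul1r.
(* The chosen coordinate moves at least at the Riemannian speed divided by [Lb * Num.sqrt Lm], and
   the segment has length [alpha]. *)
have big : alpha / (Lb * Num.sqrt Lm) <= f t - f s.
  have sp : 0 < Lb * Num.sqrt Lm by rewrite mulr_gt0// sqrtr_gt0.
  rewrite ler_pdivrMr// -LE.
  have : (Lb * Num.sqrt Lm) * f s - L s <= (Lb * Num.sqrt Lm) * f t - L t.
    pose dd u := (Lb * Num.sqrt Lm) * `|dbel g p kappa (cmap a (c u)) ('D_1 (cmap a \o c) u)| - speed g c u.
    apply: (@nondecreasing_cc _ (fun u => (Lb * Num.sqrt Lm) * f u - L u) dd _ _ st) => u hu.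
      have H := @is_deriveZ _ _ _ _ (Lb * Num.sqrt Lm) u 1 _ (df u hu).
      exact: (@is_deriveB _ _ _ _ _ u 1 _ _ H (dL u hu)).
    have [du ru] := inb u hu; have Iu : I u by apply: sI; rewrite /= in_itv.
    rewrite subr_ge0 (speed_chart (normal_atlas na) oI (geodesic_C1 gc) Iu du).
    have [_ h1] := hLm ('D_1 (cmap a \o c) u) ru; have [_ _ h2] := hLb ru ru.
    apply: (@le_trans _ _ (Num.sqrt (Lm * `|'D_1 (cmap a \o c) u| ^+ 2))).
      by rewrite ler_sqrt// mulr_ge0 ?sqr_ge0// ltW.
    rewrite sqrtrM ?(ltW Lmp)// sqrtr_sqr normr_id mulrC [Lb * _]mulrC -mulrA mulrC.
    by rewrite ler_wpM2l ?sqrtr_ge0.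
  by lra.
move=> b /andP[b0 bb].
have cf : {within `[s, t], continuous f}.
  by apply: continuous_in_subspaceT => u; rewrite inE/= in_itv/= => hu; exact: is_derive_continuous (df _ hu).
have [|u uI fu] := @IVT R f s t (f s + b) st cf.
  have h : f s + b <= f t by lra.
  by rewrite ge_min le_max lerDl b0 h orbT.
exists (c u); first by rewrite gE; exists u.
by rewrite mulrBr -/(f u) -/(f s) fu; ring.
Qed.

(** Triangle inequality for the norm of [Q], converted to the sup norm by [cq]. *)
Lemma Qball_enlarge (b b' : R) : 0 <= b -> b < b' -> exists2 h, 0 < h &
  forall v v' : 'rV[R]_d, bil Q v v <= b ^+ 2 -> `|v' - v| <= h -> bil Q v' v' <= b' ^+ 2.
Proof.
move=> b0 bb'; have b'0 : 0 < b' by exact: le_lt_trans bb'.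
have cp : 0 < Num.sqrt cq by rewrite sqrtr_gt0.
exists ((b' - b) / Num.sqrt cq) => [|v v' vb vv]; first by rewrite divr_gt0// subr_gt0.
have Q0 := Q0_ge0 g p; have [w wE] : exists w, w = v' - v by exists (v' - v).
rewrite -wE in vv; have -> : v' = v + w by rewrite wE addrC subrK.
have wb : Num.sqrt (bil Q w w) <= b' - b.
  move: vv; rewrite ler_pdivlMr// => vv; apply: (le_trans _ vv).
  rewrite -[`|w|]normr_id -sqrtr_sqr -sqrtrM ?sqr_ge0// ler_sqrt; last by rewrite mulr_ge0 ?sqr_ge0// ltW.
  have [_ h] := hcq w w; rewrite (le_trans (ler_norm _))// (le_trans h)//.
  by rewrite expr2 -mulrA mulrC.
have vb' : Num.sqrt (bil Q v v) <= b.
  by rewrite -[b]ger0_norm// -sqrtr_sqr ler_sqrt ?sqr_ge0.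
have CS : bil Q v w <= Num.sqrt (bil Q v v) * Num.sqrt (bil Q w w).
  rewrite -sqrtrM// (le_trans (ler_norm _))// -sqrtr_sqr ler_sqrt ?mulr_ge0//.
  exact: bil_CS (Q0T g p) (@Q0_pos _ _ _ g p).
have -> : bil Q (v + w) (v + w) = bil Q v v + 2 * bil Q v w + bil Q w w.
  by rewrite !(bilDl, bilDr) (bil_symm w v (Q0T g p)); ring.
have sq1 := sqr_sqrtr (Q0 v); have sq2 := sqr_sqrtr (Q0 w).
have s1 := sqrtr_ge0 (bil Q v v); have s2 := sqrtr_ge0 (bil Q w w).
apply: (@le_trans _ _ ((Num.sqrt (bil Q v v) + Num.sqrt (bil Q w w)) ^+ 2)).
  by rewrite sqrrD sq1 sq2 -mulr_natl; lra.
by rewrite ler_pXn2r// ?nnegrE ?addr_ge0 ?(ltW b'0)//; lra.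
Qed.

(** About 1/delta disjoint coordinate boxes of side comparable to delta are placed along the
    segment, each inside the tube; [segment_line] provides their centres at equally spaced values of
    one coordinate. *)
Lemma tube_volume : exists c d0 : R, [/\ 0 < c, 0 < d0 &
  forall gam x delta, chart_dom a x -> nrho g p a x < e0 ^+ 2 ->
  geodesic_segment g alpha gam -> gam x -> 0 < delta -> delta < d0 ->
  ((c * delta ^+ d.-1)%:E <= mu (tube g delta gam))%E].
Proof.
have b0 : 0 <= e0 + alpha by rewrite addr_ge0// ltW.
have bR : e0 + alpha < R1 by have := e0R; have := e0p; lra.
have [h hp hh] := Qball_enlarge b0 bR.
have sL : 0 < Num.sqrt Lm by rewrite sqrtr_gt0.
(* [c1] makes a box of half-side [c1 * delta] lie within distance delta of its centre. *)
pose c1 := (Num.sqrt Lm + 1)^-1; have c1p : 0 < c1 by rewrite invr_gt0 addr_gt0.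
have c1le : c1 <= 1 by rewrite invf_le1 ?addr_gt0// lerDr ltW.
have c1L : Num.sqrt Lm * c1 <= 1 by rewrite ler_pdivrMr ?addr_gt0// mul1r lerDl.
pose l := alpha / (Lb * Num.sqrt Lm); have lp : 0 < l by rewrite divr_gt0// mulr_gt0.
(* Over one box the coordinate varies from its centre value by at most [Lb * c1 * delta], so centres
   [k0 * delta] apart have disjoint boxes. *)
pose k0 := 2 * Lb * c1 + 1; have k0p : 0 < k0 by rewrite addr_gt0// !mulr_gt0.
exists (l / k0 * (B^-1 * (c1 *+ 2) ^+ d)), h; split=> //.
  by rewrite mulr_gt0 ?divr_gt0// mulr_gt0 ?invr_gt0// exprn_gt0// mulrn_wgt0.
move=> gam x delta dx rx hg gx dp dh.
have [i [w [wi w1 _ [z0 [sg [gz0 sg1 hz]]]]]] := segment_line dx rx hg gx.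
have kd : 0 < k0 * delta by rewrite mulr_gt0.
pose m := (Num.truncn (l / (k0 * delta))).+1.
have mle (k : 'I_m) : 0 <= k%:R * (k0 * delta) <= l.
  rewrite mulr_ge0 ?(ltW kd)//= -ler_pdivlMr//.
  apply: (@le_trans _ _ (Num.truncn (l / (k0 * delta)))%:R); first by rewrite ler_nat -ltnS.
  by rewrite truncn_le// divr_ge0// ltW.
have /choice[zf hzf] : forall k : 'I_m, exists z, gam z /\ sg * (lmap z 0 i - lmap z0 0 i) = k%:R * (k0 * delta).
  by move=> k; have [z gz E] := hz _ (mle k); exists z.
pose F (k : 'I_m) : set (borel M) := [set y | chart_dom a y /\ rbox (cmap a (zf k)) (c1 * delta) (cmap a y)].
have cd : 0 < c1 * delta by rewrite mulr_gt0.
have boxn (u v : 'rV[R]_d) (s : R) : 0 < s -> rbox u s v -> `|v - u| <= s.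
  move=> sp hb; apply: rV_norm_le; [exact: ltW|move=> j; rewrite !mxE distrC; exact: ltW (hb j)].
have near_x := segment_near dx rx hg gx.
have zfD k : chart_dom a (zf k) /\ bil Q (cmap a (zf k)) (cmap a (zf k)) <= (e0 + alpha) ^+ 2.
  have [dz rz] := near_x _ (hzf k).1; split=> //.
  rewrite -/(nrho g p a (zf k)) -(@sqr_sqrtr _ (nrho g p a (zf k))) ?nrho_ge0//.
  by rewrite ler_pXn2r// ?nnegrE ?sqrtr_ge0// addr_ge0// ltW.
have boxQ k v : rbox (cmap a (zf k)) (c1 * delta) v -> bil Q v v <= R1 ^+ 2.
  move=> hb; apply: (hh _ _ (zfD k).2); apply: (le_trans (boxn _ _ _ cd hb)).
  by rewrite (le_trans _ (ltW dh))// ler_piMl// ltW.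
have zD k : D (zf k).
  split; first exact: (zfD k).1.
  by apply: (boxQ k) => j; rewrite subrr normr0.
have FD k y : F k y -> D y by move=> [dy hb]; split=> //; exact: (boxQ k).
have Fopen k : measurable (F k).
  apply: open_borel; rewrite openE => y [dy hb].
  apply: filterI; first exact: open_near (open_chart_dom a) dy.
  have ob : \forall v \near cmap a y, rbox (cmap a (zf k)) (c1 * delta) v.
    apply: (@filter_forall _ _ (fun (j : 'I_d) (v : 'rV[R]_d) => `|cmap a (zf k) 0 j - v 0 j| < c1 * delta) _ (nbhs_filter (cmap a y))) => j.
    have cj : {for cmap a y, continuous (fun s : 'rV[R]_d => `|cmap a (zf k) 0 j - s 0 j|)}.
      apply: (@continuous_comp _ _ _ (fun s : 'rV[R]_d => cmap a (zf k) 0 j - s 0 j) (fun t : R => `|t|)).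
        apply: for_continuousD; first exact: cst_continuous.
        by apply: for_continuousN; exact: coord_continuous.
      exact: norm_continuous.
    have hj : [set t : R | t < c1 * delta] `|cmap a (zf k) 0 j - cmap a y 0 j| := hb j.
    exact: cj _ (open_near (@open_lt _ (c1 * delta)) hj).
  exact: (cmap_continuous dy) _ ob.
have Fvol k : ((B^-1 * (c1 * delta *+ 2) ^+ d)%:E <= mu (F k))%E.
  apply: (@volume_ge _ _ _ _ _ hmu a _ (cmap a (zf k))) => //.
  - exact: normal_atlas na.
  - by move=> y [].
  - exact: ltW.
  - by rewrite invr_ge0 ltW.
  move=> v hb; have vQ := boxQ k v hb; split; last by have /andP[] := hB vQ.
  have av : chart_img a v by apply/(normal_img na); exact: le_lt_trans vQ R12.
  have [h1 h2] := cinvK av; exists (cinv a v) => //; split=> //; by rewrite h1.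
have Ftube k : F k `<=` tube g delta gam.
  move=> y Fy; have Dy := FD _ _ Fy; rewrite /tube/=.
  apply: (@le_trans _ _ (gdist g y (zf k))).
    by apply: ereal_inf_lbound; exists (zf k) => //; exact: (hzf k).1.
  apply: (le_trans (gdist_nball r0 na R1p R1r Lmp hLm Dy (zD k))); rewrite lee_fin distrC.
  apply: (@le_trans _ _ (Num.sqrt Lm * (c1 * delta))).
    by rewrite ler_wpM2l ?(ltW sL)//; apply: boxn => //; exact: Fy.2.
  by rewrite mulrA ler_piMl// ltW.
have Fdist k y : F k y -> `|lmap y 0 i - lmap (zf k) 0 i| <= Lb * (c1 * delta).
  move=> Fy; have [h1 _ _] := hLb (FD _ _ Fy).2 (zD k).2.
  have -> : lmap y 0 i - lmap (zf k) 0 i = (lmap y - lmap (zf k)) 0 i by rewrite [RHS]mxE [X in _ = _ + X]mxE.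
  apply: (le_trans (rV_coord_le _ _)); apply: (le_trans h1); rewrite ler_wpM2l ?(ltW Lbp)//.
  by apply: boxn => //; exact: Fy.2.
have Ftriv : trivIset setT F.
  have sep (k k' : 'I_m) y : (k < k')%N -> F k y -> F k' y -> False.
    move=> kk Fy Fy'; have h1 := Fdist _ _ Fy; have h2 := Fdist _ _ Fy'.
    have [_ e1] := hzf k; have [_ e2] := hzf k'.
    have E : sg * (lmap (zf k') 0 i - lmap (zf k) 0 i) = (k'%:R - k%:R) * (k0 * delta).
      by rewrite mulrBl -e1 -e2; ring.
    have low : k0 * delta <= `|lmap (zf k') 0 i - lmap (zf k) 0 i|.
      rewrite -[leRHS]mul1r -sg1 -normrM E (le_trans _ (ler_norm _))//.
      by rewrite ler_peMl ?(ltW kd)// lerBrDl natr1 ler_nat.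
    have up : `|lmap (zf k') 0 i - lmap (zf k) 0 i| <= Lb * (c1 * delta) + Lb * (c1 * delta).
      have -> : lmap (zf k') 0 i - lmap (zf k) 0 i = (lmap y 0 i - lmap (zf k) 0 i) - (lmap y 0 i - lmap (zf k') 0 i) by ring.
      by rewrite (le_trans (ler_normB _ _))// lerD.
    have := le_trans low up; rewrite /k0 mulrDl mul1r.
    have -> : 2 * Lb * c1 * delta = Lb * (c1 * delta) + Lb * (c1 * delta) by ring.
    by rewrite gerDl leNgt dp.
  apply/trivIsetP => k k' _ _ kk'; apply/seteqP; split=> // y [Fy Fy'].
  by move: kk'; rewrite neq_ltn => /orP[lt|lt]; [exact: sep lt Fy Fy'|exact: sep lt Fy' Fy].
apply: (@le_trans _ _ (mu (\big[setU/set0]_(k < m) F k))); last first.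
  apply: le_measure; rewrite ?inE.
  - by apply: bigsetU_measurable => k _.
  - by apply: closed_borel; apply: (tube_closed hd2 hK R1p hnr hnc).
  - apply: (big_ind (fun A : set M => A `<=` tube g delta gam)) => [y []|A1 A2 h1 h2|k _].
    + by rewrite subUset.
    + exact: Ftube.
rewrite measure_semi_additive_ord//; last by apply: bigsetU_measurable => k _.
apply: (@le_trans _ _ (\sum_(k < m) (B^-1 * (c1 * delta *+ 2) ^+ d)%:E)%E); last by apply: lee_sum => k _; exact: Fvol.
rewrite sumEFin lee_fin sumr_const card_ord -[leRHS]mulr_natl.
have mge : l / (k0 * delta) <= m%:R by apply: ltW; rewrite /m truncnS_gt.
have -> : l / k0 * (B^-1 * (c1 *+ 2) ^+ d) * delta ^+ d.-1 = l / (k0 * delta) * (B^-1 * (c1 * delta *+ 2) ^+ d).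
  have -> : c1 * delta *+ 2 = (c1 *+ 2) * delta by rewrite mulrnAl.
  have dd : delta ^+ d = delta * delta ^+ d.-1 by rewrite -exprS prednK// ltnW.
  rewrite exprMn dd; field; by rewrite !gt_eqF.
by rewrite ler_wpM2r// mulr_ge0 ?invr_ge0 ?(ltW Bp)// exprn_ge0// mulrn_wge0// ltW.
Qed.

End LocalModel.

Section LocalModelExists.
Variables (R : realType) (d : nat) (M : ptopologicalType).
Variable g : riemannianManifold R d M.
Hypothesis hd2 : (1 < d)%N.
Variable kappa : R.
Hypothesis hK : forall a y (u v : 'rV[R]_d), atlas g a -> chart_img a y ->
  row_free (col_mx u v) -> sectional_curvature g a y u v = kappa.
Variables (mu : {measure set (borel M) -> \bar R}).
Hypothesis hmu : is_riemannian_volume g mu.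
Variables (R1 alpha : R) (nc : M -> chart R d M) (nr : M -> R).
Hypotheses (alpha0 : 0 < alpha) (alphaR1 : alpha < R1) (hnr : forall p, R1 < nr p / 2).
Hypothesis hnc : forall p, normal_chart g p (nr p) (nc p).

Definition lcell p := @cell R d M g kappa R1 nc p.

Lemma local_model (eta : R) p : 0 < eta -> eta + alpha + eta < R1 -> exists L d0 : R, [/\ 0 < L, 0 < d0,
  forall x i, ball_at g nc p R1 x -> `|lmap g kappa nc p x 0 i| <= L,
  forall delta z, 0 < delta -> measurable (lcell p delta z : set (borel M)) /\
     (mu (lcell p delta z) <= (L * delta ^+ d)%:E)%E &
  forall x gam delta, chart_dom (nc p) x -> rho g nc p x < eta ^+ 2 -> 0 < delta -> delta < d0 ->
    geodesic_segment g alpha gam -> gam x ->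
    [/\ tube g delta gam `<=` ball_at g nc p R1, (((L^-1) * delta ^+ d.-1)%:E <= mu (tube g delta gam))%E &
     exists (i : 'I_d) (w : 'rV[R]_d), [/\ w 0 i = 1, forall j, `|w 0 j| <= 1 &
       forall y j, tube g delta gam y ->
         `|lmap g kappa nc p y 0 j - lmap g kappa nc p x 0 j
           - (lmap g kappa nc p y 0 i - lmap g kappa nc p x 0 i) * w 0 j| <= L * delta]]].
Proof.
move=> e0 eR; have R1p : 0 < R1 by exact: lt_trans alpha0 alphaR1.
have r0 : 0 < nr p by have := hnr p; lra.
have R1r : R1 < nr p by have := hnr p; lra.
have R12 : R1 ^+ 2 < nr p ^+ 2 by rewrite ltr_pXn2r// nnegrE ltW.
have hKa : forall (y u v : 'rV[R]_d), chart_img (nc p) y -> row_free (col_mx u v) ->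
    sectional_curvature g (nc p) y u v = kappa.
  by move=> y u v; apply: hK; exact: normal_atlas (hnc p).
have [Lb Lbp hLb] := bel_norm r0 (hnc p) hd2 hKa R1p (hnr p).
have [Lm Lmp hLm] := metric_norm r0 (hnc p) hd2 hKa R1p (hnr p).
have [B Bp hB] := volume_density r0 (hnc p) R12.
have [cq cqp hcq] := posdef_norm (Q0T g p) (@Q0_pos _ _ _ g p).
have [c [d0 [cp d0p tv]]] := tube_volume hd2 hK hmu alpha0 alphaR1 hnr hnc Lbp Lmp Bp cqp hLb hLm hB hcq e0 eR.
pose L1 := Lb * Num.sqrt (cq * R1 ^+ 2).
pose L2 := B * (2 * Lb *+ 2) ^+ d.
pose L3 := 4 * (Lb * (Num.sqrt Lm * 2)).
have L1p : 0 <= L1 by rewrite mulr_ge0 ?sqrtr_ge0// ltW.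
have L2p : 0 <= L2 by rewrite mulr_ge0 ?(ltW Bp)// exprn_ge0// mulrn_wge0// mulr_ge0// ltW.
have L3p : 0 <= L3 by rewrite !mulr_ge0 ?sqrtr_ge0// ltW.
have icp : 0 < c^-1 by rewrite invr_gt0.
exists (L1 + L2 + L3 + c^-1), (Num.min d0 (eta / 2)); split.
- lra.
- by rewrite lt_min d0p divr_gt0.
- move=> x i Dx; have := lmap_bound Lbp cqp hLb hcq Dx; rewrite -/L1 => h.
  by rewrite (le_trans (rV_coord_le _ _))// (le_trans h)//; lra.
- move=> delta z dp; split; first exact: (cell_measurable hd2 hK alpha0 alphaR1 hnr hnc).
  apply: (le_trans (cell_volume hd2 hK hmu alpha0 alphaR1 hnr hnc Lbp Bp hLb hB z dp)).
  rewrite lee_fin; have -> : 2 * Lb * delta *+ 2 = (2 * Lb *+ 2) * delta by ring.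
  rewrite exprMn mulrA -/L2 ler_wpM2r ?exprn_ge0 ?(ltW dp)//; lra.
move=> x gam delta dx rx dp; rewrite lt_min => /andP[dd de] hg gx.
have de2 : 2 * delta < eta by rewrite ltr_pdivlMr// in de; lra.
have near_x := tube_near alpha0 alphaR1 hnr hnc Lbp Lmp hLb hLm e0 eR dx rx hg gx dp de2.
split.
- by move=> y /near_x[].
- apply: (le_trans _ (tv gam x delta dx rx hg gx dp dd)); rewrite lee_fin ler_wpM2r ?exprn_ge0 ?(ltW dp)//.
  by rewrite -[leRHS]invrK lef_pV2 ?posrE//; lra.
have [i [w [wi w1 lin _]]] := segment_line hd2 hK alpha0 alphaR1 hnr hnc Lbp Lmp hLb hLm e0 eR dx rx hg gx.
exists i, w; split=> // y j /near_x[_ [z gz [_ yz]]].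
have E := congr1 (fun v : 'rV[R]_d => v 0 j) (lin z x gz gx).
have subE (u v : 'rV[R]_d) k : (u - v) 0 k = u 0 k - v 0 k by rewrite !mxE.
set l := lmap g kappa nc p in E yz *.
have E' : l z 0 j - l x 0 j = (l z 0 i - l x 0 i) * w 0 j.
  by rewrite -subE E mxE.
have yzj k : `|l y 0 k - l z 0 k| <= Lb * (Num.sqrt Lm * (2 * delta)).
  have -> : l y 0 k - l z 0 k = (l y - l z) 0 k by rewrite subE.
  exact: le_trans (rV_coord_le _ _) yz.
have -> : l y 0 j - l x 0 j - (l y 0 i - l x 0 i) * w 0 j =
    (l y 0 j - l z 0 j) - (l y 0 i - l z 0 i) * w 0 j + (l z 0 j - l x 0 j - (l z 0 i - l x 0 i) * w 0 j) by ring.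
rewrite E' subrr addr0 (le_trans (ler_normB _ _))// normrM.
have h1 := yzj j; have h2 : `|l y 0 i - l z 0 i| * `|w 0 j| <= Lb * (Num.sqrt Lm * (2 * delta)).
  by rewrite -[leRHS]mulr1 ler_pM.
apply: (@le_trans _ _ (L3 * delta)); last by rewrite ler_wpM2r ?(ltW dp)//; lra.
apply: (le_trans (lerD h1 h2)); rewrite /L3.
have : 0 <= Lb * (Num.sqrt Lm * (2 * delta)) by exact: le_trans (normr_ge0 _) h1.
lra.
Qed.

End LocalModelExists.

(** * Wolff's hairbrush bound *)

Section Counting.
Local Close Scope classical_set_scope.
Local Open Scope set_scope.
Local Open Scope ring_scope.
Variable R : realType.

(** Rounding every coordinate down to an integer is injective on a 1-separated set, and the number
    of possible values is bounded. [f0] is kept apart because its range may be much longer than that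
    of the others. *)
Lemma packing (T Ix : finType) (S : {set T}) (f0 : T -> R) (f : T -> Ix -> R) (c L0 L : R) (e : Ix -> R) :
  0 <= L0 -> 0 <= L -> (forall t, t \in S -> c <= f0 t <= c + L0) ->
  (forall t i, t \in S -> e i <= f t i <= e i + L) ->
  (forall t t', t \in S -> t' \in S -> t != t' -> 1 <= `|f0 t - f0 t'| \/ exists i, 1 <= `|f t i - f t' i|) ->
  #|S|%:R <= (L0 + 1) * (L + 1) ^+ #|Ix|.
Proof.
move=> L00 L10 h0 h1 sep.
pose phi t := (inord (Num.truncn (f0 t - c)), [ffun i => inord (Num.truncn (f t i - e i))])
  : 'I_(Num.truncn L0).+1 * {ffun Ix -> 'I_(Num.truncn L).+1}.
have tr (x l : R) : 0 <= x <= l -> (Num.truncn x < (Num.truncn l).+1)%N.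
  by move=> /andP[x0 xl]; rewrite ltnS; apply: le_truncn.
have lt1 (x y : R) : 0 <= x -> 0 <= y -> Num.truncn x = Num.truncn y -> `|x - y| < 1.
  move=> x0 y0 E; have := truncn_itv x0; have := truncn_itv y0; rewrite E -natr1.
  by move=> /andP[k1 k2] /andP[k3 k4]; rewrite ltr_norml; apply/andP; split; lra.
have inj : {in S &, injective phi}.
  move=> t t' tS t'S [E0 E1]; apply/eqP; apply: contraT => ne.
  have /andP[a1 a2] := h0 _ tS; have /andP[b1 b2] := h0 _ t'S.
  have [k|[i k]] := sep _ _ tS t'S ne.
    move/(congr1 val): E0 => /=; rewrite !inordK ?tr//; try (apply/andP; split; lra).
    move=> /(lt1 _ _ _ _); rewrite !subr_ge0 a1 b1 => /(_ isT isT).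
    by have -> : f0 t - c - (f0 t' - c) = f0 t - f0 t' by [ring]; rewrite ltNge k.
  have /andP[a3 a4] := h1 _ i tS; have /andP[b3 b4] := h1 _ i t'S.
  move/ffunP : E1 => /(_ i); rewrite !ffunE => /(congr1 val) /=.
  rewrite !inordK ?tr//; try (apply/andP; split; lra).
  move=> /(lt1 _ _ _ _); rewrite !subr_ge0 a3 b3 => /(_ isT isT).
  by have -> : f t i - e i - (f t' i - e i) = f t i - f t' i by [ring]; rewrite ltNge k.
have := max_card (mem (phi @: S)); rewrite (card_in_imset inj) card_prod card_ffun !card_ord.
rewrite -(ler_nat R) natrM natrX => h; apply: (le_trans h).
have tl (x : R) : 0 <= x -> (Num.truncn x).+1%:R <= x + 1 by move=> x0; rewrite -natr1 lerD2r truncn_le.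
by rewrite ler_pM// ?exprn_ge0// ?tl// lerXn2r// ?nnegrE ?tl// addr_ge0.
Qed.

Lemma sqr_sum_set_le (I : finType) (E : {set I}) (x : I -> R) :
  (\sum_(i in E) x i) ^+ 2 <= #|E|%:R * \sum_(i in E) x i ^+ 2.
Proof.
set s := \sum_(i in E) x i; set k := #|E|%:R : R.
have [k0|kn] := eqVneq k 0.
  have /eqP : (#|E|%:R : R) = 0 by []; rewrite pnatr_eq0 => /eqP/cards0_eq E0.
  by rewrite /s /k E0 big_set0 expr0n/= mulr_ge0//; apply: sumr_ge0 => i _; rewrite sqr_ge0.
have kp : 0 < k by rewrite lt0r kn ler0n.
have : 0 <= \sum_(i in E) (k * x i - s) ^+ 2 by apply: sumr_ge0 => i _; rewrite sqr_ge0.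
have -> : \sum_(i in E) (k * x i - s) ^+ 2 = k * (k * \sum_(i in E) x i ^+ 2 - s ^+ 2).
  transitivity (\sum_(i in E) (k ^+ 2 * x i ^+ 2 - 2 * k * s * x i + s ^+ 2)).
    by apply: eq_bigr => i _; ring.
  rewrite !big_split/= sumrN -!mulr_sumr sumr_const -/s.
  have -> : s * (s *+ #|E|) = k * s ^+ 2 by rewrite mulrnAr -expr2 -mulr_natl.
  by ring.
by rewrite pmulr_rge0// subr_ge0.
Qed.

(** Removing [Y] destroys at most twice the energy between [Y] and [X], by symmetry of [F]. *)
Lemma double_sum_le (U : finType) (F : U -> U -> R) (X Y : {set U}) :
  (forall u v, 0 <= F u v) -> (forall u v, F u v = F v u) -> Y \subset X ->
  \sum_(u in X) \sum_(v in X) F u v <=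
  \sum_(u in X :\: Y) \sum_(v in X :\: Y) F u v + 2 * \sum_(u in Y) \sum_(v in X) F u v.
Proof.
move=> F0 Fs YX.
have sp (f : U -> R) : \sum_(u in X) f u = \sum_(u in X :\: Y) f u + \sum_(u in Y) f u.
  by rewrite (big_setID Y)/= (finset.setIidPr YX) addrC.
rewrite sp.
have -> : \sum_(u in X :\: Y) \sum_(v in X) F u v =
    \sum_(u in X :\: Y) \sum_(v in X :\: Y) F u v + \sum_(u in X :\: Y) \sum_(v in Y) F u v.
  by rewrite -big_split/=; apply: eq_bigr => u _; rewrite sp.
have -> : \sum_(u in X :\: Y) \sum_(v in Y) F u v = \sum_(u in Y) \sum_(v in X :\: Y) F u v.
  by rewrite exchange_big/=; apply: eq_bigr => u _; apply: eq_bigr => v _.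
have : \sum_(u in Y) \sum_(v in X :\: Y) F u v <= \sum_(u in Y) \sum_(v in X) F u v.
  by apply: ler_sum => u _; rewrite [leRHS]sp lerDl; apply: sumr_ge0.
by lra.
Qed.

Lemma sum_fibers (U J : finType) (pr : U -> J) (X : {set U}) (h : R) : 0 <= h ->
  (forall u, u \in X -> h <= #|[set v in X | pr v == pr u]|%:R) ->
  h * #|[set pr u | u in X]|%:R <= #|X|%:R.
Proof.
move=> h0 hX; rewrite -[in leRHS]sum1_card (partition_big_imset pr)/= natr_sum mulr_natr -sumr_const.
apply: ler_sum => j /imsetP[u uX ->]; apply: (le_trans (hX u uX)).
rewrite -sum1_card ler_nat; apply/eq_leq; apply: eq_bigl => v; by rewrite inE.
Qed.

(* The pruned set maximises the energy penalised by its size and by the number of its fibres. *)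
Lemma pruning (U J : finType) (q : nat) (pr : U -> J) (I : {set U}) (F : 'I_q -> U -> U -> R) (h : R) :
  (0 < q)%N -> 0 <= h ->
  (forall s u v, 0 <= F s u v) -> (forall s u v, F s u v = F s v u) ->
  (forall u, u \in I -> \sum_s \sum_(v in I) F s u v = 1) ->
  (forall u, u \in I -> h <= #|[set v in I | pr v == pr u]|%:R) ->
  exists s (X : {set U}), [/\ X \subset I, #|I|%:R <= 2 * q%:R * #|X|%:R :> R,
    forall u, u \in X -> h / (8 * q%:R) <= #|[set v in X | pr v == pr u]|%:R &
    forall u, u \in X -> (8 * q%:R)^-1 <= \sum_(v in X) F s u v].
Proof.
move=> q0 h0 F0 Fs F1 hI; have qp : 0 < q%:R :> R by rewrite ltr0n.
(* Some class carries the fraction 1/q of the total energy [#|I|]; with weight 1/(4q) the two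
   penalties of [I] together take away at most half of that. *)
pose b : R := (4 * q%:R)^-1; have bp : 0 < b by rewrite invr_gt0 mulr_gt0.
pose Phi s (X : {set U}) : R := \sum_(u in X) \sum_(v in X) F s u v.
have [s hs] : exists s, #|I|%:R <= q%:R * Phi s I.
  apply/not_existsP => H; have : \sum_s q%:R * Phi s I < \sum_(s < q) #|I|%:R.
    apply: ltr_sum => [|s _]; last by rewrite ltNge; apply/negP; exact: H.
    by apply/hasP; exists (Ordinal q0); rewrite ?mem_index_enum.
  rewrite -mulr_sumr /Phi exchange_big/= sumr_const card_ord -[ltRHS]mulr_natl ltr_pM2l//.
  by rewrite (eq_bigr (fun=> 1))// sumr_const ltxx.
pose Psi (X : {set U}) : R := Phi s X - b * #|X|%:R - b * (h * #|[set pr u | u in X]|%:R).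
have [X XI Xmax] : exists2 X : {set U}, X \subset I & forall Y : {set U}, Y \subset I -> Psi Y <= Psi X.
  by case: (@arg_maxP _ _ _ I (fun Y : {set U} => Y \subset I) Psi) => // X XI h'; exists X.
have Fsum u : u \in I -> \sum_(v in X) F s u v <= 1.
  move=> uI; rewrite -(F1 u uI) (bigD1 s)//=.
  have : \sum_(v in X) F s u v <= \sum_(v in I) F s u v.
    by rewrite [leRHS](big_setID X)/= (finset.setIidPr XI) lerDl; apply: sumr_ge0.
  have : 0 <= \sum_(i < q | i != s) \sum_(v in I) F i u v by do 2 (apply: sumr_ge0 => ? _).
  by lra.
have XIu u : u \in X -> u \in I by move/(fintype.subsetP XI).
(* Maximality of [X] against [X :\: Y]: the penalty saved by removing [Y] is at most the energy
   lost. *)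
have rem (Y : {set U}) : Y \subset X ->
    b * #|Y|%:R + b * (h * #|[set pr u | u in X]|%:R) - b * (h * #|[set pr u | u in X :\: Y]|%:R)
    <= 2 * \sum_(u in Y) \sum_(v in X) F s u v.
  move=> YX; have := Xmax (X :\: Y) (fintype.subset_trans (finset.subsetDl _ _) XI).
  have := double_sum_le (F0 s) (Fs s) YX; rewrite /Psi -/(Phi s X) -/(Phi s (X :\: Y)).
  have -> : #|X|%:R = #|Y|%:R + #|X :\: Y|%:R :> R.
    by rewrite -natrD -(cardsID Y X) (finset.setIidPr YX).
  by rewrite mulrDr; lra.
have mono (Y : {set U}) : b * (h * #|[set pr u | u in X :\: Y]|%:R) <= b * (h * #|[set pr u | u in X]|%:R).
  by rewrite ler_wpM2l ?(ltW bp)// ler_wpM2l// ler_nat subset_leq_card// imsetS// finset.subsetDl.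
have b8 : b = 2 * (8 * q%:R)^-1 by rewrite /b; field; rewrite gt_eqF.
exists s, X; split=> //.
- have PX : Phi s X <= #|X|%:R.
    rewrite /Phi -sum1_card natr_sum; apply: ler_sum => u /XIu; exact: Fsum.
  have := Xmax I (subxx _); rewrite /Psi => hmax.
  have fib := sum_fibers h0 hI; have bfib := ler_wpM2l (ltW bp) fib.
  have X0 : 0 <= b * (h * #|[set pr u | u in X]|%:R) by rewrite !mulr_ge0// ltW.
  have X1 : 0 <= b * #|X|%:R by rewrite mulr_ge0// ltW.
  have bI : q%:R * (b * #|I|%:R) = #|I|%:R / 4 by rewrite /b; field; rewrite gt_eqF.
  have : Phi s I - 2 * (b * #|I|%:R) <= #|X|%:R by lra.
  by move=> /(ler_wpM2l (ltW qp)); lra.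
(* Removing a whole fibre also lowers the number of fibres by one, which saves [b * h]; a fibre that
   is too small would not survive. *)
- move=> u uX; pose Y := [set v in X | pr v == pr u].
  have YX : Y \subset X by apply/fintype.subsetP => v; rewrite inE => /andP[].
  have := rem Y YX; have Ysum : \sum_(u in Y) \sum_(v in X) F s u v <= #|Y|%:R.
    rewrite -sum1_card natr_sum; apply: ler_sum => v /(fintype.subsetP YX)/XIu; exact: Fsum.
  have img : (#|[set pr u | u in X :\: Y]| < #|[set pr u | u in X]|)%N.
    apply: proper_card; apply/fintype.properP; split; first by rewrite imsetS// finset.subsetDl.
    exists (pr u); first exact: imset_f.
    apply/imsetP => -[v]; rewrite !inE => /andP[+ vX] E.
    by rewrite vX -E eqxx.
  have : (#|[set pr u | u in X :\: Y]|%:R + 1 <= #|[set pr u | u in X]|%:R :> R) by rewrite natr1 ler_nat.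
  move=> /(ler_wpM2l h0)/(ler_wpM2l (ltW bp)); rewrite mulrDr mulr1 mulrDr.
  have : 0 <= b * #|Y|%:R by rewrite mulr_ge0// ltW.
  rewrite -/Y; have -> : b * h = 2 * (h / (8 * q%:R)) by rewrite b8; ring.
  by lra.
move=> u uX; have := rem [set u]; rewrite finset.sub1set => /(_ uX).
have := mono [set u]; rewrite cards1 big_set1 b8; lra.
Qed.

End Counting.

(** * The hairbrush argument for lines over a hyperplane *)

Section Wolff.
Local Close Scope classical_set_scope.
Local Open Scope set_scope.
Local Open Scope ring_scope.
Variables (R : realType) (n : nat) (J P : finType).
Variables (x w : J -> 'I_n -> R) (lev : P -> R) (pos : P -> 'I_n -> R) (A N : R).
Hypotheses (n0 : (0 < n)%N) (A1 : 1 <= A) (N1 : 1 <= N).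
Hypothesis sepx : forall j k, j != k -> exists i, 1 <= `|x j i - x k i|.
Hypothesis sepp : forall z z', z != z' -> 1 <= `|lev z - lev z'| \/
  lev z = lev z' /\ exists i, 1 <= `|pos z i - pos z' i|.
Hypothesis levb : forall z, `|lev z| <= N.
Hypothesis wb : forall j i, `|w j i| <= 1.
Variable I : {set J * P}.
Hypothesis inc : forall j z, (j, z) \in I -> forall i, `|pos z i - x j i - lev z * w j i| <= A.

Let A0 : 0 < A. Proof. by have := A1; lra. Qed.
Let N0 : 0 < N. Proof. by have := N1; lra. Qed.
Let T2 : R := (2 * A + 1) ^+ n.
Let T21 : 1 <= T2. Proof. by rewrite exprn_ege1//; have := A0; lra. Qed.

Lemma near_count (c : 'I_n -> R) (rho : R) (S : {set J}) : 0 <= rho ->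
  (forall j i, j \in S -> `|x j i - c i| <= rho) -> #|S|%:R <= (2 * rho + 1) ^+ n.
Proof.
move=> r0 hS; apply: (@le_trans _ _ ((0 + 1) * (2 * rho + 1) ^+ n)); last by rewrite add0r mul1r.
have := @packing R _ _ S (fun=> 0) x 0 0 (2 * rho) (fun i => c i - rho).
rewrite card_ord; apply => //.
- by rewrite mulr_ge0.
- by move=> t _; rewrite addr0 lexx.
- by move=> t i tS; have := hS _ i tS; rewrite ler_norml => /andP[h1 h2]; apply/andP; split; lra.
- by move=> t t' _ _ /sepx; right.
Qed.

(** Subtracting the line from [pos] confines the transverse coordinates to an interval of length
    [2 * A], so only the level has a long range. *)
Lemma tube_count j (b1 b2 : R) (S : {set P}) : b1 <= b2 ->
  (forall z, z \in S -> (j, z) \in I /\ b1 <= lev z <= b2) -> #|S|%:R <= (b2 - b1 + 1) * T2.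
Proof.
move=> b12 hS; have := @packing R _ _ S lev (fun z i => pos z i - x j i - lev z * w j i) b1 (b2 - b1) (2 * A) (fun=> - A).
rewrite card_ord; apply => //.
- by rewrite subr_ge0.
- by rewrite mulr_ge0// ltW.
- by move=> z /hS[_ h]; rewrite addrC subrK.
- by move=> z i /hS[/inc/(_ i)]; rewrite ler_norml => /andP[h1 h2] _; apply/andP; split; lra.
- move=> z z' _ _ /sepp[h|[h [i hi]]]; [by left|right; exists i].
  by rewrite h; apply: (le_trans hi); rewrite le_eqVlt; apply/orP; left; apply/eqP; congr `|_|; ring.
Qed.

(** Shearing along [V] leaves one long coordinate [i0], where [V] is largest, and confines the other
    n - 1. The factor 2 restores separation: if the [i0] coordinates differ by less than 1/2, some
    sheared coordinate still differs by at least 1/2. *)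
Lemma line_count (e V : 'I_n -> R) (c0 : R) i0 (rho B : R) (S : {set J}) : 0 <= rho -> 0 <= B ->
  V i0 != 0 -> (forall i, `|V i| <= `|V i0|) ->
  (forall j, j \in S -> `|x j i0 - c0| <= B /\ exists m, forall i, `|x j i - e i - m * V i| <= rho) ->
  #|S|%:R <= (4 * B + 1) * (8 * rho + 1) ^+ n.-1.
Proof.
move=> r0 B0 Vn VV hS; pose s i := V i / V i0.
have s1 i : `|s i| <= 1 by rewrite /s normrM normfV ler_pdivrMr ?normr_gt0// mul1r.
have := @packing R _ {i : 'I_n | i != i0} S (fun j => 2 * x j i0)
  (fun j i => 2 * ((x j (val i) - e (val i)) - s (val i) * (x j i0 - e i0))) (2 * (c0 - B)) (4 * B) (8 * rho) (fun=> - (4 * rho)).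
rewrite card_sig; have -> : #|[pred i | i != i0]| = n.-1 by rewrite (cardC1 i0) card_ord.
apply.
- by rewrite mulr_ge0.
- by rewrite mulr_ge0.
- by move=> j /hS[]; rewrite ler_norml => /andP[h1 h2] _; apply/andP; split; lra.
- move=> j i /hS[_ [m hm]]; have h1 := hm (val i); have h2 := hm i0.
  have E : x j (val i) - e (val i) - s (val i) * (x j i0 - e i0) =
    (x j (val i) - e (val i) - m * V (val i)) - s (val i) * (x j i0 - e i0 - m * V i0).
    by rewrite /s; field.
  have : `|x j (val i) - e (val i) - s (val i) * (x j i0 - e i0)| <= rho + rho.
    rewrite E (le_trans (ler_normB _ _))// lerD// normrM -[leRHS]mul1r.
    by rewrite ler_pM.
  by rewrite ler_norml => /andP[k1 k2]; apply/andP; split; lra.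
- move=> j k _ _ /sepx[i hi]; have [E|ne] := eqVneq i i0.
    by left; rewrite -mulrBr normrM normr_nat -E; lra.
  have [h|h] := leP 1 `|2 * x j i0 - 2 * x k i0|; first by left.
  right; exists (exist _ i ne) => /=; rewrite -mulrBr normrM normr_nat.
  rewrite -mulrBr normrM normr_nat in h.
  have -> : x j i - e i - s i * (x j i0 - e i0) - (x k i - e i - s i * (x k i0 - e i0)) = (x j i - x k i) - s i * (x j i0 - x k i0) by ring.
  have h' : `|s i * (x j i0 - x k i0)| <= `|x j i0 - x k i0| by rewrite normrM ler_piMl.
  have := lerB_dist (x j i - x k i) (s i * (x j i0 - x k i0)); lra.
Qed.

Lemma meet_diff j k z i : (j, z) \in I -> (k, z) \in I ->
  `|x j i - x k i + lev z * (w j i - w k i)| <= 2 * A.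
Proof.
move=> /inc/(_ i) h1 /inc/(_ i) h2.
have -> : x j i - x k i + lev z * (w j i - w k i) = (pos z i - x k i - lev z * w k i) - (pos z i - x j i - lev z * w j i) by ring.
by rewrite (le_trans (ler_normB _ _))//; lra.
Qed.

Variables (K : R) (M : nat).
Hypotheses (K2 : 2 <= K) (KM : K ^+ M = N).

Let K0 : 0 < K. Proof. by have := K2; lra. Qed.

(** Angle scales, from 2, the largest possible difference of slopes, down to 2/N at s = M, below
    which two tubes cannot be told apart by their directions. *)
Definition th (s : nat) : R := 2 / K ^+ s.

Let th0 s : 0 < th s. Proof. by rewrite divr_gt0// exprn_gt0. Qed.

Let thN s : (s <= M)%N -> 2 <= th s * N.
Proof.
move=> sM; rewrite /th mulrAC ler_pdivlMr ?exprn_gt0// ler_pM2l// -KM.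
by rewrite ler_weXn2l//; have := K2; lra.
Qed.

Let Kth s : 1 <= 2 * (K / th s).
Proof.
have -> : 2 * (K / th s) = K ^+ s.+1.
  by rewrite /th exprS; field; rewrite expf_neq0// gt_eqF.
by rewrite exprn_ege1//; have := K2; lra.
Qed.

(** [cls] is the finest scale at which two slopes are close; by [clsP], unless it is the last scale,
    the slopes differ by more than [th s / K] in some coordinate. *)
Definition wclose (t : R) j k := [forall i, `|w j i - w k i| <= t].

Definition cls j k : 'I_M.+1 :=
  fintype.arg_max ord0 (fun s : 'I_M.+1 => wclose (th s) j k) (fun s => nat_of_ord s).

Lemma wcloseC t j k : wclose t j k = wclose t k j.
Proof. by apply: eq_forallb => i; rewrite distrC. Qed.

Lemma clsC j k : cls j k = cls k j.
Proof.
rewrite /cls; congr (odflt _ _); apply: eq_pick => s /=; rewrite wcloseC; congr (_ && _).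
by apply: eq_forallb => s'; rewrite wcloseC.
Qed.

Lemma clsP j k : wclose (th (cls j k)) j k /\ ((cls j k < M)%N -> exists i, th (cls j k) / K < `|w j i - w k i|).
Proof.
rewrite /cls; case: arg_maxnP => [|s hs smax].
  apply/forallP => i; rewrite /th expr0 divr1.
  by rewrite (le_trans (ler_normB _ _))//; have := wb j i; have := wb k i; lra.
split=> // sM; apply/not_existsP => H.
have sM' : (s.+1 < M.+1)%N by rewrite ltnS.
have /(smax (Ordinal sM')) : wclose (th (Ordinal sM')) j k.
  apply/forallP => i /=; have -> : th s.+1 = th s / K by rewrite /th exprS; field; rewrite expf_neq0 ?gt_eqF.
  by rewrite leNgt; apply/negP; exact: H.
by rewrite /= ltnn.
Qed.

Lemma cls_le j k i : `|w j i - w k i| <= th (cls j k).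
Proof. by have [/forallP/(_ i)] := clsP j k. Qed.

(** Lines that meet at a level at most N with slopes differing by at most [th] have base points
    within about [th * N]. Since [th * N >= 2], the error [2 * A] of an incidence is absorbed. *)
Lemma meet_dist j k z i : (j, z) \in I -> (k, z) \in I -> `|x j i - x k i| <= (A + 1) * (th (cls j k) * N).
Proof.
move=> jz kz; have h1 := meet_diff i jz kz; have h2 := cls_le j k i.
have -> : x j i - x k i = (x j i - x k i + lev z * (w j i - w k i)) - lev z * (w j i - w k i) by ring.
rewrite (le_trans (ler_normB _ _))// normrM.
have h3 : `|lev z| * `|w j i - w k i| <= N * th (cls j k) by rewrite ler_pM.
have h4 := @thN (cls j k) (leq_ord _).
have : A * 2 <= A * (th (cls j k) * N) by rewrite ler_wpM2l// ltW.
by lra.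
Qed.

Let C5 : R := T2 * (8 * A + 6).
Let C50 : 0 < C5. Proof. by rewrite mulr_gt0//; have := T21; have := A0; lra. Qed.

(** Two lines whose slopes differ by more than t/K in a coordinate are close only on a range of
    levels of length about K/t. At the last scale K/t is comparable to K N, and the full length of
    the tube is a sufficient bound. *)
Lemma inter_count j k (S : {set P}) : (forall z, z \in S -> (j, z) \in I /\ (k, z) \in I) ->
  #|S|%:R <= C5 * (K / th (cls j k)).
Proof.
move=> hS; set t := th _; have Kt := Kth (cls j k); rewrite -/t in Kt.
have T20 : 0 < T2 by have := T21; lra.
have fin (D : R) : 0 <= D -> D + 1 <= (8 * A + 6) * (K / t) -> (D + 1) * T2 <= C5 * (K / t).
  by move=> D0 hD; rewrite /C5 -mulrA mulrC ler_wpM2l// ltW.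
have [sM|] := ltnP (cls j k) M; last first.
  move=> sM; have E : nat_of_ord (cls j k) = M by apply/eqP; rewrite eqn_leq sM leq_ord.
  have h : #|S|%:R <= (N - - N + 1) * T2.
    apply: (@tube_count j); first by have := N0; lra.
    by move=> z /hS[jz _]; split=> //; have := levb z; rewrite ler_norml.
  apply: (le_trans h); apply: fin; first by have := N0; lra.
  have KN : N <= K / t.
    have -> : K / t = (K / 2) * N.
      by rewrite /t E /th -KM; field; rewrite expf_neq0// gt_eqF.
    by rewrite ler_peMl ?(ltW N0)// ler_pdivlMr//; have := K2; lra.
  have : 6 * (K / t) <= (8 * A + 6) * (K / t) by rewrite ler_wpM2r//; have := A0; have := N0; lra.
  by have := N1; lra.
have [S0|[z1 z1S]] := set_0Vmem S; first by rewrite S0 finset.cards0 mulr_ge0 ?(ltW C50)//; lra.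
have [_ /(_ sM)[i hi]] := clsP j k; rewrite -/t in hi.
pose D := 4 * A * (K / t).
have Kt0 : 0 <= K / t by lra.
have D0 : 0 <= D by rewrite mulr_ge0// mulr_ge0// ltW.
have h : #|S|%:R <= (lev z1 + D - (lev z1 - D) + 1) * T2.
  apply: (@tube_count j); first by lra.
  move=> z zS; have [jz kz] := hS _ zS; have [jz1 kz1] := hS _ z1S; split=> //.
  have h1 := meet_diff i jz kz; have h2 := meet_diff i jz1 kz1.
  suff : `|lev z - lev z1| <= D by rewrite ler_norml => /andP[k1 k2]; apply/andP; split; lra.
  have h3 : `|lev z - lev z1| * `|w j i - w k i| <= 4 * A.
    rewrite -normrM; have -> : (lev z - lev z1) * (w j i - w k i) =
      (x j i - x k i + lev z * (w j i - w k i)) - (x j i - x k i + lev z1 * (w j i - w k i)) by ring.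
    by rewrite (le_trans (ler_normB _ _))//; lra.
  have tK : 0 < t / K by rewrite divr_gt0// th0.
  have h4 : `|lev z - lev z1| * (t / K) <= 4 * A.
    by apply: (le_trans _ h3); rewrite ler_wpM2l// ltW.
  by rewrite /D -[K / t]invf_div ler_pdivlMr.
apply: (le_trans h); have -> : lev z1 + D - (lev z1 - D) + 1 = 2 * D + 1 by ring.
by apply: fin; [rewrite mulr_ge0|rewrite /D; lra].
Qed.

(** If [k] and [k'] meet the stem [j] and each other away from it, then up to an error rho the base
    point of [k'] lies on the line through that of [j] in direction [w k - w j]. Hence about th N
    rho^(n-1) lines [k'] of class s relative to [k], each sharing about K/th cells with it: the
    product does not depend on the scale, and there are M+1 scales. *)
Lemma hairbrush_inter j (H : {set J}) (zk : J -> P) (G : J -> {set P}) (tau : R) k : 0 < tau ->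
  (forall k, k \in H -> [/\ (j, zk k) \in I, (k, zk k) \in I & (cls j k < M)%N]) ->
  (forall k z, k \in H -> z \in G k -> (k, z) \in I /\ tau <= `|lev z - lev (zk k)|) ->
  k \in H ->
  \sum_(k' in H) #|G k :&: G k'|%:R <=
    M.+1%:R * ((4 * A + 5) * C5 * N * K * (8 * (2 * A + 6 * A * N / tau) + 1) ^+ n.-1).
Proof.
move=> tau0 hH hG kH; set rho := 2 * A + 6 * A * N / tau.
have rho0 : 0 <= rho by rewrite addr_ge0 ?divr_ge0 ?mulr_ge0 ?(ltW A0) ?(ltW N0) ?(ltW tau0).
rewrite (partition_big (fun k' => cls k k') xpredT)//=.
apply: (@le_trans _ _ (\sum_(s < M.+1) ((4 * A + 5) * C5 * N * K * (8 * rho + 1) ^+ n.-1))); last first.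
  by rewrite sumr_const card_ord -[leLHS]mulr_natl.
apply: ler_sum => s _.
pose S := [set k' in H | (cls k k' == s) && (G k :&: G k' != finset.set0)].
have tN := @thN s (leq_ord s).
apply: (@le_trans _ _ (\sum_(k' in S) C5 * (K / th s))).
  rewrite [leLHS](bigID (fun k' => G k :&: G k' != finset.set0))/= [X in _ + X]big1 ?addr0; last first.
    by move=> k' /andP[_]; rewrite negbK => /eqP ->; rewrite finset.cards0.
  rewrite (eq_bigl (fun k' => k' \in S)); last by move=> k'; rewrite inE andbA.
  apply: ler_sum => k'; rewrite inE => /andP[k'H /andP[/eqP sE _]].
  rewrite -sE; apply: inter_count => z; rewrite inE => /andP[z1 z2].
  by have [h1 _] := hG _ _ kH z1; have [h2 _] := hG _ _ k'H z2.
rewrite sumr_const -[leLHS]mulr_natl.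
have [i0 i0max] : exists i0, forall i, `|w k i - w j i| <= `|w k i0 - w j i0|.
  have [i0 _ h] := @arg_maxP _ _ _ (Ordinal n0) xpredT (fun i => `|w k i - w j i|) isT.
  by exists i0 => i; exact: h.
have [jzk kzk skM] := hH _ kH.
have Vn : w k i0 - w j i0 != 0.
  have [_ /(_ skM)[i hi]] := clsP j k; rewrite -normr_gt0 (lt_le_trans _ (i0max i))// distrC.
  by rewrite (le_lt_trans _ hi)// divr_ge0// ltW// th0.
have cS : #|S|%:R <= (4 * ((A + 1) * (th s * N)) + 1) * (8 * rho + 1) ^+ n.-1.
  apply: (@line_count (x j) (fun i => w k i - w j i) (x k i0) i0) => //.
    have tN0 : 0 <= th s * N by lra.
    by rewrite mulr_ge0//; have := A0; lra.
  move=> k'; rewrite inE => /andP[k'H /andP[/eqP sE /set0Pn[z]]]; rewrite inE => /andP[zk1 zk2].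
  have [kz ktau] := hG _ _ kH zk1; have [k'z k'tau] := hG _ _ k'H zk2.
  split; first by have := meet_dist i0 k'z kz; rewrite clsC sE.
  have [jzk' k'zk' _] := hH _ k'H.
  set l := lev (zk k'); set L := lev z in ktau k'tau *; set l0 := lev (zk k) in ktau.
  have Ln : L - l != 0 by rewrite -normr_gt0 (lt_le_trans tau0).
  (* Obtained by eliminating [w k' - w j] from the three approximate meeting relations [R1], [R2],
     [R3]; dividing by [L - l], at least tau in size, produces the term [6 * A * N / tau] of rho. *)
  exists (- l * ((L - l0) / (L - l))) => i.
  have r1 := meet_diff i kzk jzk; have r2 := meet_diff i k'zk' jzk'; have r3 := meet_diff i kz k'z.
  rewrite -/l -/L -/l0 in r1 r2 r3.
  set R1 := x k i - x j i + l0 * (w k i - w j i) in r1.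
  set R2 := x k' i - x j i + l * (w k' i - w j i) in r2.
  set R3 := x k i - x k' i + L * (w k i - w k' i) in r3.
  have -> : x k' i - x j i - - l * ((L - l0) / (L - l)) * (w k i - w j i) = R2 - l * ((R1 - R3 - R2) / (L - l)).
    by rewrite /R1 /R2 /R3; field.
  rewrite (le_trans (ler_normB _ _))// /rho lerD// normrM [6 * A * N]mulrC -mulrA.
  rewrite ler_pM//; first exact: levb.
  rewrite normrM normfV ler_pM ?invr_ge0//.
    rewrite (le_trans (ler_normB _ _))//; have := ler_normB R1 R3; lra.
  by rewrite lef_pV2 ?posrE// normr_gt0.
apply: (@le_trans _ _ ((4 * ((A + 1) * (th s * N)) + 1) * (8 * rho + 1) ^+ n.-1 * (C5 * (K / th s)))).
  by rewrite ler_wpM2r// mulr_ge0 ?(ltW C50)// divr_ge0 ?(ltW K0) ?(ltW (th0 s)).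
have rr : 0 <= (8 * rho + 1) ^+ n.-1 by rewrite exprn_ge0// addr_ge0// mulr_ge0.
have e1 : (4 * ((A + 1) * (th s * N)) + 1) <= (4 * A + 5) * (th s * N) by lra.
have e2 : (4 * A + 5) * C5 * N * K * (8 * rho + 1) ^+ n.-1 = (4 * A + 5) * (th s * N) * ((8 * rho + 1) ^+ n.-1 * (C5 * (K / th s))).
  by field; rewrite gt_eqF// th0.
rewrite e2 -mulrA ler_wpM2r// mulr_ge0// mulr_ge0 ?(ltW C50)// divr_ge0 ?(ltW K0) ?(ltW (th0 s))//.
Qed.

(* Cauchy-Schwarz for the incidences between the far parts of a hairbrush and the cells they cover. *)
Lemma hairbrush (H : {set J}) (G : J -> {set P}) (Ej : {set P}) (gg W : R) : 0 <= gg -> 0 <= W ->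
  (forall k, k \in H -> G k \subset Ej) -> (forall k, k \in H -> gg <= #|G k|%:R) ->
  (forall k, k \in H -> \sum_(k' in H) #|G k :&: G k'|%:R <= W) ->
  #|H|%:R * gg ^+ 2 <= #|Ej|%:R * W.
Proof.
move=> g0 W0 GE hg hW; pose c z : R := \sum_(k in H) (z \in G k)%:R.
have cardE (S : {set P}) : S \subset Ej -> #|S|%:R = \sum_(z in Ej) (z \in S)%:R :> R.
  move=> SE; rewrite -sum1_card natr_sum [RHS](bigID (fun z => z \in S))/=.
  rewrite [X in _ + X]big1 ?addr0; last by move=> z /andP[_ /negbTE ->].
  apply: eq_big => [z|z]; last by move=> ->.
  by case zS : (z \in S); rewrite ?andbF// andbT; apply/esym/(fintype.subsetP SE).
have s1 : #|H|%:R * gg <= \sum_(z in Ej) c z.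
  rewrite /c exchange_big/= mulr_natl -sumr_const; apply: ler_sum => k kH.
  by rewrite -cardE ?GE// hg.
have s2 : \sum_(z in Ej) c z ^+ 2 <= #|H|%:R * W.
  have -> : \sum_(z in Ej) c z ^+ 2 = \sum_(k in H) \sum_(k' in H) #|G k :&: G k'|%:R.
    transitivity (\sum_(z in Ej) \sum_(k in H) \sum_(k' in H) (z \in G k :&: G k')%:R : R).
      apply: eq_bigr => z _; rewrite expr2 /c mulr_suml; apply: eq_bigr => k _.
      by rewrite mulr_sumr; apply: eq_bigr => k' _; rewrite inE -mulnb natrM.
    rewrite exchange_big/=; apply: eq_bigr => k kH; rewrite exchange_big/=; apply: eq_bigr => k' _.
    by rewrite -cardE// (fintype.subset_trans (finset.subsetIl _ _))// GE.
  by rewrite mulr_natl -sumr_const; apply: ler_sum => k kH; exact: hW.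
have cs := sqr_sum_set_le Ej c.
have H0 : 0 <= #|H|%:R * gg by rewrite mulr_ge0.
have [Hz|Hn] := eqVneq #|H| 0%N; first by rewrite Hz mul0r mulr_ge0.
have Hp : 0 < #|H|%:R :> R by rewrite ltr0n lt0n.
rewrite -(ler_pM2l Hp).
have -> : #|H|%:R * (#|H|%:R * gg ^+ 2) = (#|H|%:R * gg) ^+ 2 by ring.
apply: (@le_trans _ _ ((\sum_(z in Ej) c z) ^+ 2)).
  by rewrite ler_pXn2r// nnegrE// (le_trans H0).
rewrite (le_trans cs)// mulrCA ler_wpM2l//.
Qed.

(** Union bound, applied once to lines covered by cells and once to lines covered by balls. *)
Lemma cover_count (T T' : finType) (S : {set T}) (V : {set T'}) (nb : T' -> {set T}) :
  (forall j, j \in S -> exists2 v, v \in V & j \in nb v) -> (#|S| <= \sum_(v in V) #|nb v|)%N.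
Proof.
move=> hS; have SV : S \subset \bigcup_(v in V) nb v.
  by apply/fintype.subsetP => j /hS[v vV jv]; apply/finset.bigcupP; exists v.
apply: (leq_trans (subset_leq_card SV)).
apply: (big_ind2 (fun (a : {set T}) b => (#|a| <= b)%N)) => [|a1 b1 a2 b2 h1 h2|v _] //.
  by rewrite finset.cards0.
by rewrite (leq_trans (leq_card_setU _ _))// leq_add.
Qed.

(** Take a maximal 2B-separated subset V of [S]. The B-balls about V share no point of [S] and each
    holds the fraction 1/Q of [S], so V has at most Q elements; by maximality the 3B-balls about V
    cover the B-neighbourhood of [S]. *)
Lemma neighbour_count (S : {set J}) (B Q : R) : 0 <= B -> 0 < Q ->
  (forall k, k \in S -> #|S|%:R / Q <= #|[set k' in S | [forall i, `|x k' i - x k i| <= B]]|%:R) ->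
  #|[set j | [exists k in S, [forall i, `|x j i - x k i| <= B]]]|%:R <= Q * (6 * B + 1) ^+ n.
Proof.
move=> B0 Q0 hS; pose cl r k k' := [forall i, `|x k i - x k' i| <= r].
pose sepd (V : {set J}) := [forall v in V, forall v' in V, (v != v') ==> ~~ cl (2 * B) v v'].
have : (finset.set0 \subset S) && sepd finset.set0.
  by rewrite finset.sub0set/=; apply/forall_inP => v; rewrite inE.
case/(@arg_maxnP _ _ (fun V : {set J} => (V \subset S) && sepd V) (fun V => #|V|)) => V /andP[VS /forall_inP Vsep] Vmax.
have [S0|[k0 k0S]] := set_0Vmem S.
  have -> : [set j | [exists k in S, [forall i, `|x j i - x k i| <= B]]] = finset.set0.
    by apply/setP => j; rewrite !inE S0; apply/negbTE/exists_inP => -[k]; rewrite inE.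
  by rewrite finset.cards0 mulr_ge0 ?(ltW Q0)// exprn_ge0// addr_ge0// mulr_ge0.
have Sp : 0 < #|S|%:R :> R by rewrite ltr0n card_gt0; apply/set0Pn; exists k0.
have cV : #|V|%:R <= Q.
  have le1 : \sum_(v in V) #|S|%:R / Q <= #|S|%:R.
    apply: (@le_trans _ _ (\sum_(v in V) #|[set k' in S | cl B k' v]|%:R)).
      by apply: ler_sum => v vV; apply: hS; exact: (fintype.subsetP VS).
    apply: (@le_trans _ _ (\sum_(v in V) \sum_(y in S) (cl B y v)%:R)).
      apply: ler_sum => v vV; rewrite -sum1_card natr_sum (bigID (fun y => cl B y v) (fun y => y \in S))/=.
      rewrite -[leLHS]addr0 lerD//; last by apply: sumr_ge0.
      by rewrite le_eqVlt; apply/orP; left; apply/eqP; apply: eq_big => [y|y]; rewrite ?inE// => /andP[_ ->].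
    rewrite exchange_big/= -sum1_card natr_sum; apply: ler_sum => y yS.
    have [/exists_inP[v vV yv]|] := boolP [exists v in V, cl B y v]; last first.
      rewrite negb_exists_in => /forall_inP h; rewrite big1// => v vV.
      by rewrite (negbTE (h v vV)).
    rewrite (bigD1 v)//= yv big1 ?addr0// => v' /andP[v'V v'v].
    move/forall_inP : (Vsep _ vV) => /(_ _ v'V); rewrite eq_sym v'v/= => /negP h.
    case y' : (cl B y v') => //; exfalso; apply: h; apply/forallP => i.
    have -> : x v i - x v' i = (x y i - x v' i) - (x y i - x v i) by ring.
    rewrite (le_trans (ler_normB _ _))//.
    by have /forallP/(_ i) := y'; have /forallP/(_ i) := yv; lra.
  rewrite sumr_const -[leLHS]mulr_natl mulrCA ger_pMr// ler_pdivrMr// mul1r in le1.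
  exact: le1.
have near_V k : k \in S -> exists2 v, v \in V & cl (2 * B) k v.
  move=> kS; apply/exists_inP; apply: contraT; rewrite negb_exists_in => /forall_inP h.
  have kV : k \notin V.
    apply/negP => /h /negP; apply; apply/forallP => i.
    by rewrite subrr normr0 mulr_ge0.
  have /Vmax : (k |: V \subset S) && sepd (k |: V); last by rewrite /= cardsU1 kV add1n ltnn.
  rewrite finset.subUset finset.sub1set kS VS/=; apply/forall_inP => v; rewrite !inE => /orP[/eqP ->|vV].
    apply/forall_inP => v'; rewrite !inE => /orP[/eqP ->|v'V]; first by rewrite eqxx.
    by apply/implyP => _; exact: h.
  apply/forall_inP => v'; rewrite !inE => /orP[/eqP ->|v'V]; last by move/forall_inP : (Vsep _ vV); exact.
  apply/implyP => _; apply/negP => /forallP vk; move/negP: (h v vV); apply; apply/forallP => i.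
  by rewrite distrC.
have := @cover_count _ _ [set j | [exists k in S, cl B j k]] V (fun v => [set j | cl (3 * B) j v]).
move=> /(_ _)/wrap[j|].
  rewrite inE => /exists_inP[k kS jk]; have [v vV kv] := near_V k kS; exists v; rewrite // inE.
  apply/forallP => i; have -> : x j i - x v i = (x j i - x k i) + (x k i - x v i) by ring.
  rewrite (le_trans (ler_normD _ _))//.
  by have /forallP/(_ i) := jk; have /forallP/(_ i) := kv; lra.
rewrite -(ler_nat R) => hc; apply: (le_trans hc); rewrite natr_sum.
apply: (@le_trans _ _ (\sum_(v in V) (6 * B + 1) ^+ n)).
  apply: ler_sum => v _; have -> : 6 * B + 1 = 2 * (3 * B) + 1 by ring.
  apply: (@near_count (x v)); first by rewrite mulr_ge0.
  by move=> j i; rewrite inE => /forallP.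
by rewrite sumr_const -[leLHS]mulr_natl ler_wpM2r// exprn_ge0// addr_ge0// mulr_ge0.
Qed.

Variables (h t : R) (E : {set P}).
Hypotheses (h0 : 0 < h) (t0 : 0 < t) (tJ : t ^+ n = #|J|%:R).
Hypothesis hI : forall j, h <= #|[set u in I | u.1 == j]|%:R.
Hypothesis IE : forall j z, (j, z) \in I -> z \in E.

Let q : R := M.+1%:R.
Let q1 : 1 <= q. Proof. by rewrite /q ler1n. Qed.

Let m1 : 1 <= #|J|%:R :> R.
Proof. by rewrite ler1n -(ltr0n R) -tJ exprn_gt0. Qed.

Let fiber (X : {set J * P}) j : #|[set u in X | u.1 == j]| = #|[set z | (j, z) \in X]|.
Proof.
rewrite -(card_imset (mem [set z | (j, z) \in X]) (f := fun z => (j, z))); last by move=> z z' [].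
apply: eq_card => -[j' z]; rewrite !inE/=; apply/andP/imsetP => [[uX /eqP <-]|[z' z'X [-> ->]]].
  by exists z; rewrite // inE.
by rewrite inE in z'X; rewrite z'X.
Qed.

Lemma h_le : h <= 3 * T2 * N.
Proof.
have [j _] : exists j : J, true by have := m1; rewrite ler1n => /card_gt0P[j _]; exists j.
apply: (le_trans (hI j)); rewrite fiber; apply: (@le_trans _ _ ((N - - N + 1) * T2)).
  apply: (@tube_count j); first by have := N0; lra.
  by move=> z; rewrite inE => jz; split=> //; have := levb z; rewrite ler_norml.
rewrite mulrAC ler_wpM2r//; first by have := T21; lra.
by have := N1; lra.
Qed.

(** The trivial bound, for [h] below a constant: each line passes through some cell of [E], and a
    cell meets at most about N^n lines. [t] is the n-th root of the number of lines. *)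
Lemma few_incidences : #|J|%:R * t <= #|E|%:R ^+ 2 * ((2 * A + 3) * N) ^+ n.+1.
Proof.
have := @cover_count _ _ [set: J]%SET E (fun z => [set j | (j, z) \in I]).
move=> /(_ _)/wrap[j _|].
  have : 0 < #|[set u in I | u.1 == j]|%:R :> R by exact: lt_le_trans h0 (hI j).
  rewrite ltr0n card_gt0 => /set0Pn[[j' z]]; rewrite inE/= => /andP[uI /eqP E1].
  by exists z; [exact: IE uI|rewrite inE -E1].
rewrite finset.cardsT -(ler_nat R) natr_sum => hc.
have hc2 : #|J|%:R <= #|E|%:R * ((2 * A + 3) * N) ^+ n.
  apply: (le_trans hc); rewrite mulr_natl -sumr_const; apply: ler_sum => z _.
  apply: (@le_trans _ _ ((2 * (A + N) + 1) ^+ n)).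
    apply: (@near_count (pos z)); first by have := A0; have := N0; lra.
    move=> j i; rewrite inE => /inc/(_ i) h1.
    have -> : x j i - pos z i = - (pos z i - x j i - lev z * w j i) - lev z * w j i by ring.
    rewrite (le_trans (ler_normB _ _))// normrN lerD// normrM -[leRHS]mulr1 ler_pM//; exact: levb.
  have AN : A <= A * N by rewrite ler_peMr// ltW.
  have b1 : 0 <= 2 * (A + N) + 1 by have := A0; have := N0; lra.
  have b2 : 2 * (A + N) + 1 <= (2 * A + 3) * N by have := N1; lra.
  by rewrite lerXn2r// nnegrE// (le_trans b1).
have E1 : 1 <= #|E|%:R :> R.
  rewrite ler1n lt0n; apply/negP => /eqP E0; move: hc2; rewrite E0 mul0r.
  by have := m1; lra.
have Y0 : 0 <= (2 * A + 3) * N by rewrite mulr_ge0 ?(ltW N0)//; have := A0; lra.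
have tE : t <= #|E|%:R * ((2 * A + 3) * N).
  have tn : t ^+ n <= (#|E|%:R * ((2 * A + 3) * N)) ^+ n.
    rewrite tJ exprMn (le_trans hc2)// ler_wpM2r ?exprn_ge0// -[leLHS]expr1.
    exact: ler_weXn2l.
  have tp : t \is Num.nneg by rewrite nnegrE ltW.
  have Yp : #|E|%:R * ((2 * A + 3) * N) \is Num.nneg by rewrite nnegrE mulr_ge0.
  by move: tn; rewrite (ler_pXn2r n0 tp Yp).
have -> : #|E|%:R ^+ 2 * ((2 * A + 3) * N) ^+ n.+1 = (#|E|%:R * ((2 * A + 3) * N) ^+ n) * (#|E|%:R * ((2 * A + 3) * N)) by rewrite (exprSr _ n); ring.
by rewrite ler_pM// ltW.
Qed.

Let incidences : h * #|J|%:R <= #|I|%:R.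
Proof.
rewrite -[in leRHS]sum1_card (partition_big fst xpredT)//= natr_sum mulr_natr -sumr_const.
rewrite (eq_bigl xpredT)//; apply: ler_sum => j _; apply: (le_trans (hI j)).
rewrite -sum1_card ler_nat; apply/eq_leq; apply: eq_bigl => v; by rewrite inE.
Qed.

Definition clear_const1 : R := (3 * T2) ^+ n.+1 * (16 * q ^+ 2 * (4 * A + 5) ^+ n) ^+ 2.

Let q0 : 0 < q. Proof. by have := q1; lra. Qed.

Let T20 : 0 < T2. Proof. by have := T21; lra. Qed.

(** [C6] bounds the packing radius of [hairbrush_inter] in units of N/h; [C8] and [C10] are the
    constants of [stem_count] and [stem_overlap]. *)
Definition C6 : R := (16 * A + 1) * (3 * T2) + 48 * A * (64 * q * T2).
Definition C8 : R := 256 * q ^+ 3 * ((4 * A + 5) * C5) * C6 ^+ n.-1.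
Definition C10 : R := 8 * q * (6 * A + 7).
Definition clear_const2 : R := 32 * q ^+ 3 * C5 * C8 * C10.

Let C60 : 0 < C6.
Proof.
apply: addr_gt0; first by apply: mulr_gt0; [have := A0; lra|exact: mulr_gt0].
by apply: mulr_gt0; [exact: mulr_gt0|apply: mulr_gt0 => //; exact: mulr_gt0].
Qed.

Let A5 : 0 < 4 * A + 5. Proof. by have := A0; lra. Qed.

Let C8_ge0 : 0 <= C8.
Proof.
apply: mulr_ge0; last by apply: exprn_ge0; exact: ltW.
apply: mulr_ge0; last by apply: mulr_ge0; exact: ltW.
exact: mulr_ge0 (ler0n R 256) (exprn_ge0 3 (ltW q0)).
Qed.

Let C10_ge0 : 0 <= C10.
Proof. by apply: mulr_ge0; [apply: mulr_ge0 => //; exact: ltW|have := A0; lra]. Qed.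

(** * Incidences pruned to one angle class *)

Section Class.
Variables (s : 'I_M.+1) (X : {set J * P}).
Hypotheses (XI : X \subset I) (XIcard : #|I|%:R <= 2 * q * #|X|%:R :> R).
Hypothesis Xfib : forall j z, (j, z) \in X -> h / (8 * q) <= #|[set z | (j, z) \in X]|%:R.
Hypothesis Xdeg : forall j z, (j, z) \in X ->
  #|[set k | (k, z) \in X]|%:R / (8 * q) <= #|[set k | ((k, z) \in X) && (cls j k == s)]|%:R.
Hypothesis XE : forall j z, (j, z) \in X -> z \in E.

Let XIu j z : (j, z) \in X -> (j, z) \in I. Proof. by move/(fintype.subsetP XI). Qed.

Let cardX : #|X|%:R = \sum_(z in E) #|[set k | (k, z) \in X]|%:R :> R.
Proof.
rewrite -[in LHS]sum1_card (partition_big snd (fun z => z \in E))/=; last by move=> [j z]; exact: XE.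
rewrite natr_sum; apply: eq_bigr => z zE; congr (_%:R).
rewrite -(card_imset (mem [set k | (k, z) \in X]) (f := fun k => (k, z))); last by move=> k k' [].
rewrite -sum1_card; apply: eq_bigl => -[k z'] /=; apply/andP/imsetP => [[uX /eqP <-]|[k' k'X [-> ->]]].
  by exists k; rewrite // inE.
by rewrite inE in k'X; rewrite k'X.
Qed.

Let hm : h * #|J|%:R <= 2 * q * #|X|%:R. Proof. exact: le_trans incidences XIcard. Qed.

(** In the last class a fixed fraction of the lines through a cell have base points within a
    constant of one another, so multiplicities are bounded and h |J| is at most a constant times
    |E|. The remaining powers are absorbed by h <= 3 T2 N and t <= |J|. *)
Lemma wolff_parallel : nat_of_ord s = M ->
  h ^+ n.+3 * #|J|%:R * t <= clear_const1 * N ^+ n.+1 * #|E|%:R ^+ 2.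
Proof.
move=> sM; have thM : th s * N = 2 by rewrite sM /th -KM divfK// expf_neq0// gt_eqF.
have mult z : #|[set k | (k, z) \in X]|%:R <= 8 * q * (4 * A + 5) ^+ n.
  have [->|[j]] := set_0Vmem [set k | (k, z) \in X].
    rewrite finset.cards0 mulr_ge0 ?exprn_ge0// ?mulr_ge0 ?(ltW q0)//; have := A0; lra.
  rewrite inE => jX; have := Xdeg jX; rewrite ler_pdivrMr ?mulr_gt0// mulrC => hd; apply: (le_trans hd).
  rewrite ler_wpM2l ?mulr_ge0 ?(ltW q0)//.
  have -> : 4 * A + 5 = 2 * (2 * A + 2) + 1 by ring.
  apply: (@near_count (x j)); first by have := A0; lra.
  move=> k i; rewrite inE => /andP[kX /eqP ks].
  have := meet_dist i (XIu kX) (XIu jX); rewrite clsC ks thM; lra.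
have cX : #|X|%:R <= #|E|%:R * (8 * q * (4 * A + 5) ^+ n).
  by rewrite cardX mulr_natl -sumr_const; apply: ler_sum => z _; exact: mult.
have hmE : h * #|J|%:R <= (16 * q ^+ 2 * (4 * A + 5) ^+ n) * #|E|%:R.
  apply: (le_trans hm); have := ler_wpM2l (ltW (mulr_gt0 (ltr0n R 2) q0)) cX; lra.
have tm : t <= #|J|%:R.
  have t1 : 1 <= t by rewrite -(ler_pXn2r n0) ?nnegrE ?(ltW t0)// tJ expr1n.
  by rewrite -tJ -[leLHS]expr1 ler_weXn2l.
have h3 : h ^+ n.+1 <= (3 * T2 * N) ^+ n.+1.
  by rewrite lerXn2r// ?nnegrE ?(ltW h0) ?(le_trans (ltW h0))// h_le.
have hm0 : 0 <= h * #|J|%:R by rewrite mulr_ge0// ltW.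
apply: (@le_trans _ _ (h ^+ n.+1 * (h * #|J|%:R) ^+ 2)).
  have -> : h ^+ n.+1 * (h * #|J|%:R) ^+ 2 = h ^+ n.+3 * #|J|%:R * #|J|%:R.
    by have -> : h ^+ n.+3 = h ^+ 2 * h ^+ n.+1 by [rewrite -exprD]; ring.
  by rewrite ler_wpM2l// mulr_ge0// exprn_ge0// ltW.
have -> : clear_const1 * N ^+ n.+1 * #|E|%:R ^+ 2 = (3 * T2 * N) ^+ n.+1 * ((16 * q ^+ 2 * (4 * A + 5) ^+ n) * #|E|%:R) ^+ 2.
  by rewrite /clear_const1 !exprMn; ring.
rewrite ler_pM ?exprn_ge0// ?(ltW h0)// ler_pXn2r// nnegrE//.
by rewrite (le_trans hm0).
Qed.

Hypotheses (sM : (s < M)%N) (hbig : 32 * q * T2 <= h).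

(** [Hj j] is the hairbrush with stem [j], and [Ej j] the cells its bristles cover. *)
Let Hj j := [set k | [exists z, [&& (j, z) \in X, (k, z) \in X & cls j k == s]]].
Let Ej j := [set z | [exists k in Hj j, (k, z) \in X]].

(** Cauchy-Schwarz for the far parts of the bristles: each keeps a fixed fraction of its cells, and
    their overlaps are bounded by [hairbrush_inter]. *)
Lemma stem_count j : #|Hj j|%:R * h ^+ n.+1 <= C8 * K * N ^+ n * #|Ej j|%:R.
Proof.
(* At most h/(32q) + T2 cells of a line lie within [tau] of its crossing with the stem. Since h >=
   32 q T2, at least h/(16q) of the h/(8q) cells left by pruning are far. *)
pose tau := h / (64 * q * T2).
have c64 : 0 < 64 * q * T2 by rewrite mulr_gt0// mulr_gt0.
have tau0 : 0 < tau by rewrite divr_gt0.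
have /choice[zk hzk] : forall k, exists z, k \in Hj j -> [/\ (j, z) \in X, (k, z) \in X & cls j k = s].
  move=> k; have [|kn] := boolP (k \in Hj j).
    by rewrite inE => /existsP[z /and3P[a1 a2 /eqP a3]]; exists z.
  (* A default cell for the indices outside the hairbrush; some cell exists because every line has
     an incidence. *)
  have [z _] : exists z : P, true; last by exists z.
    have : 0 < #|[set u in I | u.1 == j]|%:R :> R by exact: lt_le_trans h0 (hI j).
    by rewrite ltr0n card_gt0 => /set0Pn[[? z] _]; exists z.
pose G k := [set z | ((k, z) \in X) && (tau <= `|lev z - lev (zk k)|)].
have GE k : k \in Hj j -> G k \subset Ej j.
  move=> kH; apply/fintype.subsetP => z; rewrite !inE => /andP[zX _].
  by apply/exists_inP; exists k.
have Gbig k : k \in Hj j -> h / (16 * q) <= #|G k|%:R.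
  move=> kH; have [jz kz _] := hzk _ kH; have f := Xfib kz.
  have split : #|[set z | (k, z) \in X]|%:R <= #|G k|%:R + #|[set z | ((k, z) \in X) && ~~ (tau <= `|lev z - lev (zk k)|)]|%:R :> R.
    rewrite -natrD ler_nat; apply: (leq_trans _ (leq_card_setU _ _)); apply: subset_leq_card.
    by apply/fintype.subsetP => z; rewrite !inE => ->/=; case: (tau <= _).
  have nearc : #|[set z | ((k, z) \in X) && ~~ (tau <= `|lev z - lev (zk k)|)]|%:R <= (lev (zk k) + tau - (lev (zk k) - tau) + 1) * T2.
    apply: (@tube_count k); first by lra.
    move=> z; rewrite inE -ltNge ltr_norml => /andP[zX /andP[l1 l2]]; split; first exact: XIu.
    by apply/andP; split; lra.
  have e1 : (lev (zk k) + tau - (lev (zk k) - tau) + 1) * T2 = h / (32 * q) + T2.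
    by rewrite /tau; field; rewrite !gt_eqF//; have := q0.
  have e2 : T2 <= h / (32 * q) by rewrite ler_pdivlMr ?mulr_gt0// mulrC.
  have e3 : h / (8 * q) = h / (16 * q) + h / (32 * q) + h / (32 * q) by field; rewrite gt_eqF.
  rewrite e3 in f; rewrite e1 in nearc; move: f split nearc e2 {e1 e3}.
  move: (h / (16 * q)) (h / (32 * q)) => a1 a2; move: (#|G k|%:R) T2 => a3 a4.
  by move: (#|_|%:R) (#|_|%:R) => a5 a6; lra.
have hH k : k \in Hj j -> [/\ (j, zk k) \in I, (k, zk k) \in I & (cls j k < M)%N].
  by move=> /hzk[a1 a2 ->]; split=> //; exact: XIu.
have hG k z : k \in Hj j -> z \in G k -> (k, z) \in I /\ tau <= `|lev z - lev (zk k)|.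
  by move=> _; rewrite inE => /andP[/XIu].
have W k (kH : k \in Hj j) := hairbrush_inter tau0 hH hG kH.
set WW := M.+1%:R * _ in W.
have rho0 : 0 <= 8 * (2 * A + 6 * A * N / tau) + 1.
  apply: addr_ge0 => //; apply: mulr_ge0 => //; apply: addr_ge0; first by apply: mulr_ge0 => //; exact: ltW.
  by apply: divr_ge0; [apply: mulr_ge0; [apply: mulr_ge0|]|]; rewrite ?(ltW A0) ?(ltW N0) ?(ltW tau0).
have W0 : 0 <= WW.
  apply: mulr_ge0 => //; apply: mulr_ge0; last exact: exprn_ge0.
  by apply: mulr_ge0 (ltW K0); apply: mulr_ge0 (ltW N0); exact: mulr_ge0 (ltW A5) (ltW C50).
have hb := hairbrush (ltW (divr_gt0 h0 (mulr_gt0 (ltr0n R 16) q0))) W0 GE Gbig W.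
have rhoC : 8 * (2 * A + 6 * A * N / tau) + 1 <= C6 * (N / h).
  have Nh : 1 <= 3 * T2 * (N / h) by rewrite mulrA ler_pdivlMr// mul1r h_le.
  have -> : 6 * A * N / tau = 6 * A * (64 * q * T2) * (N / h).
    by rewrite /tau; field; rewrite !gt_eqF//; have := q0.
  have : (16 * A + 1) * 1 <= (16 * A + 1) * (3 * T2 * (N / h)) by rewrite ler_wpM2l//; have := A0; lra.
  rewrite /C6; lra.
have WC : WW <= q * ((4 * A + 5) * C5 * N * K * (C6 * (N / h)) ^+ n.-1).
  have pre : 0 <= (4 * A + 5) * C5 * N * K := mulr_ge0 (mulr_ge0 (mulr_ge0 (ltW A5) (ltW C50)) (ltW N0)) (ltW K0).
  rewrite /WW -/q; apply: ler_wpM2l (ltW q0) _ _ _; apply: ler_wpM2l pre _ _ _.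
  by rewrite lerXn2r// nnegrE// (le_trans rho0).
have fin := le_trans hb (ler_wpM2l (ler0n R #|Ej j|) WC).
have p1 : 0 < 256 * q ^+ 2 * h ^+ n.-1 := mulr_gt0 (mulr_gt0 (ltr0n R 256) (exprn_gt0 2 q0)) (exprn_gt0 n.-1 h0).
have := ler_wpM2l (ltW p1) fin.
have hn : h ^+ n.+1 = h ^+ 2 * h ^+ n.-1 by rewrite -exprD; congr (_ ^+ _); move: n0; case: (n).
have -> : 256 * q ^+ 2 * h ^+ n.-1 * (#|Hj j|%:R * (h / (16 * q)) ^+ 2) = #|Hj j|%:R * h ^+ n.+1.
  by rewrite hn; field; rewrite gt_eqF.
have Nn : N ^+ n = N * N ^+ n.-1 by rewrite -exprS prednK.
have -> // : 256 * q ^+ 2 * h ^+ n.-1 * (#|Ej j|%:R * (q * ((4 * A + 5) * C5 * N * K * (C6 * (N / h)) ^+ n.-1))) = C8 * K * N ^+ n * #|Ej j|%:R.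
by rewrite /C8 Nn !exprMn exprVn; field; rewrite expf_neq0// gt_eqF.
Qed.

(** A cell lies in [Ej j] only if [j] is within about th N of a line through that cell, so by
    [neighbour_count] for at most Y^n stems with Y of order th N, and never for more than |J| = t^n.
    In either case the number times t is at most Y |J|. *)
Lemma stem_overlap : (\sum_j #|Ej j|%:R) * t <= #|E|%:R * (C10 * (th s * N) * #|J|%:R).
Proof.
have tN := @thN s (ltnW sM).
set B := (A + 1) * (th s * N); have B0 : 0 <= B by rewrite mulr_ge0//; have := A0; lra.
pose Y := C10 * (th s * N).
have Ecount z : #|[set j | z \in Ej j]|%:R <= Y ^+ n.
  pose S := [set k | (k, z) \in X].
  have sub : [set j | z \in Ej j] \subset [set j | [exists k in S, [forall i, `|x j i - x k i| <= B]]].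
    apply/fintype.subsetP => j; rewrite !inE => /exists_inP[k]; rewrite inE => /existsP[y /and3P[y1 y2 /eqP y3]] zX.
    apply/exists_inP; exists k; first by rewrite inE.
    by apply/forallP => i; have := meet_dist i (XIu y1) (XIu y2); rewrite y3.
  apply: (@le_trans _ _ (8 * q * (6 * B + 1) ^+ n)).
    apply: (le_trans _ (@neighbour_count S B (8 * q) B0 (mulr_gt0 (ltr0n R 8) q0) _)); first by rewrite ler_nat subset_leq_card.
    move=> k; rewrite inE => kz; apply: (le_trans (Xdeg kz)); rewrite ler_nat subset_leq_card//.
    apply/fintype.subsetP => k'; rewrite !inE => /andP[k'z /eqP ks]; rewrite k'z/=.
    by apply/forallP => i; have := meet_dist i (XIu k'z) (XIu kz); rewrite clsC ks.
  have b6 : 6 * B + 1 <= (6 * A + 7) * (th s * N) by rewrite /B; lra.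
  have b60 : 0 <= 6 * B + 1 by lra.
  have q8 : 1 <= 8 * q by have := q1; lra.
  have -> : Y = (8 * q) * ((6 * A + 7) * (th s * N)) by rewrite /Y /C10; ring.
  rewrite [leRHS]exprMn ler_pM ?exprn_ge0//; first by lra.
    by rewrite -[leLHS]expr1 ler_weXn2l.
  by rewrite lerXn2r// nnegrE// (le_trans b60).
have tN0 : 0 <= th s * N by lra.
have Y0 : 0 <= Y := mulr_ge0 C10_ge0 tN0.
have key z : #|[set j | z \in Ej j]|%:R * t <= Y * #|J|%:R.
  have [Yt|tY] := leP Y t.
    apply: (@le_trans _ _ (Y ^+ n * t)); first by rewrite ler_wpM2r ?(ltW t0).
    have e (y : R) : y ^+ n = y * y ^+ n.-1 by rewrite -exprS prednK.
    rewrite -tJ (e Y) (e t) -mulrA ler_wpM2l// [leRHS]mulrC ler_wpM2r ?(ltW t0)//.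
    by rewrite lerXn2r// nnegrE ltW.
  rewrite mulrC ler_pM// ?(ltW t0) ?(ltW tY)// ler_nat; exact: max_card.
have -> : \sum_j #|Ej j|%:R = \sum_(z in E) #|[set j | z \in Ej j]|%:R :> R.
  transitivity (\sum_j \sum_(z in E) (z \in Ej j)%:R : R).
    apply: eq_bigr => j _; rewrite -sum1_card natr_sum [RHS](bigID (fun z => z \in Ej j))/=.
    rewrite [X in _ = _ + X]big1 ?addr0; last by move=> z /andP[_ /negbTE ->].
    apply: eq_big => [z|z ->//]; case zE : (z \in Ej j); rewrite ?andbF// andbT; apply/esym.
    by move: zE; rewrite inE => /exists_inP[k _]; exact: XE.
  rewrite exchange_big/=; apply: eq_bigr => z _; rewrite -sum1_card natr_sum [RHS]big_mkcond/=.
  by apply: eq_bigr => j _; rewrite [in RHS]inE; case: (z \in Ej j).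
rewrite mulr_suml mulr_natl -sumr_const; apply: ler_sum => z _; exact: key.
Qed.

(** Cauchy-Schwarz bounds |X|^2 by |E| times the number of pairs of lines meeting in a cell. Pruning
    makes a fixed fraction of these pairs belong to class s, and each such pair shares about K/th
    cells. *)
Lemma pair_count : th s * #|X|%:R ^+ 2 <= 8 * q * C5 * K * #|E|%:R * \sum_j #|Hj j|%:R.
Proof.
pose mu z : R := #|[set k | (k, z) \in X]|%:R.
have s1 : #|X|%:R ^+ 2 <= #|E|%:R * \sum_(z in E) mu z ^+ 2 by rewrite cardX; exact: sqr_sum_set_le.
have s2 : \sum_(z in E) mu z ^+ 2 <= 8 * q * \sum_(z in E) \sum_(j | (j, z) \in X) #|[set k | ((k, z) \in X) && (cls j k == s)]|%:R.
  rewrite mulr_sumr; apply: ler_sum => z _.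
  have -> : mu z ^+ 2 = \sum_(j | (j, z) \in X) mu z.
    rewrite sumr_const -[RHS]mulr_natl expr2; congr (_ * _); rewrite /mu; congr (_%:R).
    by apply: eq_card => j; rewrite !inE.
  rewrite mulr_sumr; apply: ler_sum => j jX; rewrite mulrC -ler_pdivrMr ?mulr_gt0//; exact: Xdeg jX.
have s3 : \sum_(z in E) \sum_(j | (j, z) \in X) #|[set k | ((k, z) \in X) && (cls j k == s)]|%:R <=
    \sum_j \sum_(k in Hj j) C5 * (K / th s).
  apply: (@le_trans _ _ (\sum_j \sum_(k in Hj j) #|[set z | ((j, z) \in X) && ((k, z) \in X)]|%:R)); last first.
    apply: ler_sum => j _; apply: ler_sum => k; rewrite inE => /existsP[z /and3P[_ _ /eqP <-]].
    by apply: inter_count => z'; rewrite inE => /andP[/XIu ? /XIu].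
  rewrite (eq_bigr (fun z => \sum_j \sum_k (((j, z) \in X) && (((k, z) \in X) && (cls j k == s)))%:R)); last first.
    move=> z _; rewrite big_mkcond/=; apply: eq_bigr => j _; case: ((j, z) \in X) => /=; last by rewrite big1.
    rewrite -sum1_card natr_sum big_mkcond/=; apply: eq_bigr => k _; rewrite inE.
    by case: (_ && _).
  rewrite exchange_big/=; apply: ler_sum => j _; rewrite exchange_big/=.
  rewrite [leRHS]big_mkcond/=; apply: ler_sum => k _; case: ifPn => [kH|].
    rewrite -sum1_card natr_sum [leRHS]big_mkcond/= [leRHS](bigID (fun z => z \in E))/=.
    rewrite -[leLHS]addr0 lerD//; last by apply: sumr_ge0 => z _; case: ifP.
    apply: ler_sum => z _; rewrite inE; case: ((j, z) \in X) => //=; case: ((k, z) \in X) => //=.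
    by case: (_ == _).
  rewrite inE negb_exists => /forallP nH; rewrite big1// => z _.
  by have := nH z; rewrite negb_and; case: (_ \in X) => //=; rewrite -?negb_and; case: (_ && _).
have s4 : \sum_j \sum_(k in Hj j) C5 * (K / th s) = C5 * (K / th s) * \sum_j #|Hj j|%:R.
  by rewrite mulr_sumr; apply: eq_bigr => j _; rewrite sumr_const -[LHS]mulr_natl mulrC.
rewrite s4 in s3.
have e1 := le_trans s1 (ler_wpM2l (ler0n R _) (le_trans s2 (ler_wpM2l (ltW (mulr_gt0 (ltr0n R 8) q0)) s3))).
have := ler_wpM2l (ltW (th0 s)) e1; move=> e2; apply: (le_trans e2).
by rewrite le_eqVlt; apply/orP; left; apply/eqP; field; rewrite gt_eqF// th0.
Qed.

(** Product of [pair_count], [stem_count] and [stem_overlap]. The scale [th s] cancels, and |X| >= h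
    |J| / (2q) returns to the original incidences; one factor K comes from each of the first two. *)
Lemma wolff_transverse : h ^+ n.+3 * #|J|%:R * t <= clear_const2 * K ^+ 2 * N ^+ n.+1 * #|E|%:R ^+ 2.
Proof.
have s1 := pair_count; have s3 := stem_overlap.
have s2 : (\sum_j #|Hj j|%:R) * h ^+ n.+1 <= C8 * K * N ^+ n * \sum_j #|Ej j|%:R.
  by rewrite mulr_suml mulr_sumr; apply: ler_sum => j _; exact: stem_count.
set SH := \sum_j #|Hj j|%:R in s1 s2; set SE := \sum_j #|Ej j|%:R in s2 s3.
have hn0 : 0 <= h ^+ n.+1 by rewrite exprn_ge0// ltW.
have C80 := C8_ge0.
have c1 : 0 <= 8 * q * C5 * K * #|E|%:R by rewrite mulr_ge0// mulr_ge0 ?(ltW K0)// mulr_ge0 ?(ltW C50)// mulr_ge0 ?(ltW q0).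
have c2 : 0 <= C8 * K * N ^+ n by rewrite mulr_ge0 ?exprn_ge0 ?(ltW N0)// mulr_ge0 ?(ltW K0).
have u1 : th s * #|X|%:R ^+ 2 * (h ^+ n.+1 * t) <= (8 * q * C5 * K * #|E|%:R) * ((C8 * K * N ^+ n) * (#|E|%:R * (C10 * (th s * N) * #|J|%:R))).
  apply: (@le_trans _ _ (8 * q * C5 * K * #|E|%:R * SH * (h ^+ n.+1 * t))).
    by rewrite ler_wpM2r// mulr_ge0// ltW.
  have -> : 8 * q * C5 * K * #|E|%:R * SH * (h ^+ n.+1 * t) = 8 * q * C5 * K * #|E|%:R * (SH * h ^+ n.+1 * t) by ring.
  rewrite ler_wpM2l//; apply: (@le_trans _ _ (C8 * K * N ^+ n * SE * t)).
    by rewrite ler_wpM2r// ltW.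
  by rewrite -mulrA ler_wpM2l.
have u2 : #|X|%:R ^+ 2 * (h ^+ n.+1 * t) <= (8 * q * C5 * K * #|E|%:R) * ((C8 * K * N ^+ n) * (#|E|%:R * (C10 * N * #|J|%:R))).
  rewrite -(ler_pM2l (th0 s)); apply: (le_trans _ (le_trans u1 _)).
    by rewrite [leLHS]mulrA.
  by rewrite le_eqVlt; apply/orP; left; apply/eqP; ring.
have hm0 : 0 <= h * #|J|%:R by rewrite mulr_ge0// ltW.
have u3 : (h * #|J|%:R) ^+ 2 <= (2 * q) ^+ 2 * #|X|%:R ^+ 2.
  by rewrite -exprMn ler_pXn2r// ?nnegrE ?mulr_ge0 ?(ltW q0).
have ht : 0 <= h ^+ n.+1 * t by rewrite mulr_ge0// ltW.
have u5 : (2 * q) ^+ 2 * #|X|%:R ^+ 2 * (h ^+ n.+1 * t) <=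
    (2 * q) ^+ 2 * ((8 * q * C5 * K * #|E|%:R) * ((C8 * K * N ^+ n) * (#|E|%:R * (C10 * N * #|J|%:R)))).
  by rewrite -mulrA ler_wpM2l// exprn_ge0// mulr_ge0// ltW.
have u4 := le_trans (ler_wpM2r ht u3) u5.
have mp : 0 < #|J|%:R :> R by have := m1; lra.
rewrite -(ler_pM2l mp); apply: (le_trans _ (le_trans u4 _)).
  rewrite le_eqVlt; apply/orP; left; apply/eqP; have -> : h ^+ n.+3 = h ^+ 2 * h ^+ n.+1 by [rewrite -exprD]; ring.
by rewrite le_eqVlt; apply/orP; left; apply/eqP; rewrite /clear_const2 (exprS N n); ring.
Qed.

End Class.

Definition wolff_const : R := clear_const1 + clear_const2 + (32 * q * T2) ^+ n.+3 * (2 * A + 3) ^+ n.+1.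

Let mulI z := #|[set k | (k, z) \in I]|.
(** Pairs of incidences at a common cell, weighted by the inverse multiplicity of the cell, so that
    each incidence has total energy 1 over all classes, as [pruning] requires. *)
Let F (s : 'I_M.+1) (u v : J * P) : R :=
  if (u.2 == v.2) && (cls u.1 v.1 == s) then (mulI u.2)%:R^-1 else 0.

Let sumF s (X : {set J * P}) j z :
  \sum_(v in X) F s (j, z) v = #|[set k | ((k, z) \in X) && (cls j k == s)]|%:R / (mulI z)%:R.
Proof.
rewrite (bigID (fun v : J * P => (z == v.2) && (cls j v.1 == s)))/= [X in _ + X]big1 ?addr0; last first.
  by move=> v /andP[_ /negbTE h1]; rewrite /F/= h1.
rewrite (eq_bigr (fun=> (mulI z)%:R^-1)); last by move=> v /andP[_ h1]; rewrite /F/= h1.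
rewrite sumr_const -[LHS]mulr_natl; congr (_%:R * _).
rewrite -(card_imset (mem [set k | ((k, z) \in X) && (cls j k == s)]) (f := fun k => (k, z))); last by move=> k k' [].
apply: eq_card => -[k z']; apply/andP/imsetP => /= [[uX /andP[/eqP zz ks]]|[k' + [-> ->]]].
  by exists k; [rewrite /= inE zz uX ks|rewrite zz].
by rewrite inE => /andP[h1 h2]; split; rewrite ?eqxx.
Qed.

Theorem wolff_discrete :
  h ^+ n.+3 * #|J|%:R * t <= wolff_const * K ^+ 2 * N ^+ n.+1 * #|E|%:R ^+ 2.
Proof.
have N10 : 0 <= N ^+ n.+1 by rewrite exprn_ge0// ltW.
have E20 : 0 <= #|E|%:R ^+ 2 :> R by rewrite exprn_ge0.
have K21 : 1 <= K ^+ 2 by rewrite exprn_ege1//; have := K2; lra.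
have cc1 : 0 <= clear_const1.
  apply: mulr_ge0; apply: exprn_ge0; first by apply: mulr_ge0 => //; exact: ltW.
  apply: mulr_ge0; last by apply: exprn_ge0; exact: ltW.
  by apply: mulr_ge0 => //; apply: exprn_ge0; exact: ltW.
have cc2 : 0 <= clear_const2.
  apply: mulr_ge0 C10_ge0; apply: mulr_ge0 C8_ge0; apply: mulr_ge0 (ltW C50).
  by apply: mulr_ge0 => //; apply: exprn_ge0; exact: ltW.
have cc3 : 0 <= (32 * q * T2) ^+ n.+3 * (2 * A + 3) ^+ n.+1.
  rewrite mulr_ge0// exprn_ge0//; first by rewrite mulr_ge0 ?mulr_ge0 ?(ltW q0) ?(ltW T20).
  by have := A0; lra.
have fin (c : R) : 0 <= c -> c <= wolff_const ->
    c * N ^+ n.+1 * #|E|%:R ^+ 2 <= wolff_const * K ^+ 2 * N ^+ n.+1 * #|E|%:R ^+ 2.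
  move=> c0 cw; rewrite ler_wpM2r// ler_wpM2r// (le_trans cw)// ler_peMr// (le_trans c0)//.
have [hbig|hsmall] := leP (32 * q * T2) h; last first.
  apply: (le_trans _ (fin _ cc3 _)); last by rewrite /wolff_const lerDr addr_ge0.
  have -> : (32 * q * T2) ^+ n.+3 * (2 * A + 3) ^+ n.+1 * N ^+ n.+1 * #|E|%:R ^+ 2 =
    (32 * q * T2) ^+ n.+3 * (#|E|%:R ^+ 2 * ((2 * A + 3) * N) ^+ n.+1).
    by rewrite [X in _ = _ * (_ * X)]exprMn; move: (_ ^+ n.+3) ((2 * A + 3) ^+ _) (N ^+ _) => a b c; ring.
  rewrite -mulrA ler_pM ?exprn_ge0 ?(ltW h0)//.
  - by rewrite mulr_ge0// ltW.
  - by rewrite lerXn2r// ?nnegrE ?(ltW h0) ?(ltW hsmall)// (le_trans (ltW h0))// ltW.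
  - exact: few_incidences.
have [||||s [X [XI XIcard Xfib Xdeg]]] := @pruning R _ J M.+1 fst I F h isT (ltW h0).
- by move=> s u v; rewrite /F; case: ifP.
- move=> s u v; rewrite /F eq_sym clsC; case: ifP => // /andP[/eqP -> _].
  by [].
- move=> [j z] uI; rewrite (eq_bigr (fun s => #|[set k | ((k, z) \in I) && (cls j k == s)]|%:R / (mulI z)%:R)); last by move=> s _; exact: sumF.
  rewrite -mulr_suml -natr_sum.
  have -> : (\sum_(i < M.+1) #|[set k | ((k, z) \in I) && (cls j k == i)]| = mulI z)%N.
    rewrite /mulI -sum1_card (partition_big (cls j) xpredT)//=; apply: eq_bigr => s _.
    by rewrite -sum1_card; apply: eq_bigl => k; rewrite !inE.
  by rewrite divff// pnatr_eq0 -lt0n; apply/card_gt0P; exists j; rewrite inE.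
- by move=> u _; exact: hI.
have Xfib' j z : (j, z) \in X -> h / (8 * q) <= #|[set z | (j, z) \in X]|%:R.
  by move=> /Xfib; rewrite fiber.
have Xdeg' j z : (j, z) \in X ->
    #|[set k | (k, z) \in X]|%:R / (8 * q) <= #|[set k | ((k, z) \in X) && (cls j k == s)]|%:R.
  move=> jX; have := Xdeg _ jX; rewrite sumF => hd.
  have mp : 0 < (mulI z)%:R :> R.
    by rewrite ltr0n; apply/card_gt0P; exists j; rewrite inE; exact: (fintype.subsetP XI).
  rewrite ler_pdivlMr// mulrC in hd; apply: (le_trans _ hd); rewrite ler_wpM2r ?invr_ge0 ?mulr_ge0 ?(ltW q0)//.
  rewrite ler_nat subset_leq_card//; apply/fintype.subsetP => k; rewrite !inE; exact: (fintype.subsetP XI).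
have XE j z : (j, z) \in X -> z \in E by move=> /(fintype.subsetP XI); exact: IE.
have [sM|Ms] := ltnP s M.
  apply: (le_trans (wolff_transverse XI XIcard Xfib' Xdeg' XE sM hbig)).
  rewrite ler_wpM2r// ler_wpM2r// ler_wpM2r ?exprn_ge0 ?(ltW K0)//.
  by rewrite /wolff_const addrAC lerDr addr_ge0.
have sM : nat_of_ord s = M by apply/eqP; rewrite eqn_leq Ms -ltnS ltn_ord.
apply: (le_trans (wolff_parallel XI XIcard Xdeg' XE sM)).
by apply: fin => //; rewrite /wolff_const -addrA lerDl addr_ge0.
Qed.

End Wolff.

(** * From incidences to a strong-type bound *)

Section StrongType.
Local Close Scope classical_set_scope.
Local Open Scope set_scope.
Local Open Scope ring_scope.
Variables (R : realType) (n : nat) (J P : finType).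
Variables (x w : J -> 'I_n -> R) (lev : P -> R) (pos : P -> 'I_n -> R) (A N : R).
Hypotheses (n0 : (0 < n)%N) (A1 : 1 <= A) (N1 : 1 <= N).
Hypothesis sepx : forall j k, j != k -> exists i, 1 <= `|x j i - x k i|.
Hypothesis sepp : forall z z', z != z' -> 1 <= `|lev z - lev z'| \/
  lev z = lev z' /\ exists i, 1 <= `|pos z i - pos z' i|.
Hypothesis levb : forall z, `|lev z| <= N.
Hypothesis wb : forall j i, `|w j i| <= 1.
Variable I : {set J * P}.
Hypothesis inc : forall j z, (j, z) \in I -> forall i, `|pos z i - x j i - lev z * w j i| <= A.
Variables (K : R) (M : nat).
Hypotheses (K2 : 2 <= K) (KM : K ^+ M = N).

Let wc : R := wolff_const n A M.
Let nr : R := n%:R.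
Let nr0 : 0 < nr. Proof. by rewrite ltr0n. Qed.
Let a : R := nr / (nr + 1).
Let a0 : 0 < a. Proof. by rewrite divr_gt0// addr_gt0. Qed.
Let K0 : 0 < K. Proof. by have := K2; lra. Qed.
Let N0 : 0 < N. Proof. by have := N1; lra. Qed.

Variable q : R.
Hypothesis hq : (nr + 3) * a <= q.

(** The power a = n/(n+1) of [wolff_discrete] turns |J| t into |J| and N^(n+1) into N^n. The rest of
    the exponent q is supplied by h <= |E|, and q - (n+3)a + 2a = q - n because (n+1)a = n. *)
Lemma level_bound (J' : {set J}) (E : {set P}) (h : R) : 1 <= h ->
  (forall j, j \in J' -> h <= #|[set z in E | (j, z) \in I]|%:R) ->
  #|J'|%:R * h `^ q <= (1 + `|wc| * K ^+ 2) * N ^+ n * #|E|%:R `^ (q - nr).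
Proof.
move=> h1 hJ; have h0 : 0 < h by lra.
have c0 : 0 <= 1 + `|wc| * K ^+ 2 by rewrite addr_ge0// mulr_ge0// exprn_ge0// ltW.
have [->|[j0 j0J]] := set_0Vmem J'.
  by rewrite finset.cards0 mul0r !mulr_ge0 ?powR_ge0// exprn_ge0// ltW.
pose m : R := #|J'|%:R; have m0 : 0 < m by rewrite ltr0n card_gt0; apply/set0Pn; exists j0.
pose t := m `^ (nr^-1); have t0 : 0 < t by rewrite powR_gt0.
have hE : h <= #|E|%:R.
  apply: (le_trans (hJ _ j0J)); rewrite ler_nat subset_leq_card//.
  by apply/fintype.subsetP => z; rewrite inE => /andP[].
have W := @wolff_discrete R n {j : J | j \in J'} P (fun j => x (val j)) (fun j => w (val j)) lev pos A N
  n0 A1 N1 _ sepp levb (fun j => wb (val j)) [set u | ((val u.1, u.2) \in I) && (u.2 \in E)] _ K M K2 KM h t E h0 t0 _ _ _.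
have {W} W : h ^+ n.+3 * m * t <= wc * K ^+ 2 * N ^+ n.+1 * #|E|%:R ^+ 2.
  have -> : m = #|{: {j : J | j \in J'}}|%:R by rewrite card_sig.
  apply: W.
  - by move=> j k jk; apply: sepx; apply: contra jk => /eqP/val_inj ->.
  - by move=> j z; rewrite inE => /andP[/inc].
  - rewrite card_sig /t -powR_mulrn ?powR_ge0// -powRrM mulVf ?gt_eqF// powRr1//; exact: ltW.
  - move=> j; apply: (le_trans (hJ _ (valP j))); rewrite ler_nat.
    rewrite -(card_imset (mem [set z in E | (val j, z) \in I]) (f := fun z => (j, z))); last by move=> z z' [].
    apply: subset_leq_card; apply/fintype.subsetP => _ /imsetP[z + ->].
    by rewrite !inE/= => /andP[-> ->]/=.
  - by move=> j z; rewrite inE => /andP[].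
have D0 : 0 <= `|wc| * K ^+ 2 by rewrite mulr_ge0// exprn_ge0// ltW.
have W' : h ^+ n.+3 * m * t <= `|wc| * K ^+ 2 * N ^+ n.+1 * #|E|%:R ^+ 2.
  apply: (le_trans W); rewrite ler_wpM2r ?exprn_ge0// ler_wpM2r ?exprn_ge0 ?(ltW N0)//.
  by rewrite ler_wpM2r ?exprn_ge0 ?(ltW K0)// ler_norm.
have l0 : 0 <= h ^+ n.+3 * m * t.
  by apply: mulr_ge0 (ltW t0); apply: mulr_ge0 (ltW m0); apply: exprn_ge0; exact: ltW.
have Wa := ge0_ler_powR (ltW a0) l0 (le_trans l0 W') W'.
have pwn (y : R) k : 0 <= y -> (y ^+ k) `^ a = y `^ (k%:R * a) by move=> y0; rewrite -powR_mulrn// -powRrM.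
have LE : (h ^+ n.+3 * m * t) `^ a = h `^ ((nr + 3) * a) * m.
  have hn : 0 <= h ^+ n.+3 by rewrite exprn_ge0// ltW.
  have hm : 0 <= h ^+ n.+3 * m by apply: mulr_ge0 (ltW m0).
  rewrite (powRM a hm (ltW t0)) (powRM a hn (ltW m0)) (pwn _ _ (ltW h0)).
  have -> : (n.+3%:R : R) = nr + 3 by rewrite -addn3 natrD.
  rewrite -mulrA; congr (_ * _); rewrite /t -powRrM -powRD; last by rewrite (gt_eqF m0) implybT.
  have -> : a + nr^-1 * a = 1 by rewrite /a; field; rewrite !gt_eqF ?addr_gt0.
  by rewrite powRr1// ltW.
have RE : (`|wc| * K ^+ 2 * N ^+ n.+1 * #|E|%:R ^+ 2) `^ a = (`|wc| * K ^+ 2) `^ a * N ^+ n * #|E|%:R `^ (2 * a).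
  have N1p : 0 <= N ^+ n.+1 by rewrite exprn_ge0// ltW.
  have e2p : 0 <= #|E|%:R ^+ 2 :> R by rewrite exprn_ge0.
  rewrite (powRM a (mulr_ge0 D0 N1p) e2p) (powRM a D0 N1p) (pwn _ _ (ltW N0)) (pwn #|E|%:R)//.
  congr (_ * _ * _).
  have -> : n.+1%:R * a = nr by rewrite /a -natr1 -/nr; field; rewrite gt_eqF// addr_gt0.
  by rewrite powR_mulrn// ltW.
rewrite LE RE in Wa.
have Da : (`|wc| * K ^+ 2) `^ a <= 1 + `|wc| * K ^+ 2.
  have le1 : (`|wc| * K ^+ 2) `^ a <= (1 + `|wc| * K ^+ 2) `^ a.
    by apply: ge0_ler_powR; rewrite ?nnegrE ?(ltW a0)//; lra.
  apply: (le_trans le1); rewrite -[leRHS]powRr1//; apply: ler_powR; first by lra.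
  by rewrite /a ler_pdivrMr ?addr_gt0//; have := nr0; lra.
have E0 : 0 < #|E|%:R :> R by lra.
have -> : h `^ q = h `^ (q - (nr + 3) * a) * h `^ ((nr + 3) * a).
  by rewrite -powRD ?subrK// (gt_eqF h0) implybT.
have -> : #|E|%:R `^ (q - nr) = #|E|%:R `^ (q - (nr + 3) * a) * #|E|%:R `^ (2 * a) :> R.
  rewrite -powRD; last by rewrite (gt_eqF E0) implybT.
  by congr (_ `^ _); rewrite /a; field; rewrite gt_eqF// addr_gt0.
have e1 : h `^ (q - (nr + 3) * a) <= #|E|%:R `^ (q - (nr + 3) * a).
  by apply: ge0_ler_powR; rewrite ?nnegrE ?subr_ge0 ?(ltW h0) ?(ltW E0).
have e2 : h `^ ((nr + 3) * a) * m <= (1 + `|wc| * K ^+ 2) * N ^+ n * #|E|%:R `^ (2 * a).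
  apply: (le_trans Wa); rewrite ler_wpM2r ?powR_ge0// ler_wpM2r ?exprn_ge0 ?(ltW N0)//.
have -> : #|J'|%:R * (h `^ (q - (nr + 3) * a) * h `^ ((nr + 3) * a)) = h `^ (q - (nr + 3) * a) * (h `^ ((nr + 3) * a) * m).
  by rewrite -/m; ring.
have -> : (1 + `|wc| * K ^+ 2) * N ^+ n * (#|E|%:R `^ (q - (nr + 3) * a) * #|E|%:R `^ (2 * a)) =
  #|E|%:R `^ (q - (nr + 3) * a) * ((1 + `|wc| * K ^+ 2) * N ^+ n * #|E|%:R `^ (2 * a)) by ring.
by rewrite ler_pM ?powR_ge0// mulr_ge0 ?powR_ge0// ltW.
Qed.

Let T2 : R := (2 * A + 1) ^+ n.
Let T21 : 1 <= T2. Proof. by rewrite exprn_ege1//; have := A1; lra. Qed.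

Let cnt (E : {set P}) j : nat := #|[set z in E | (j, z) \in I]|.

Lemma cnt_le E j : (cnt E j)%:R <= 3 * T2 * N.
Proof.
apply: (@le_trans _ _ ((N - - N + 1) * T2)).
  apply: (@tube_count R n J P x w lev pos A A1 sepp I inc j); first by have := N0; lra.
  by move=> z; rewrite inE => /andP[_ jz]; split=> //; have := levb z; rewrite ler_norml.
rewrite mulrAC ler_wpM2r//; first by have := T21; lra.
by have := N1; lra.
Qed.

(** Lines are sorted by the power of K just below their number of cells. On the top class the count
    is bounded by [cnt_le] instead, whence the factor [3 * T2]. *)
Lemma count_sum (E : {set P}) : 0 <= q ->
  \sum_j (cnt E j)%:R `^ q <=
    M.+1%:R * ((3 * T2 * K) `^ q * ((1 + `|wc| * K ^+ 2) * N ^+ n * #|E|%:R `^ (q - nr))).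
Proof.
move=> q0; set X := (1 + _) * _ * _.
have T0 : 0 < 3 * T2 * K by rewrite mulr_gt0//; have := T21; lra.
pose cl l := [set j | K ^+ l <= (cnt E j)%:R <= 3 * T2 * K * K ^+ l].
have qn0 : q != 0.
  by rewrite gt_eqF// (lt_le_trans _ hq)// mulr_gt0// addr_gt0.
have cover j : (0 < cnt E j)%N -> exists l : 'I_M.+1, j \in cl l.
  move=> c0; have c1 : 1 <= (cnt E j)%:R :> R by rewrite ler1n.
  have P0 : K ^+ (ord0 : 'I_M.+1) <= (cnt E j)%:R by rewrite expr0.
  case: (@arg_maxnP _ (ord0 : 'I_M.+1) (fun l : 'I_M.+1 => K ^+ l <= (cnt E j)%:R) (fun l => nat_of_ord l) P0) => l Pl lmax.
  exists l; rewrite inE Pl/=; have [lM|Ml] := ltnP l M.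
    have lM' : (l.+1 < M.+1)%N by [].
    have : ~~ (K ^+ l.+1 <= (cnt E j)%:R).
      by apply/negP => H; have := lmax (Ordinal lM') H; rewrite /= ltnn.
    rewrite -ltNge exprS => /ltW hc; apply: (le_trans hc); rewrite -mulrA ler_peMl//.
      by rewrite mulr_ge0 ?exprn_ge0 ?(ltW K0).
    by have := T21; lra.
  have -> : nat_of_ord l = M by apply/eqP; rewrite eqn_leq Ml -ltnS ltn_ord.
  rewrite KM (le_trans (cnt_le E j))// [leRHS]mulrAC ler_peMr//; last by have := K2; lra.
  by rewrite mulr_ge0 ?(ltW N0)//; have := T21; lra.
have term (l : 'I_M.+1) : \sum_(j in cl l) (cnt E j)%:R `^ q <= (3 * T2 * K) `^ q * X.
  have Kl : 1 <= K ^+ l by rewrite exprn_ege1//; have := K2; lra.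
  apply: (@le_trans _ _ (\sum_(j in cl l) (3 * T2 * K) `^ q * (K ^+ l) `^ q)).
    apply: ler_sum => j; rewrite inE => /andP[_ hc]; rewrite -powRM ?(ltW T0) ?exprn_ge0 ?(ltW K0)//.
    by apply: ge0_ler_powR => //; rewrite nnegrE//; apply: (le_trans _ hc).
  rewrite sumr_const -[leLHS]mulr_natl mulrCA ler_wpM2l ?powR_ge0//; apply: level_bound => // j.
  by rewrite inE => /andP[].
have split : \sum_j (cnt E j)%:R `^ q <= \sum_(l < M.+1) \sum_(j in cl l) (cnt E j)%:R `^ q.
  under [leRHS]eq_bigr do rewrite big_mkcond/=.
  rewrite exchange_big/=; apply: ler_sum => j _.
  have [c0|c0] := posnP (cnt E j).
    by rewrite c0 powR0//; apply: sumr_ge0 => l _; case: ifP => // _; rewrite powR_ge0.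
  have [l jl] := cover j c0; rewrite (bigD1 l)//= jl lerDl; apply: sumr_ge0 => l' _.
  by case: ifP => // _; rewrite powR_ge0.
apply: (le_trans split); rewrite mulr_natl -[M.+1 in leRHS]card_ord -sumr_const.
by apply: ler_sum => l _; exact: term.
Qed.

(** Every term is at most the r-th root of the sum of r-th powers. The crude factor is harmless,
    since the index set will be the M+1 levels. *)
Lemma powR_sum_le (T : finType) (f : T -> R) (r : R) : 0 < r -> (forall i, 0 <= f i) ->
  (\sum_i f i) `^ r <= #|T|%:R `^ r * \sum_i f i `^ r.
Proof.
move=> r0 f0; have s0 : 0 <= \sum_i f i `^ r by apply: sumr_ge0 => i _; rewrite powR_ge0.
pose y := (\sum_i f i `^ r) `^ r^-1.
have yr : y `^ r = \sum_i f i `^ r by rewrite /y -powRrM mulVf ?gt_eqF// powRr1.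
have fy i : f i <= y.
  have -> : f i = (f i `^ r) `^ r^-1 by rewrite -powRrM mulfV ?gt_eqF// powRr1.
  apply: ge0_ler_powR; rewrite ?nnegrE ?powR_ge0// ?invr_ge0 ?(ltW r0)//.
  by rewrite (bigD1 i)//= lerDl; apply: sumr_ge0 => k _; rewrite powR_ge0.
have fs : \sum_i f i <= #|T|%:R * y.
  by rewrite mulr_natl -sumr_const; apply: ler_sum.
rewrite -yr -powRM ?powR_ge0//; apply: ge0_ler_powR; rewrite ?nnegrE ?(ltW r0)//.
  by apply: sumr_ge0.
by rewrite mulr_ge0// powR_ge0.
Qed.

Variables (p Cb : R) (b : P -> R).
Hypotheses (p1 : 1 < p) (qp : p * (q - nr) = q) (b0 : forall z, 0 <= b z).
Hypotheses (Cb0 : 0 <= Cb) (hJ : #|J|%:R <= Cb * N ^+ n).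

Let q_gt0 : 0 < q.
Proof. by apply: (lt_le_trans _ hq); rewrite mulr_gt0// addr_gt0. Qed.
Let q_gen : nr <= q.
Proof. by rewrite -subr_ge0 -(@pmulr_rge0 _ p) ?qp ?ltW//; have := p1; lra. Qed.

(** The function [b] is split into levels K^(-i), and [count_sum] is applied to the cells of each
    level. *)
Lemma unit_strong_type : \sum_z b z `^ p <= 1 ->
  \sum_j (\sum_(z | (j, z) \in I) b z) `^ q <=
    M.+1%:R `^ q * (M.+1%:R * ((3 * T2) `^ q * (Cb + M.+1%:R * (1 + `|wc|)) * (K `^ (2 * q) * K ^+ 2 * N ^+ n))).
Proof.
move=> bp; have p0 : 0 < p by have := p1; lra.
have K1 : 1 <= K by have := K2; lra.
have Kn0 k : 0 < K ^+ k by rewrite exprn_gt0.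
have T0 : 0 < 3 * T2 by have := T21; lra.
have bp1 z : b z `^ p <= 1.
  by apply: (le_trans _ bp); rewrite (bigD1 z)//= lerDl; apply: sumr_ge0 => k _; rewrite powR_ge0.
have b1 z : b z <= 1.
  by rewrite leNgt; apply/negP => h; have := bp1 z; rewrite leNgt -[ltLHS](congr1 (fun f => f p) (@powR1 R)) gt0_ltr_powR ?nnegrE.
(* The last class i = M gathers all values up to K^(-M) = 1/N, zero included; there the number of
   cells on a line, at most about N, already suffices. *)
pose E (i : 'I_M.+1) := [set z | (b z <= (K ^+ i)^-1) && (((K ^+ i.+1)^-1 < b z) || (i == M :> nat))].
have cov z : exists i, z \in E i.
  have P0 : b z <= (K ^+ (ord0 : 'I_M.+1))^-1 by rewrite expr0 invr1.
  case: (@arg_maxnP _ (ord0 : 'I_M.+1) (fun l : 'I_M.+1 => b z <= (K ^+ l)^-1) (fun l => nat_of_ord l) P0) => l Pl lmax.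
  exists l; rewrite inE Pl/=; case: (ltngtP l M) => [lM|Ml|_]; last by rewrite orbT.
    rewrite orbF ltNge; apply/negP => H.
    by have := lmax (@Ordinal M.+1 l.+1 lM) H; rewrite /= ltnn.
  by have := ltn_ord l; rewrite ltnS leqNgt Ml.
have Sj j : \sum_(z | (j, z) \in I) b z <= \sum_(i < M.+1) (K ^+ i)^-1 * (cnt (E i) j)%:R.
  apply: (@le_trans _ _ (\sum_(z | (j, z) \in I) \sum_(i < M.+1) (K ^+ i)^-1 * (z \in E i)%:R)).
    apply: ler_sum => z _; have [i zi] := cov z; rewrite (bigD1 i)//= zi mulr1.
    apply: (@le_trans _ _ (K ^+ i)^-1); first by move: zi; rewrite inE => /andP[].
    by rewrite lerDl; apply: sumr_ge0 => k _; rewrite mulr_ge0// invr_ge0 ltW.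
  rewrite exchange_big/=; apply: ler_sum => i _; rewrite -mulr_sumr ler_wpM2l ?invr_ge0 ?(ltW (Kn0 _))//.
  rewrite -natr_sum ler_nat /cnt -sum1_card big_mkcond/= [leqRHS]big_mkcond/=.
  by apply: leq_sum => z _; rewrite inE; case: (_ \in I); case: (z \in E i).
pose B := (3 * T2) `^ q * (Cb + M.+1%:R * (1 + `|wc|)) * (K `^ (2 * q) * K ^+ 2 * N ^+ n).
have Kq1 : 1 <= K `^ (2 * q) by rewrite -[leLHS](powRr0 K) ler_powR// mulr_ge0 ?ltW.
have wc0 : 0 <= `|wc| by rewrite normr_ge0.
have NN0 : 0 < N ^+ n by rewrite exprn_gt0.
have K21 : 1 <= K ^+ 2 by rewrite exprn_ege1.
have lev_i (i : 'I_M.+1) : \sum_j ((K ^+ i)^-1 * (cnt (E i) j)%:R) `^ q <= B.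
  have [iM|iM] := eqVneq (i : nat) M.
    apply: (@le_trans _ _ (\sum_(j : J) (3 * T2) `^ q)).
      apply: ler_sum => j _; apply: ge0_ler_powR; rewrite ?nnegrE ?(ltW q_gt0) ?(ltW T0)//.
        by rewrite mulr_ge0// invr_ge0 ltW.
      by rewrite iM KM ler_pdivrMl// mulrC; apply: cnt_le.
    rewrite sumr_const -[leLHS]mulr_natl /B mulrC -!mulrA ler_wpM2l ?powR_ge0//.
    apply: (le_trans hJ); rewrite !mulrA ler_wpM2r ?(ltW NN0)//.
    apply: (@le_trans _ _ (Cb + M.+1%:R * (1 + `|wc|))).
      by rewrite lerDl mulr_ge0// addr_ge0.
    rewrite -!mulrA -expr2 ler_peMr//; last by rewrite -[leLHS]mul1r ler_pM.
    by rewrite addr_ge0// mulr_ge0// addr_ge0.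
  (* Chebyshev's inequality for the normalised [b]. *)
  have Ecard : #|E i|%:R <= K `^ (i.+1%:R * p).
    have : \sum_(z in E i) (K ^+ i.+1)^-1 `^ p <= 1.
      apply: (le_trans _ bp); rewrite [leRHS](bigID (mem (E i)))/= -[leLHS]addr0; apply: lerD.
        apply: ler_sum => z; rewrite inE (negPf iM) orbF => /andP[_ /ltW h].
        by apply: ge0_ler_powR; rewrite ?nnegrE ?invr_ge0 ?(ltW p0) ?(ltW (Kn0 _)).
      by apply: sumr_ge0 => z _; rewrite powR_ge0.
    rewrite sumr_const -[leLHS]mulr_natl -powR_mulrn ?(ltW K0)// -powRN -powRrM mulNr powRN.
    by rewrite ler_pdivrMr ?mul1r// powR_gt0.
  (* By p (q - n) = q the cardinality contributes (K^(i+1))^q, which cancels the weight K^(-i q) up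
     to K^q. *)
  have Eq : #|E i|%:R `^ (q - nr) <= K `^ q * (K ^+ i) `^ q.
    apply: (@le_trans _ _ ((K `^ (i.+1%:R * p)) `^ (q - nr))).
      by apply: ge0_ler_powR; rewrite ?nnegrE ?powR_ge0// subr_ge0.
    rewrite -powRrM -mulrA qp -powR_mulrn ?(ltW K0)// -powRrM -powRD; last by rewrite (gt_eqF K0) implybT.
    by have -> : i.+1%:R * q = q + i%:R * q by rewrite -natr1; ring.
  have step : \sum_j ((K ^+ i)^-1 * (cnt (E i) j)%:R) `^ q = ((K ^+ i)`^ q)^-1 * \sum_j (cnt (E i) j)%:R `^ q.
    rewrite mulr_sumr; apply: eq_bigr => j _; rewrite powRM ?invr_ge0 ?(ltW (Kn0 _))//; congr (_ * _).
    by rewrite -powR_inv1 ?(ltW (Kn0 _))// -!powRrM mulN1r powRN.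
  rewrite step ler_pdivrMl ?powR_gt0//.
  apply: (le_trans (count_sum _ (ltW q_gt0))).
  set Y := (K ^+ i) `^ q in Eq *; have Y0 : 0 <= Y by rewrite powR_ge0.
  rewrite powRM ?(ltW K0) ?(ltW T0)//.
  have Kqq : K `^ (2 * q) = K `^ q * K `^ q.
    by rewrite -powRD ?mulr2n ?mulrDl ?mul1r// (gt_eqF K0) implybT.
  rewrite /B Kqq; move: Eq; set e := _ `^ (q - nr); set k := K `^ q; set s := (3 * T2) `^ q => Eq.
  have k0 : 0 <= k by rewrite powR_ge0.
  have s0 : 0 <= s by rewrite powR_ge0.
  have m0 : 0 <= M.+1%:R :> R by [].
  have d1 : 1 + `|wc| * K ^+ 2 <= (1 + `|wc|) * K ^+ 2.
    by rewrite mulrDl mul1r lerD2r.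
  have hh : (1 + `|wc| * K ^+ 2) * N ^+ n * e <= (1 + `|wc|) * K ^+ 2 * N ^+ n * (k * Y).
    apply: ler_pM => //; [|exact: powR_ge0|].
      by rewrite mulr_ge0 ?(ltW NN0)// addr_ge0// mulr_ge0// (le_trans ler01).
    by rewrite ler_wpM2r// ltW.
  apply: (@le_trans _ _ (M.+1%:R * (s * k * ((1 + `|wc|) * K ^+ 2 * N ^+ n * (k * Y))))).
    by rewrite ler_wpM2l// ler_wpM2l// mulr_ge0.
  have -> : M.+1%:R * (s * k * ((1 + `|wc|) * K ^+ 2 * N ^+ n * (k * Y))) =
    Y * (s * (M.+1%:R * (1 + `|wc|)) * (k * k * K ^+ 2 * N ^+ n)) by ring.
  rewrite ler_wpM2l//; apply: ler_pM => //.
  - by rewrite mulr_ge0// mulr_ge0// addr_ge0.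
  - by apply: mulr_ge0 (ltW NN0); apply: mulr_ge0; [exact: mulr_ge0|lra].
  - by rewrite ler_wpM2l// lerDr.
apply: (@le_trans _ _ (\sum_j M.+1%:R `^ q * \sum_(i < M.+1) ((K ^+ i)^-1 * (cnt (E i) j)%:R) `^ q)).
  apply: ler_sum => j _; have := @powR_sum_le 'I_M.+1 (fun i => (K ^+ i)^-1 * (cnt (E i) j)%:R) q q_gt0.
  rewrite card_ord => H; apply: (le_trans _ (H _)); last first.
    by move=> i; rewrite mulr_ge0// invr_ge0 ltW.
  apply: ge0_ler_powR (Sj j); rewrite ?nnegrE ?(ltW q_gt0)//; first exact: sumr_ge0.
  by apply: sumr_ge0 => i _; rewrite mulr_ge0// invr_ge0 ltW.
rewrite -mulr_sumr ler_wpM2l ?powR_ge0// exchange_big/= -/B.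
have -> : M.+1%:R * B = \sum_(i < M.+1) B by rewrite sumr_const card_ord mulr_natl.
by apply: ler_sum => i _; exact: lev_i.
Qed.

End StrongType.

Lemma powR_invK (R : realType) (y p : R) : p != 0 -> 0 <= y -> (y `^ p^-1) `^ p = y.
Proof. by move=> p0 y0; rewrite -powRrM mulVf// powRr1. Qed.

(** All losses are powers of K and of M. The number M of scales is fixed by eps, and K = (c N)^(1/M)
    then makes the powers of K cost at most N^eps; homogeneity reduces to unit norm. *)
Lemma strong_type (R : realType) (n : nat) (A p Cb eps : R) : (0 < n)%N -> 1 <= A ->
  1 < p -> p <= (n%:R + 3) / 2 -> 0 <= Cb -> 0 < eps ->
  exists2 C : R, 0 <= C & forall (J P : finType) (x w : J -> 'I_n -> R) (lev : P -> R)
    (pos : P -> 'I_n -> R) (N : R) (I : {set J * P}) (b : P -> R),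
  1 <= N ->
  (forall j k, j != k -> exists i, 1 <= `|x j i - x k i|) ->
  (forall z z', z != z' -> 1 <= `|lev z - lev z'| \/
    lev z = lev z' /\ exists i, 1 <= `|pos z i - pos z' i|) ->
  (forall z, `|lev z| <= N) -> (forall j i, `|w j i| <= 1) ->
  (forall j z, (j, z) \in I -> forall i, `|pos z i - x j i - lev z * w j i| <= A) ->
  #|J|%:R <= Cb * N ^+ n -> (forall z, 0 <= b z) ->
  \sum_j (\sum_(z | (j, z) \in I) b z) `^ (n%:R * (p / (p - 1))) <=
    C * (N ^+ n * N `^ eps) * (\sum_z b z `^ p) `^ (n%:R * (p / (p - 1)) / p).
Proof.
move=> n0 A1 p1 pn Cb0 e0; set nr : R := n%:R; set q := nr * _.
have nr0 : 0 < nr by rewrite ltr0n.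
have p0 : 0 < p by lra.
have pm : 0 < p - 1 by lra.
have q0 : 0 < q by rewrite mulr_gt0// divr_gt0.
have hq : (nr + 3) * (nr / (nr + 1)) <= q.
  have -> : (nr + 3) * (nr / (nr + 1)) = nr * ((nr + 3) / (nr + 1)) by ring.
  rewrite ler_wpM2l ?(ltW nr0)// ler_pdivrMr ?addr_gt0//.
  have -> : p / (p - 1) * (nr + 1) = (p * (nr + 1)) / (p - 1) by ring.
  rewrite ler_pdivlMr// -subr_ge0.
  have -> : p * (nr + 1) - (nr + 3) * (p - 1) = nr + 3 - p * 2 by ring.
  by move: pn; rewrite -/nr ler_pdivlMr// subr_ge0.
have qp : p * (q - nr) = q by rewrite /q; field; rewrite gt_eqF.
(* The total loss is K^(2q+2) = (c N)^((2q+2)/M), so M must exceed (2q+2)/eps. *)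
pose M := (Num.truncn ((2 * q + 2) / eps)).+1.
have M0 : (0 : R) < M%:R by rewrite ltr0n.
have Me : (2 * q + 2) / M%:R <= eps.
  rewrite ler_pdivrMr// [leRHS]mulrC -ler_pdivrMr//; apply: ltW; exact: truncnS_gt.
pose T2 : R := (2 * A + 1) ^+ n.
pose D := M.+1%:R `^ q * (M.+1%:R * ((3 * T2) `^ q * (Cb + M.+1%:R * (1 + `|wolff_const n A M|)))).
have T20 : 0 <= T2 by rewrite exprn_ge0//; lra.
have D0 : 0 <= D.
  by rewrite /D; do ?[exact: powR_ge0 | exact: ler0n | exact: normr_ge0 | exact: Cb0 | exact: ler01 | apply: mulr_ge0 | apply: addr_ge0].
(* Enlarging N by 2^M ensures K >= 2 even for N = 1; the factor depends on M only and goes into the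
   constant. *)
pose c : R := 2 ^+ M.
have c1 : 1 <= c by rewrite exprn_ege1//; lra.
exists (D * (c ^+ n * c `^ eps)).
  by rewrite mulr_ge0// mulr_ge0 ?powR_ge0// exprn_ge0//; lra.
move=> J P x w lev pos N I b N1 sepx sepp levb wb inc hJ b0.
pose N' := c * N; pose K := N' `^ M%:R^-1.
have N0 : 0 < N by lra.
have N'1 : N <= N' by rewrite /N' ler_peMl// ltW.
have c0 : 0 < c by lra.
have N'0 : 0 < N' by rewrite mulr_gt0.
have KM : K ^+ M = N' by rewrite -powR_mulrn ?powR_ge0// powR_invK ?gt_eqF// ltW.
have K2 : 2 <= K.
  rewrite leNgt; apply/negP => h.
  have : K ^+ M < c by rewrite /c ltr_pXn2r ?nnegrE ?powR_ge0.
  by rewrite KM /N' ltNge ler_peMr// ltW.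
have K0 : 0 < K by lra.
have Kq : K `^ (2 * q) * K ^+ 2 <= c `^ eps * N `^ eps.
  rewrite -powRM ?(ltW c0) ?(ltW N0)// -/N' -powR_mulrn ?(ltW K0)// -powRD; last by rewrite (gt_eqF K0) implybT.
  rewrite /K -powRrM ler_powR//; first by lra.
  by rewrite mulrC.
have hJ' : #|J|%:R <= Cb * N' ^+ n.
  by apply: (le_trans hJ); rewrite ler_wpM2l// lerXn2r ?nnegrE ?(ltW N0) ?(ltW N'0).
have U (b' : P -> R) : (forall z, 0 <= b' z) -> \sum_z b' z `^ p <= 1 ->
    \sum_j (\sum_(z | (j, z) \in I) b' z) `^ q <= D * (c ^+ n * c `^ eps) * (N ^+ n * N `^ eps).
  move=> b'0 b'1; have levb' z : `|lev z| <= N' by exact: le_trans (levb z) N'1.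
  have N'11 : 1 <= N' by lra.
  have := @unit_strong_type R n J P x w lev pos A N' n0 A1 N'11 sepx sepp levb' wb I inc K M K2 KM q hq
    p Cb b' p1 qp b'0 Cb0 hJ' b'1.
  move=> H; apply: (le_trans H); rewrite -/T2.
  set a1 := M.+1%:R `^ q; set a2 := (3 * T2) `^ q * _; rewrite -[leLHS]/(a1 * (M.+1%:R * (a2 * _))).
  have -> : D * (c ^+ n * c `^ eps) * (N ^+ n * N `^ eps) = a1 * (M.+1%:R * (a2 * (c `^ eps * N `^ eps * (N' ^+ n)))).
    by rewrite /D -/a1 -/a2 /N' exprMn; move: a1 a2 (M.+1%:R : R) => v1 v2 v3; ring.
  rewrite ler_wpM2l ?powR_ge0// ler_wpM2l// ler_wpM2l//.
    by do ?[exact: powR_ge0 | exact: ler0n | exact: normr_ge0 | exact: Cb0 | exact: ler01 | apply: mulr_ge0 | apply: addr_ge0].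
  by rewrite ler_wpM2r// exprn_ge0// ltW.
pose be := (\sum_z b z `^ p) `^ p^-1.
have s0 : 0 <= \sum_z b z `^ p by apply: sumr_ge0 => z _; rewrite powR_ge0.
have be0 : 0 <= be by rewrite powR_ge0.
have bq : be `^ q = (\sum_z b z `^ p) `^ (q / p) by rewrite /be -powRrM mulrC.
have bp : be `^ p = \sum_z b z `^ p by rewrite powR_invK// gt_eqF.
rewrite -bq; have [be00|bepos] := eqVneq be 0.
  rewrite be00 powR0 ?gt_eqF// mulr0 big1// => j _; rewrite big1 ?powR0 ?gt_eqF// => z _.
  have : b z `^ p <= \sum_z b z `^ p.
    by rewrite (bigD1 z)//= lerDl; apply: sumr_ge0 => k _; rewrite powR_ge0.
  rewrite -bp be00 powR0 ?gt_eqF// => h; apply/eqP.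
  have : b z `^ p == 0 by rewrite eq_le h powR_ge0.
  by rewrite powR_eq0 => /andP[].
have bpos : 0 < be by rewrite lt_def bepos be0.
have b'0 z : 0 <= b z / be by rewrite divr_ge0.
have b'1 : \sum_z (b z / be) `^ p <= 1.
  under eq_bigr => z _ do rewrite powRM ?invr_ge0//.
  by rewrite -mulr_suml -bp -powRM ?powR_ge0 ?invr_ge0// mulfV// (congr1 (fun f => f p) (@powR1 R)).
have := U _ b'0 b'1; set CC := D * _ * _ => H.
have -> : \sum_j (\sum_(z | (j, z) \in I) b z) `^ q = (\sum_j (\sum_(z | (j, z) \in I) b z / be) `^ q) * be `^ q.
  rewrite mulr_suml; apply: eq_bigr => j _; rewrite -mulr_suml -powRM ?divfK//.
  by rewrite divr_ge0//; apply: sumr_ge0.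
by rewrite ler_wpM2r// powR_ge0.
Qed.

(** * The maximal bound on a cubic grid *)

Section GridStrongType.
Local Close Scope classical_set_scope.
Local Open Scope set_scope.
Local Open Scope ring_scope.

Definition grid_insert n mm (i : 'I_n.+1) (u : 'I_mm * {ffun 'I_n -> 'I_mm}) : {ffun 'I_n.+1 -> 'I_mm} :=
  [ffun k => if unlift i k is Some k' then u.2 k' else u.1].

Lemma grid_insert_axis n mm (i : 'I_n.+1) u : @grid_insert n mm i u i = u.1.
Proof. by rewrite ffunE unlift_none. Qed.

Lemma grid_insert_lift n mm (i : 'I_n.+1) u k : @grid_insert n mm i u (lift i k) = u.2 k.
Proof. by rewrite ffunE liftK. Qed.

Lemma grid_sum (R : realType) n mm (i : 'I_n.+1) (F : {ffun 'I_n.+1 -> 'I_mm} -> R) :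
  \sum_z F z = \sum_t \sum_j F (grid_insert i (t, j)).
Proof.
rewrite pair_bigA/= (reindex (@grid_insert n mm i))/=.
  by apply: eq_bigr => -[t j].
exists (fun z => (z i, [ffun k => z (lift i k)])) => [[t j] _|z _].
  rewrite grid_insert_axis; congr (_, _); apply/ffunP => k.
  by rewrite ffunE grid_insert_lift.
apply/ffunP => k; rewrite ffunE; case: unliftP => [k'|] -> //.
by rewrite ffunE.
Qed.

Lemma nat_dist_ge1 (R : realType) (a b : nat) : a != b -> 1 <= `|a%:R - b%:R : R|.
Proof.
by case: ltngtP => // h _; [rewrite distrC|]; rewrite -natrB ?(ltnW h)// normr_nat ler1n subn_gt0.
Qed.

(** Cells near a line through [y], with coordinate [i] as parameter; slopes at most 1 express that
    [i] is a steepest coordinate. *)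
Definition grid_line (R : realType) n mm (A : R) (i : 'I_n.+1) (y : {ffun 'I_n.+1 -> 'I_mm})
    (w : 'I_n.+1 -> R) (S : {set {ffun 'I_n.+1 -> 'I_mm}}) : Prop :=
  (forall j, `|w j| <= 1) /\ forall z, z \in S ->
    forall j, `|(z j)%:R - (y j)%:R - ((z i)%:R - (y i)%:R) * w j| <= A.

(** For each axis the base points are sliced by their coordinate on that axis. One slice is an
    instance of [strong_type], levels being measured from the slice; there are mm slices and n+1
    axes. *)
Lemma grid_strong_type (R : realType) (n : nat) (A p eps : R) : (0 < n)%N -> 1 <= A ->
  1 < p -> p <= (n%:R + 3) / 2 -> 0 < eps ->
  exists2 C : R, 0 <= C & forall (mm : nat) (b : {ffun 'I_n.+1 -> 'I_mm} -> R),
  (0 < mm)%N -> (forall z, 0 <= b z) ->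
  exists W : 'I_n.+1 -> {ffun 'I_n.+1 -> 'I_mm} -> R, [/\ forall i y, 0 <= W i y,
    forall i y w S, grid_line A i y w S -> \sum_(z in S) b z <= W i y &
    \sum_i \sum_y (W i y) `^ (n%:R * (p / (p - 1))) <=
      C * (mm%:R ^+ n.+1 * mm%:R `^ eps) * (\sum_z b z `^ p) `^ (n%:R * (p / (p - 1)) / p)].
Proof.
move=> n0 A1 p1 pn e0; set q := n%:R * _.
have [C C0 hC] := @strong_type R n A p 1 eps n0 A1 p1 pn ler01 e0.
exists (n.+1%:R * C); first by rewrite mulr_ge0.
move=> mm b mm0 b0; pose Z := {ffun 'I_n.+1 -> 'I_mm}.
(* For every base cell and axis, a set of cells on a line with the largest sum of [b]: the maximal
   function is linearised by choosing one line for each point. *)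
have /choice[S hS] : forall iy : 'I_n.+1 * Z, exists S : {set Z},
    (exists w, grid_line A iy.1 iy.2 w S) /\
    forall w S', grid_line A iy.1 iy.2 w S' -> \sum_(z in S') b z <= \sum_(z in S) b z.
  move=> [i y]; pose Pr (S : {set Z}) := `[< exists w, grid_line A i y w S >].
  have P0 : Pr finset.set0.
    by apply/asboolP; exists (fun=> 0); split=> [j|z]; rewrite ?normr0// inE.
  case: (@Order.TotalTheory.arg_maxP _ _ _ finset.set0 Pr (fun S => \sum_(z in S) b z) P0) => S /asboolP PS maxS.
  by exists S; split=> // w S' hS'; apply: maxS; apply/asboolP; exists w.
have /choice[w hw] : forall iy : 'I_n.+1 * Z, exists w, grid_line A iy.1 iy.2 w (S iy).
  by move=> iy; have [] := hS iy.
exists (fun i y => \sum_(z in S (i, y)) b z); split.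
- by move=> i y; apply: sumr_ge0.
- by move=> i y w' S' h; have [_ h'] := hS (i, y); exact: h' h.
set X := _ `^ (q / p).
have row i : \sum_y (\sum_(z in S (i, y)) b z) `^ q <= C * (mm%:R ^+ n.+1 * mm%:R `^ eps) * X.
  rewrite (grid_sum i).
  have slice t : \sum_j (\sum_(z in S (i, grid_insert i (t, j))) b z) `^ q <= C * (mm%:R ^+ n * mm%:R `^ eps) * X.
    pose J := {ffun 'I_n -> 'I_mm}; pose In : {set J * Z} := [set u | u.2 \in S (i, grid_insert i (t, u.1))].
    have := @hC J Z (fun j k => (j k)%:R) (fun j k => w (i, grid_insert i (t, j)) (lift i k))
      (fun z => (z i)%:R - t%:R) (fun z k => (z (lift i k))%:R) mm%:R In b.
    have -> : \sum_j (\sum_(z | (j, z) \in In) b z) `^ q =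
        \sum_j (\sum_(z in S (i, grid_insert i (t, j))) b z) `^ q.
      by apply: eq_bigr => j _; congr (_ `^ _); apply: eq_bigl => z; rewrite inE.
    apply=> //.
    - by rewrite ler1n.
    - move=> j k /eqP jk; have [k' /eqP hk'] : exists k', j k' != k k'.
        apply/existsP; apply: contra_notT jk => /existsPn h; apply/ffunP => k'.
        by apply/eqP; move: (h k'); rewrite negbK.
      by exists k'; apply: nat_dist_ge1; apply/eqP => /val_inj.
    - move=> z z' zz'; have [e|ne] := eqVneq (z i) (z' i); last first.
        left; have -> : (z i)%:R - t%:R - ((z' i)%:R - t%:R) = (z i)%:R - (z' i)%:R :> R by ring.
        exact: nat_dist_ge1.
      right; split; first by rewrite e.
      have [k /eqP hk] : exists k, z (lift i k) != z' (lift i k).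
        apply/existsP; apply: contraNT zz' => /existsPn h; apply/eqP/ffunP => k.
        by case: (unliftP i k) => [k'|] -> //; apply/eqP; move: (h k'); rewrite negbK.
      by exists k; apply: nat_dist_ge1; apply/eqP => /val_inj.
    - move=> z; have h1 : (z i)%:R <= mm%:R :> R by rewrite ler_nat ltnW.
      have h2 : t%:R <= mm%:R :> R by rewrite ler_nat ltnW.
      have h3 : 0 <= (z i)%:R :> R by [].
      have h4 : 0 <= t%:R :> R by [].
      by rewrite ler_norml; apply/andP; split; lra.
    - by move=> j k; have [h _] := hw (i, grid_insert i (t, j)); exact: h.
    - move=> j z; rewrite inE => zS k; have [_ h] := hw (i, grid_insert i (t, j)).
      by have := h z zS (lift i k); rewrite /= grid_insert_axis grid_insert_lift.
    - by rewrite mul1r card_ffun !card_ord natrX.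
  apply: (@le_trans _ _ (\sum_(t < mm) C * (mm%:R ^+ n * mm%:R `^ eps) * X)); first by apply: ler_sum => t _; exact: slice.
  by rewrite sumr_const card_ord -[leLHS]mulr_natl exprS le_eqVlt; apply/orP; left; apply/eqP; ring.
apply: (@le_trans _ _ (\sum_(i < n.+1) C * (mm%:R ^+ n.+1 * mm%:R `^ eps) * X)); first by apply: ler_sum => i _; exact: row.
by rewrite sumr_const card_ord -[leLHS]mulr_natl !mulrA.
Qed.

End GridStrongType.

(** * From the grid to the manifold *)

Lemma measure_bigsetU_le (dd : measure_display) (T : measurableType dd) (R : realType)
  (mu : {measure set T -> \bar R}) (I : Type) (s : seq I) (A : I -> set T) (m : I -> R) :
  (forall i, measurable (A i)) -> (forall i, (mu (A i) <= (m i)%:E)%E) ->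
  (mu (\big[setU/set0]_(i <- s) A i) <= (\sum_(i <- s) m i)%:E)%E.
Proof.
move=> mA hA; elim: s => [|i s IH]; first by rewrite !big_nil measure0.
rewrite !big_cons EFinD; apply: (@le_trans _ _ (mu (A i) + mu (\big[setU/set0]_(j <- s) A j))%E).
  by apply: measureU2 => //; apply: bigsetU_measurable.
exact: leeD.
Qed.

Section SetHolder.
Context (dd : measure_display) (T : measurableType dd) (R : realType).
Variables (mu : {measure set T -> \bar R}) (f : T -> R) (p : R).
Hypotheses (mf : measurable_fun setT f) (p1 : 1 < p).

Lemma measurable_powR_abs (D : set T) : measurable_fun D (fun x => (`|f x| `^ p)%:E).
Proof.
apply/measurable_EFinP; apply: (measurable_funS measurableT) => //.
apply: (measurableT_comp (measurable_powR _)) => //; exact: measurableT_comp.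
Qed.

Lemma measurable_absE (D : set T) : measurable_fun D (fun x => (`|f x|)%:E).
Proof.
by apply/measurable_EFinP; apply: (measurable_funS measurableT) => //; exact: measurableT_comp.
Qed.

(** Hoelder's inequality for [f] cut off to [A] against the indicator of [A]. *)
Lemma holder_set (A : set T) (m : R) : measurable A -> 0 <= m -> (mu A <= m%:E)%E ->
  (\int[mu]_(y in A) `|f y|%:E <= (m `^ (1 - p^-1))%:E * (\int[mu]_(y in A) (`|f y| `^ p)%:E) `^ p^-1)%E.
Proof.
move=> mA m0 mAm; have p0 : 0 < p := lt_trans ltr01 p1.
have ip : 0 < 1 - p^-1 by rewrite subr_gt0 invf_lt1.
have mg : measurable_fun setT (\1_A : T -> R) by exact: measurable_indic.
have mfg : measurable_fun setT (f \* \1_A) by exact: measurable_funM.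
have H := @hoelder dd T R mu (f \* \1_A) (\1_A) p (1 - p^-1)^-1 mfg mg p0.
have {}H := H (_ : 0 < (1 - p^-1)^-1) (_ : p^-1 + (1 - p^-1)^-1^-1 = 1).
have {H} : ('N[mu]_1[(EFin \o ((f \* \1_A) \* \1_A)%R)] <= 'N[mu]_p%:E[EFin \o (f \* \1_A)%R] * 'N[mu]_((1 - p^-1)^-1%:E)[EFin \o \1_A])%E.
  by apply: H; [rewrite invr_gt0|rewrite invrK; ring].
have -> : ('N[mu]_1[(EFin \o ((f \* \1_A) \* \1_A)%R)])%E = (\int[mu]_(y in A) `|f y|%:E)%E.
  rewrite Lnorm1 [RHS]integral_mkcond; apply: eq_integral => x _; rewrite /patch /= indicE.
  by case: ifPn => _; rewrite ?mulr1// !mulr0 normr0.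
have -> : ('N[mu]_p%:E[EFin \o (f \* \1_A)%R])%E = ((\int[mu]_(y in A) (`|f y| `^ p)%:E) `^ p^-1)%E.
  rewrite unlock; apply: (congr1 (fun z => z `^ p^-1)%E); rewrite [RHS]integral_mkcond; apply: eq_integral => x _.
  rewrite /patch /= indicE; case: ifPn => _; first by rewrite mulr1.
  by rewrite mulr0 normr0 powR0// gt_eqF.
have -> : ('N[mu]_((1 - p^-1)^-1%:E)[EFin \o \1_A])%E = (mu A `^ (1 - p^-1))%E.
  rewrite unlock invrK; congr (_ `^ _)%E; have -> : mu A = (\int[mu]_x (\1_A x)%:E)%E by rewrite integral_indic// setIT.
  apply: eq_integral => x _; rewrite /= indicE; case: (x \in A); rewrite /= ?normr1 ?powR1// normr0 powR0//.
  by rewrite gt_eqF// invr_gt0.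
move=> h; apply: (le_trans h); rewrite muleC; apply: lee_wpmul2r; first exact: poweR_ge0.
have fA : mu A \is a fin_num by rewrite ge0_fin_numE ?(le_lt_trans mAm) ?ltry.
rewrite -(fineK fA) poweR_EFin lee_fin; apply: ge0_ler_powR; rewrite ?nnegrE ?fine_ge0 ?(ltW ip)//.
by rewrite -lee_fin fineK.
Qed.

End SetHolder.

(** * From tubes in a measure space with coordinates to the grid *)

Section Transfer.
Context (dd : measure_display) (T : measurableType dd) (R : realType).
Variables (mu : {measure set T -> \bar R}) (n : nat) (D : set T) (u : T -> 'I_n.+1 -> R) (L : R).
Hypotheses (L0 : 0 < L) (uL : forall x i, D x -> `|u x i| <= L).

Definition grid_cell (delta : R) (z : 'I_n.+1 -> int) : set T :=
  [set x | D x /\ forall i, (z i)%:~R * delta <= u x i < (z i + 1)%:~R * delta].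

Hypothesis mcell : forall delta z, 0 < delta -> measurable (grid_cell delta z) /\
  (mu (grid_cell delta z) <= (L * delta ^+ n.+1)%:E)%E.

(** What geometry must supply for one tube. From here on the manifold enters only through this
    condition and through the volumes of cells. *)
Definition line_tube (delta : R) (x : T) (tau : set T) : Prop :=
  [/\ measurable tau, tau `<=` D, (((L^-1) * delta ^+ n)%:E <= mu tau)%E &
   exists (i : 'I_n.+1) (w : 'I_n.+1 -> R), (forall j, `|w j| <= 1) /\
     forall y j, tau y -> `|u y j - u x j - (u y i - u x i) * w j| <= L * delta].

Variables (delta : R).
Hypotheses (delta0 : 0 < delta) (delta1 : delta < 1).

(** [m] cells on each side of 0 cover the range of [u]; cell indices are shifted by [m] to become
    natural numbers. *)
Let m : nat := (Num.truncn (L / delta)).+1.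
Definition grid_size : nat := (m + m).+1.
Local Notation Z := {ffun 'I_n.+1 -> 'I_grid_size}.

Lemma grid_size_le : grid_size%:R <= (2 * L + 3) / delta.
Proof.
have h : (Num.truncn (L / delta))%:R <= L / delta by rewrite truncn_le// divr_ge0// ltW.
have d1 : 1 <= delta^-1 by rewrite invf_ge1// ltW.
rewrite /grid_size /m -natr1 natrD -natr1 mulrDl -mulrA; move: h d1.
by move: (L / delta) (delta^-1) (_%:R) => a b c; lra.
Qed.

Definition cell_of (z : Z) : set T := grid_cell delta (fun i => (z i : nat)%:Z - m%:Z).

Lemma cell_ofE z x : cell_of z x -> D x /\ forall i, 0 <= u x i / delta - (z i)%:R + m%:R <= 1.
Proof.
move=> [Dx h]; split=> // i; have := h i; rewrite !rmorphD /= !rmorphN/= -!pmulrn !mulr1n.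
rewrite -ler_pdivlMr// -ltr_pdivrMr// => /andP[h1 h2].
by apply/andP; split; move: h1 h2; lra.
Qed.

Lemma cell_of_cover x : D x -> exists z : Z, cell_of z x.
Proof.
move=> Dx; have Lm : L / delta < m%:R by rewrite /m truncnS_gt.
have ub i : 0 <= u x i / delta + m%:R <= (m + m)%:R.
  have := uL i Dx; rewrite natrD ler_norml => /andP[h1 h2].
  have k1 : u x i / delta <= L / delta by rewrite ler_wpM2r// invr_ge0 ltW.
  have k2 : - (L / delta) <= u x i / delta by rewrite -mulNr ler_wpM2r// invr_ge0 ltW.
  by apply/andP; split; lra.
exists [ffun i => inord (Num.truncn (u x i / delta + m%:R))]; split=> // i.
have /andP[b0 b1] := ub i.
have tl : (Num.truncn (u x i / delta + m%:R) < grid_size)%N.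
  by rewrite ltnS; rewrite -(@ler_nat R) (le_trans _ b1)// truncn_le.
rewrite ffunE inordK//; have /andP[t1 t2] := truncn_itv b0.
rewrite !rmorphD /= !rmorphN/= -!pmulrn !mulr1n; move: t1 t2; rewrite -natr1.
rewrite -ler_pdivlMr// -ltr_pdivrMr// => t1 t2; apply/andP; split; lra.
Qed.

Lemma cell_of_trivIset : trivIset [set: Z] cell_of.
Proof.
apply/trivIsetP => z z' _ _ zz'; apply/seteqP; split=> // x [[_ h] [_ h']].
move/eqP: zz'; apply; apply/ffunP => i; apply/val_inj/eqP.
have := h i; have := h' i; rewrite !rmorphD /= !rmorphN/= -!pmulrn !mulr1n => /andP[a1 a2] /andP[b1 b2].
have c1 : (z i)%:R - m%:R < (z' i)%:R - m%:R + 1 :> R by rewrite -(ltr_pM2r delta0) (le_lt_trans b1).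
have c2 : (z' i)%:R - m%:R < (z i)%:R - m%:R + 1 :> R by rewrite -(ltr_pM2r delta0) (le_lt_trans a1).
have d1 : (z i)%:R < (z' i).+1%:R :> R by rewrite -natr1; lra.
have d2 : (z' i)%:R < (z i).+1%:R :> R by rewrite -natr1; lra.
by rewrite eqn_leq; apply/andP; split; rewrite -ltnS -(ltr_nat R).
Qed.

(** Rounding [x] and a point of the tube to their cells adds at most 1 in coordinate [j] and at most
    1 in coordinate [i] times a slope, hence the tolerance [L + 2]. *)
Lemma tube_grid_line x y z tau i w : cell_of y x -> (forall j, `|w j| <= 1) ->
  (forall y j, tau y -> `|u y j - u x j - (u y i - u x i) * w j| <= L * delta) ->
  (exists2 v, tau v & cell_of z v) ->
  forall j, `|(z j)%:R - (y j)%:R - ((z i)%:R - (y i)%:R) * w j| <= L + 2.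
Proof.
move=> /cell_ofE[_ yx] hw ht [v /ht tv /cell_ofE[_ zv]] j.
have := tv j; rewrite -ler_pdivrMr// -(gtr0_norm (_ : 0 < delta^-1)) ?invr_gt0// -normrM.
have := yx j; have := yx i; have := zv j; have := zv i; have := hw j.
have -> : (u v j - u x j - (u v i - u x i) * w j) * delta^-1 =
  u v j / delta - u x j / delta - (u v i / delta - u x i / delta) * w j by ring.
move: (u v j / _) (u x j / _) (u v i / _) (u x i / _) (w j) => a b c e W hW h1 h2 h3 h4 h5.
have hp : `|(c - (z i)%:R - (e - (y i)%:R)) * W| <= 1.
  rewrite normrM -[leRHS]mul1r ler_pM// ler_norml; move/andP: h1 => [? ?]; move/andP: h3 => [? ?].
  by apply/andP; split; lra.
move: h5 hp; rewrite !ler_norml; move/andP: h2 => [? ?]; move/andP: h4 => [? ?].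
rewrite !mulrBl; move: (c * W) (e * W) ((z i)%:R * W) ((y i)%:R * W) => k1 k2 k3 k4.
by move=> /andP[? ?] /andP[? ?]; apply/andP; split; lra.
Qed.

Lemma model_domain_finite : measurable D /\ exists2 m' : R, 0 <= m' & (mu D <= m'%:E)%E.
Proof.
have mc z : measurable (cell_of z) by have [] := mcell (fun i => (z i : nat)%:Z - m%:Z) delta0.
have DE : D = \big[setU/set0]_(z <- enum [set: Z]%SET) cell_of z.
  apply/seteqP; split=> x; rewrite -bigcup_seq.
    by move=> /cell_of_cover[z zx]; exists z => //=; rewrite mem_enum inE.
  by move=> [z _ []].
split; first by rewrite DE; apply: bigsetU_measurable.
have Ld0 : 0 <= L * delta ^+ n.+1 by rewrite mulr_ge0 ?exprn_ge0// ltW.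
exists (\sum_(z <- enum [set: Z]%SET) L * delta ^+ n.+1); first by apply: sumr_ge0.
rewrite DE; apply: measure_bigsetU_le => // z.
by have [] := mcell (fun i => (z i : nat)%:Z - m%:Z) delta0.
Qed.

Variables (p eps : R).
Hypotheses (n0 : (0 < n)%N) (p1 : 1 < p) (pn : p <= (n%:R + 3) / 2) (e0 : 0 < eps).
Let q : R := n%:R * (p / (p - 1)).

Variables (C0 : R).
Hypothesis C00 : 0 <= C0.
Hypothesis hC : forall (mm : nat) (b : {ffun 'I_n.+1 -> 'I_mm} -> R),
  (0 < mm)%N -> (forall z, 0 <= b z) ->
  exists W : 'I_n.+1 -> {ffun 'I_n.+1 -> 'I_mm} -> R, [/\ forall i y, 0 <= W i y,
    forall i y w S, grid_line (L + 2) i y w S -> \sum_(z in S) b z <= W i y &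
    \sum_i \sum_y (W i y) `^ q <= C0 * (mm%:R ^+ n.+1 * mm%:R `^ eps) * (\sum_z b z `^ p) `^ (q / p)].

Variables (f : T -> R) (X : R).
Hypotheses (mf : measurable_fun setT f) (fX : (\int[mu]_x (`|f x| `^ p)%:E <= X%:E)%E).

Let p0 : 0 < p. Proof. exact: lt_trans ltr01 p1. Qed.
Let q0 : 0 < q. Proof. by rewrite mulr_gt0 ?ltr0n// divr_gt0// subr_gt0. Qed.

Let mcell_of z : measurable (cell_of z). Proof. by have [] := mcell (fun i => (z i : nat)%:Z - m%:Z) delta0. Qed.

Let sum_cell (S : {set Z}) (h : T -> \bar R) : measurable_fun setT h -> (forall x, 0 <= h x)%E ->
  (\int[mu]_(x in \big[setU/set0]_(z <- enum S) cell_of z) h x = \sum_(z in S) \int[mu]_(x in cell_of z) h x)%E.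
Proof.
move=> mh h0; rewrite ge0_integral_bigsetU//; last 3 first.
- exact: enum_uniq.
- by apply: (sub_trivIset _ cell_of_trivIset).
- exact: (measurable_funS measurableT).
by rewrite big_enum.
Qed.

(** The average over a tube is at most L / delta^n times the sum, over the cells it meets, of the
    integrals of |f|. Hoelder on each cell turns these into L^p masses, to which the grid bound
    applies. The majorant [H] is constant on cells, hence measurable. *)
Lemma transfer_at : exists H : T -> R, [/\ measurable_fun setT H, forall x, 0 <= H x,
  (\int[mu]_x (H x)%:E <= (L * (L * L `^ (1 - p^-1)) `^ q * C0 * (2 * L + 3) ^+ n.+1 * (2 * L + 3) `^ eps
     * delta `^ (- eps) * (delta `^ (1 - n.+1%:R / p)) `^ q * X `^ (q / p))%:E)%E &
  forall x tau, D x -> line_tube delta x tau -> exists v : R, [/\ 0 <= v, v `^ q <= H x &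
    ((mu tau)^-1 * \int[mu]_(y in tau) `|f y|%:E <= v%:E)%E]].
Proof.
have mg A : measurable_fun A (fun x => (`|f x| `^ p)%:E) by exact: measurable_powR_abs.
have g0 x : (0 <= (`|f x| `^ p)%:E)%E by rewrite lee_fin powR_ge0.
have cX z : (\int[mu]_(x in cell_of z) (`|f x| `^ p)%:E <= X%:E)%E.
  by apply: (le_trans _ fX); apply: ge0_subset_integral.
have cfin z : (\int[mu]_(x in cell_of z) (`|f x| `^ p)%:E \is a fin_num)%E.
  by rewrite ge0_fin_numE ?(le_lt_trans (cX z)) ?ltry// integral_ge0.
pose F z := fine (\int[mu]_(x in cell_of z) (`|f x| `^ p)%:E)%E.
have F0 z : 0 <= F z by apply: fine_ge0; apply: integral_ge0.
pose b z := F z `^ p^-1.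
have b0 z : 0 <= b z by rewrite powR_ge0.
have bX : \sum_z b z `^ p <= X.
  rewrite -lee_fin; apply: (le_trans _ fX); rewrite -sumEFin.
  under eq_bigr => z _ do rewrite /b powR_invK ?gt_eqF// /F fineK//.
  have -> : (\sum_z \int[mu]_(x in cell_of z) (`|f x| `^ p)%:E = \sum_(z in [set: Z]%SET) \int[mu]_(x in cell_of z) (`|f x| `^ p)%:E)%E.
    by apply: eq_bigl => z; rewrite inE.
  rewrite -sum_cell//; apply: ge0_subset_integral => //.
  by apply: bigsetU_measurable.
have X0 : 0 <= X by apply: (le_trans _ bX); apply: sumr_ge0 => z _; rewrite powR_ge0.
have [W [W0 hW hS]] := hC (ltn0Sn _ : 0 < grid_size)%N b0.
(* [k] is the Hoelder factor of one cell and [c] adds the division by the tube volume; together they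
   produce the exponent -n + (n+1)(1 - 1/p) = 1 - (n+1)/p of delta. *)
pose k := (L * delta ^+ n.+1) `^ (1 - p^-1); pose c := L / delta ^+ n * k.
have dn0 : 0 < delta ^+ n by rewrite exprn_gt0.
have c0 : 0 <= c by rewrite mulr_ge0 ?powR_ge0// divr_ge0// ltW.
pose h z := \sum_i (c * W i z) `^ q.
have h0 z : 0 <= h z by apply: sumr_ge0 => i _; rewrite powR_ge0.
have hI z x : 0 <= h z * \1_(cell_of z) x by rewrite mulr_ge0// indicE.
exists (fun x => \sum_z h z * \1_(cell_of z) x); split.
- apply: measurable_sum => z; apply: measurable_funM => //; exact: measurable_indic.
- by move=> x; apply: sumr_ge0.
- under eq_integral do rewrite -sumEFin.
  rewrite ge0_integral_sum//; last 2 first.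
  - by move=> z; apply/measurable_EFinP; apply: measurable_funM => //; exact: measurable_indic.
  - by move=> z x _; rewrite lee_fin.
  apply: (@le_trans _ _ (\sum_z (h z * (L * delta ^+ n.+1))%:E)%E).
    apply: lee_sum => z _; under eq_integral do rewrite EFinM.
    rewrite ge0_integralZl_EFin//; last by apply/measurable_EFinP; exact: measurable_indic.
    rewrite integral_indic// setIT EFinM lee_wpmul2l ?lee_fin//.
    by have [] := mcell (fun i => (z i : nat)%:Z - m%:Z) delta0.
  rewrite sumEFin lee_fin -mulr_suml.
  have -> : \sum_z h z = c `^ q * \sum_i \sum_z W i z `^ q.
    rewrite exchange_big/= mulr_sumr; apply: eq_bigr => z _.
    by rewrite mulr_sumr; apply: eq_bigr => i _; rewrite powRM.
  have cE : c = (L * L `^ (1 - p^-1)) * delta `^ (1 - n.+1%:R / p).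
    rewrite /c /k powRM ?exprn_ge0 ?(ltW L0) ?(ltW delta0)// -[delta ^+ n]powR_mulrn ?(ltW delta0)//.
    rewrite -[delta ^+ n.+1]powR_mulrn ?(ltW delta0)// -powRN -powRrM.
    have -> : delta `^ (1 - n.+1%:R / p) = delta `^ (- n%:R) * delta `^ (n.+1%:R * (1 - p^-1)).
      rewrite -powRD; last by rewrite (gt_eqF delta0) implybT.
      by congr (_ `^ _); rewrite -natr1; ring.
    ring.
  have -> : c `^ q = (L * L `^ (1 - p^-1)) `^ q * (delta `^ (1 - n.+1%:R / p)) `^ q.
    by rewrite cE powRM ?powR_ge0// mulr_ge0 ?powR_ge0// ltW.
  set a1 := (L * _) `^ q; set a2 := (delta `^ _) `^ q.
  have a10 : 0 <= a1 by rewrite powR_ge0.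
  have a20 : 0 <= a2 by rewrite powR_ge0.
  set B := 2 * L + 3; have B0 : 0 < B by rewrite /B; have := L0; lra.
  have gB : grid_size%:R <= B / delta := grid_size_le.
  have e1 : grid_size%:R ^+ n.+1 <= B ^+ n.+1 / delta ^+ n.+1 :> R.
    by rewrite -expr_div_n lerXn2r ?nnegrE// divr_ge0 ?ltW.
  have e2 : grid_size%:R `^ eps <= B `^ eps * delta `^ (- eps).
    rewrite powRN -powR_inv1 ?powR_ge0// -powRrM mulrN1 -mulN1r powRrM powR_inv1 ?(ltW delta0)//.
    rewrite -powRM ?invr_ge0 ?(ltW B0) ?(ltW delta0)//.
    by apply: ge0_ler_powR; rewrite ?nnegrE ?(ltW e0)// divr_ge0 ?ltW.
  have e3 : (\sum_z b z `^ p) `^ (q / p) <= X `^ (q / p).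
    apply: ge0_ler_powR; rewrite ?nnegrE ?divr_ge0 ?(ltW q0) ?(ltW p0)//.
    by apply: sumr_ge0 => z _; rewrite powR_ge0.
  have d0 : 0 < delta ^+ n.+1 by rewrite exprn_gt0.
  have e4 : \sum_i \sum_y W i y `^ q <= C0 * (B ^+ n.+1 / delta ^+ n.+1 * (B `^ eps * delta `^ (- eps))) * X `^ (q / p).
    apply: (le_trans hS); apply: ler_pM => //; first by rewrite mulr_ge0// mulr_ge0 ?powR_ge0// exprn_ge0.
      by rewrite powR_ge0.
    by rewrite ler_wpM2l//; apply: ler_pM => //; rewrite ?exprn_ge0 ?powR_ge0.
  set V := \sum_i _ in e4 *; set x1 := B `^ eps in e4 *; set x2 := delta `^ (- eps) in e4 *.
  set x3 := X `^ _ in e4 *.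
  have -> : L * a1 * C0 * B ^+ n.+1 * x1 * x2 * a2 * x3 =
    a1 * a2 * (L * delta ^+ n.+1) * (C0 * (B ^+ n.+1 / delta ^+ n.+1 * (x1 * x2)) * x3).
    by field; rewrite gt_eqF.
  have -> : a1 * a2 * V * (L * delta ^+ n.+1) = a1 * a2 * (L * delta ^+ n.+1) * V by ring.
  apply: ler_wpM2l => //; apply: mulr_ge0; [exact: mulr_ge0|apply: mulr_ge0; exact: ltW].
move=> x tau Dx [mtau tD tvol [i [w [w1 hw]]]].
have [y yx] := cell_of_cover Dx.
pose S : {set Z} := finset.finset (fun z => `[< exists2 v, tau v & cell_of z v >]).
have Sline : grid_line (L + 2) i y w S.
  split=> // z; rewrite finset.in_set => /asboolP zS; exact: (tube_grid_line yx w1 hw zS).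
exists (c * W i y); split; first by rewrite mulr_ge0.
  rewrite (bigD1 y)//= indicE mem_set// mulr1 -[leLHS]addr0 lerD//.
    by rewrite /h (bigD1 i)//= lerDl; apply: sumr_ge0 => j _; rewrite powR_ge0.
  by apply: sumr_ge0.
have ma A : measurable_fun A (fun x => (`|f x|)%:E) by exact: measurable_absE.
have I1 : (\int[mu]_(y in tau) `|f y|%:E <= (k * W i y)%:E)%E.
  apply: (@le_trans _ _ (\int[mu]_(y in \big[setU/set0]_(z <- enum S) cell_of z) `|f y|%:E)%E).
    apply: ge0_subset_integral => //; first by apply: bigsetU_measurable.
    move=> v tv; have [z zv] := cell_of_cover (tD _ tv).
    by rewrite -bigcup_seq; exists z => //=; rewrite mem_enum finset.in_set; apply/asboolP; exists v.
  rewrite sum_cell//; apply: (@le_trans _ _ (\sum_(z in S) (k * b z)%:E)%E).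
    apply: lee_sum => z _; have [_ vz] := mcell (fun i => (z i : nat)%:Z - m%:Z) delta0.
    have Ld0 : 0 <= L * delta ^+ n.+1 by rewrite mulr_ge0 ?exprn_ge0// ltW.
    apply: (le_trans (holder_set mf p1 (mcell_of z) Ld0 vz)).
    by rewrite -/k -(fineK (cfin z)) poweR_EFin.
  by rewrite sumEFin lee_fin -mulr_sumr ler_wpM2l ?powR_ge0//; exact: hW Sline.
apply: (@le_trans _ _ ((L / delta ^+ n)%:E * (k * W i y)%:E)%E).
  apply: lee_pmul => //; [|by apply: integral_ge0|].
    by rewrite inve_ge0.
  have mt0 : (0 < mu tau)%E by apply: (lt_le_trans _ tvol); rewrite lte_fin mulr_gt0// invr_gt0.
  move: tvol mt0; case: (mu tau) => [r| |]; last by [].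
    rewrite lee_fin lte_fin => hr r0; rewrite inver gt_eqF// lee_fin.
    have -> : L / delta ^+ n = (L^-1 * delta ^+ n)^-1 by rewrite invfM invrK.
    by rewrite lef_pV2// posrE mulr_gt0// invr_gt0.
  by move=> _ _; rewrite invey lee_fin divr_ge0// ltW.
by rewrite -EFinM lee_fin mulrA.
Qed.

End Transfer.

(** * Existence of segments and the reach of a tube *)

Section Segments.
Variables (R : realType) (n : nat) (M : ptopologicalType).
Variable g : riemannianManifold R n.+1 M.
Variables (R1 alpha : R) (nc : M -> chart R n.+1 M) (nr : M -> R).
Hypotheses (alpha0 : 0 < alpha) (alphaR1 : alpha < R1) (hnr : forall p, R1 < nr p / 2).
Hypothesis hnc : forall p, normal_chart g p (nr p) (nc p).
Implicit Types (x y z p : M) (I : set R).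

Let R1p : 0 < R1. Proof. exact: lt_trans alpha0 alphaR1. Qed.

(** A radial geodesic of constant speed [R1] run for time alpha / R1. It makes the supremum in
    [nikodym] range over a nonempty set, so the maximal function is nonnegative. *)
Lemma segment_exists x : exists gam, geodesic_segment g alpha gam /\ gam x.
Proof.
have r0 : 0 < nr x by have := hnr x; have := R1p; lra.
have R1r : R1 < nr x by have := hnr x; have := R1p; lra.
pose v : 'rV[R]_n.+1 := const_mx 1.
have v0 : v != 0 by apply/eqP => /matrixP/(_ 0 0); rewrite !mxE => /eqP; rewrite oner_eq0.
set Q := Q0 g x; have Qv : 0 < bil Q v v by exact: Q0_pos.
pose y := (R1 / Num.sqrt (bil Q v v)) *: v.
have Qy : bil Q y y = R1 ^+ 2.
  rewrite /y bilZl bilZr mulrA -expr2 expr_div_n sqr_sqrtr ?(ltW Qv)// divfK// gt_eqF//.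
have iy : chart_img (nc x) y.
  by apply/(normal_img (hnc x)); rewrite -/Q Qy ltr_pXn2r// nnegrE ltW.
have [c [I [gc sI c0 vc cE]]] := normal_ray (hnc x) iy.
have aA := normal_atlas (hnc x).
pose tau := alpha / R1.
have tau0 : 0 < tau by rewrite divr_gt0.
have tau1 : tau < 1 by rewrite ltr_pdivrMr// mul1r.
have sI' : `[0, tau] `<=` I.
  by move=> u; rewrite /= in_itv/= => /andP[u0 u1]; apply: sI; rewrite /= in_itv/= u0 (le_trans u1 (ltW tau1)).
have [oI _ _] := gc.
have imgt (t : R) : 0 <= t <= 1 -> chart_img (nc x) (t *: y) by move=> t01; exact: (normal_imgZ (hnc x) t01 iy).
have sp (u : R) : 0 <= u <= tau -> Num.sqrt (inner g (c u) (velocity g c u) (velocity g c u)) = R1.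
  move=> /andP[u0 ut]; have RR : Num.sqrt (R1 ^+ 2) = R1 by rewrite sqrtr_sqr ger0_norm// ltW.
  have [->|un0] := eqVneq u 0; first by rewrite c0 vc innerE -/Q Qy RR.
  have up : 0 < u by rewrite lt_def un0.
  have u1 : u < 1 by exact: le_lt_trans ut tau1.
  have u01 : 0 <= u <= 1 by rewrite u0 ltW.
  have Iu : I u by apply: sI; rewrite /= in_itv.
  have [eu du] := cinvK (imgt _ u01).
  have cu : cmap (nc x) (c u) = u *: y by rewrite cE.
  have dcu : chart_dom (nc x) (c u) by rewrite cE.
  rewrite -/(speed g c u) (speed_chart aA oI (geodesic_C1 gc) Iu dcu) cu.
  have -> : 'D_1 (cmap (nc x) \o c) u = y.
    have N : \forall s \near u, 0 + s *: y = (cmap (nc x) \o c) s.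
      near=> s; have s0 : 0 < s by near: s; exact: lt_nbhsr.
      have s1 : s < 1 by near: s; exact: lt_nbhsl.
      have s01 : 0 <= s <= 1 by rewrite !ltW.
      by rewrite add0r /= cE//; have [-> _] := cinvK (imgt _ s01).
    by have [_ ->] := near_eq_is_derive N (is_derive_line 0 y u).
  rewrite -RR -Qy; congr Num.sqrt.
  have hz (B : 'M[R]_n.+1) : bil B (u *: y) (u *: y) = u * u * bil B y y by rewrite bilZl bilZr mulrA.
  have := metric_radial_norm r0 (hnc x) (imgt _ u01); rewrite !hz -/Q.
  by apply: mulfI; rewrite mulf_neq0.
exists (c @` `[0, tau]); split; last by exists 0 => //=; rewrite in_itv/= lexx ltW.
exists c, 0, tau, I; split=> //; first exact: ltW.
have [F [dF ->]] := length_primitive oI (geodesic_C1 gc) (ltW tau0) sI' => //; last exact: ltW.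
have [||t /itvP tb ->] := @MVT_segment R F (speed g c) 0 tau (ltW tau0).
- by move=> t; rewrite in_itv/= => /andP[/ltW t0 /ltW t1]; apply: dF; rewrite t0.
- apply: continuous_in_subspaceT => t; rewrite inE/= in_itv/= => tb.
  exact: is_derive_continuous (dF _ tb).
by rewrite [speed _ _ _]sp ?tb// subr0 /tau mulrC divfK// gt_eqF.
Unshelve. all: by end_near. Qed.

(** Less than 1 from the tube to the segment and at most alpha < 1 along it; 3 is a round upper
    bound, the thickening of [K] used in the cover. *)
Lemma tube_reach gam x y (delta : R) : delta < 1 -> alpha < 1 -> geodesic_segment g alpha gam -> gam x ->
  tube g delta gam y -> exists2 l, joined g y x l & (l <= 3%:E)%E.
Proof.
move=> d1 a1 [c [s [t [I [st sI gc len ->]]]]] [u /= uI cu] ty.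
have : (gdist_set g y (c @` `[s, t]) < 1%:E)%E by apply: (le_lt_trans ty); rewrite lte_fin.
move=> /ereal_inf_lt[_ [z [v /= vI cv] <-] /gdist_joined[l J lb]].
rewrite in_itv/= in uI; rewrite in_itv/= in vI; have [oI _ _] := gc.
have [l' J' lb'] := joined_on_curve oI (geodesic_C1 gc) sI vI uI.
rewrite cu cv len in J' lb'; exists (l + l')%E; first exact: joined_trans J J'.
apply: (@le_trans _ _ (1%:E + alpha%:E)%E); first by apply: leeD => //; exact: ltW.
by rewrite -EFinD lee_fin; have := a1; lra.
Qed.

End Segments.

(** [F] carries no measurability assumption: the integral is monotone for nonnegative functions, so
    the bound for [H] suffices. *)
Lemma Lnorm_le_majorant (dd : measure_display) (T : measurableType dd) (R : realType)
  (mu : {measure set T -> \bar R}) (F H : T -> \bar R) (q b : R) : 0 < q -> 0 <= b ->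
  (forall x, 0 <= F x)%E -> (forall x, F x `^ q <= H x)%E -> (\int[mu]_x H x <= (b `^ q)%:E)%E ->
  ('N[mu]_q%:E[F] <= b%:E)%E.
Proof.
move=> q0 b0 F0 FH Hb; rewrite unlock.
have h : (\int[mu]_x `|F x| `^ q <= (b `^ q)%:E)%E.
  apply: (le_trans _ Hb); apply: le_integral_ge0 => x _; first exact: poweR_ge0.
  by rewrite gee0_abs.
have i0 : (0 <= \int[mu]_x `|F x| `^ q)%E by apply: integral_ge0 => x _; exact: poweR_ge0.
have fi : (\int[mu]_x `|F x| `^ q)%E \is a fin_num by rewrite ge0_fin_numE ?(le_lt_trans h) ?ltry.
rewrite -(fineK fi) in h i0 *; rewrite lee_fin in h; rewrite lee_fin in i0; rewrite poweR_EFin lee_fin.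
have -> : b = (b `^ q) `^ q^-1 by rewrite -powRrM mulfV ?gt_eqF// powRr1.
by apply: ge0_ler_powR; rewrite ?nnegrE ?invr_ge0 ?powR_ge0 ?(ltW q0).
Qed.

Lemma seq_lower_bound (R : realType) (I : eqType) (s : seq I) (m : I -> R) : (forall i, 0 < m i) ->
  exists2 e : R, 0 < e & forall i, i \in s -> e <= m i.
Proof.
move=> m0; elim: s => [|i s [e e0 h]]; first by exists 1.
exists (Num.min e (m i)); first by rewrite lt_min e0 m0.
move=> j; rewrite inE => /orP[/eqP ->|/h hj]; first by rewrite ge_min lexx orbT.
by rewrite ge_min hj.
Qed.

(** * The Nikodym maximal function *)

Section Nikodym.
Variables (R : realType) (n : nat) (M : ptopologicalType).
Variable g : riemannianManifold R n.+1 M.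
Hypothesis n1 : (1 < n)%N.
Variable kappa : R.
Hypothesis hK : forall a y (u v : 'rV[R]_n.+1), atlas g a -> chart_img a y ->
  row_free (col_mx u v) -> sectional_curvature g a y u v = kappa.
Variables (mu : {measure set (borel M) -> \bar R}).
Hypothesis hmu : is_riemannian_volume g mu.
Variables (R1 alpha eta : R) (nc : M -> chart R n.+1 M) (nr : M -> R).
Hypotheses (alpha0 : 0 < alpha) (alpha1 : alpha < 1) (alphaR1 : alpha < R1) (hnr : forall p, R1 < nr p / 2).
Hypothesis hnc : forall p, normal_chart g p (nr p) (nc p).
Hypotheses (eta0 : 0 < eta) (etaR : eta + alpha + eta < R1).
Implicit Types (x y : borel M) (o : M) (f : borel M -> R).

Let R1p : 0 < R1. Proof. exact: lt_trans alpha0 alphaR1. Qed.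
Let d2 : (1 < n.+1)%N. Proof. by rewrite ltnS ltnW. Qed.

Let D o : set (borel M) := ball_at g nc o R1.
Let u o (x : borel M) (i : 'I_n.+1) : R := lmap g kappa nc o x 0 i.
Definition near_point o x := chart_dom (nc o) x /\ rho g nc o x < eta ^+ 2.

(** The local picture at [o] in the form required by the transfer, with [d0] the largest admissible
    tube radius. *)
Definition tube_model o (L d0 : R) : Prop :=
  [/\ 0 < L, 0 < d0, forall x i, D o x -> `|u o x i| <= L,
   forall delta z, 0 < delta -> measurable (grid_cell (D o) (u o) delta z) /\
     (mu (grid_cell (D o) (u o) delta z) <= (L * delta ^+ n.+1)%:E)%E &
   forall x gam delta, near_point o x -> 0 < delta -> delta < d0 ->
     geodesic_segment g alpha gam -> gam x -> line_tube mu (D o) (u o) L delta x (tube g delta gam)].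

Lemma tube_measurable (delta : R) gam : measurable (tube g delta gam : set (borel M)).
Proof. apply: closed_borel; exact: (tube_closed d2 hK R1p hnr hnc). Qed.

Lemma tube_model_exists o : exists Ld : R * R, tube_model o Ld.1 Ld.2.
Proof.
have [L [d0 [L0 d00 uL cells tubes]]] := local_model d2 hK hmu alpha0 alphaR1 hnr hnc o eta0 etaR.
exists (L, d0); split=> // x gam delta [dx rx] delta0 deltad hg gx.
have [tD tv [i [w [_ w1 hw]]]] := tubes x gam delta dx rx delta0 deltad hg gx.
split=> //; first exact: tube_measurable.
by exists i, (fun j => w 0 j).
Qed.

Variables (L d0 : M -> R) (ps : seq M) (K : set M).
Hypothesis hmodel : forall o, tube_model o (L o) (d0 o).
Hypothesis hps : forall (y x : M) l, K y -> joined g y x l -> (l <= 3%:E)%E ->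
  exists2 o, o \in ps & near_point o x.

Let nik delta f := nikodym g mu alpha delta f.
Let avg delta (f : borel M -> R) gam : \bar R :=
  ((mu (tube g delta gam))^-1 * \int[mu]_(y in tube g delta gam) `|f y|%:E)%E.

Let avg_ge0 delta f gam : (0 <= avg delta f gam)%E.
Proof. by apply: mule_ge0; [rewrite inve_ge0|apply: integral_ge0]. Qed.

Lemma nikodym_ge0 delta f x : (0 <= nik delta f x)%E.
Proof.
have [gam hg] := segment_exists alpha0 alphaR1 hnr hnc x.
by apply: (le_trans (avg_ge0 delta f gam)); apply: ereal_sup_ubound; exists gam.
Qed.

Lemma nikodym_le delta f x (v : \bar R) :
  (forall gam, geodesic_segment g alpha gam -> gam x -> (avg delta f gam <= v)%E) -> (nik delta f x <= v)%E.
Proof. by move=> h; apply: ge_ereal_sup => _ [gam [hg gx] <-]; exact: h. Qed.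

(** A tube around a segment through [x] that met [K] would put [x] within distance 3 of [K], hence
    near a point of the cover. *)
Lemma nikodym_far delta f x : delta < 1 -> (forall x, ~ K x -> f x = 0) ->
  ~ (exists2 o, o \in ps & near_point o x) -> nik delta f x = 0%E.
Proof.
move=> d1 fK far; apply/eqP; rewrite eq_le nikodym_ge0 andbT; apply: nikodym_le => gam hg gx.
rewrite /avg integral0_eq ?mule0// => y ty; rewrite fK ?normr0// => Ky; apply: far.
by have [l J lb] := tube_reach d1 alpha1 hg gx ty; exact: hps Ky J lb.
Qed.

(** For radii beyond the local threshold [d0 o] the tube contains that of radius [d0 o / 2], whose
    volume is bounded below. *)
Lemma tube_volume_near : exists2 c : R, 0 < c & forall o x gam delta, o \in ps -> near_point o x ->
  0 < delta -> delta < 1 -> geodesic_segment g alpha gam -> gam x ->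
  ((c * delta ^+ n)%:E <= mu (tube g delta gam))%E.
Proof.
have m0 o : 0 < Num.min 1 (d0 o / 2).
  by have [_ d00 _ _ _] := hmodel o; rewrite lt_min ltr01 divr_gt0.
have L0 o : 0 < L o by have [] := hmodel o.
have [|c c0 hc] := @seq_lower_bound R _ ps (fun o => (L o)^-1 * Num.min 1 (d0 o / 2) ^+ n).
  by move=> o; rewrite mulr_gt0 ?invr_gt0// exprn_gt0.
exists c => // o x gam delta ops ox delta0 delta1 hg gx; have [_ d00 _ _ tubes] := hmodel o.
have dn0 : 0 < delta ^+ n by rewrite exprn_gt0.
have [small|big] := ltP delta (d0 o).
  have [_ _ h _] := tubes x gam delta ox delta0 small hg gx; apply: (le_trans _ h).
  rewrite lee_fin ler_pM2r//; apply: (le_trans (hc o ops)); rewrite ger_pMr ?invr_gt0//.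
  by apply: exprn_ile1; rewrite ?(ltW (m0 o))// ge_min lexx.
have h0 : 0 < d0 o / 2 by rewrite divr_gt0.
have h1 : d0 o / 2 < d0 o by rewrite ltr_pdivrMr// ltr_pMr// ltr1n.
have [_ _ h _] := tubes x gam _ ox h0 h1 hg gx.
apply: (@le_trans _ _ (mu (tube g (d0 o / 2) gam))).
  apply: (le_trans _ h); rewrite lee_fin; apply: (@le_trans _ _ c).
    by rewrite ger_pMr//; apply: exprn_ile1; exact: ltW.
  apply: (le_trans (hc o ops)); rewrite ler_wpM2l ?invr_ge0 ?(ltW (L0 o))//.
  by rewrite lerXn2r ?nnegrE ?(ltW (m0 o)) ?(ltW h0)// ge_min lexx orbT.
apply: le_measure; rewrite ?inE; [exact: tube_measurable|exact: tube_measurable|].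
move=> y /= h'; apply: (le_trans h'); rewrite lee_fin; exact: le_trans (ltW h1) big.
Qed.

Lemma nikodym_le_L1 : exists2 c : R, 0 < c & forall (delta : R) f x, 0 < delta -> delta < 1 ->
  measurable_fun setT f -> (forall x, ~ K x -> f x = 0) ->
  (nik delta f x <= (c / delta ^+ n)%:E * \int[mu]_y `|f y|%:E)%E.
Proof.
have [c c0 hc] := tube_volume_near; exists c^-1; first by rewrite invr_gt0.
move=> delta f x delta0 delta1 mf fK; have dn0 : 0 < delta ^+ n by rewrite exprn_gt0.
have v0 : 0 <= c^-1 / delta ^+ n by rewrite divr_ge0 ?invr_ge0 ?(ltW c0) ?(ltW dn0).
case: (pselect (exists2 o, o \in ps & near_point o x)) => [[i ops ox]|far]; last first.
  by rewrite nikodym_far// mule_ge0 ?lee_fin//; apply: integral_ge0.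
apply: nikodym_le => gam hg gx; have vol := hc i x gam delta ops ox delta0 delta1 hg gx.
apply: lee_pmul; [by rewrite inve_ge0|by apply: integral_ge0| |].
  have mt0 : (0 < mu (tube g delta gam))%E by apply: (lt_le_trans _ vol); rewrite lte_fin mulr_gt0.
  move: vol mt0; case: (mu (tube g delta gam)) => [r| |]; last by [].
    rewrite lee_fin lte_fin => hr r0; rewrite inver gt_eqF// lee_fin.
    by rewrite -invfM lef_pV2// posrE mulr_gt0.
  by move=> _ _; rewrite invey lee_fin.
apply: ge0_subset_integral => //; first exact: tube_measurable.
exact: measurable_absE.
Qed.

Variable p : R.
Hypotheses (p1 : 1 < p) (pn : p <= (n%:R + 3) / 2).
Let q : R := n%:R * (p / (p - 1)).
Let p0 : 0 < p. Proof. exact: lt_trans ltr01 p1. Qed.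
Let q0 : 0 < q. Proof. by rewrite mulr_gt0 ?ltr0n ?(ltnW n1)// divr_gt0// subr_gt0. Qed.

Let U : set (borel M) := \big[setU/set0]_(o <- ps) D o.

Lemma domain_finite : measurable U /\ exists2 m : R, 0 <= m & (mu U <= m%:E)%E.
Proof.
have h o : measurable (D o) /\ exists2 m : R, 0 <= m & (mu (D o) <= m%:E)%E.
  have [L0 _ uL mc _] := hmodel o.
  have half0 : 0 < 2^-1 :> R by rewrite invr_gt0.
  by apply: (model_domain_finite L0 uL mc half0).
have mD o : measurable (D o) by have [] := h o.
have /choice[m hm] : forall o, exists m : R, 0 <= m /\ (mu (D o) <= m%:E)%E.
  by move=> o; have [_ [m m0 mm]] := h o; exists m.
split; first by apply: bigsetU_measurable.
exists (\sum_(o <- ps) m o); first by apply: sumr_ge0 => o _; have [] := hm o.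
by apply: measure_bigsetU_le => // o; have [] := hm o.
Qed.

Let eta_R1 : eta ^+ 2 <= R1 ^+ 2.
Proof. by rewrite lerXn2r ?nnegrE ?(ltW eta0) ?(ltW R1p)//; have := etaR; have := alpha0; have := eta0; lra. Qed.

Lemma near_domain o x : near_point o x -> D o x.
Proof. by move=> [dx rx]; split=> //; apply: le_trans (ltW rx) eta_R1. Qed.

Lemma support_domain : K `<=` U.
Proof.
move=> x Kx; have [|o ops ox] := hps Kx (joined_refl g x); first by rewrite lee_fin.
by rewrite /U -bigcup_seq; exists o => //; exact: near_domain.
Qed.

Lemma near_in_U o x : o \in ps -> near_point o x -> U x.
Proof. by move=> ops ox; rewrite /U -bigcup_seq; exists o => //; exact: near_domain. Qed.

Variable eps : R.
Hypothesis eps0 : 0 < eps.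

(* [X] stands for the p-th power of the L^p norm of [f]. *)
Let estimate (f : borel M -> R) (X C delta : R) : Prop :=
  ('N[mu]_q%:E[nik delta f] <= (C * delta `^ (- eps) * delta `^ (1 - n.+1%:R / p) * X `^ p^-1)%:E)%E.

Let admissible (f : borel M -> R) (X : R) : Prop :=
  [/\ measurable_fun setT f, forall x, ~ K x -> f x = 0 & (\int[mu]_x (`|f x| `^ p)%:E <= X%:E)%E].

Let pn1 : p <= n.+1%:R.
Proof. apply: (le_trans pn); rewrite ler_pdivrMr//.
have -> : (n.+1%:R : R) = n%:R + 1 by rewrite -natr1.
have : 2%:R <= n%:R :> R by rewrite (ler_nat R 2 n).
by move: (n%:R : R) => k; lra. Qed.

(** For delta bounded below, the pointwise bound by the L^1 norm is enough: the maximal function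
    lives on the set [U] of finite volume, and [f] on [K], which is part of [U]. *)
Lemma nikodym_large (e : R) : 0 < e -> exists2 C, 0 <= C & forall f X delta, 0 <= X -> admissible f X ->
  e <= delta -> delta < 1 -> estimate f X C delta.
Proof.
move=> e0; have [c c0 hc] := nikodym_le_L1; have [mU [m m0 hm]] := domain_finite.
pose C := c / e ^+ n * m `^ (1 - p^-1) * m `^ q^-1.
have en0 : 0 < e ^+ n by rewrite exprn_gt0.
have ce0 : 0 <= c / e ^+ n by rewrite divr_ge0 ?(ltW c0) ?(ltW en0).
have C0 : 0 <= C by rewrite /C; apply: mulr_ge0; [apply: mulr_ge0 => //|]; exact: powR_ge0.
exists C => // f X delta X0 [mf fK fX] ed d1; have delta0 : 0 < delta by exact: lt_le_trans ed.
have I1 : (\int[mu]_y `|f y|%:E <= (m `^ (1 - p^-1) * X `^ p^-1)%:E)%E.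
  have -> : (\int[mu]_y `|f y|%:E = \int[mu]_(y in U) `|f y|%:E)%E.
    rewrite [RHS]integral_mkcond; apply: eq_integral => x _; rewrite /patch; case: ifPn => // xU.
    by rewrite fK ?normr0// => Kx; move: xU; rewrite mem_set//; exact: support_domain.
  apply: (le_trans (holder_set mf p1 mU m0 hm)); rewrite EFinM lee_wpmul2l ?lee_fin ?powR_ge0//.
  have hX : (\int[mu]_(y in U) (`|f y| `^ p)%:E <= X%:E)%E.
    have mg : measurable_fun setT (fun x => (`|f x| `^ p)%:E) by exact: measurable_powR_abs.
    have g0 x : [set: borel M] x -> (0 <= (`|f x| `^ p)%:E)%E by move=> ?; rewrite lee_fin powR_ge0.
    exact: le_trans (ge0_subset_integral mu mU measurableT mg g0 (@subsetT _ _)) fX.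
  have i0 : (0 <= \int[mu]_(y in U) (`|f y| `^ p)%:E)%E by apply: integral_ge0 => x _; rewrite lee_fin powR_ge0.
  have fi : (\int[mu]_(y in U) (`|f y| `^ p)%:E)%E \is a fin_num by rewrite ge0_fin_numE ?(le_lt_trans hX) ?ltry.
  rewrite -(fineK fi) poweR_EFin lee_fin; apply: ge0_ler_powR; rewrite ?nnegrE ?fine_ge0 ?invr_ge0 ?(ltW p0)//.
  by rewrite -lee_fin fineK.
pose v := c / e ^+ n * (m `^ (1 - p^-1) * X `^ p^-1).
have v0 : 0 <= v by apply: mulr_ge0 => //; apply: mulr_ge0; exact: powR_ge0.
have nv x : (nik delta f x <= (v * \1_U x)%:E)%E.
  have [[i ops ox]|far] := pselect (exists2 o, o \in ps & near_point o x); last first.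
    by rewrite nikodym_far// lee_fin mulr_ge0// indicE.
  rewrite indicE mem_set ?mulr1; last exact: near_in_U ox.
  apply: (le_trans (hc delta f x delta0 d1 mf fK)); rewrite /v [leRHS]EFinM; apply: lee_pmul => //.
  - by rewrite lee_fin divr_ge0 ?(ltW c0)// exprn_ge0// ltW.
  - by apply: integral_ge0.
  - by rewrite lee_fin ler_wpM2l ?(ltW c0)// lef_pV2 ?posrE ?exprn_gt0// lerXn2r ?nnegrE ?(ltW delta0) ?(ltW e0).
have b0 : 0 <= v * m `^ q^-1 by apply: mulr_ge0 => //; exact: powR_ge0.
(* The exponents -eps and 1 - (n+1)/p are both nonpositive, the latter since p <= n+1, so the powers
   of delta on the right are at least 1. *)
have big1 (s : R) : s <= 0 -> 1 <= delta `^ s.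
  move=> s0; rewrite -[s]opprK powRN -powR_inv1 ?powR_ge0// -powRrM mulrN1 opprK.
  have -> : delta `^ s = (delta^-1) `^ (- s) by rewrite -powR_inv1 ?(ltW delta0)// -powRrM mulN1r opprK.
  rewrite -[leLHS](powRr0 delta^-1) ler_powR ?oppr_ge0//; by rewrite invf_ge1// ltW.
apply: (@le_trans _ _ (v * m `^ q^-1)%:E).
  apply: (@Lnorm_le_majorant _ _ _ _ _ (fun x => (v `^ q * \1_U x)%:E)) => //.
  - by move=> x; exact: nikodym_ge0.
  - move=> x; have nx := nv x; have n0 := nikodym_ge0 delta f x.
    have fi : nik delta f x \is a fin_num by rewrite ge0_fin_numE ?(le_lt_trans nx) ?ltry.
    rewrite -(fineK fi) in nx n0 *; rewrite lee_fin in nx; rewrite lee_fin in n0; rewrite poweR_EFin lee_fin.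
    apply: (@le_trans _ _ ((v * \1_U x) `^ q)).
      by apply: ge0_ler_powR; rewrite ?nnegrE ?(ltW q0)// (le_trans n0 nx).
    by rewrite indicE; case: (x \in U); rewrite ?mulr1// !mulr0 powR0// gt_eqF.
  - under eq_integral do rewrite EFinM.
    rewrite ge0_integralZl_EFin ?powR_ge0//; last by apply/measurable_EFinP; exact: measurable_indic.
    rewrite integral_indic// setIT powRM ?powR_ge0// powR_invK ?gt_eqF// EFinM.
    by apply: lee_wpmul2l => //; rewrite lee_fin powR_ge0.
rewrite lee_fin.
have -> : v * m `^ q^-1 = C * X `^ p^-1 by rewrite /v /C; ring.
rewrite ler_wpM2r ?powR_ge0// -mulrA ler_peMr// -[leLHS]mul1r ler_pM// big1//.
  by rewrite oppr_le0 ltW.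
by rewrite subr_le0 ler_pdivlMr// mul1r.
Qed.

(** The sum over the finite cover of the local majorants bounds the q-th power of the maximal
    function everywhere, since a point near no element of the cover has value zero. *)
Lemma nikodym_small : exists2 C, 0 <= C & forall f X delta, 0 <= X -> admissible f X ->
  0 < delta -> delta < 1 -> (forall o, o \in ps -> delta < d0 o) -> estimate f X C delta.
Proof.
(* The grid bound controls the q-th power of the norm, so it is used with loss [eps * q]. *)
have eq0 : 0 < eps * q by rewrite mulr_gt0.
have L0 o : 0 < L o by have [] := hmodel o.
have L21 o : 1 <= L o + 2 by have := L0 o; lra.
have /choice[C1 hC1] : forall o, exists C, 0 <= C /\ _ :=
  fun o => let: ex_intro2 C a b := @grid_strong_type R n (L o + 2) p (eps * q) (ltnW n1) (L21 o) p1 pn eq0 in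
    ex_intro _ C (conj a b).
pose A o := L o * (L o * L o `^ (1 - p^-1)) `^ q * C1 o * (2 * L o + 3) ^+ n.+1 * (2 * L o + 3) `^ (eps * q).
have A0 o : 0 <= A o.
  rewrite /A; apply: mulr_ge0; last exact: powR_ge0.
  apply: mulr_ge0; last by rewrite exprn_ge0//; have := L0 o; lra.
  apply: mulr_ge0; last by have [] := hC1 o.
  by apply: mulr_ge0; [exact: ltW|exact: powR_ge0].
pose S := \sum_(o <- ps) A o.
have S0 : 0 <= S by apply: sumr_ge0.
exists (S `^ q^-1); first exact: powR_ge0.
move=> f X delta X0 [mf fK fX] delta0 delta1 small.
pose Y := delta `^ (- (eps * q)) * (delta `^ (1 - n.+1%:R / p)) `^ q * X `^ (q / p).
have Y0 : 0 <= Y by do 2?apply: mulr_ge0; exact: powR_ge0.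
have /choice[H hH] : forall o, exists H : borel M -> R, [/\ measurable_fun setT H, forall x, 0 <= H x,
    (\int[mu]_x (H x)%:E <= (A o * Y)%:E)%E & forall x tau, D o x -> line_tube mu (D o) (u o) (L o) delta x tau ->
    exists v : R, [/\ 0 <= v, v `^ q <= H x & ((mu tau)^-1 * \int[mu]_(y in tau) `|f y|%:E <= v%:E)%E]].
  move=> o; have [_ _ uL mc _] := hmodel o; have [C10 hC] := hC1 o.
  have [H [h1 h2 h3 h4]] := @transfer_at _ _ R mu n (D o) (u o) (L o) (L0 o) uL mc delta delta0 delta1
    p (eps * q) (ltnW n1) p1 eq0 (C1 o) C10 hC f X mf fX.
  exists H; split=> //; apply: (le_trans h3); rewrite lee_fin /A /Y.
  by rewrite -/q !mulrA.
have H0 o x : 0 <= H o x by have [] := hH o.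
apply: (@Lnorm_le_majorant _ _ _ _ _ (fun x => (\sum_(o <- ps) H o x)%:E)) => //.
- by do 3?apply: mulr_ge0; exact: powR_ge0.
- by move=> x; exact: nikodym_ge0.
- move=> x; have [[i ops ox]|far] := pselect (exists2 o, o \in ps & near_point o x); last first.
    by rewrite nikodym_far// poweR_EFin powR0 ?gt_eqF// lee_fin sumr_ge0.
  have nx : (nik delta f x <= (H i x `^ q^-1)%:E)%E.
    apply: nikodym_le => gam hg gx; have [_ _ _ _ tubes] := hmodel i; have [_ _ _ hx] := hH i.
    have [v [v0 vH hv]] := hx x _ (near_domain ox) (tubes x gam delta ox delta0 (small i ops) hg gx).
    apply: (le_trans hv); rewrite lee_fin.
    have -> : v = (v `^ q) `^ q^-1 by rewrite -powRrM mulfV ?gt_eqF// powRr1.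
    by apply: ge0_ler_powR; rewrite ?nnegrE ?invr_ge0 ?powR_ge0 ?(ltW q0).
  have n0 := nikodym_ge0 delta f x.
  have fi : nik delta f x \is a fin_num by rewrite ge0_fin_numE ?(le_lt_trans nx) ?ltry.
  rewrite -(fineK fi) in nx n0 *; rewrite lee_fin in nx; rewrite lee_fin in n0; rewrite poweR_EFin lee_fin.
  apply: (@le_trans _ _ (H i x)).
    rewrite -[leRHS](@powR_invK _ _ q) ?gt_eqF//.
    by apply: ge0_ler_powR; rewrite ?nnegrE ?powR_ge0 ?(ltW q0).
  by rewrite (big_rem i)//= lerDl sumr_ge0.
under eq_integral do rewrite -sumEFin.
rewrite ge0_integral_sum//; last 2 first.
- by move=> o; apply/measurable_EFinP; have [] := hH o.
- by move=> o x _; rewrite lee_fin.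
apply: (@le_trans _ _ (S * Y)%:E).
  by rewrite /S mulr_suml -sumEFin; apply: lee_sum => o _; have [_ _ h _] := hH o.
rewrite lee_fin.
have -> : S `^ q^-1 * delta `^ (- eps) * delta `^ (1 - n.+1%:R / p) * X `^ p^-1 =
  S `^ q^-1 * (delta `^ (- eps) * delta `^ (1 - n.+1%:R / p) * X `^ p^-1) by ring.
rewrite powRM ?powR_ge0//; last by do 2?apply: mulr_ge0; exact: powR_ge0.
rewrite powR_invK ?gt_eqF// powRM ?powR_ge0//; last by apply: mulr_ge0; exact: powR_ge0.
rewrite powRM ?powR_ge0// -!powRrM mulNr /Y -!powRrM.
by rewrite [p^-1 * q]mulrC.
Qed.

End Nikodym.

Lemma Lfun_Lnorm (dd : measure_display) (T : measurableType dd) (R : realType)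
  (mu : {measure set T -> \bar R}) (f : T -> R) (p : R) : 1 <= p -> f \in Lfun mu p%:E ->
  measurable_fun setT f /\ exists X : R, [/\ 0 <= X, (\int[mu]_x (`|f x| `^ p)%:E = X%:E)%E &
    ('N[mu]_(p%:E) [EFin \o f] = (X `^ p^-1)%:E)%E].
Proof.
move=> p1 fL; split; first by have := sub_Lfun_mfun fL; rewrite inE.
have /integrableP[_] := Lfun_integrable p1 fL.
have -> : (\int[mu]_x `|(`|f x| `^ p)%:E| = \int[mu]_x (`|f x| `^ p)%:E)%E.
  by apply: eq_integral => x _; rewrite gee0_abs// lee_fin powR_ge0.
move=> fin; have i0 : (0 <= \int[mu]_x (`|f x| `^ p)%:E)%E by apply: integral_ge0 => x _; rewrite lee_fin powR_ge0.
have fi : (\int[mu]_x (`|f x| `^ p)%:E)%E \is a fin_num by rewrite ge0_fin_numE.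
exists (fine (\int[mu]_x (`|f x| `^ p)%:E)%E); split; [exact: fine_ge0|by rewrite fineK|].
rewrite -poweR_EFin fineK// unlock; congr (_ `^ _)%E.
Qed.

Theorem theorem4 (R : realType) (d : nat) (hd : (3 <= d)%N)
  (M : ptopologicalType) (g : riemannianManifold R d M)
  (hcurv : constant_curvature g)
  (mu : {measure set (borel M) -> \bar R}) (hmu : is_riemannian_volume g mu)
  (hinj : (0 < inj_radius g)%E)
  (alpha : R) (halpha0 : 0 < alpha)
  (halpha : (alpha%:E < Order.min 1 ((2^-1)%:E * inj_radius g))%E)
  (K : set M) (hK : compact K)
  (hKpatch : exists a : chart R d M, atlas g a /\ K `<=` chart_dom a)
  (p : R) (hp1 : 1 <= p) (hp2 : p <= (d%:R + 2) / 2)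
  (q : \bar R) (hq : q = ((d%:R - 1)%:E * hoelder_conjugate p%:E)%E)
  (eps : R) (heps : 0 < eps) :
  exists C : R, forall (delta : R) (f : borel M -> R),
    0 < delta -> delta < 1 ->
    f \in Lfun mu p%:E -> (forall x, ~ K x -> f x = 0) ->
    ('N[mu]_q [nikodym g mu alpha delta f]
     <= (C * delta `^ (- eps) * delta `^ (1 - d%:R / p))%:E
        * 'N[mu]_(p%:E) [EFin \o f])%E.
Proof.
case: d hd M g hcurv mu hmu hinj halpha K hK hKpatch hp2 hq => // n hd M g [kappa hk] mu hmu hinj halpha K hK _ hp2 hq.
have n1 : (1 < n)%N by [].
have d2 : (1 < n.+1)%N by rewrite ltnS ltnW.
(* [r0] lies strictly between [2 * alpha] and the injectivity radius, which may be infinite; it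
   bounds the normal radii from below at all points. *)
have [alpha1 [r0 r0a r0i]] : alpha < 1 /\ exists2 r0 : R, alpha < r0 / 2 & (r0%:E < inj_radius g)%E.
  move: halpha; rewrite lt_min => /andP[a1 ai]; split; first by rewrite -lte_fin.
  case: (inj_radius g) hinj ai => [s| |]//.
    rewrite -EFinM !lte_fin => s0 as2; exists (alpha + s / 2); last by rewrite lte_fin; lra.
    by lra.
  by move=> _ _; exists (2 * alpha + 1); [lra|rewrite ltry].
have /choice[F hF] : forall o, exists F : R * chart R n.+1 M, r0 < F.1 /\ normal_chart g o F.1 F.2.
  move=> o; have : (r0%:E < inj_radius_at g o)%E.
    by apply: (lt_le_trans r0i); apply: ereal_inf_lbound; exists o.
  by move=> /ereal_sup_gt[_ [r [rp [a na]] <-]]; rewrite lte_fin => rr; exists (r, a).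
(* Strictly between alpha and half of every normal radius: a segment through a point close to the
   centre fits in the ball of radius [R1], and Beltrami's map is defined there. *)
pose R1 : R := (alpha + r0 / 2) / 2.
pose nc o := (F o).2; pose nr o := (F o).1.
have alphaR1 : alpha < R1 by rewrite /R1; lra.
have hnr o : R1 < nr o / 2 by have [+ _] := hF o; rewrite /R1 /nr; lra.
have hnc o : normal_chart g o (nr o) (nc o) by have [] := hF o.
pose eta : R := (R1 - alpha) / 4.
have eta0 : 0 < eta by rewrite /eta; lra.
have etaR : eta + alpha + eta < R1 by rewrite /eta; lra.
have R1p : 0 < R1 by lra.
have eta20 : 0 < eta ^+ 2 by rewrite exprn_gt0.
have [ps hps] := @finite_cover R n.+1 M g d2 kappa hk R1 nc nr R1p hnr hnc K 3 (eta ^+ 2) hK eta20.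
have /choice[Ld hLd] := @tube_model_exists R n M g n1 kappa hk mu hmu R1 alpha eta nc nr halpha0 alphaR1 hnr hnc eta0 etaR.
pose L o := (Ld o).1; pose d0 o := (Ld o).2.
have hmodel o : tube_model g kappa mu R1 alpha eta nc o (L o) (d0 o) := hLd o.
have [p1|p1] := eqVneq p 1.
  have [c c0 hc] := nikodym_le_L1 n1 hk halpha0 alpha1 alphaR1 hnr hnc hmodel hps.
  exists c => delta f delta0 delta1 fL fK.
  have [mf _] := Lfun_Lnorm hp1 fL.
  have -> : q = +oo%E.
    rewrite hq p1 hoelder_conjugate1 gt0_muley// lte_fin subr_gt0 ltr1n; exact: ltnW.
  rewrite p1 Lnorm1.
  have Cd : c / delta ^+ n <= c * delta `^ (- eps) * delta `^ (1 - n.+1%:R / 1).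
    rewrite divr1 -mulrA ler_wpM2l ?(ltW c0)//.
    have -> : 1 - n.+1%:R = - n%:R :> R by rewrite -natr1; ring.
    rewrite [X in _ * X]powRN powR_mulrn ?(ltW delta0)// ler_peMl ?invr_ge0 ?exprn_ge0 ?(ltW delta0)//.
    by rewrite powRN invf_ge1 ?powR_gt0// -[leRHS](powRr0 delta) ger_powR ?delta0 ?(ltW delta1) ?(ltW heps).
  have I0 : (0 <= \int[mu]_x `|(EFin \o f) x|)%E by apply: integral_ge0.
  (* For p = 1 the exponent q is infinite and the norm an essential supremum; on a space of zero
     measure it is 0 by convention. *)
  rewrite unlock; case: ifPn => _; last first.
    by rewrite mule_ge0// lee_fin (le_trans _ Cd)// divr_ge0 ?(ltW c0) ?exprn_ge0 ?(ltW delta0).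
  apply/ess_sup_inf.ess_supP; apply: nearW => x /=.
  rewrite gee0_abs; last apply: (nikodym_ge0 _ halpha0 alphaR1 hnr hnc).
  apply: (le_trans (hc delta f x delta0 delta1 mf fK)).
  by apply: lee_wpmul2r => //; rewrite lee_fin.
have p1' : 1 < p by rewrite lt_def p1.
have pn : p <= (n%:R + 3) / 2 by move: hp2; rewrite -natr1; lra.
have qE : q = (n%:R * (p / (p - 1)))%:E.
  rewrite hq /hoelder_conjugate /=.
  have -> : (p%:E - 1 = (p - 1)%:E)%E by rewrite EFinB.
  rewrite inver.
  rewrite eqe (gt_eqF (lt_trans ltr01 p1')) (gt_eqF (_ : 0 < p - 1)) ?subr_gt0// -!EFinM; congr ((_ * _)%:E).
  by rewrite -natr1; ring.
have [C1 C10 small] := nikodym_small n1 halpha0 alpha1 alphaR1 hnr hnc eta0 etaR hmodel hps p1' pn heps.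
have d00 o : 0 < d0 o by have [] := hmodel o.
have [e e0 he] := seq_lower_bound ps d00.
have [C2 C20 large] := nikodym_large n1 hk halpha0 alpha1 alphaR1 hnr hnc eta0 etaR hmodel hps p1' pn heps e0.
exists (C1 + C2) => delta f delta0 delta1 fL fK.
have [mf [X [X0 fX ->]]] := Lfun_Lnorm hp1 fL.
have adm : (\int[mu]_x (`|f x| `^ p)%:E <= X%:E)%E by rewrite fX.
rewrite qE -EFinM.
(* [e] is below the thresholds [d0] of all points of the finite cover. *)
have [hde|hde] := ltP delta e.
  have h := small f X delta X0 (And3 mf fK adm) delta0 delta1 (fun o ops => lt_le_trans hde (he o ops)).
  apply: (le_trans h); rewrite lee_fin -!mulrA ler_wpM2r ?lerDl//.
  by do 2?apply: mulr_ge0; exact: powR_ge0.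
have h := large f X delta X0 (And3 mf fK adm) hde delta1.
apply: (le_trans h); rewrite lee_fin -!mulrA ler_wpM2r ?lerDr//.
by do 2?apply: mulr_ge0; exact: powR_ge0.
Qed.
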